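(* Let $p \ge 1$ and let $\varphi:[0,+\infty)\to[0,+\infty)$ be a function with $\varphi(0)=0$ that is continuous on $[0,+\infty)$ except at a finite number of points of $(0,+\infty)$, at each of which it admits a limit from the left and from the right. Assume that (i) $\varphi(t)\le \alpha t^{p+1}$ for all $t\in[0,1]$, for some constant $\alpha>0$; (ii) $\varphi(t)\le\beta$ for all $t\in[0,+\infty)$, for some constant $\beta>0$; (iii) $\int_0^\infty \varphi(t)\,t^{-(p+1)}\,dt = 1/2$. Then there exists a constant $\kappa$ (depending on $\varphi$ and $p$, but independent of the interval $I$) with $0\le\kappa\le 1$ such that, for every open interval $I\subset\mathbb{R}$ (bounded or unbounded), as $\delta\to 0$, the functionals $\Lambda_\delta(\cdot,I)$ $\Gamma$-converge in $L^p(I)$ to the functional $\Lambda_0(\cdot,I)$ given by $$\Lambda_0(u,I)=\kappa\int_I |u'|^p\,dx,\qquad u\in L^p(I),$$ with the following conventions: if $\kappa=0$, then $\Lambda_0(u,I)=0$ for all $u\in L^p(I)$; if $\kappa>0$, then $\Lambda_0(u,I)=+\infty$ whenever $u\notin W^{1,p}(I)$ in the case $p>1$, respectively whenever $u\notin BV(I)$ in the case $p=1$.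
   Context: For a measurable function $u$ on an open interval $I$ and $\delta>0$, $$\Lambda(u,I)=\int_I\int_I\frac{\varphi(|u(x)-u(y)|)}{|x-y|^{p+1}}\,dx\,dy\in[0,+\infty],\qquad \Lambda_\delta(u,I)=\delta^p\,\Lambda(u/\delta,I).$$ When $p=1$ and $u\in BV(I)$, $\int_I|u'|\,dx$ denotes the total variation of the measure $u'$ on $I$. $\Gamma$-convergence of $\Lambda_\delta(\cdot,I)$ to $\Lambda_0(\cdot,I)$ in $L^p(I)$ as $\delta\to0$ means that the following two properties hold: (G1) for each $g\in L^p(I)$ and for every family $(g_\delta)\subset L^p(I)$ with $g_\delta\to g$ in $L^p(I)$ as $\delta\to0$, one has $\liminf_{\delta\to0}\Lambda_\delta(g_\delta,I)\ge\Lambda_0(g,I)$; (G2) for each $g\in L^p(I)$ there exists a family $(g_\delta)\subset L^p(I)$ with $g_\delta\to g$ in $L^p(I)$ as $\delta\to0$ and $\limsup_{\delta\to0}\Lambda_\delta(g_\delta,I)\le\Lambda_0(g,I)$. Families are indexed by $\delta>0$, and $\delta \to 0$ means $\delta\to0^+$. *)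

(* Defs.v *)
From HB Require Import structures.
From mathcomp Require Import all_boot all_order all_algebra.
From mathcomp Require Import all_classical all_reals all_analysis.

Set Implicit Arguments.
Unset Strict Implicit.
Unset Printing Implicit Defensive.

Import Order.TTheory GRing.Theory Num.Theory.
Import numFieldTopology.Exports numFieldNormedType.Exports.

Local Open Scope classical_set_scope.
Local Open Scope ring_scope.

Section Definitions.
Context {R : realType}.
Implicit Types (p delta : R) (phi u v psi : R -> R) (I : set R).

Local Notation mu := (@lebesgue_measure R).

(* The empty set is not excluded; every functional below vanishes on it. *)
Definition open_interval I : Prop := open I /\ is_interval I.

(* A function on I is represented by a function on R whose values outside I are
   irrelevant: [u \_ I] is its extension by 0. *)
Definition in_Lp p I u : Prop := u \_ I \in Lfun mu p%:E.

Definition cvg_Lp p I (g_ : R -> R -> R) (g : R -> R) : Prop :=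
  ('N[mu]_(p%:E)[EFin \o ((g_ delta \- g)%R \_ I)])%E @[delta --> 0^'+] --> 0%E.

(* On the diagonal x = y, a null set, the integrand is 0 because 0^-1 = 0. *)
Definition Lambda phi p u I : \bar R :=
  (\int[mu]_(x in I) \int[mu]_(y in I)
     (phi `|u x - u y| / `|x - y| `^ (p + 1))%:E)%E.

Definition Lambda_delta phi p delta u I : \bar R :=
  ((delta `^ p)%:E * Lambda phi p (fun x => (u x / delta)%R) I)%E.

Definition test_function I psi : Prop :=
  [/\ forall n x, derivable (derive1n n psi) x 1,
      compact (closure [set x | psi x != 0])
    & closure [set x | psi x != 0] `<=` I].

Definition weak_derivative I u v : Prop :=
  forall psi, test_function I psi ->
    (\int[mu]_(x in I) (u x * derive1 psi x)%:E =
     - \int[mu]_(x in I) (v x * psi x)%:E)%E.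

Definition sobolev_derivative p I u v : Prop :=
  in_Lp p I v /\ weak_derivative I u v.

Definition in_W1p p I u : Prop :=
  in_Lp p I u /\ exists v, sobolev_derivative p I u v.

Definition hahn_pos (nu : {charge set (measurableTypeR R) -> \bar R}) : set R :=
  sval (cid (Hahn_decomposition nu)).

Definition hahn_neg (nu : {charge set (measurableTypeR R) -> \bar R}) : set R :=
  sval (cid (svalP (cid (Hahn_decomposition nu)))).

Definition hahnP (nu : {charge set (measurableTypeR R) -> \bar R}) :
    hahn_decomposition nu (hahn_pos nu) (hahn_neg nu) :=
  svalP (cid (svalP (cid (Hahn_decomposition nu)))).

Definition charge_integral (nu : {charge set (measurableTypeR R) -> \bar R}) I psi : \bar R :=
  (\int[jordan_pos (hahnP nu)]_(x in I) (psi x)%:E -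
   \int[jordan_neg (hahnP nu)]_(x in I) (psi x)%:E)%E.

Definition charge_total_variation (nu : {charge set (measurableTypeR R) -> \bar R}) I : \bar R :=
  charge_variation (hahnP nu) I.

(* Charges are finite, so nu is a finite signed measure; only its restriction
   to I matters. *)
Definition measure_derivative I u (nu : {charge set (measurableTypeR R) -> \bar R}) : Prop :=
  forall psi, test_function I psi ->
    (\int[mu]_(x in I) (u x * derive1 psi x)%:E = - charge_integral nu I psi)%E.

Definition in_BV I u : Prop :=
  in_Lp 1 I u /\ exists nu, measure_derivative I u nu.

(* The derivative u' is unique almost everywhere on I (as a measure on I when
   p = 1), so the value does not depend on the choice made by [cid]. *)
Definition W1p_energy p I u : \bar R :=
  match pselect (in_W1p p I u) with
  | left uW => (\int[mu]_(x in I) (`|sval (cid uW.2) x| `^ p)%:E)%E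
  | right _ => +oo%E
  end.

Definition BV_energy I u : \bar R :=
  match pselect (in_BV I u) with
  | left uBV => charge_total_variation (sval (cid uBV.2)) I
  | right _ => +oo%E
  end.

Definition derivative_energy p I u : \bar R :=
  if p == 1 then BV_energy I u else W1p_energy p I u.

Definition Lambda0 (kappa : R) p u I : \bar R :=
  if kappa == 0 then 0%E else (kappa%:E * derivative_energy p I u)%E.

Definition Gamma_converges p I (F_ : R -> (R -> R) -> \bar R)
    (F0 : (R -> R) -> \bar R) : Prop :=
  (forall (g : R -> R) (g_ : R -> R -> R),
      in_Lp p I g -> (forall delta, 0 < delta -> in_Lp p I (g_ delta)) ->
      cvg_Lp p I g_ g ->
      (F0 g <= limf_einf (fun delta => F_ delta (g_ delta)) 0^'+)%E) /\
  (forall g : R -> R, in_Lp p I g ->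
      exists g_ : R -> R -> R,
        [/\ forall delta, 0 < delta -> in_Lp p I (g_ delta),
            cvg_Lp p I g_ g
          & (limf_esup (fun delta => F_ delta (g_ delta)) 0^'+ <= F0 g)%E]).

Definition piecewise_continuous phi : Prop :=
  exists S : set R,
    [/\ finite_set S,
        forall t, S t -> 0 < t,
        forall t, 0 <= t -> ~ S t ->
          phi s @[s --> within `[0, +oo[%classic (nbhs t)] --> phi t
      & forall t, S t -> cvg (phi s @[s --> t^'-]) /\ cvg (phi s @[s --> t^'+])].

End Definitions.

(* Main.v *)
(** The constant is [kappa = inf (1/H^p) * J(W, [0,1[ x R)], the infimum of the
    cost per unit slope over the cells [W], i.e. the maps [W] vanishing near [0]
    with [W (x + 1) = W x + H]; testing with the cells obtained by periodizing a given
    function shows that the energy of any [u] near an interval on which it rises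
    by [h] is at least about [kappa h^p / length^(p-1)].

    Lower bound.  Along a sequence [g_d -> g] with energies at most [c], the
    energies of [g_d] restricted to half-lines define nondecreasing functions,
    whose limit [W] satisfies [|g y - g x|^p <= (y - x)^(p-1) (W y - W x)] for
    almost all [x < y], with [0 <= W <= c / kappa] ("slope bound").

    Upper bound.  Under a slope bound with [0 <= W <= M], a piecewise affine
    interpolation of [g] has energy at most [M]; replacing every affine piece by
    rescaled copies of a nearly optimal cell gives a recovery family of energy at
    most [kappa M + o(1)].

    Slope bounds with total mass [M] are equivalent to [int |u'|^p <= M].  One
    direction is the fundamental theorem of calculus and Jensen's inequality.
    Conversely, [W + u] and [W] are nondecreasing, so [u'] is the difference of two
    Stieltjes measures; two finite measures that agree on the intervals with
    endpoints off a null set agree on [I], which gives [|u'| <= dW] when [p = 1].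
    When [p > 1], Young's inequality gives [|u'| <= e dW + K_e dx] for all [e],
    hence [u'] has a density, and Fatou's lemma applied to difference quotients
    bounds its [p]-th power. *)
Require Import Defs.
From HB Require Import structures.
From mathcomp Require Import all_boot all_order all_algebra.
From mathcomp Require Import all_classical all_reals all_analysis.
From mathcomp Require Import measurable_realfun ring lra.

Set Implicit Arguments.
Unset Strict Implicit.
Unset Printing Implicit Defensive.

Import Order.TTheory GRing.Theory Num.Theory.
Import numFieldTopology.Exports numFieldNormedType.Exports.

Local Open Scope classical_set_scope.
Local Open Scope ring_scope.

(** Two sets whose points at distance less than [eta] carry equal values interact by at most a
    constant times [eta ^ (- p)] per unit length. The natural [eta] is of order [d], and then the
    factor [d ^ p] leaves a quantity of order one: cutting or gluing is not free at the scale [d].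
    Both inequalities therefore use the intermediate scale [sqrt d]. In the lower bound, cutting at
    a point [z] costs an [edge] term, which may be large at particular points; its average over [z]
    is estimated at that scale, and along a fast sequence it vanishes at almost every [z]. In the
    upper bound, the points within [sqrt d] of a junction have small measure, and the others are far
    from it.

    Errors that come only from adding plateaus are bounded independently of the function, because
    [phi] is bounded; multiplication by [d ^ p] removes them.

    That [kappa] is finite and at most 1 is itself drawn from the lower bound, applied to the
    identity on []0, 1[], whose energy is at most 1 by the normalization of [phi]. For this reason
    the lower bound is first proved for every real [K] below [kappaE]. *)

Local Notation mu := (@lebesgue_measure _).

(** * Affine changes of variable and reflections in Lebesgue integrals *)

Section AffineChange.
Context {R : realType}.

Definition affine (a b : R) (x : measurableTypeR R) : measurableTypeR R := a * x + b.

Lemma measurable_affine (a b : R) : measurable_fun setT (affine a b).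
Proof.
by apply: measurable_funD => //; apply: measurable_funM.
Qed.

Lemma affine_preimage_ocitv (a b c d : R) : 0 < a ->
  affine a b @^-1` `]c, d] = `](c - b) / a, (d - b) / a]%classic.
Proof.
move=> a0; apply/seteqP; split=> x /=; rewrite /affine !in_itv/=.
  by rewrite ltr_pdivrMr// ler_pdivlMr// ltrBlDr lerBrDr mulrC.
by rewrite ltr_pdivrMr// ler_pdivlMr// ltrBlDr lerBrDr mulrC.
Qed.

(** The push-forward of Lebesgue measure under [affine a b], multiplied by [a], has the right value
    on half-open intervals, hence is Lebesgue measure; the rest is the change of variables for
    push-forwards. *)
Lemma ge0_integral_affine (a b : R) (D : set R) (f : R -> \bar R) :
  0 < a -> measurable D -> measurable_fun D f -> (forall x, D x -> 0 <= f x)%E ->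
  (\int[mu]_(x in affine a b @^-1` D) f (a * x + b)%R = (a^-1)%:E * \int[mu]_(x in D) f x)%E.
Proof.
move=> a0 mD mf f0.
have a1 : 0 <= a^-1 by rewrite invr_ge0 ltW.
pose nu : {measure set (measurableTypeR R) -> \bar R} :=
  measure_function_pushforward__canonical__measure_function_Measure
    mu (measurable_affine a b).
have H A : measurable A -> mscale (NngNum a1) mu A = nu A.
  move=> mA.
  have -> : mscale (NngNum a1) mu A = (a^-1%:E * mu A)%E by [].
  have -> : (mu A = (mscale (NngNum (ltW a0)) nu) A)%E.
    apply: lebesgue_measure_unique => // _ [[c d]] _ <-.
    transitivity (a%:E * mu (affine a b @^-1` `]c, d]))%E => //=.
    rewrite affine_preimage_ocitv//.
    rewrite !lebesgue_measure_itv/= !lte_fin ltr_pM2r ?invr_gt0// ltrD2r.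
    case: ifPn => _; last by rewrite mule0.
    rewrite -!EFinD -EFinM; congr EFin; field; exact: lt0r_neq0.
  rewrite /mscale/= muleA -EFinM mulVf ?mul1e//; exact: lt0r_neq0.
transitivity (\int[nu]_(x in D) f x)%E.
  rewrite /nu/= ge0_integral_pushforward//; first exact: measurable_affine.
  by move=> x /set_mem; exact: f0.
rewrite -(ge0_integral_mscale mu mD (NngNum a1) mf f0).
by apply: eq_measure_integral => A mA _; apply/esym; exact: H.
Qed.

Lemma ge0_integral_opp (D : set R) (f : R -> \bar R) :
  measurable D -> measurable_fun D f -> (forall x, D x -> 0 <= f x)%E ->
  (\int[mu]_(x in -%R @^-1` D) f (- x)%R = \int[mu]_(x in D) f x)%E.
Proof.
move=> mD mf f0.
have mN : measurable_fun setT (-%R : measurableTypeR R -> measurableTypeR R).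
  exact: oppr_measurable.
rewrite -[LHS](@ge0_integral_pushforward _ _ _ _ _ _ mN mu D f)//.
- by apply: eq_measure_integral => A mA _; exact: lebesgue_measureN.
- by move=> x /set_mem; exact: f0.
Qed.

End AffineChange.

(** * Tonelli's theorem for kernels restricted to product sets *)

Section Tonelli.
Context {R : realType}.
Variable (k : measurableTypeR R * measurableTypeR R -> \bar R).
Hypothesis mk : measurable_fun setT k.
Hypothesis k0 : forall z, (0 <= k z)%E.

Lemma tonelli_set (A B : set (measurableTypeR R)) : measurable A -> measurable B ->
  (\int[mu]_(x in A) \int[mu]_(y in B) k (x, y) =
   \int[mu]_(y in B) \int[mu]_(x in A) k (x, y))%E.
Proof.
move=> mA mB.
have mAB : measurable (A `*` B) by exact: measurableX.
have h0 : forall z, (0 <= (k \_ (A `*` B)) z)%E.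
  by move=> z; rewrite patchE; case: ifP.
have mh : measurable_fun setT (k \_ (A `*` B)).
  by apply/(measurable_restrictT _ _).1 => //; apply: measurable_funTS.
have := fubini_tonelli (m1 := @lebesgue_measure R) (m2 := @lebesgue_measure R) _ mh h0.
rewrite /fubini_F /fubini_G => E.
rewrite integral_mkcond [RHS]integral_mkcond.
transitivity (\int[mu]_x \int[mu]_y (k \_ (A `*` B)) (x, y))%E.
  apply: eq_integral => x _; rewrite patchE; case: ifPn => xA.
    rewrite integral_mkcond; apply: eq_integral => y _.
    rewrite !patchE; congr (if _ then _ else _); apply/idP/idP; rewrite !inE.
      by move=> ?; split=> //; exact/set_mem.
    by case.
  rewrite integral0_eq// => y _; rewrite patchE ifF//; apply/negP; rewrite inE => -[/= ? _].
  by move: xA; rewrite notin_setE.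
rewrite E.
apply: eq_integral => y _; rewrite [RHS]patchE; case: ifPn => yB.
  rewrite [RHS]integral_mkcond; apply: eq_integral => x _.
  rewrite !patchE; congr (if _ then _ else _); apply/idP/idP; rewrite !inE.
    by case.
  by move=> ?; split=> //; exact/set_mem.
rewrite integral0_eq// => x _; rewrite patchE ifF//; apply/negP; rewrite inE => -[/= _ ?].
by move: yB; rewrite notin_setE.
Qed.

Lemma measurable_int_set (B : set (measurableTypeR R)) : measurable B ->
  measurable_fun setT (fun x => \int[mu]_(y in B) k (x, y))%E.
Proof.
move=> mB.
have mAB : measurable (setT `*` B : set (measurableTypeR R * measurableTypeR R)) by exact: measurableX.
have h0 : forall z, (0 <= (k \_ (setT `*` B)) z)%E.
  by move=> z; rewrite patchE; case: ifP.
have mh : measurable_fun setT (k \_ (setT `*` B)).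
  by apply/(measurable_restrictT _ _).1 => //; apply: measurable_funTS.
have := measurable_fun_fubini_tonelli_F (m2 := @lebesgue_measure R) _ mh h0.
apply: eq_measurable_fun => x _; rewrite /fubini_F [RHS]integral_mkcond.
apply: eq_integral => y _; rewrite !patchE; congr (if _ then _ else _).
by apply/idP/idP; rewrite !inE//=; case.
Qed.

End Tonelli.

(** * Primitives and one-sided Lebesgue differentiation *)

Section Primitive.
Context {R : realType}.
Local Notation T := (measurableTypeR R).

Definition primitive (f : T -> R) (x : R) : R := \int[mu]_(t in `]-oo, x]) f t.

Lemma primitiveB (f : T -> R) (x y : R) : mu.-integrable setT (EFin \o f) -> x <= y ->
  primitive f y - primitive f x = \int[mu]_(t in `]x, y]) f t.
Proof.
move=> fi xy; rewrite /primitive; apply: Rintegral_itvB => //.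
by apply: integrableS fi => //; exact: measurable_itv.
Qed.

Lemma lebesgue_measure_ocitv (x y : R) : x <= y -> mu (`]x, y]%classic : set T) = (y - x)%:E.
Proof.
move=> xy; rewrite lebesgue_measure_itv/= lte_fin; case: ltP => [_|yx]; first by rewrite EFinB.
by have -> : x = y; [apply/eqP; rewrite eq_le xy|rewrite subrr].
Qed.

Lemma primitive_lipschitz (f : T -> R) (n x y : R) : mu.-integrable setT (EFin \o f) ->
  (forall t, `|f t| <= n) -> `|primitive f y - primitive f x| <= n * `|y - x|.
Proof.
move=> fi fn; wlog xy : x y / x <= y => [H|].
  have [xy|/ltW yx] := leP x y; first exact: H.
  by rewrite distrC (distrC y); exact: H.
rewrite (primitiveB fi xy) (ger0_norm (x := y - x)) ?subr_ge0//.
have mI : measurable (`]x, y]%classic : set T) by exact: measurable_itv.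
have fI : mu.-integrable (`]x, y]%classic : set T) (EFin \o f) by apply: integrableS fi.
apply: (le_trans (le_normr_Rintegral mI fI)).
have muI := lebesgue_measure_ocitv xy.
have -> : n * (y - x) = \int[mu]_(t in (`]x, y]%classic : set T)) n.
  by rewrite Rintegral_cst// [X in fine X]muI.
apply: le_Rintegral => //; first by apply: integrable_abse fI.
by apply/integrableP; split; [exact: measurable_cst|rewrite integral_cst// [X in (_ * X)%E]muI -EFinM ltry].
Qed.

Lemma average_right_cvg (f : T -> R) (d : R^nat) (x : R) : mu.-integrable setT (EFin \o f) ->
  (forall n, 0 < d n) -> d n @[n --> \oo] --> (0 : R) -> lebesgue_pt f x ->
  (d n)^-1 * (primitive f (x + d n) - primitive f x) @[n --> \oo] --> f x.
Proof.
move=> fi d0 dcv lx.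
have locf : locally_integrable setT f by apply: open_integrable_locally => //; exact: openT.
pose E (z : R) (n : nat) : set R := `]z, (z + d n)%R]%classic.
have muE z n : mu (E z n) = (d n)%:E.
  by rewrite lebesgue_measure_ocitv ?lerDl ?ltW// addrC addKr.
have nice z : nicely_shrinking z (E z).
  split=> [n|]; first exact: measurable_itv.
  (* The included end [z + d n] forces an open ball of radius larger than [d n]; the radius
     [2 * d n] gives measure [4 * d n], four times that of the interval. *)
  exists (4, fun n => PosNum (mulr_gt0 (ltr0n R 2) (d0 n))); split => //=.
  - by rewrite -[X in _ --> X](mulr0 2); apply: cvgMr.
  - move=> n t; rewrite /E/= in_itv/= => /andP[zt tz].
    rewrite /ball/= ltr_distlC; apply/andP; split.
      by rewrite (lt_trans _ zt)// gtrBl mulr_gt0.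
    by rewrite (le_lt_trans tz)// ltrD2l ltr_pMl// ltr1n.
  - move=> n; rewrite lebesgue_measure_ball ?mulr_ge0 ?(ltW (d0 n))// muE -EFinM lee_fin.
    by rewrite -mulr_natr; lra.
have := nice_lebesgue_differentiation nice locf lx.
move=> /fine_cvgP[_]; apply: cvg_trans; apply: near_eq_cvg; near=> n.
rewrite /= muE inver gt_eqF// (primitiveB fi) ?lerDl ?(ltW (d0 n))//.
rewrite fineM// -/(E x n); apply: integrable_fin_num => //; first exact: measurable_itv.
by apply: integrableS fi => //; exact: measurable_itv.
Unshelve. all: by end_near. Qed.

End Primitive.

(** * Infinitely differentiable functions built from exp(-1/t) *)

Section Smooth.
Context {R : realType}.
Implicit Types (f g h : R -> R) (t x y : R) (m n : nat).

(** The powers of [t^-1] are carried along because differentiating exp(-1/t) produces them: the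
    derivative of each member of the family is a linear combination of two others. *)
Definition flat m t : R := if 0 < t then t^-1 ^+ m * expR (- t^-1) else 0.

(** A class closed under taking the derivative: one differentiation rule per constructor yields
    derivatives of every order without a formula for the [n]-th one. [smooth_prim] adds
    antiderivatives, needed for [step]. *)
Inductive smooth : (R -> R) -> Prop :=
| smooth_flat m : smooth (flat m)
| smooth_cst c : smooth (cst c)
| smooth_add f g : smooth f -> smooth g -> smooth (fun t => f t + g t)
| smooth_mul f g : smooth f -> smooth g -> smooth (fun t => f t * g t)
| smooth_affine a b f : smooth f -> smooth (fun t => f (a * t + b))
| smooth_prim f h : smooth h -> (forall x, is_derive x 1 f (h x)) -> smooth f.

Lemma flat_ge0 m t : 0 <= flat m t.
Proof. by rewrite /flat; case: ifP => // t0; rewrite mulr_ge0 ?exprn_ge0 ?invr_ge0 ?expR_ge0 ?ltW. Qed.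

(** Comes from exp(s) >= s^(m+2)/(m+2)! at [s = t^-1]. The quadratic bound makes the difference
    quotient of [flat m] at 0 tend to 0. *)
Lemma flat_le m t : flat m t <= (m.+2)`!%:R * t ^+ 2.
Proof.
rewrite /flat; case: ifP => t0; last by rewrite mulr_ge0// sqr_ge0.
have s0 : 0 <= t^-1 by rewrite invr_ge0 ltW.
have := expR_ge1Dxn m.+1 s0; set c := (m.+2)`!%:R => h.
have c0 : 0 < c :> R by rewrite ltr0n fact_gt0.
have : t^-1 ^+ m.+2 / c <= expR t^-1 by apply: le_trans h; rewrite lerDr.
rewrite expRN ler_pdivrMr// => h'.
rewrite ler_pdivrMr ?expR_gt0// -mulrA mulrCA.
rewrite -(ler_pM2l (x := t^-1 ^+ 2)) ?exprn_gt0 ?invr_gt0//.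
rewrite -exprD add2n [leRHS]mulrA -exprMn mulVf ?gt_eqF// expr1n mul1r.
by rewrite mulrC.
Qed.

Lemma is_derive_flat m t : is_derive t 1 (flat m) (- m%:R * flat m.+1 t + flat m.+2 t).
Proof.
have [t0|t0|->] := ltgtP t 0.
- rewrite {2 3}/flat ltNge (ltW t0)/= mulr0 addr0.
  apply: (@near_eq_is_derive _ _ _ (cst 0)).
  near=> s; rewrite /flat ltNge ltW//=; near: s.
  exact: lt_nbhsl.
- rewrite {2 3}/flat t0.
  suff : is_derive t 1 (fun s : R => s^-1 ^+ m * expR (- s^-1))
      (- m%:R * (t^-1 ^+ m.+1 * expR (- t^-1)) + t^-1 ^+ m.+2 * expR (- t^-1)).
    apply: near_eq_is_derive; near=> s; rewrite /flat ifT//; near: s; exact: lt_nbhsr.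
  have t0' : t != 0 by rewrite gt_eqF.
  have dV : is_derive t 1 (fun s : R => s^-1) (- t ^- 2).
    have := @is_deriveV R id t 1 1 t0' (is_derive_id _ _).
    by rewrite /GRing.scale/= mulr1.
  have dE : is_derive t 1 (fun s => expR (- s^-1)) (expR (- t^-1) * t ^- 2).
    have dN : is_derive t 1 (fun s : R => - s^-1) (t ^- 2).
      by have := is_deriveN dV; rewrite opprK.
    exact: (@is_derive1_comp _ expR (fun s => - s^-1)).
  have dX := is_deriveX m dV.
  have := is_deriveM dX dE.
  rewrite (_ : (fun s : R => s^-1) ^+ m * _ = (fun s => s^-1 ^+ m * expR (- s^-1))); last first.
    by apply/funext => s; rewrite mulrfctE exprfctE.
  move=> /is_derive_eq; apply; rewrite exprfctE /GRing.scale/=.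
  case: m {dX} => [|m].
    by rewrite !mul0r mulr0 addr0 oppr0 mul0r add0r !expr0 mul1r exprVn mulrC.
  rewrite /= -[(t ^+ 2)^-1]exprVn; set E := expR (- t^-1); clearbody E; set s := t^-1; clearbody s.
  by rewrite !exprS; ring.
- rewrite {2 3}/flat ltxx mulr0 addr0.
  have c0 : 0 < (m.+2)`!%:R :> R by rewrite ltr0n fact_gt0.
  have D : (fun h : R => h^-1 *: (flat m (h *: 1 + 0) - flat m 0)) @ 0^' --> (0 : R).
    apply/cvgrPdist_le => e e0.
    have ec : 0 < e / (m.+2)`!%:R by rewrite divr_gt0.
    have : \forall h \near (0 : R)^', `|h| < e / (m.+2)`!%:R.
      apply: (@nbhs_dnbhs _ (0 : R)).
      have : \forall h \near (0 : R), ball 0 (e / (m.+2)`!%:R) h by exact: nbhsx_ballx.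
      by apply: filterS => h; rewrite /ball/= sub0r normrN.
    apply: filterS => h he; rewrite sub0r normrN /GRing.scale/= mulr1 addr0.
    rewrite {2}/flat ltxx subr0 normrM normfV.
    have [->|h0] := eqVneq h 0; first by rewrite normr0 invr0 mul0r ltW.
    rewrite mulrC ler_pdivrMr ?normr_gt0// ger0_norm ?flat_ge0//.
    apply: (le_trans (flat_le _ _)).
    rewrite -real_normK ?num_real// expr2 mulrA; apply: ler_wpM2r => //.
    by rewrite mulrC -ler_pdivlMr// ltW.
  by apply: DeriveDef; [apply/cvg_ex; exists 0; exact: D|rewrite /derive; exact: cvg_lim].
Unshelve. all: by end_near. Qed.

Lemma smooth_deriv f : smooth f -> exists2 h, smooth h & forall x, is_derive x 1 f (h x).
Proof.
elim=> {f} [m|c|f g sf [f' sf' df] sg [g' sg' dg]|f g sf [f' sf' df] sg [g' sg' dg]|a b f sf [f' sf' df]|f h sh _ df].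
- exists (fun t => - m%:R * flat m.+1 t + flat m.+2 t); last exact: is_derive_flat.
  by apply: smooth_add; [apply: smooth_mul; [exact: (smooth_cst (- m%:R))|]|]; exact: smooth_flat.
- by exists (cst 0); [exact: smooth_cst|move=> x; exact: is_derive_cst].
- exists (fun t => f' t + g' t); first exact: smooth_add.
  by move=> x; exact: is_deriveD.
- exists (fun t => f t * g' t + g t * f' t); first by apply: smooth_add; exact: smooth_mul.
  by move=> x; exact: is_deriveM.
- exists (fun t => f' (a * t + b) * a).
    by apply: smooth_mul; [exact: smooth_affine|exact: (smooth_cst a)].
  move=> x; apply: (@is_derive1_comp _ f (fun t => a * t + b)).
  rewrite -[X in is_derive _ _ _ X]addr0.
  apply: (@is_deriveD _ _ _ (fun t => a * t) (cst b)).
  rewrite -[X in is_derive _ _ _ X]mulr1.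
  exact: (@is_deriveZ _ _ _ id a).
- by exists h.
Qed.

Lemma smooth_derivable f n x : smooth f -> derivable (derive1n n f) x 1.
Proof.
elim: n f => [|n IH] f /smooth_deriv[h sh df].
  by rewrite derive1n0; have [] := df x.
rewrite derive1Sn (_ : derive1 f = h); first exact: IH.
by apply/funext => y; rewrite derive1E; have [] := df y.
Qed.

End Smooth.

(** * A compactly supported bump of unit mass and its primitive *)

Section Bump.
Context {R : realType}.
Local Notation T := (measurableTypeR R).
Implicit Types (t x y : R) (n : nat).

Lemma smooth_continuous (f : R -> R) : smooth f -> continuous f.
Proof.
move=> /smooth_deriv[h _ df] x; have [/derivable1_diffP/differentiable_continuous + _] := df x.
exact.
Qed.

Lemma smooth_measurable (f : R -> R) : smooth f -> measurable_fun setT (f : T -> R).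
Proof. by move=> /smooth_continuous cf; exact: continuous_measurable_fun. Qed.

Definition bump0 t : R := flat 0 t * flat 0 (-1 * t + 1).

Lemma smooth_bump0 : smooth bump0.
Proof. by apply: smooth_mul; [exact: smooth_flat|apply: smooth_affine; exact: smooth_flat]. Qed.

Lemma flat0_le1 t : flat 0 t <= 1.
Proof.
rewrite /flat; case: ifP => // t0; rewrite expr0 mul1r -expR0 ler_expR oppr_le0 invr_ge0.
exact: ltW.
Qed.

Lemma bump0_ge0 t : 0 <= bump0 t. Proof. by rewrite mulr_ge0 ?flat_ge0. Qed.

Lemma bump0_le1 t : bump0 t <= 1.
Proof. by rewrite mulr_ile1 ?flat_ge0 ?flat0_le1. Qed.

Lemma bump0_out t : ~~ (0 < t < 1) -> bump0 t = 0.
Proof.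
rewrite negb_and -!leNgt /bump0 /flat => /orP[t0|t1].
  by rewrite ltNge t0 mul0r.
by rewrite [X in _ * X]ifF ?mulr0//; apply/negbTE; rewrite -leNgt; lra.
Qed.

Lemma integrable_supp (f : T -> R) (a b B : R) : measurable_fun setT f -> (forall t, `|f t| <= B) ->
  (forall t : R, ~~ (a <= t <= b) -> f t = 0) -> mu.-integrable setT (EFin \o f).
Proof.
move=> mf fB f0; pose D : set T := `[a, b]%classic.
have mD : measurable D by exact: measurable_itv.
apply/integrableP; split; first exact/measurable_EFinP.
have muD : (mu D < +oo)%E by rewrite /D lebesgue_measure_itv/=; case: ifP => _; rewrite ?ltry// -EFinB ltry.
have B0 : 0 <= B by apply: le_trans (fB 0).
apply: (@le_lt_trans _ _ (\int[mu]_(x in D) cst B%:E x)%E); last first.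
  by rewrite integral_cst//; apply: lte_mul_pinfty.
rewrite [leRHS]integral_mkcond; apply: ge0_le_integral.
- exact: measurableT.
- by [].
- by apply: measurableT_comp => //; exact/measurable_EFinP.
- by apply: (proj1 (measurable_restrictT _ mD)); exact: measurable_cst.
- move=> x _; rewrite patchE; case: ifPn => [_|/negP nD]; first by rewrite lee_fin.
  rewrite /= f0 ?normr0//; apply/negP => h; apply: nD; rewrite inE /D/= in_itv/=.
  exact: h.
Qed.

Lemma integrable_bump0 : mu.-integrable setT (EFin \o (bump0 : T -> R)).
Proof.
apply: (@integrable_supp _ 0 1 1) => //.
- exact: smooth_measurable smooth_bump0.
- by move=> t; rewrite ger0_norm ?bump0_ge0 ?bump0_le1.
- move=> t h; apply: bump0_out; apply: contra h => /andP[h1 h2].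
  by rewrite !ltW.
Qed.

Definition bump_mass : R := \int[mu]_t bump0 t.

Lemma bump_mass_gt0 : 0 < bump_mass.
Proof.
pose D : set T := `[(4^-1)%R, (3 / 4)%R]%classic.
have mD : measurable D by exact: measurable_itv.
(* On [[1/4, 3/4]] both [t] and [1 - t] are at least 1/4, so each factor of [bump0] is at least
   exp(-4). *)
pose q : R := expR (- 4) * expR (- 4).
have q0 : 0 < q by rewrite mulr_gt0 ?expR_gt0.
have muD : mu D = (2^-1)%:E.
  rewrite /D lebesgue_measure_itv/= lte_fin ifT; last by lra.
  by rewrite -EFinB; congr EFin; field.
have h : ((q * 2^-1)%:E <= \int[mu]_t (bump0 t)%:E)%E.
  rewrite EFinM -muD -integral_cst//.
  apply: (@le_trans _ _ (\int[mu]_(t in D) (bump0 t)%:E)%E).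
    apply: ge0_le_integral => //.
    - by move=> x _; rewrite lee_fin ltW.
    - apply/measurable_EFinP; apply: measurable_funTS; exact: smooth_measurable smooth_bump0.
    - move=> t; rewrite /D/= in_itv/= => /andP[t1 t2]; rewrite lee_fin /bump0 /flat.
      have h (s : R) : 4^-1 <= s -> expR (- 4) <= s^-1 ^+ 0 * expR (- s^-1).
        move=> hs; rewrite expr0 mul1r ler_expR lerN2.
        rewrite -(invrK (4 : R)) lef_pV2// posrE ?invr_gt0//.
        by apply: lt_le_trans hs; rewrite invr_gt0.
      rewrite !ifT; [|by lra|by lra].
      by apply: ler_pM; rewrite ?expR_ge0//; apply: h => //; lra.
  apply: ge0_subset_integral => //.
    by apply/measurable_EFinP; exact: smooth_measurable smooth_bump0.
  by move=> x _; rewrite lee_fin bump0_ge0.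
have fin := integrable_fin_num measurableT integrable_bump0.
have : 0 < q * 2^-1 by rewrite mulr_gt0.
rewrite -lte_fin => /lt_le_trans/(_ h) h'.
by rewrite -lte_fin /bump_mass /Rintegral fineK.
Qed.

Definition bump t : R := bump_mass^-1 * bump0 t.

Definition step t : R := primitive (bump : T -> R) t.

Lemma smooth_bump : smooth bump.
Proof. by apply: smooth_mul; [exact: (smooth_cst bump_mass^-1)|exact: smooth_bump0]. Qed.

Lemma bump_ge0 t : 0 <= bump t.
Proof. by rewrite mulr_ge0 ?bump0_ge0// invr_ge0 ltW// bump_mass_gt0. Qed.

Lemma bump_le t : bump t <= bump_mass^-1.
Proof. by rewrite ler_piMr ?bump0_le1// invr_ge0 ltW// bump_mass_gt0. Qed.

Lemma bump_out t : ~~ (0 < t < 1) -> bump t = 0.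
Proof. by move=> /bump0_out h; rewrite /bump h mulr0. Qed.

Lemma integrable_bump : mu.-integrable setT (EFin \o (bump : T -> R)).
Proof.
apply: (@integrable_supp _ 0 1 bump_mass^-1) => //.
- exact: smooth_measurable smooth_bump.
- by move=> t; rewrite ger0_norm ?bump_ge0 ?bump_le.
- move=> t h; apply: bump_out; apply: contra h => /andP[h1 h2].
  by rewrite !ltW.
Qed.

Lemma integral_bump : (\int[mu]_t (bump t)%:E = 1)%E.
Proof.
have fin := integrable_fin_num measurableT integrable_bump0.
have -> : (\int[mu]_t (bump t)%:E = \int[mu]_t (bump_mass^-1%:E * (bump0 t)%:E))%E.
  by apply: eq_integral => t _; rewrite -EFinM.
have mb : measurable_fun setT (EFin \o (bump0 : T -> R)).
  by apply/measurable_EFinP; exact: smooth_measurable smooth_bump0.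
have m0 : 0 <= bump_mass^-1 by rewrite invr_ge0 ltW// bump_mass_gt0.
have b0 : forall t : T, setT t -> (0 <= (EFin \o (bump0 : T -> R)) t)%E.
  by move=> t _; rewrite lee_fin bump0_ge0.
rewrite (ge0_integralZl_EFin _ measurableT b0 mb m0).
rewrite -[X in (_ * X)%E]fineK// -EFinM.
have -> : fine (\int[mu]_t (EFin \o (bump0 : T -> R)) t)%E = bump_mass by [].
by rewrite mulVf// gt_eqF// bump_mass_gt0.
Qed.

Lemma is_derive_step t : is_derive t 1 step (bump t).
Proof.
have tu : t < t + 1 by rewrite ltrDl.
have bi : mu.-integrable `]-oo, (t + 1)%R]%classic (EFin \o (bump : R -> R)).
  by apply: integrableS integrable_bump => //; exact: measurable_itv.
have [||d1 d2] := @continuous_FTC1 R (bump : R -> R) -oo%O t (t + 1) tu bi.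
- exact: ltNyr.
- exact: smooth_continuous smooth_bump t.
by apply: DeriveDef; [exact: d1|rewrite -derive1E; exact: d2].
Qed.

Lemma smooth_step : smooth step.
Proof. by apply: smooth_prim smooth_bump _ => t; exact: is_derive_step. Qed.

Lemma step_le0 t : t <= 0 -> step t = 0.
Proof.
move=> t0; rewrite /step /primitive /Rintegral integral0_eq// => s /=.
rewrite in_itv/= => st; rewrite bump_out//.
by rewrite negb_and -leNgt (le_trans st).
Qed.

Lemma step_ge1 t : 1 <= t -> step t = 1.
Proof.
move=> t1; rewrite /step /primitive /Rintegral.
suff -> : (\int[mu]_(x in `]-oo, t]) (bump x)%:E = 1)%E by [].
rewrite integral_mkcond -integral_bump; apply: eq_integral => s _; rewrite patchE; case: ifPn => // /negP nI.
rewrite bump_out// negb_and -!leNgt; apply/orP; right; rewrite leNgt; apply/negP => s1.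
by apply: nI; rewrite inE/= in_itv/= (le_trans (ltW s1)).
Qed.

Lemma step_itv t : 0 <= step t <= 1.
Proof.
have bI : mu.-integrable (`]-oo, t]%classic : set T) (EFin \o (bump : T -> R)).
  by apply: integrableS integrable_bump => //; exact: measurable_itv.
apply/andP; split; first by apply: Rintegral_ge0 => s _; exact: bump_ge0.
have mt : measurable (`]-oo, t]%classic : set T) by exact: measurable_itv.
have fin := integrable_fin_num mt bI.
rewrite -lee_fin /step /primitive /Rintegral fineK// -integral_bump.
apply: ge0_subset_integral => //.
- by apply/measurable_EFinP; exact: smooth_measurable smooth_bump.
- by move=> s _; rewrite lee_fin bump_ge0.
Qed.

End Bump.

(** * One-sided mollification *)

Section Ramp.
Context {R : realType}.
Local Notation T := (measurableTypeR R).
Implicit Types (t x y : R) (n : nat).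

Lemma integrable_mul_supp (f h : T -> R) (a b B : R) : locally_integrable setT (f : R -> R) ->
  measurable_fun setT h -> (forall t, `|h t| <= B) -> (forall t : R, ~~ (a <= t <= b) -> h t = 0) ->
  mu.-integrable setT (EFin \o (fun t => f t * h t)).
Proof.
move=> [mf _ locf] mh hB h0; pose D : set T := `[a, b]%classic.
have mD : measurable D by exact: measurable_itv.
have B0 : 0 <= B by apply: le_trans (hB 0).
apply/integrableP; split; first by apply/measurable_EFinP; exact: measurable_funM.
have fD : (\int[mu]_(x in D) `|f x|%:E < +oo)%E by apply: locf => //; exact: segment_compact.
have mfD : measurable_fun D (fun x : T => `|f x|%:E).
  by apply/measurable_EFinP; apply: measurableT_comp => //; exact: measurable_funTS.
apply: (@le_lt_trans _ _ (\int[mu]_(x in D) (B%:E * `|f x|%:E))%E); last first.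
  rewrite ge0_integralZl_EFin//.
  by apply: lte_mul_pinfty; rewrite ?lee_fin.
rewrite [leRHS]integral_mkcond; apply: ge0_le_integral.
- exact: measurableT.
- by [].
- by apply: measurableT_comp => //; apply/measurable_EFinP; exact: measurable_funM.
- by apply: (proj1 (measurable_restrictT _ mD)); exact: measurable_funeM.
- move=> x _; rewrite patchE; case: ifPn => [_|/negP nD].
    by rewrite -EFinM lee_fin normrM mulrC ler_wpM2r.
  rewrite /= h0 ?mulr0 ?normr0//; apply/negP => h'; apply: nD; rewrite inE /D/= in_itv/=.
  exact: h'.
Qed.

(** A one-sided mollifier of unit mass supported in [[x, x + 1/(n+1)]]; it is the derivative of the
    rescaled [step]. *)
Definition spike n x t : R := n.+1%:R * bump (n.+1%:R * t + - (n.+1%:R * x)).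

Lemma spike_ge0 n x t : 0 <= spike n x t. Proof. by rewrite mulr_ge0// bump_ge0. Qed.

Lemma spike_out n x t : ~~ (x <= t <= x + n.+1%:R^-1) -> spike n x t = 0.
Proof.
move=> h; rewrite /spike bump_out ?mulr0//; apply: contra h => /andP[h1 h2].
have K0 : 0 < n.+1%:R :> R by rewrite ltr0n.
move: h1 h2; rewrite -mulrBr pmulr_rgt0// subr_gt0 => /ltW -> /=.
by rewrite mulrC -ltr_pdivlMr// mul1r ltrBlDl => /ltW.
Qed.

Lemma measurable_spike n x : measurable_fun setT (spike n x : T -> R).
Proof.
apply: measurable_funM => //; apply: smooth_measurable.
exact: (smooth_affine n.+1%:R (- (n.+1%:R * x)) smooth_bump).
Qed.

Lemma spike_le n x t : spike n x t <= n.+1%:R * bump_mass^-1.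
Proof. by rewrite ler_wpM2l// bump_le. Qed.

Lemma integrable_mul_spike (f : T -> R) n x : locally_integrable setT (f : R -> R) ->
  mu.-integrable setT (EFin \o (fun t => f t * spike n x t)).
Proof.
move=> locf; apply: (@integrable_mul_supp _ _ x (x + n.+1%:R^-1) (n.+1%:R * bump_mass^-1)) => //.
- exact: measurable_spike.
- by move=> t; rewrite ger0_norm ?spike_ge0 ?spike_le.
- by move=> t; exact: spike_out.
Qed.

Lemma integral_spike n x : \int[mu]_t spike n x t = 1.
Proof.
have K0 : 0 < n.+1%:R :> R by rewrite ltr0n.
have mb : measurable_fun setT (fun t : R => (bump t)%:E).
  by apply/measurable_EFinP; exact: smooth_measurable smooth_bump.
have := @ge0_integral_affine R n.+1%:R (- (n.+1%:R * x)) setT (fun t => (bump t)%:E) K0 measurableT mb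
  (fun t _ => bump_ge0 t).
rewrite preimage_setT integral_bump mule1 => E.
rewrite /Rintegral.
have -> : (\int[mu]_t (spike n x t)%:E = \int[mu]_t (n.+1%:R%:E * (bump (n.+1%:R * t + - (n.+1%:R * x)))%:E))%E.
  by apply: eq_integral => t _; rewrite -EFinM.
rewrite ge0_integralZl_EFin//.
- by rewrite E -EFinM mulfV// gt_eqF.
- by move=> t _; rewrite lee_fin bump_ge0.
- apply/measurable_EFinP; apply: smooth_measurable.
  exact: (smooth_affine n.+1%:R (- (n.+1%:R * x)) smooth_bump).
Qed.

Lemma locally_integrable_cst (c : R) : locally_integrable setT (cst c : R -> R).
Proof.
split => //; first exact: openT.
move=> K _ cK; have mK : measurable (K : set T) by exact: compact_measurable.
have -> : (\int[mu]_(x in K) `|cst c x|%:E = \int[mu]_(x in K) cst `|c|%:E x)%E by [].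
rewrite integral_cst//; apply: lte_mul_pinfty => //; exact: compact_finite_measure.
Qed.

(** The spike is at most a constant over the length of a ball containing its support, so the error
    is controlled by the mean oscillation of [f] about [f x], which vanishes in the limit at a
    Lebesgue point. *)
Lemma spike_cvg (f : T -> R) x : locally_integrable setT (f : R -> R) -> lebesgue_pt f x ->
  \int[mu]_t (f t * spike n x t) @[n --> \oo] --> f x.
Proof.
move=> locf lx; have [mf _ loci] := locf.
(* The open ball of radius [2/(n+1)] contains the closed support of the spike. Its measure
   [4/(n+1)], against the height bound [(n+1)/bump_mass], gives the constant in [bound]. *)
pose r n : R := 2 * n.+1%:R^-1.
have r0 n : 0 < r n by rewrite mulr_gt0// invr_gt0.
have rcv : r n @[n --> \oo] --> (0 : R).
  rewrite -[X in _ --> X](mulr0 2); apply: cvgMr; exact: cvg_harmonic.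
have b0 := @bump_mass_gt0 R.
have locc : locally_integrable setT (fun t : R => f t - f x).
  by apply: locally_integrableB => //; exact: locally_integrable_cst.
have bound n : (`|(\int[mu]_t (f t * spike n x t)) - f x|%:E <= (4 * bump_mass^-1)%:E * davg f x (r n))%E.
  have K0 : 0 < n.+1%:R :> R by rewrite ltr0n.
  have i1 := integrable_mul_spike n x locf.
  have i3 := integrable_mul_spike n x locc.
  have isp : mu.-integrable setT (EFin \o (spike n x : T -> R)).
    have := integrable_mul_spike n x (locally_integrable_cst 1).
    by congr (is_true (mu.-integrable _ _)); apply/funext => t; rewrite /= mul1r.
  have -> : (\int[mu]_t (f t * spike n x t)) - f x = \int[mu]_t ((f t - f x) * spike n x t).
    rewrite -[X in _ - X]mulr1 -(integral_spike n x) -RintegralZl// -RintegralB//;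
      last exact: (integrable_mul_spike n x (locally_integrable_cst (f x))).
    by apply: eq_Rintegral => t _; rewrite mulrBl.
  apply: (@le_trans _ _ (\int[mu]_t `|(f t - f x) * spike n x t|)%:E).
    by rewrite lee_fin; apply: le_normr_Rintegral.
  rewrite /Rintegral fineK; last by apply: integrable_fin_num => //; exact: integrable_abse i3.
  have mball : measurable (ball x (r n) : set T) by rewrite ball_itv; exact: measurable_itv.
  rewrite /davg /iavg lebesgue_measure_ball ?(ltW (r0 n))//.
  pose G (t : T) : \bar R := `|f t - f x|%:E.
  have mG : measurable_fun setT G.
    by apply/measurable_EFinP; apply: measurableT_comp => //; exact: measurable_funB.
  have -> : (\int[mu]_(y in ball x (r n)) `|((center (f x) \o f) y)%:E| = \int[mu]_(y in ball x (r n)) G y)%E.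
    by apply: eq_integral => t _.
  rewrite muleA inver gt_eqF ?pmulrn_lgt0// -EFinM.
  have -> : 4 * bump_mass^-1 * (r n *+ 2)^-1 = n.+1%:R * bump_mass^-1 :> R.
    by rewrite /r; field; rewrite !gt_eqF.
  rewrite -ge0_integralZl_EFin//; last 3 first.
  - by move=> t _; rewrite lee_fin.
  - exact: measurable_funTS.
  - by rewrite mulr_ge0// invr_ge0 ltW.
  rewrite [leRHS]integral_mkcond; apply: ge0_le_integral.
  - exact: measurableT.
  - by move=> t _; rewrite lee_fin.
  - apply/measurable_EFinP; apply: measurableT_comp => //; apply: measurable_funM; last exact: measurable_spike.
    exact: measurable_funB.
  - by apply: (proj1 (measurable_restrictT _ mball)); apply: measurable_funeM; exact: measurable_funTS.
  - move=> t _; rewrite patchE; case: ifPn => [_|/negP nD].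
      rewrite /G -EFinM lee_fin normrM (ger0_norm (spike_ge0 _ _ _)) mulrC.
      by apply: ler_wpM2r => //; exact: spike_le.
    rewrite spike_out ?mulr0 ?normr0//; apply/negP => /andP[h1 h2]; apply: nD.
    rewrite inE ball_itv/= in_itv/=; apply/andP; split.
      by rewrite (lt_le_trans _ h1)// gtrBl.
    by rewrite (le_lt_trans h2)// ltrD2l /r ltr_pMl ?invr_gt0// ltr1n.
have dcv : davg f x (r n) @[n --> \oo] --> 0%E.
  apply: (cvg_comp r (davg f x) _ lx) => A HA.
  have : \forall n \near \oo, (0 < r n -> A (r n)) by exact: (rcv (fun u => 0 < u -> A u) HA).
  move=> near_r; change (\forall n \near \oo, A (r n)); move: near_r.
  by apply: filterS => n h; exact: (h (r0 n)).
have {}dcv := cvgeZl (y := (4 * bump_mass^-1)%:E) isT dcv; rewrite mule0 in dcv.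
apply/cvgrPdist_le => e e0.
move: dcv => /fine_cvgP[fin /cvgrPdist_le/(_ e e0)] near_e.
near=> n; rewrite distrC -lee_fin; apply: (le_trans (bound n)).
have h1 : ((4 * bump_mass^-1)%:E * davg f x (r n))%E \is a fin_num by near: n.
rewrite -(fineK h1) lee_fin.
have : `|0 - fine ((4 * bump_mass^-1)%:E * davg f x (r n))%E| <= e by near: n.
by rewrite sub0r normrN; apply: le_trans; exact: ler_norm.
Unshelve. all: by end_near. Qed.

End Ramp.

(** * Increments of a function recovered from its weak derivative *)

Section WeakJump.
Context {R : realType}.
Local Notation T := (measurableTypeR R).
Implicit Types (t x y : R) (n : nat) (I : set R).

(** A smooth plateau approximating the indicator of []x, y]]. Its derivative is a spike at [x] minus
    a spike at [y], so testing with it turns a weak derivative into an increment. *)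
Definition ramp n x y t : R :=
  step (n.+1%:R * t + - (n.+1%:R * x)) - step (n.+1%:R * t + - (n.+1%:R * y)).

Lemma smooth_ramp n x y : smooth (ramp n x y).
Proof.
have -> : ramp n x y = fun t => step (n.+1%:R * t + - (n.+1%:R * x)) + (cst (-1) t) * step (n.+1%:R * t + - (n.+1%:R * y)).
  by apply/funext => t; rewrite /ramp /cst/= mulN1r.
apply: smooth_add; first exact: (smooth_affine n.+1%:R (- (n.+1%:R * x)) smooth_step).
apply: smooth_mul; first exact: smooth_cst.
exact: (smooth_affine n.+1%:R (- (n.+1%:R * y)) smooth_step).
Qed.

Lemma derive_step_affine n x t : is_derive t 1 (fun s => step (n.+1%:R * s + - (n.+1%:R * x))) (spike n x t).
Proof.
rewrite /spike [X in is_derive _ _ _ X]mulrC.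
apply: (@is_derive1_comp _ step (fun s => n.+1%:R * s + - (n.+1%:R * x))).
  exact: is_derive_step.
rewrite -[X in is_derive _ _ _ X]addr0.
apply: (@is_deriveD _ _ _ (fun t => n.+1%:R * t) (cst (- (n.+1%:R * x)))).
rewrite -[X in is_derive _ _ _ X]mulr1.
exact: (@is_deriveZ _ _ _ id n.+1%:R).
Qed.

Lemma derive1_ramp n x y t : derive1 (ramp n x y) t = spike n x t - spike n y t.
Proof.
have d1 := derive_step_affine n x t; have d2 := derive_step_affine n y t.
by have [_ <-] := is_deriveB d1 d2; rewrite derive1E.
Qed.

Lemma ramp_out n x y t : x <= y -> ~~ (x <= t <= y + n.+1%:R^-1) -> ramp n x y t = 0.
Proof.
move=> xy h; have K0 : 0 < n.+1%:R :> R by rewrite ltr0n.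
have [tx|xt] := ltP t x.
  rewrite /ramp !step_le0 ?subrr//; rewrite -mulrBr pmulr_rle0// subr_le0 ltW//.
  exact: lt_le_trans xy.
move: h; rewrite xt/= -ltNge => h.
have aux z : z <= y -> 1 <= n.+1%:R * t + - (n.+1%:R * z).
  move=> zy; rewrite -mulrBr mulrC -ler_pdivrMr// div1r lerBrDr.
  by apply: le_trans (ltW h); rewrite addrC lerD2r.
by rewrite /ramp !step_ge1 ?subrr//; exact: aux.
Qed.

Lemma ramp_norm n x y t : `|ramp n x y t| <= 1.
Proof.
rewrite /ramp; have := step_itv (n.+1%:R * t + - (n.+1%:R * x)).
have := step_itv (n.+1%:R * t + - (n.+1%:R * y)).
move: (step _) (step _) => a b /andP[a0 a1] /andP[b0 b1].
by rewrite ler_norml; apply/andP; split; lra.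
Qed.

Lemma ramp_cvg x y t : x <= y -> ramp n x y t @[n --> \oo] --> ((x < t <= y)%R%:R : R).
Proof.
move=> xy.
have cv z : step (n.+1%:R * t + - (n.+1%:R * z)) @[n --> \oo] --> ((z < t)%R%:R : R).
  have [tz|zt] := leP t z.
    apply: cvg_near_cst; apply: nearW => n.
    by rewrite step_le0// -mulrBr pmulr_rle0 ?ltr0n// subr_le0.
  apply: cvg_near_cst; near=> n; rewrite step_ge1//.
  have tz0 : 0 < t - z by rewrite subr_gt0.
  rewrite -mulrBr -ler_pdivrMr// mul1r.
  have : (t - z)^-1 <= n%:R by near: n; exact: nbhs_infty_ger.
  by move=> /le_trans; apply; rewrite ler_nat.
have -> : ((x < t <= y)%R%:R : R) = (x < t)%R%:R - (y < t)%R%:R.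
  have [ty|yt] := leP t y; rewrite ?andbT ?andbF ?subr0//.
  by rewrite (le_lt_trans xy yt) subrr.
by apply: cvgB; exact: cv.
Unshelve. all: by end_near. Qed.

Lemma ramp_test I n x y : x <= y -> `[x, (y + n.+1%:R^-1)%R]%classic `<=` I -> test_function I (ramp n x y).
Proof.
move=> xy KI.
have cl : closure [set t | ramp n x y t != 0] `<=` `[x, (y + n.+1%:R^-1)%R]%classic.
  have cK : closed (`[x, (y + n.+1%:R^-1)%R]%classic : set R) by exact: itv_closed.
  rewrite [X in _ `<=` X](closure_id _).1//; apply: closure_subset => t /= rt.
  by rewrite in_itv/=; apply/negP => /negP h; move/eqP: rt; apply; exact: ramp_out.
split.
- by move=> k t; apply: smooth_derivable; exact: smooth_ramp.
- apply: (subclosed_compact _ (@segment_compact _ x (y + n.+1%:R^-1)) cl).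
  exact: closed_closure.
- exact: subset_trans KI.
Qed.

Lemma measurable_ramp n x y : measurable_fun setT (ramp n x y : T -> R).
Proof. exact: smooth_measurable (smooth_ramp n x y). Qed.

(** The ramps overshoot [y] by [1/(n+1)]; they are test functions on [I] only once this margin fits
    into [I]. *)
Lemma open_right_room I y : open I -> I y -> exists m : nat, `[y, (y + m.+1%:R^-1)%R]%classic `<=` I.
Proof.
move=> oI Iy; have [r r0 rI] := (@nbhs_ballP R R y I).1 (open_nbhs_nbhs (conj oI Iy)).
exists (Num.truncn r^-1) => t /=; rewrite in_itv/= => /andP[yt ty]; apply: rI.
rewrite /ball/= distrC ger0_norm ?subr_ge0//.
have h : (Num.truncn r^-1).+1%:R^-1 < r.
  by rewrite -[X in _ < X]invrK ltf_pV2 ?posrE ?invr_gt0// truncnS_gt.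
by apply: le_lt_trans h; rewrite lerBlDl.
Qed.

Lemma room_inv I x y m n : is_interval I -> I x -> I y -> `[y, (y + m.+1%:R^-1)%R]%classic `<=` I ->
  x <= y -> (m <= n)%N -> `[x, (y + n.+1%:R^-1)%R]%classic `<=` I.
Proof.
move=> II Ix Iy mI xy mn t /=; rewrite in_itv/= => /andP[xt ty].
have Im : I (y + m.+1%:R^-1) by apply: mI; rewrite /= in_itv/= lexx andbT lerDl invr_ge0.
apply: (II _ _ Ix Im); rewrite xt/= (le_trans ty)// lerD2l lef_pV2 ?posrE// ler_nat.
by [].
Qed.

Lemma ramp_dct (m : {measure set T -> \bar R}) I (w : T -> R) x y k :
  measurable (I : set T) -> is_interval I -> I x -> I y -> x <= y ->
  `[y, (y + k.+1%:R^-1)%R]%classic `<=` I ->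
  measurable_fun I w -> (\int[m]_(t in `[x, (y + k.+1%:R^-1)%R]) `|w t|%:E < +oo)%E ->
  (\int[m]_(t in I) (w t * ramp n x y t)%:E)%E @[n --> \oo] --> (\int[m]_(t in `]x, y]) (w t)%:E)%E.
Proof.
move=> mI II Ix Iy xy kI mw wK.
pose K : set T := `[x, (y + k.+1%:R^-1)%R]%classic.
have mK : measurable K by exact: measurable_itv.
have KI : K `<=` I by apply: room_inv kI _ _.
have mwK : measurable_fun K w by apply: measurable_funS mw.
have Kxy : `]x, y]%classic `<=` K.
  move=> t; rewrite /K/= !in_itv/= => /andP[/ltW -> ty]/=.
  by rewrite (le_trans ty)// lerDl invr_ge0.
have mxy : measurable (`]x, y]%classic : set T) by exact: measurable_itv.
have E2 : (\int[m]_(t in `]x, y]) (w t)%:E = \int[m]_(t in K) (w t * (x < t <= y)%R%:R)%:E)%E.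
  rewrite -[in LHS](setIidr Kxy) integral_mkcondr; apply: eq_integral => t _.
  rewrite patchE; case: ifPn => [|/negP nt].
    by rewrite inE/= in_itv/= => ->; rewrite mulr1.
  suff -> : (x < t <= y)%R = false by rewrite mulr0.
  by apply/negbTE/negP => h; apply: nt; rewrite inE/= in_itv/=.
rewrite E2.
(* After a shift of the index by [k], all ramps are supported in the single compact interval [K], on
   which the integrable function [|w|] dominates. *)
pose F n (t : T) : \bar R := (w t * ramp (n + k) x y t)%:E.
have out n (t : R) : ~ K t -> ramp (n + k) x y t = 0.
  move=> nK; apply: ramp_out => //; apply/negP => /andP[h1 h2]; apply: nK.
  rewrite /K/= in_itv/= h1/= (le_trans h2)// lerD2l lef_pV2 ?posrE// ler_nat ltnS leq_addl.
  by [].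
have EF n : (\int[m]_(t in I) (w t * ramp (n + k) x y t)%:E = \int[m]_(t in K) F n t)%E.
  rewrite -[in RHS](setIidr KI) integral_mkcondr; apply: eq_integral => t _.
  rewrite patchE; case: ifPn => // /negP nK; rewrite out ?mulr0// => Kt; apply: nK.
  by rewrite inE.
suff H : (\int[m]_(t in K) F n t)%E @[n --> \oo] --> (\int[m]_(t in K) (w t * (x < t <= y)%R%:R)%:E)%E.
  rewrite -(cvg_shiftn k); apply: cvg_trans H; apply: near_eq_cvg; apply: nearW => n.
  by rewrite /= EF.
have mF n : measurable_fun K (F n).
  apply/measurable_EFinP; apply: measurable_funM => //; apply: measurable_funTS.
  exact: measurable_ramp.
have iw : m.-integrable K (fun t => `|w t|%:E).
  apply/integrableP; split; first by apply/measurable_EFinP; exact: measurableT_comp.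
  have -> : (\int[m]_(t in K) `| `|w t|%:E | = \int[m]_(t in K) `|w t|%:E)%E.
    by apply: eq_integral => t _; rewrite gee0_abs// lee_fin.
  exact: wK.
apply: (@dominated_cvg _ _ _ m K mK F _ (fun t => `|w t|%:E)) => //.
- move=> t Kt; apply: cvg_EFin; first by apply: nearW.
  apply: cvgMr; have : ramp n x y t @[n --> \oo] --> ((x < t <= y)%R%:R : R) by exact: ramp_cvg.
  by rewrite -(cvg_shiftn k).
- move=> n t Kt; rewrite /F lee_fin normrM ler_piMr//; exact: ramp_norm.
Qed.

(** [L] stands for the pairing with the derivative and is left abstract, so that one argument serves
    derivatives that are functions and derivatives that are charges. At Lebesgue points the two
    spikes evaluate [u]. *)
Lemma weak_jump I (u : T -> R) x y (L : (R -> R) -> \bar R) (D : R) :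
  open I -> is_interval I -> locally_integrable setT (u \_ I) ->
  I x -> I y -> x <= y -> lebesgue_pt (u \_ I) x -> lebesgue_pt (u \_ I) y ->
  (forall psi, test_function I psi -> (\int[mu]_(t in I) (u t * derive1 psi t)%:E = - L psi)%E) ->
  L (ramp n x y) @[n --> \oo] --> D%:E -> u y - u x = D.
Proof.
move=> oI II locu Ix Iy xy lx ly wd LD.
have [m mI] := open_right_room oI Iy.
pose f : T -> R := u \_ I.
have fx z : I z -> f z = u z by move=> Iz; rewrite /f patchE mem_set.
have cv : (\int[mu]_t (f t * spike n x t)) - (\int[mu]_t (f t * spike n y t)) @[n --> \oo] --> u x - u y.
  by rewrite -(fx x)// -(fx y)//; apply: cvgB; exact: spike_cvg.
have E : \forall n \near \oo, ((\int[mu]_t (f t * spike n x t)) - (\int[mu]_t (f t * spike n y t)))%:E = (- L (ramp n x y))%E.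
  near=> n.
  have mn : (m <= n)%N by near: n; exact: nbhs_infty_ge.
  rewrite -(wd (ramp n x y)); last by apply: ramp_test => //; exact: (room_inv II Ix Iy mI).
  have i1 := integrable_mul_spike n x locu; have i2 := integrable_mul_spike n y locu.
  rewrite -RintegralB// /Rintegral fineK; last first.
    apply: integrable_fin_num => //.
    have := integrableB measurableT i1 i2.
    by congr (is_true (mu.-integrable _ _)).
  rewrite [RHS]integral_mkcond; apply: eq_integral => t _.
  rewrite !patchE; case: ifPn => tI; rewrite /f patchE ?(negbTE tI) ?tI.
    by rewrite derive1_ramp mulrBr.
  by rewrite !mul0r subrr.
have L2 : L (ramp n x y) @[n --> \oo] --> (u y - u x)%:E.
  have -> : (u y - u x)%:E = (- (u x - u y)%:E)%E by rewrite -EFinN opprB.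
  have cvE : ((\int[mu]_t (f t * spike n x t)) - (\int[mu]_t (f t * spike n y t)))%:E @[n --> \oo] --> (u x - u y)%:E.
    by apply: cvg_EFin => //; exact: nearW.
  apply: cvg_trans (cvgeN cvE); apply: near_eq_cvg.
  by apply: filterS E => n ->; rewrite oppeK.
by apply: EFin_inj; exact: (cvg_unique _ L2 LD).
Unshelve. all: by end_near. Qed.

End WeakJump.

(** * Increments of functions whose derivative is in L^p or a measure; Jensen's inequality *)

Section SlopesOfDerivatives.
Context {R : realType}.
Local Notation T := (measurableTypeR R).
Implicit Types (x y : R) (I : set R) (u v : T -> R).

Lemma open_interval_measurable I : open I -> measurable (I : set T).
Proof. exact: open_measurable. Qed.

(** [|f|] is at most [|f| ^ p + 1], and compact sets have finite measure. *)
Lemma Lp_locally_integrable (p : R) (f : T -> R) : 1 <= p -> measurable_fun setT f ->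
  (\int[mu]_x (`|f x| `^ p)%:E < +oo)%E -> locally_integrable setT (f : R -> R).
Proof.
move=> p1 mf fp; split => //; first exact: openT.
move=> K _ cK; have mK : measurable (K : set T) by exact: compact_measurable.
pose g (x : T) : \bar R := (`|f x| `^ p)%:E.
have mg : measurable_fun setT g.
  by apply/measurable_EFinP; apply: (measurableT_comp (measurable_powR _)); exact: measurableT_comp.
have g0 x : (0 <= g x)%E by rewrite lee_fin powR_ge0.
apply: (@le_lt_trans _ _ (\int[mu]_(x in K) (g x + 1))%E).
  apply: ge0_le_integral.
  - exact: mK.
  - by move=> x _; rewrite lee_fin.
  - by apply/measurable_EFinP; apply: measurableT_comp => //; exact: measurable_funTS.
  - by apply: emeasurable_funD => //; exact: measurable_funTS.
  - move=> x _; rewrite -EFinD lee_fin; have [f1|f1] := leP `|f x| 1.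
      by rewrite (le_trans f1)// lerDr powR_ge0.
    apply: (@le_trans _ _ (`|f x| `^ p)); last by rewrite lerDl.
    by rewrite -[leLHS]powRr1// ler_powR// ltW.
rewrite ge0_integralD//; last exact: measurable_funTS.
rewrite integral_cst// mul1e; apply: lte_add_pinfty; last exact: compact_finite_measure.
apply: le_lt_trans fp; apply: ge0_subset_integral => //.
Qed.

Lemma restrict_Lp (p : R) I (f : T -> R) : 0 < p -> (\int[mu]_(x in I) (`|f x| `^ p)%:E < +oo)%E ->
  (\int[mu]_x (`|(f \_ I) x| `^ p)%:E < +oo)%E.
Proof.
move=> p0; rewrite integral_mkcond; apply: le_lt_trans; rewrite le_eqVlt; apply/orP; left; apply/eqP.
by apply: eq_integral => x _; rewrite !patchE; case: ifP => // _; rewrite normr0 powR0// gt_eqF.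
Qed.

Lemma weak_fun_jump I u v : open I -> is_interval I ->
  locally_integrable setT (u \_ I) -> locally_integrable setT (v \_ I) -> weak_derivative I u v ->
  exists N : set T, [/\ measurable N, mu N = 0%E & forall x y, I x -> I y -> ~ N x -> ~ N y -> x < y ->
    u y - u x = \int[mu]_(t in `]x, y]) (v \_ I) t].
Proof.
move=> oI II locu locv wd.
have [N [mN N0 NB]] := lebesgue_differentiation locu.
exists N; split => // x y Ix Iy Nx Ny xy.
have lx z : ~ N z -> lebesgue_pt (u \_ I) z by move=> Nz; apply: contrapT => h; apply: Nz; exact: NB.
have [k kI] := open_right_room oI Iy.
have mI := open_interval_measurable oI.
have [mv _ cv] := locv.
have KI : `[x, (y + k.+1%:R^-1)%R]%classic `<=` I by apply: room_inv II Ix Iy kI (ltW xy) _.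
have mK : measurable (`[x, (y + k.+1%:R^-1)%R]%classic : set T) by exact: measurable_itv.
have wK : (\int[mu]_(t in `[x, (y + k.+1%:R^-1)%R]) `|(v \_ I) t|%:E < +oo)%E.
  by apply: cv => //; exact: segment_compact.
have dct := ramp_dct mI II Ix Iy (ltW xy) kI (measurable_funTS mv) wK.
pose L (psi : R -> R) : \bar R := (\int[mu]_(t in I) ((v \_ I) t * psi t)%:E)%E.
have fin : (\int[mu]_(t in `]x, y]) ((v \_ I) t)%:E)%E \is a fin_num.
  apply: integrable_fin_num; first exact: measurable_itv.
  apply/integrableP; split; first by apply/measurable_EFinP; exact: measurable_funTS.
  apply: le_lt_trans wK; apply: ge0_subset_integral => //.
  - by apply: measurableT_comp => //; apply/measurable_EFinP; exact: measurable_funTS.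
  - move=> t /=; rewrite !in_itv/= => /andP[/ltW -> ty]/=.
    by rewrite (le_trans ty)// lerDl invr_ge0.
apply: (weak_jump oI II locu Ix Iy (ltW xy) (lx _ Nx) (lx _ Ny) (L := L)).
- move=> psi tpsi; rewrite (wd psi tpsi); congr (- _)%E; apply: eq_integral => t tI.
  by rewrite patchE tI.
- by rewrite /Rintegral fineK.
Qed.

Lemma weak_measure_jump I u (nu : {charge set T -> \bar R}) : open I -> is_interval I ->
  locally_integrable setT (u \_ I) -> measure_derivative I u nu ->
  exists N : set T, [/\ measurable N, mu N = 0%E & forall x y, I x -> I y -> ~ N x -> ~ N y -> x < y ->
    (u y - u x)%:E = nu `]x, y]%classic].
Proof.
move=> oI II locu wd.
have [N [mN N0 NB]] := lebesgue_differentiation locu.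
exists N; split => // x y Ix Iy Nx Ny xy.
have lx z : ~ N z -> lebesgue_pt (u \_ I) z by move=> Nz; apply: contrapT => h; apply: Nz; exact: NB.
have [k kI] := open_right_room oI Iy.
have mI := open_interval_measurable oI.
have mxy : measurable (`]x, y]%classic : set T) by exact: measurable_itv.
have mK : measurable (`[x, (y + k.+1%:R^-1)%R]%classic : set T) by exact: measurable_itv.
have dct (m : {finite_measure set T -> \bar R}) :
    (\int[m]_(t in I) (ramp n x y t)%:E)%E @[n --> \oo] --> m `]x, y]%classic.
  have wK : (\int[m]_(t in `[x, (y + k.+1%:R^-1)%R]) `|(cst 1 : T -> R) t|%:E < +oo)%E.
    rewrite (_ : (\int[m]_(t in _) _)%E = \int[m]_(t in `[x, (y + k.+1%:R^-1)%R]) cst 1%:E t)%E; last first.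
      by apply: eq_integral => t _; rewrite normr1.
    by rewrite integral_cst// mul1e ltey_eq fin_num_measure.
  have := @ramp_dct R m I (cst 1) x y k mI II Ix Iy (ltW xy) kI (measurable_cst _) wK.
  have -> : (\int[m]_(t in `]x, y]) ((cst 1 : T -> R) t)%:E = m `]x, y]%classic)%E.
    by rewrite -[RHS]mul1e -integral_cst.
  apply: cvg_trans; apply: near_eq_cvg; apply: nearW => n.
  by apply: eq_integral => t _; rewrite mul1r.
pose P := jordan_pos (hahnP nu); pose Q := jordan_neg (hahnP nu).
have finP : P `]x, y]%classic \is a fin_num by exact: fin_num_measure.
have finQ : Q `]x, y]%classic \is a fin_num by exact: fin_num_measure.
have nuE : nu `]x, y]%classic = (P `]x, y]%classic - Q `]x, y]%classic)%E.
  by rewrite (jordan_decomp (hahnP nu) mxy) /cadd/= /cscale/= mulN1e.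
have finnu : nu `]x, y]%classic \is a fin_num by rewrite nuE fin_numB finP.
rewrite -(fineK finnu); congr EFin.
apply: (weak_jump oI II locu Ix Iy (ltW xy) (lx _ Nx) (lx _ Ny) wd).
rewrite fineK// nuE /charge_integral; apply: cvgeB; [by rewrite fin_num_adde_defl// fin_numN|exact: dct|exact: dct].
Qed.

(** The tangent inequality for the power function at the mean value [s = A / L] is integrated over
    [D]. It is read off from Young's inequality with exponents [p] and [q = p / (p - 1)], which is
    why [p = 1] is treated apart. *)
Lemma jensen_powR (p : R) (D : set T) (f : T -> R) (L : R) : 1 <= p -> measurable D -> mu D = L%:E -> 0 < L ->
  measurable_fun D f -> (\int[mu]_(x in D) (`|f x| `^ p)%:E < +oo)%E ->
  (\int[mu]_(x in D) `|f x|%:E < +oo)%E ->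
  (fine (\int[mu]_(x in D) `|f x|%:E)) `^ p <= L `^ (p - 1) * fine (\int[mu]_(x in D) (`|f x| `^ p)%:E).
Proof.
move=> p1 mD DL L0 mf fp f1.
have i10 : (0 <= \int[mu]_(x in D) `|f x|%:E)%E by apply: integral_ge0 => x _; rewrite lee_fin.
have ip0 : (0 <= \int[mu]_(x in D) (`|f x| `^ p)%:E)%E.
  by apply: integral_ge0 => x _; rewrite lee_fin powR_ge0.
have finp : (\int[mu]_(x in D) (`|f x| `^ p)%:E)%E \is a fin_num by rewrite ge0_fin_numE.
have fin1 : (\int[mu]_(x in D) `|f x|%:E)%E \is a fin_num by rewrite ge0_fin_numE.
have [->|pN1] := eqVneq p 1.
  rewrite subrr powRr0 mul1r powRr1 ?fine_ge0//.
  rewrite le_eqVlt; apply/orP; left; apply/eqP; congr fine.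
  by apply: eq_integral => x _; rewrite powRr1.
have {}p1 : 1 < p by rewrite lt_neqAle eq_sym pN1.
have p0 : 0 < p by exact: lt_trans p1.
pose A := fine (\int[mu]_(x in D) `|f x|%:E); pose B := fine (\int[mu]_(x in D) (`|f x| `^ p)%:E).
have A0 : 0 <= A by exact: fine_ge0.
pose s := A / L; have s0 : 0 <= s by rewrite divr_ge0// ltW.
pose q := p / (p - 1).
have p10 : 0 < p - 1 by rewrite subr_gt0.
have q0 : 0 < q by rewrite divr_gt0.
have pq : p^-1 + q^-1 = 1 by rewrite /q; field; rewrite !gt_eqF.
have tangent t : 0 <= t -> p * s `^ (p - 1) * t <= t `^ p + (p - 1) * s `^ p.
  move=> t0; have := conjugate_powR t0 (powR_ge0 s (p - 1)) p0 q0 pq.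
  rewrite -powRrM (_ : (p - 1) * q = p); last by rewrite /q; field; rewrite gt_eqF.
  rewrite -(ler_pM2l p0) mulrDr => h; apply: le_trans (le_trans h _).
    by rewrite -mulrA [X in _ * X]mulrC.
  rewrite le_eqVlt; apply/orP; left; apply/eqP; rewrite /q; field; rewrite !gt_eqF//.
have m1 : measurable_fun D (fun x : T => `|f x|%:E) by apply/measurable_EFinP; exact: measurableT_comp.
have mp : measurable_fun D (fun x : T => (`|f x| `^ p)%:E).
  by apply/measurable_EFinP; apply: (measurableT_comp (measurable_powR _)); exact: measurableT_comp.
have key : p * s `^ (p - 1) * A <= B + (p - 1) * s `^ p * L.
  rewrite -lee_fin EFinD EFinM /A /B !fineK// -ge0_integralZl_EFin//; last by rewrite mulr_ge0 ?powR_ge0// ltW.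
  have -> : ((p - 1) * s `^ p * L)%:E = (\int[mu]_(x in D) cst ((p - 1) * s `^ p)%:E x)%E.
    by rewrite integral_cst// [X in (_ * X)%E]DL.
  rewrite -ge0_integralD//; last first.
    by move=> x _; rewrite lee_fin mulr_ge0 ?powR_ge0// ltW.
  apply: ge0_le_integral => //.
  - by move=> x _; rewrite mule_ge0// lee_fin mulr_ge0 ?powR_ge0// ltW.
  - exact: measurable_funeM.
  - exact: emeasurable_funD.
  - by move=> x _; rewrite -EFinM -EFinD lee_fin; exact: tangent.
have AE : A = s * L by rewrite /s divfK// gt_eqF.
have sp : s `^ (p - 1) * s = s `^ p.
  by rewrite -[X in _ * X]powRr1// -powRD ?subrK// (gt_eqF p0).
have key2 : s `^ p * L <= B.
  move: key; rewrite AE (_ : p * s `^ (p - 1) * (s * L) = p * (s `^ p * L)); last by rewrite -sp; ring.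
  rewrite -mulrA; move: (_ * L) => t; lra.
have Lp : L `^ (p - 1) * L = L `^ p.
  by rewrite -[X in _ * X]powRr1 ?ltW// -powRD ?subrK// (gt_eqF p0).
rewrite -/A -/B AE powRM ?(ltW L0)// -Lp mulrCA mulrA -[leLHS]mulrA; apply: ler_wpM2l; first exact: powR_ge0.
exact: key2.
Qed.

End SlopesOfDerivatives.

(** * Finite Stieltjes measures and their uniqueness *)

Section Monotone.
Context {R : realType}.
Local Notation T := (measurableTypeR R).
Implicit Types (x y : R) (I : set R).

Lemma stieltjes_ex (f : R -> R) (l s : R) : {homo f : x y / x <= y} -> right_continuous f ->
  (forall x, l <= f x <= s) ->
  exists m : {finite_measure set T -> \bar R},
    (forall x y, x <= y -> m `]x, y]%classic = (f y - f x)%:E) /\ (m setT <= (s - l)%:E)%E.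
Proof.
move=> nd rc fb.
pose F : cumulative R R := HB.pack f (isCumulative.Build _ _ _ f nd rc).
pose m0 := lebesgue_stieltjes_measure F.
have m0E x y : x <= y -> m0 `]x, y]%classic = (f y - f x)%:E.
  move=> xy; rewrite /m0 /lebesgue_stieltjes_measure /measure_extension measurable_mu_extE/=; last exact: is_ocitv.
  rewrite wlength_itv/= lte_fin; case: ltP => yx; first by rewrite EFinB.
  by have -> : x = y; [apply/eqP; rewrite eq_le xy yx|rewrite subrr].
have m0T : (m0 setT <= (s - l)%:E)%E.
  have -> : [set: T] = \bigcup_n (`](- n%:R)%R, n%:R]%classic : set T).
    apply/seteqP; split => // x _; exists (Num.truncn `|x|).+1 => //=.
    have : `|x| < (Num.truncn `|x|).+1%:R by exact: truncnS_gt.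
    by rewrite ltr_norml in_itv/= => /andP[-> /ltW ->].
  have cv : (m0 \o (fun n : nat => `](- n%:R)%R, n%:R]%classic : set T)) n @[n --> \oo] -->
      m0 (\bigcup_n (`](- n%:R)%R, n%:R]%classic : set T)).
    apply: nondecreasing_cvg_mu.
    - by move=> n; exact: measurable_itv.
    - by apply: bigcup_measurable => n _; exact: measurable_itv.
    - move=> n k nk; apply/subsetPset => x /=; rewrite !in_itv/= => /andP[h1 h2].
      have nkR : n%:R <= k%:R :> R by rewrite ler_nat.
      by rewrite (le_lt_trans _ h1) ?lerN2//= (le_trans h2).
  rewrite -(cvg_lim _ cv)//; apply: lime_le; first by apply/cvg_ex; eexists; exact: cv.
  apply: nearW => n /=; rewrite m0E; last by rewrite (@le_trans _ _ 0)// oppr_le0.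
  rewrite lee_fin; apply: lerB; first by case/andP: (fb n%:R).
  by case/andP: (fb (- n%:R)).
have m0oo : (m0 setT < +oo)%E by apply: le_lt_trans m0T _; rewrite ltry.
pose m : {finite_measure set T -> \bar R} := mfrestr (measurableT : measurable (setT : set T)) m0oo.
have mE (A : set T) : m A = m0 A.
  by change (m0 (A `&` setT) = m0 A); rewrite setIT.
by exists m; split; [move=> x y xy; rewrite mE m0E|rewrite mE].
Qed.

(** The intervals []x, x + 1/(n+1)]] decrease to the empty set and [m] is finite, so their measures
    tend to 0. *)
Lemma finite_measure_right (m : {finite_measure set T -> \bar R}) x (e : R) : 0 < e ->
  exists2 h : R, 0 < h & forall y, x <= y < x + h -> (m `]x, y]%classic <= e%:E)%E.
Proof.
move=> e0; pose F (n : nat) : set T := `]x, (x + n.+1%:R^-1)%R]%classic.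
have cv : (m \o F) n @[n --> \oo] --> m (\bigcap_n F n).
  apply: nonincreasing_cvg_mu.
  - by rewrite ltey_eq fin_num_measure//; exact: measurable_itv.
  - by move=> n; exact: measurable_itv.
  - by apply: bigcap_measurable => [|n _]; [exists 0%N|exact: measurable_itv].
  - move=> n k nk; apply/subsetPset => t; rewrite /F/= !in_itv/= => /andP[-> h]/=.
    by rewrite (le_trans h)// lerD2l lef_pV2 ?posrE// ler_nat ltnS.
have F0 : \bigcap_n F n = set0.
  apply/seteqP; split => // t Ft; have := Ft 0%N I; rewrite /F/= in_itv/= => /andP[xt _].
  have tx : 0 < t - x by rewrite subr_gt0.
  have := Ft (Num.truncn (t - x)^-1) I; rewrite /F/= in_itv/= => /andP[_].
  rewrite -lerBlDl leNgt => /negP; apply.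
  by rewrite -[X in _ < X]invrK ltf_pV2 ?posrE ?invr_gt0// truncnS_gt.
rewrite F0 measure0 in cv; move: cv => /fine_cvgP[fin /cvgrPdist_le/(_ e e0) near_e].
have [n [h1 h2]] : exists n, m (F n) \is a fin_num /\ fine (m (F n)) <= e.
  near \oo => n; exists n; split; first by near: n.
  have /= : `|0 - fine (m (F n))| <= e by near: n.
  by rewrite sub0r normrN; apply: le_trans; exact: ler_norm.
exists n.+1%:R^-1; first by rewrite invr_gt0.
move=> y /andP[xy yn]; apply: (@le_trans _ _ (m (F n))); last by rewrite -(fineK h1) lee_fin.
apply: le_measure; rewrite ?inE; [exact: measurable_itv|exact: measurable_itv|].
by move=> t; rewrite /F/= !in_itv/= => /andP[-> ty]/=; rewrite (le_trans ty)// ltW.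
Unshelve. all: by end_near. Qed.

Lemma finite_measure_unique (m1 m2 : {measure set T -> \bar R}) : (m1 setT < +oo)%E ->
  (forall x y, x <= y -> m1 `]x, y]%classic = m2 `]x, y]%classic) ->
  forall A : set T, measurable A -> m1 A = m2 A.
Proof.
move=> m1oo m12 A mA.
apply: (@measure_unique _ R T (@ocitv R) (fun n => `](- n%:R)%R, n%:R]%classic)) => //.
- exact: ocitvI.
- by move=> n; exact: is_ocitv.
- apply/seteqP; split => // x _; exists (Num.truncn `|x|).+1 => //=.
  have : `|x| < (Num.truncn `|x|).+1%:R by exact: truncnS_gt.
  by rewrite ltr_norml in_itv/= => /andP[-> /ltW ->].
- move=> _ [[x y] /= _ <-]; have [xy|yx] := leP x y; first exact: m12.
  rewrite (_ : `]x, y]%classic = set0) ?measure0//.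
  by apply/seteqP; split => t //=; rewrite in_itv/= => /andP[xt ty]; have := lt_le_trans xt ty; rewrite ltNge (ltW yx).
- move=> n; apply: le_lt_trans m1oo; by apply: le_measure; rewrite ?inE.
Qed.

End Monotone.

(** * Right-continuous representatives of functions monotone off a null set *)

Section RightRepresentative.
Context {R : realType}.
Local Notation T := (measurableTypeR R).
Implicit Types (x y : R).
Variables (I N : set R) (a : R -> R) (l s : R).
Hypothesis nda : forall x y, I x -> I y -> ~ N x -> ~ N y -> x < y -> a x <= a y.
Hypothesis ba : forall x, I x -> ~ N x -> l <= a x <= s.
Hypothesis ls : l <= s.

(** The value [s] keeps the set non-empty when no good point lies to the right of [x]; it changes no
    other infimum, since [s] bounds [a] from above at good points. *)
Definition right_values x : set R := [set z | (exists y, [/\ I y, ~ N y, x < y & z = a y]) \/ z = s].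

Definition right_rep x : R := inf (right_values x).

Let has_inf_rv x : has_inf (right_values x).
Proof.
split; first by exists s; right.
by exists l => z [[y [Iy Ny _ ->]]|->//]; case/andP: (ba Iy Ny).
Qed.

Lemma right_rep_itv x : l <= right_rep x <= s.
Proof.
apply/andP; split; last by apply: ge_inf; [case: (has_inf_rv x)|right].
by apply: lb_le_inf; [case: (has_inf_rv x)|move=> z [[y [Iy Ny _ ->]]|->//]; case/andP: (ba Iy Ny)].
Qed.

Lemma right_rep_nd : {homo right_rep : x y / x <= y}.
Proof.
move=> x y xy; apply: lb_le_inf; first by case: (has_inf_rv y).
move=> z [[w [Iw Nw yw ->]]|->]; last by case/andP: (right_rep_itv x).
apply: ge_inf; first by case: (has_inf_rv x).
by left; exists w; split => //; exact: le_lt_trans yw.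
Qed.

Lemma right_rep_le x y : I y -> ~ N y -> x < y -> right_rep x <= a y.
Proof. by move=> Iy Ny xy; apply: ge_inf; [case: (has_inf_rv x)|left; exists y]. Qed.

Lemma right_rep_ge x : I x -> ~ N x -> a x <= right_rep x.
Proof.
move=> Ix Nx; apply: lb_le_inf; first by case: (has_inf_rv x).
by move=> z [[w [Iw Nw xw ->]]|->]; [exact: nda|case/andP: (ba Ix Nx)].
Qed.

Lemma right_rep_rc : right_continuous right_rep.
Proof.
move=> x; apply/cvgrPdist_le => e e0.
have [z zv ze] := inf_adherent e0 (has_inf_rv x).
have [w xw wz] : exists2 w, x < w & forall t, x < t < w -> right_rep t <= z.
  case: zv => [[w [Iw Nw xw ->]]|->].
    by exists w => // t /andP[_ tw]; exact: right_rep_le.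
  by exists (x + 1); [rewrite ltrDl|move=> t _; case/andP: (right_rep_itv t)].
near=> t.
have xt : x < t by near: t; exact: nbhs_right_gt.
have tw : t < w by near: t; exact: nbhs_right_lt.
have h1 : right_rep t <= z by apply: wz; rewrite xt.
have h2 := right_rep_nd (ltW xt).
rewrite distrC ger0_norm ?subr_ge0// lerBlDl; apply: (le_trans h1); exact: ltW.
Unshelve. all: by end_near. Qed.

(** At distinct such points the intervals []a x, right_rep x[] are disjoint, and a rational number
    chosen in each gives an injection into a countable set. *)
Lemma right_rep_countable : countable [set x | [/\ I x, ~ N x & a x != right_rep x]].
Proof.
have /choice[q Hq] : forall x, exists q : rat, a x < right_rep x -> a x < ratr q < right_rep x.
  move=> x; have [h|h] := ltP (a x) (right_rep x).
    by have [q Hq] := rat_in_itvoo h; exists q => _; move: Hq; rewrite in_itv.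
  by exists 0 => //.
apply/countable_injP; exists (fun x => pickle (q x)) => x y.
rewrite !inE => -[Ix Nx ax] [Iy Ny ay] /(pcan_inj pickleK) qxy.
have lt z : I z -> ~ N z -> a z != right_rep z -> a z < right_rep z.
  by move=> Iz Nz az; rewrite lt_neqAle az right_rep_ge.
have /andP[x1 x2] := Hq x (lt x Ix Nx ax); have /andP[y1 y2] := Hq y (lt y Iy Ny ay).
have [xy|xy|//] := ltgtP x y.
- have := lt_le_trans x2 (right_rep_le Iy Ny xy); rewrite qxy => /lt_trans/(_ y1).
  by rewrite ltxx.
- have := lt_le_trans y2 (right_rep_le Ix Nx xy); rewrite -qxy => /lt_trans/(_ x1).
  by rewrite ltxx.
Qed.

End RightRepresentative.

(** * Integration by parts against Stieltjes measures *)

Section IntegrationByParts.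
Context {R : realType}.
Local Notation T := (measurableTypeR R).
Implicit Types (x y t : R) (I : set R).

Lemma test_facts I psi : test_function I psi -> exists r B : R,
  [/\ 0 < r, [/\ measurable_fun setT (psi : T -> R) & measurable_fun setT (derive1 psi : T -> R)],
      (forall x, ~ I x \/ ~~ (- r < x < r) -> psi x = 0 /\ derive1 psi x = 0),
      (forall x, `|psi x| <= B /\ `|derive1 psi x| <= B) &
      forall x y, x < y -> (\int[mu]_(t in `[x, y]) (derive1 psi t)%:E = (psi y - psi x)%:E)%E].
Proof.
move=> [dpsi cC CI]; set C := closure _ in cC CI.
have d0 x : derivable psi x 1 by have := dpsi 0%N x; rewrite derive1n0.
have d1 x : derivable (derive1 psi) x 1 by have := dpsi 1%N x; rewrite derive1n1.
have c0 : continuous psi by move=> x; apply: differentiable_continuous; exact/derivable1_diffP.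
have c1 : continuous (derive1 psi) by move=> x; apply: differentiable_continuous; exact/derivable1_diffP.
have out x : ~ C x -> psi x = 0 /\ derive1 psi x = 0.
  move=> nC; have oC : open (~` C) by apply: closed_openC; exact: closed_closure.
  have : \forall y \near x, ~ C y by exact: (open_nbhs_nbhs (conj oC nC)).
  move=> nearC.
  have near0 : \forall y \near x, cst 0 y = psi y.
    apply: filterS nearC => y nCy; apply/esym/eqP/negPn/negP => py; apply: nCy.
    exact: subset_closure.
  split; first by have := nbhs_singleton near0.
  have := near_eq_is_derive near0 (is_derive_cst (0 : R) x 1).
  by move=> [_ <-]; rewrite derive1E.
have [M [_ HM]] := compact_bounded cC.
pose r := Num.max 1 (M + 2).
have r0 : 0 < r by rewrite lt_max ltr01.
have Cr x : ~~ (- r < x < r) -> ~ C x.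
  move=> h Cx; move/negP: h; apply.
  have M1 : M < M + 1 by rewrite ltrDl.
  have := HM _ M1 x Cx; rewrite -ltr_norml => h; apply: (le_lt_trans h).
  by rewrite lt_max; apply/orP; right; rewrite ltrD2l ltr1n.
have bd (f : R -> R) : continuous f -> (forall x, ~ C x -> f x = 0) -> exists2 B, 0 <= B & forall x, `|f x| <= B.
  move=> cf f0.
  have cI : compact (f @` C) by apply: continuous_compact => //; exact: continuous_subspaceT.
  have [B [_ HB]] := compact_bounded cI.
  exists (Num.max 0 (B + 1)); first by rewrite le_max lexx.
  move=> x; have [Cx|nCx] := pselect (C x); last by rewrite f0// normr0 le_max lexx.
  have B1 : B < B + 1 by rewrite ltrDl.
  by rewrite le_max (HB _ B1) ?orbT//; exists x.
have [B0 B00 HB0] := bd psi c0 (fun x h => (out x h).1).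
have [B1 B10 HB1] := bd (derive1 psi) c1 (fun x h => (out x h).2).
exists r, (B0 + B1); split => //.
- by split; apply: continuous_measurable_fun.
- by move=> x [nI|/Cr]; apply: out => // Cx; apply: nI; exact: CI.
- by move=> x; split; [apply: (le_trans (HB0 x)); rewrite lerDl|apply: (le_trans (HB1 x)); rewrite lerDr].
- move=> x y xy; rewrite EFinB; apply: (continuous_FTC2 xy); last by move=> t _.
  + exact: continuous_subspaceT.
  + by split; [move=> t _; exact: d0|apply: cvg_at_right_filter; exact: c0|apply: cvg_at_left_filter; exact: c0].
Qed.

(** Fubini's theorem for the kernel [f]: integrating first in [s] gives [psi t], integrating first
    in [t] gives [- derive1 psi s * (A s - A (- r))]. The constant [A (- r)] disappears because
    [derive1 psi] has integral 0. *)
Lemma test_parts I psi (m : {finite_measure set T -> \bar R}) (A : R -> R) :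
  test_function I psi -> (forall x y, x <= y -> m `]x, y]%classic = (A y - A x)%:E) ->
  measurable_fun setT (A : T -> R) -> (exists K, forall x, `|A x| <= K) ->
  [/\ m.-integrable setT (fun t : T => (psi t)%:E), mu.-integrable setT (fun t : T => (A t * derive1 psi t)%:E) &
    (\int[mu]_t (A t * derive1 psi t)%:E = - \int[m]_t (psi t)%:E)%E].
Proof.
move=> tpsi mA_ mA [K AK].
have [r [B [r0 [mpsi mdpsi] out bd ftc]]] := test_facts tpsi.
have B0 : 0 <= B by apply: le_trans (bd 0).1.
have K0 : 0 <= K by apply: le_trans (AK 0).
have ip : m.-integrable setT (fun t : T => (psi t)%:E).
  apply: measurable_bounded_integrable => //; first by rewrite ltey_eq fin_num_measure.
  by exists B; split; [exact: num_real|move=> M BM t _; apply: (le_trans (bd t).1); exact: ltW].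
have z t : ~~ (- r < t < r) -> psi t = 0 by move=> h; exact: (out t (or_intror h)).1.
have dz t : ~~ (- r < t < r) -> derive1 psi t = 0 by move=> h; exact: (out t (or_intror h)).2.
have supp (f : T -> R) (b : R) : measurable_fun setT f -> (forall t, `|f t| <= b) ->
    mu.-integrable setT (EFin \o (fun t => f t * derive1 psi t)).
  move=> mf fb; apply: (@integrable_supp _ _ (- r) r (b * B)).
  - exact: measurable_funM.
  - by move=> t; rewrite normrM; apply: ler_pM => //; exact: (bd t).2.
  - move=> t h; rewrite dz ?mulr0//; apply: contra h => /andP[/ltW -> /ltW ->].
    by [].
have iA : mu.-integrable setT (fun t : T => (A t * derive1 psi t)%:E) by exact: supp AK.
split => //.
have id1 : mu.-integrable setT (fun t : T => (derive1 psi t)%:E).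
  have n1 t : `|(cst 1 : T -> R) t| <= 1 by rewrite normr1.
  have := supp (cst 1) 1 (measurable_cst _) n1.
  by congr (is_true (mu.-integrable _ _)); apply/funext => t /=; rewrite mul1r.
have int_d : (\int[mu]_t (derive1 psi t)%:E = 0)%E.
  have rr : - r < r by rewrite gtrN.
  have := ftc _ _ rr; rewrite z; last by rewrite ltxx andbF.
  rewrite z; last by rewrite ltxx.
  rewrite subrr => ftc0; rewrite -[RHS]/(0%:E) -ftc0 [RHS]integral_mkcond; apply: eq_integral => t _.
  rewrite patchE; case: ifPn => // /negP nt; rewrite dz//.
  by apply/negP => /andP[h1 h2]; apply: nt; rewrite inE/= in_itv/= !ltW.
(* Cutting at [- r], below the support of [psi], makes the sections in [t] the intervals []- r, s]],
   whose measure is an increment of [A]. *)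
pose f (z : T * T) : \bar R := (if (- r < (z.1 : R)) && ((z.1 : R) <= (z.2 : R)) then - derive1 psi z.2 else 0)%:E.
have mf : measurable_fun setT f.
  apply/measurable_EFinP; apply: measurable_fun_ifT => //.
    apply: measurable_and; first by apply: measurable_fun_ltr => //; exact: measurable_fst.
    by apply: measurable_fun_ler; [exact: measurable_fst|exact: measurable_snd].
  by apply: measurableT_comp => //; apply: measurableT_comp => //; exact: measurable_snd.
pose g : T -> \bar R := fun s => `|derive1 psi s|%:E.
have mg : measurable_fun setT g by apply/measurable_EFinP; exact: measurableT_comp.
have gfin : (\int[mu]_s g s < +oo)%E.
  by have /integrableP[_] := id1.
have if_ : (m \x mu)%E.-integrable setT f.
  apply/(integrable12ltyP m mu mf).
  apply: (@le_lt_trans _ _ (\int[m]_t (\int[mu]_s g s))%E).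
    apply: ge0_le_integral => //.
    - by move=> t _; apply: integral_ge0 => s _; exact: abse_ge0.
    - have mAf : measurable_fun setT (fun w => `|f w|%E) by exact: measurableT_comp.
      exact: (measurable_fun_fubini_tonelli_F (m2 := mu) _ mAf (fun w => abse_ge0 (f w))).
    - move=> t _; apply: ge0_le_integral => //.
      + apply: measurableT_comp => //; apply: measurableT_comp mf _; exact: measurable_pair1.
      + by move=> s _; rewrite /f/g/= lee_fin; case: ifP; rewrite ?normrN ?normr0.
  rewrite integral_cst//; apply: lte_mul_pinfty => //.
  - by apply: integral_ge0 => s _; rewrite lee_fin.
  - by rewrite ge0_fin_numE//; apply: integral_ge0 => s _; rewrite lee_fin.
  - by rewrite ltey_eq fin_num_measure.
have L t : (\int[mu]_s f (t, s) = (psi t)%:E)%E.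
  rewrite /f/=; have [rt|tr] := ltP (- r) t; last first.
    rewrite z; last by rewrite ltNge tr.
    by apply: integral0_eq.
  (* The end [Num.max r (t + 1)] lies beyond the support of [psi] and strictly to the right of [t],
     so the fundamental theorem applies and leaves only [psi t]. *)
  have E : (\int[mu]_s (if true && (t <= (s : R)) then - derive1 psi s else 0)%:E =
      \int[mu]_(s in `[t, (Num.max r (t + 1))%R]) (- derive1 psi s)%:E)%E.
    rewrite [RHS]integral_mkcond; apply: eq_integral => s _; rewrite patchE.
    case: ifPn => ts; case: ifPn => //.
      move=> /negP ns; rewrite dz ?oppr0//; apply/negP => /andP[_ sr]; apply: ns; rewrite inE/= in_itv/=.
      by rewrite (ts : t <= s)/= le_max ltW.
    by rewrite inE/= in_itv/= => /andP[h _]; move: ts; rewrite /= h.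
  rewrite E.
  have tm : t < Num.max r (t + 1) by rewrite lt_max ltrDl ltr01 orbT.
  have mI : measurable (`[t, (Num.max r (t + 1))%R]%classic : set T) by exact: measurable_itv.
  have -> : (\int[mu]_(s in `[t, (Num.max r (t + 1))%R]) (- derive1 psi s)%:E =
     - \int[mu]_(s in `[t, (Num.max r (t + 1))%R]) (derive1 psi s)%:E)%E.
    have id1' := integrableS measurableT mI (@subsetT _ _) id1.
    rewrite -[RHS]mulN1e -[(- 1%:E)%E]/((-1)%:E) -integralZl//.
    by apply: eq_integral => s _; rewrite EFinN mulN1e.
  rewrite ftc// z; first by rewrite sub0r EFinN oppeK.
  by rewrite negb_and orbC -leNgt le_max lexx.
have Rr s : (\int[m]_t f (t, s) = (- derive1 psi s * (A s - A (- r)))%:E)%E.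
  have [rs|sr] := ltP (- r) s; last first.
    rewrite dz; last by rewrite ltNge sr.
    rewrite oppr0 mul0r; apply: integral0_eq => t _; rewrite /f/=; case: ifP => // /andP[h1 h2].
    by have := lt_le_trans h1 (le_trans h2 sr); rewrite ltxx.
  have mI : measurable (`](- r)%R, s]%classic : set T) by exact: measurable_itv.
  have -> : (\int[m]_t f (t, s) = \int[m]_(t in `](- r)%R, s]) cst (- derive1 psi s)%:E t)%E.
    rewrite [RHS]integral_mkcond; apply: eq_integral => t _; rewrite patchE /f/=.
    case: ifPn => h; first by rewrite mem_set//= in_itv.
    by rewrite memNset//= in_itv/=; exact/negP.
  rewrite integral_cst//; transitivity ((- derive1 psi s)%:E * (A s - A (- r))%:E)%E; last by rewrite -EFinM.
  by congr (_ * _)%E; exact: mA_ (ltW rs).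
have := Fubini if_; under eq_integral do rewrite L; move=> ->.
have -> : (\int[mu]_s \int[m]_t f (t, s) = \int[mu]_s ((A (- r))%:E * (derive1 psi s)%:E - (A s * derive1 psi s)%:E))%E.
  by apply: eq_integral => s _; rewrite Rr -EFinM -EFinB; congr EFin; ring.
rewrite integralB//; last exact: integrableZl.
by rewrite integralZl// int_d mule0 add0e oppeK.
Qed.

End IntegrationByParts.

Lemma oc_add {R : realType} (m : {measure set (measurableTypeR R) -> \bar R}) (x y z : R) : x <= y <= z ->
  m `]x, z]%classic = (m `]x, y]%classic + m `]y, z]%classic)%E.
Proof.
move=> /andP[xy yz]; have mi (a b : R) : measurable (`]a, b]%classic : set (measurableTypeR R)) by exact: measurable_itv.
have -> : `]x, z]%classic = (`]x, y]%classic `|` `]y, z]%classic : set (measurableTypeR R)).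
  apply/seteqP; split => t /=; rewrite !in_itv/=.
    by move=> /andP[xt tz]; have [ty|yt] := leP t y; [left; rewrite xt|right].
  by move=> [/andP[-> ty]|/andP[yt ->]]; rewrite ?(le_trans ty)// (le_lt_trans xy).
rewrite measureU//; apply/seteqP; split => // t []/=; rewrite !in_itv/=.
by move=> /andP[_ ty] /andP[yt _]; have := lt_le_trans yt ty; rewrite ltxx.
Qed.

Lemma finite_restrict {R : realType} (m : {measure set (measurableTypeR R) -> \bar R}) : (m setT < +oo)%E ->
  exists m' : {finite_measure set (measurableTypeR R) -> \bar R}, forall A, m' A = m A.
Proof.
move=> moo; have m0oo : (m setT < +oo)%E by [].
have mT : measurable (setT : set (measurableTypeR R)) by [].
exists (mfrestr mT m0oo) => A.
by change (m (A `&` setT) = m A); rewrite setIT.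
Qed.

Lemma nullU {R : realType} (A B : set (measurableTypeR R)) : measurable A -> measurable B ->
  mu A = 0%E -> mu B = 0%E -> mu (A `|` B) = 0%E.
Proof.
move=> mA mB A0 B0; have : (mu (A `|` B) <= mu A + mu B)%E by exact: measureU2.
by rewrite A0 B0 adde0 => h; apply/eqP; rewrite eq_le h; exact: measure_ge0.
Qed.

(** A difference of measures is not a measure. Moving the subtracted terms across turns an identity
    between charges into one between sums of measures, where uniqueness and additivity of the
    integral are available. *)
Lemma fin_swap {R : realType} (p q a b : \bar R) : p \is a fin_num -> q \is a fin_num ->
  a \is a fin_num -> b \is a fin_num -> (p - q = a - b)%E -> (p + b = q + a)%E.
Proof. by move: p q a b => [p| |] [q| |] [a| |] [b| |] //= _ _ _ _ [h]; congr EFin; lra. Qed.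

Lemma fin_swap2 {R : realType} (p q : \bar R) (a b d : R) : p \is a fin_num -> q \is a fin_num ->
  (p - q = d%:E)%E -> a + d = b -> (a%:E + p = b%:E + q)%E.
Proof. by move: p q => [p| |] [q| |] //= _ _ [h] h'; congr EFin; lra. Qed.

Lemma fin_swap3 {R : realType} (p q : \bar R) (a b d : R) : p \is a fin_num -> q \is a fin_num ->
  (p - q = d%:E)%E -> a = b + d -> (a%:E + q = b%:E + p)%E.
Proof. by move: p q => [p| |] [q| |] //= _ _ [h] h'; congr EFin; lra. Qed.

(** * Measures determined by the intervals with endpoints off a null set *)

Section GoodPoints.
Context {R : realType}.
Local Notation T := (measurableTypeR R).
Implicit Types (x y t : R).
Variables (I : set R).
Hypotheses (oI : open I) (II : is_interval I).

Lemma good_right (N : set T) x (e : R) : measurable N -> mu N = 0%E -> I x -> 0 < e ->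
  exists y, [/\ I y, ~ N y & x < y < x + e].
Proof.
move=> mN N0 Ix e0; have [r /= r0 rI] := (@nbhs_ballP R R x I).1 (open_nbhs_nbhs (conj oI Ix)).
pose h := Num.min r e; have h0 : 0 < h by rewrite lt_min r0.
apply: contrapT => nex.
have sub : (`]x, (x + h)%R[%classic : set T) `<=` N.
  move=> y /=; rewrite in_itv/= => /andP[xy yh]; apply: contrapT => Ny; apply: nex; exists y; split => //.
    apply: rI; rewrite /ball/= distrC gtr0_norm ?subr_gt0// ltrBlDl; apply: (lt_le_trans yh).
    by rewrite lerD2l ge_min lexx.
  by rewrite xy/=; apply: (lt_le_trans yh); rewrite lerD2l ge_min lexx orbT.
have mi : measurable (`]x, (x + h)%R[%classic : set T) by exact: measurable_itv.
have : (mu (`]x, (x + h)%R[%classic : set T) <= mu N)%E by apply: le_measure; rewrite ?inE.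
by rewrite N0 lebesgue_measure_itv/= lte_fin ltrDl h0 -EFinB addrAC subrr add0r lee_fin leNgt h0.
Qed.

Lemma interval_cover x0 : I x0 -> exists c d : nat -> R,
  (forall k, [/\ I (c k), I (d k) & c k < d k]) /\ forall x, I x -> exists k, c k < x < d k.
Proof.
have ballI x : I x -> exists2 r, 0 < r & forall y, `|x - y| < r -> I y.
  by move=> Ix; have [r /= r0 rI] := (@nbhs_ballP R R x I).1 (open_nbhs_nbhs (conj oI Ix)); exists r.
move=> Ix0; have [r0 r00 Ir0] := ballI _ Ix0.
have Ix1 : I (x0 + r0 / 2).
  by apply: Ir0; rewrite opprD addrA subrr sub0r normrN gtr0_norm ?divr_gt0//; lra.
(* Rational endpoints make the cover countable; pairs that are not the ends of an interval in [I]
   are sent to one fixed interval. *)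
pose g (qr : rat * rat) : R * R :=
  if `[< [/\ I (ratr qr.1), I (ratr qr.2) & (ratr qr.1 : R) < ratr qr.2] >] then (ratr qr.1, ratr qr.2)
  else (x0, x0 + r0 / 2).
pose w (k : nat) := g (odflt (0, 0) (unpickle k)).
exists (fun k => (w k).1), (fun k => (w k).2); split.
  move=> k; rewrite /w /g; case: ifPn => [/asboolP//|_]; split => //=.
  by rewrite ltrDl divr_gt0.
move=> x Ix; have [r r1 Ir] := ballI _ Ix.
have [q Hq] := rat_in_itvoo (ltac:(by rewrite ltrBlDr ltrDl) : x - r < x).
have [s Hs] := rat_in_itvoo (ltac:(by rewrite ltrDl) : x < x + r).
move: Hq Hs; rewrite !in_itv/= => /andP[q1 q2] /andP[s1 s2].
exists (pickle (q, s)); rewrite /w pickleK/= /g asboolT/= ?q2//.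
split; [| |exact: lt_trans s1]; apply: Ir.
- by rewrite gtr0_norm ?subr_gt0//; lra.
- by rewrite distrC gtr0_norm ?subr_gt0//; lra.
Qed.

Let q (m : {finite_measure set T -> \bar R}) x y : R := fine (m `]x, y]%classic).

Let qE (m : {finite_measure set T -> \bar R}) x y : m `]x, y]%classic = (q m x y)%:E.
Proof. by rewrite fineK//; apply: fin_num_measure; exact: measurable_itv. Qed.

Let q_ge0 (m : {finite_measure set T -> \bar R}) x y : 0 <= q m x y.
Proof. by apply: fine_ge0; exact: measure_ge0. Qed.

Let q_add (m : {finite_measure set T -> \bar R}) x y z : x <= y <= z -> q m x z = q m x y + q m y z.
Proof. by move=> xyz; apply: EFin_inj; rewrite EFinD -!qE; exact: oc_add. Qed.

Let q_small (m : {finite_measure set T -> \bar R}) x (e : R) : 0 < e -> exists2 h, 0 < h & forall y, x <= y < x + h -> q m x y <= e.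
Proof.
move=> e0; have [h h0 H] := finite_measure_right m x e0.
by exists h => // y /H; rewrite qE lee_fin.
Qed.

Let good_unique_itv (N : set T) (m1 m2 : {finite_measure set T -> \bar R}) : measurable N -> mu N = 0%E ->
  (forall x y, I x -> I y -> ~ N x -> ~ N y -> x < y -> m1 `]x, y]%classic = m2 `]x, y]%classic) ->
  forall x y, I x -> I y -> x < y -> m1 `]x, y]%classic = m2 `]x, y]%classic.
Proof.
move=> mN N0 H x y Ix Iy xy; rewrite !qE; congr EFin.
apply/eqP; rewrite -subr_eq0 -normr_le0; apply/ler_addgt0Pr => e e0; rewrite add0r.
(* Moving both endpoints to good points introduces four errors in [[0, e / 2]], two with each sign,
   so the total is at most [e]. *)
have e2 : 0 < e / 2 by rewrite divr_gt0.
have [h1 h10 H1] := q_small m1 x e2; have [h2 h20 H2] := q_small m2 x e2.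
have [h3 h30 H3] := q_small m1 y e2; have [h4 h40 H4] := q_small m2 y e2.
have hx : 0 < Num.min h1 (Num.min h2 (y - x)) by rewrite !lt_min h10 h20 subr_gt0.
have hy : 0 < Num.min h3 h4 by rewrite lt_min h30.
have [x' [Ix' Nx' /andP[xx' x'h]]] := good_right mN N0 Ix hx.
have [y' [Iy' Ny' /andP[yy' y'h]]] := good_right mN N0 Iy hy.
have : x' - x < Num.min h1 (Num.min h2 (y - x)) by rewrite ltrBlDl.
rewrite !lt_min => /and3P[a1 a2 a3].
have : y' - y < Num.min h3 h4 by rewrite ltrBlDl.
rewrite lt_min => /andP[a4 a5].
have x'y : x' < y by lra.
have b1 : q m1 x x' <= e / 2 by apply: H1; rewrite ltW//=; lra.
have b2 : q m2 x x' <= e / 2 by apply: H2; rewrite ltW//=; lra.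
have b3 : q m1 y y' <= e / 2 by apply: H3; rewrite ltW//=; lra.
have b4 : q m2 y y' <= e / 2 by apply: H4; rewrite ltW//=; lra.
have E : q m1 x' y' = q m2 x' y' by rewrite /q H// (lt_trans x'y).
have o1 : x <= x' <= y' by rewrite !ltW//= (lt_trans x'y).
have o2 : x <= y <= y' by rewrite !ltW.
have A1 := q_add m1 o1; have A2 := q_add m1 o2; have A3 := q_add m2 o1; have A4 := q_add m2 o2.
have := q_ge0 m1 x x'; have := q_ge0 m2 x x'; have := q_ge0 m1 y y'; have := q_ge0 m2 y y'.
move=> c1 c2 c3 c4; rewrite ler_norml; apply/andP; split; lra.
Qed.

Lemma cover_measure (m : {measure set T -> \bar R}) (F : nat -> set T) (E : set T) :
  (forall k, measurable (F k)) -> measurable E -> E `<=` \bigcup_k F k ->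
  m E = (\sum_(k <oo | k \in [set: nat]) m (E `&` seqDU F k))%E.
Proof.
move=> mF mE EF; rewrite -[in LHS](setIidl EF) (seqDU_bigcup_eq F) setI_bigcupr measure_bigcup//.
- by move=> k _; apply: measurableI => //; apply: measurableD => //; exact: bigsetU_measurable.
- by apply: trivIset_setIl; exact: trivIset_seqDU.
Qed.

(* Finite measures agreeing on the intervals with good endpoints agree on all
   the intervals of I, by continuity from the right. *)
Lemma good_unique (N : set T) (m1 m2 : {measure set T -> \bar R}) : measurable N -> mu N = 0%E ->
  (m1 setT < +oo)%E -> (m2 setT < +oo)%E ->
  (forall x y, I x -> I y -> ~ N x -> ~ N y -> x < y -> m1 `]x, y]%classic = m2 `]x, y]%classic) ->
  forall E : set T, measurable E -> E `<=` I -> m1 E = m2 E.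
Proof.
move=> mN N0 m1oo m2oo H0.
have [m1' E1] := finite_restrict m1oo; have [m2' E2] := finite_restrict m2oo.
have H x y : I x -> I y -> x < y -> m1 `]x, y]%classic = m2 `]x, y]%classic.
  move=> Ix Iy xy; rewrite -E1 -E2; apply: (good_unique_itv mN N0) => // a b Ia Ib Na Nb ab.
  by rewrite E1 E2; exact: H0.
have loc c d : I c -> I d -> c < d -> forall E : set T, measurable E -> E `<=` `]c, d]%classic -> m1 E = m2 E.
  move=> Ic Id cd E mE Ecd.
  have mcd : measurable (`]c, d]%classic : set T) by exact: measurable_itv.
  have : mrestr m1 mcd E = mrestr m2 mcd E.
    apply: finite_measure_unique => //.
      apply: le_lt_trans m1oo; apply: (le_measure m1 _ _ (@subsetT _ _)); rewrite inE//.
      by rewrite setTI.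
    move=> x y xy; change (m1 (`]x, y]%classic `&` `]c, d]%classic) = m2 (`]x, y]%classic `&` `]c, d]%classic)).
    have -> : `]x, y]%classic `&` `]c, d]%classic = (`]Num.max x c, Num.min y d]%classic : set T).
      apply/seteqP; split => t /=; rewrite !in_itv/= gt_max le_min.
        by move=> [/andP[-> ->] /andP[-> ->]].
      by move=> /andP[/andP[-> ->] /andP[-> ->]].
    have [h|h] := ltP (Num.max x c) (Num.min y d); last first.
      have -> : (`]Num.max x c, Num.min y d]%classic : set T) = set0 by apply: set_itv_ge; rewrite bnd_simp -leNgt.
      by rewrite !measure0.
    have h1 : c <= Num.max x c by rewrite le_max lexx orbT.
    have h2 : Num.min y d <= d by rewrite ge_min lexx orbT.
    apply: H => //; apply: (II Ic Id); rewrite ?h1 ?h2 ?andbT/=.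
      exact: le_trans (ltW h) h2.
    exact: le_trans h1 (ltW h).
  by rewrite /mrestr/= (setIidl Ecd).
move=> E mE EI.
have [[x0 Ix0]|I0] := pselect (exists x, I x); last first.
  have -> : E = set0 by apply/seteqP; split => // x Ex; apply: I0; exists x; exact: EI.
  by rewrite !measure0.
(* [E] may reach up to the ends of [I]; it is cut into countably many disjoint pieces, each inside
   an interval []c k, d k]] with endpoints in [I], to which [loc] applies. *)
have [c [d [cdI cov]]] := interval_cover Ix0.
pose F (k : nat) : set T := `]c k, d k]%classic.
have mF k : measurable (F k) by exact: measurable_itv.
have EF : E `<=` \bigcup_k F k.
  move=> x /EI /cov[k /andP[ck dk]]; exists k => //.
  by rewrite /F/= in_itv/= ck ltW.
rewrite (cover_measure m1 mF mE EF) (cover_measure m2 mF mE EF).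
apply: eq_eseriesr => k _; have [Ic Id cd] := cdI k; apply: (loc _ _ Ic Id cd).
  by apply: measurableI => //; apply: measurableD => //; exact: bigsetU_measurable.
by move=> t [_ h]; exact: (@subset_seqDU _ F k t h).
Qed.

(** [N'] adds to [N] the countably many points at which [a] differs from its right-continuous
    representative. *)
Lemma stieltjes_rep (N : set T) (a : R -> R) (l s : R) : measurable N -> mu N = 0%E -> l <= s ->
  (forall x y, I x -> I y -> ~ N x -> ~ N y -> x < y -> a x <= a y) ->
  (forall x, I x -> ~ N x -> l <= a x <= s) ->
  exists (A : R -> R) (m : {finite_measure set T -> \bar R}) (N' : set T),
    [/\ measurable N', mu N' = 0%E, N `<=` N', {homo A : x y / x <= y} & forall x, l <= A x <= s] /\
    [/\ forall x, I x -> ~ N' x -> A x = a x, forall x y, x <= y -> m `]x, y]%classic = (A y - A x)%:E &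
      (m setT <= (s - l)%:E)%E].
Proof.
move=> mN N0 ls nda ba; pose A := right_rep I N a s.
have [m [mE ms]] := stieltjes_ex (right_rep_nd ba ls) (right_rep_rc ba ls) (right_rep_itv ba ls).
have cC := right_rep_countable nda ba ls.
pose C : set T := [set x | [/\ I x, ~ N x & a x != right_rep I N a s x]].
have mC : measurable C by exact: countable_measurable.
exists A, m, (N `|` C); split.
  split; [exact: measurableU| |by left|exact: (right_rep_nd ba ls)|exact: (right_rep_itv ba ls)].
  apply: nullU => //; exact: countable_lebesgue_measure0.
split => // x Ix NCx; apply: contrapT => Aa; apply: NCx; have [Nx|Nx] := pselect (N x); [by left|right].
by split => //; apply/eqP => aA; apply: Aa; rewrite aA.
Qed.

Lemma test_integrable psi (m : {finite_measure set T -> \bar R}) : test_function I psi ->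
  m.-integrable setT (fun t : T => (psi t)%:E).
Proof.
move=> tp; have [r [B [r0 [mpsi _] _ bd _]]] := test_facts tp.
apply: measurable_bounded_integrable => //; first by rewrite ltey_eq fin_num_measure.
by exists B; split; [exact: num_real|move=> M BM t _; apply: (le_trans (bd t).1); exact: ltW].
Qed.

Lemma test_integral_dom psi (m : {measure set T -> \bar R}) (w : T -> R) : test_function I psi ->
  (\int[m]_(t in I) (psi t)%:E = \int[m]_t (psi t)%:E)%E /\
  (\int[m]_(t in I) (w t * derive1 psi t)%:E = \int[m]_t (w t * derive1 psi t)%:E)%E.
Proof.
move=> tp; have [r [B [r0 _ out _ _]]] := test_facts tp.
split; rewrite integral_mkcond; apply: eq_integral => t _; rewrite patchE; case: ifPn => //;
  rewrite notin_setE => nI; have [z1 z2] := out t (or_introl nI); by rewrite ?z1 ?z2 ?mulr0.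
Qed.

(** Frees [charge_integral] from the Jordan decomposition [P], [Q]: on subsets of [I] one has
    [P + mB = Q + mA], and the integral is additive in the measure. *)
Lemma charge_integralE (nu : {charge set T -> \bar R}) (mA mB : {finite_measure set T -> \bar R}) psi :
  test_function I psi -> (forall E : set T, measurable E -> E `<=` I -> nu E = (mA E - mB E)%E) ->
  charge_integral nu I psi = (\int[mA]_(t in I) (psi t)%:E - \int[mB]_(t in I) (psi t)%:E)%E.
Proof.
move=> tp nuE; rewrite /charge_integral.
have mI : measurable (I : set T) by exact: open_interval_measurable.
pose P := jordan_pos (hahnP nu); pose Q := jordan_neg (hahnP nu).
have it (m : {finite_measure set T -> \bar R}) : m.-integrable I (fun t : T => (psi t)%:E).
  by apply: (integrableS measurableT) => //; exact: test_integrable.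
have fi (m : {finite_measure set T -> \bar R}) : (\int[m]_(t in I) (psi t)%:E)%E \is a fin_num.
  exact: (integrable_fin_num mI (it m)).
have eqm (E : set T) : measurable E -> E `<=` I -> measure_add P mB E = measure_add Q mA E.
  move=> mE EI; rewrite !measure_addE.
  have h1 : nu E = (P E - Q E)%E by rewrite (jordan_decomp (hahnP nu) mE) /cadd/= /cscale/= mulN1e.
  have := nuE E mE EI; rewrite h1.
  have fP : P E \is a fin_num by exact: fin_num_measure.
  have fQ : Q E \is a fin_num by exact: fin_num_measure.
  have fA : mA E \is a fin_num by exact: fin_num_measure.
  have fB : mB E \is a fin_num by exact: fin_num_measure.
  exact: fin_swap.
have := eq_measure_integral (measure_add Q mA) (f := fun t : T => (psi t)%:E) eqm.
rewrite !integral_measure_add//; [|exact: it|exact: it|exact: it|exact: it].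
have := fi P; have := fi Q; have := fi mA; have := fi mB; rewrite -/P -/Q.
move: (\int[P]_(t in _) _)%E (\int[Q]_(t in _) _)%E (\int[mA]_(t in _) _)%E (\int[mB]_(t in _) _)%E.
move=> [a| |] [b| |] [c| |] [d| |] //= _ _ _ _ [h].
by congr EFin; lra.
Qed.

(** * Derivatives whose increments are dominated by a monotone function *)

Section Variation.
Variables (N : set T) (u V : R -> R) (M : R).
Hypotheses (mN : measurable N) (N0 : mu N = 0%E) (V_itv : forall x, 0 <= V x <= M).
Hypothesis uV : forall x y, I x -> I y -> ~ N x -> ~ N y -> x < y -> `|u y - u x| <= V y - V x.

Lemma slope_bounded : exists2 K, 0 <= K & forall x, I x -> ~ N x -> `|u x| <= K.
Proof.
have M0 : 0 <= M by have /andP[] := V_itv 0; exact: le_trans.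
have [[x0 [Ix0 Nx0]]|no] := pselect (exists x, I x /\ ~ N x); last first.
  by exists 0 => // x Ix Nx; exfalso; apply: no; exists x.
exists (`|u x0| + M) => [|x Ix Nx]; first by rewrite addr_ge0.
have h : `|u x - u x0| <= M.
  have /andP[a1 a2] := V_itv x; have /andP[b1 b2] := V_itv x0.
  have [->|/eqP] := eqVneq x x0; first by rewrite subrr normr0.
  move=> /eqP; rewrite neq_lt => /orP[xx0|x0x].
    by rewrite distrC; apply: (le_trans (uV Ix Ix0 Nx Nx0 xx0)); lra.
  by apply: (le_trans (uV Ix0 Ix Nx0 Nx x0x)); lra.
by have := ler_normD (u x0) (u x - u x0); rewrite addrC subrK => /le_trans; apply; rewrite lerD2l.
Qed.

(** The slope bound makes [V + e u] nondecreasing as soon as [|e| <= 1]. The values 1, 0 and -1 are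
    the ones used, for [V + u], [V] and [V - u]. *)
Lemma slope_rep (e : R) : `|e| <= 1 -> exists (A : R -> R) (m : {finite_measure set T -> \bar R}) (N' : set T),
    [/\ measurable N', mu N' = 0%E, N `<=` N', {homo A : x y / x <= y} & exists K, forall x, `|A x| <= K] /\
    [/\ forall x, I x -> ~ N' x -> A x = V x + e * u x & forall x y, x <= y -> m `]x, y]%classic = (A y - A x)%:E].
Proof.
move=> e1; have [K K0 HK] := slope_bounded.
have M0 : 0 <= M by have /andP[] := V_itv 0; exact: le_trans.
have eu z : `|e * z| <= `|z| by rewrite normrM ler_piMl.
have [|x y Ix Iy Nx Ny xy|x Ix Nx|A [m [N' [[a1 a2 a3 a4 a5] [b1 b2 _]]]]] :=
  @stieltjes_rep N (fun x => V x + e * u x) (- K) (M + K) mN N0.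
- by lra.
- have := uV Ix Iy Nx Ny xy; have := eu (u y - u x); rewrite mulrBr => h1 h2.
  by have := le_trans h1 h2; rewrite ler_norml => /andP[h3 h4]; lra.
- have := le_trans (eu (u x)) (HK x Ix Nx); rewrite ler_norml => /andP[h1 h2].
  by have /andP[v1 v2] := V_itv x; apply/andP; split; lra.
exists A, m, N'; split; split => //; exists (M + K) => x.
by have /andP[h1 h2] := a5 x; rewrite ler_norml; apply/andP; split; lra.
Qed.

Lemma bv_exists : measurable_fun I (u : T -> R) -> exists nu, measure_derivative I u nu.
Proof.
move=> mu_; have mI : measurable (I : set T) by exact: open_interval_measurable.
have [|A [mA [NA [[mNA NA0 NNA ndA [KA bA]] [AE mAE]]]]] := @slope_rep 1; first by rewrite normr1.
have [|B [mB [NB [[mNB NB0 NNB ndB [KB bB]] [BE mBE]]]]] := @slope_rep 0; first by rewrite normr0.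
exists (cadd (charge_of_finite_measure mA) (cscale (-1) (charge_of_finite_measure mB))) => psi tp.
rewrite (@charge_integralE _ mA mB)//; last first.
  by move=> E mE EI; change ((mA E + (- 1%:E) * mB E)%E = (mA E - mB E)%E); rewrite mulN1e.
have msA : measurable_fun setT (A : T -> R) by exact: nondecreasing_measurable.
have msB : measurable_fun setT (B : T -> R) by exact: nondecreasing_measurable.
have [iA iA' EA] := test_parts tp mAE msA (ex_intro _ KA bA).
have [iB iB' EB] := test_parts tp mBE msB (ex_intro _ KB bB).
rewrite (test_integral_dom mA u tp).1 (test_integral_dom mB u tp).1.
have uE : (\int[mu]_(x in I) (u x * derive1 psi x)%:E =
    \int[mu]_(x in I) ((A x * derive1 psi x)%:E - (B x * derive1 psi x)%:E))%E.
  have [r [Bd [r0 [mpsi mdpsi] _ _ _]]] := test_facts tp.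
  have uAB x : I x -> ~ (NA `|` NB) x -> u x = A x - B x.
    move=> Ix NAB; rewrite AE// ?BE//; last by move=> h; apply: NAB; left.
      by rewrite mul1r mul0r addr0 addrC addrA addNr add0r.
    by move=> h; apply: NAB; right.
  have mNAB : measurable (NA `|` NB) by exact: measurableU.
  have NAB0 : mu (NA `|` NB) = 0%E by exact: nullU.
  have mw : measurable_fun I (fun x : T => (u x * derive1 psi x)%:E).
    by apply/measurable_EFinP; apply: measurable_funM => //; exact: measurable_funTS mdpsi.
  have mAB : measurable_fun I (fun x : T => ((A x * derive1 psi x)%:E - (B x * derive1 psi x)%:E)%E).
    apply: emeasurable_funB; apply/measurable_EFinP; apply: measurable_funM; apply: measurable_funTS => //.
  apply: ae_eq_integral => //.
  exists (NA `|` NB); split => // x /= /not_implyP[Ix ne]; apply: contrapT => nx; apply: ne.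
  by rewrite uAB// -EFinB mulrBl.
rewrite uE integralB//; [|exact: integrableS iA'|exact: integrableS iB'].
rewrite (test_integral_dom mu A tp).2 (test_integral_dom mu B tp).2 EA EB.
have fA : (\int[mA]_t (psi t)%:E)%E \is a fin_num by exact: integrable_fin_num.
have fB : (\int[mB]_t (psi t)%:E)%E \is a fin_num by exact: integrable_fin_num.
move: fA fB; move: (\int[mA]_t _)%E (\int[mB]_t _)%E => [a| |] [b| |] //= _ _.
by congr EFin; lra.
Qed.

(** With [mp] and [mn] representing [V + u] and [V - u], comparing increments gives [mn + P = m + Q]
    and [mp + Q = m + P] for the Jordan parts [P], [Q]. On the positive Hahn set [Q] vanishes, hence
    [P <= m] there; on the negative one [Q <= m]. The two sets are complementary, so the bounds add
    up to [m E]. *)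
Lemma variation_le (nu : {charge set T -> \bar R}) :
  (forall x y, I x -> I y -> ~ N x -> ~ N y -> x < y -> (u y - u x)%:E = nu `]x, y]%classic) ->
  (forall x y, I x -> I y -> ~ N x -> ~ N y -> x < y -> V x <= V y) ->
  exists (m : {finite_measure set T -> \bar R}) (N' : set T),
    [/\ measurable N', mu N' = 0%E, N `<=` N', (m setT <= M%:E)%E &
     forall x y, I x -> I y -> ~ N' x -> ~ N' y -> x < y -> m `]x, y]%classic = (V y - V x)%:E] /\
    forall E : set T, measurable E -> E `<=` I -> (jordan_pos (hahnP nu) E + jordan_neg (hahnP nu) E <= m E)%E.
Proof.
move=> nuE ndV.
have M0 : 0 <= M by have /andP[] := V_itv 0; exact: le_trans.
have [A [m [N1 [[mN1 N10 NN1 ndA _] [AE mE ms]]]]] := stieltjes_rep mN N0 M0 ndV (fun x _ _ => V_itv x).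
have [|Ap [mp [Np [[mNp Np0 NNp ndAp _] [ApE mpE]]]]] := @slope_rep 1; first by rewrite normr1.
have [|An [mn [Nn [[mNn Nn0 NNn ndAn _] [AnE mnE]]]]] := @slope_rep (-1); first by rewrite normrN normr1.
pose N' := N1 `|` (Np `|` Nn).
have mN' : measurable N' by apply: measurableU => //; exact: measurableU.
have N'0 : mu N' = 0%E by exact: (nullU mN1 (measurableU _ _ mNp mNn) N10 (nullU mNp mNn Np0 Nn0)).
have N'N x : ~ N' x -> [/\ ~ N x, ~ N1 x, ~ Np x & ~ Nn x].
  move=> h; split => h'; apply: h; [left; exact: NN1|by left|by right; left|by right; right].
rewrite subr0 in ms.
have mV x y : I x -> I y -> ~ N' x -> ~ N' y -> x < y -> m `]x, y]%classic = (V y - V x)%:E.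
  by move=> Ix Iy /N'N[_ nx _ _] /N'N[_ ny _ _] xy; rewrite mE ?ltW// !AE.
exists m, N'; split; first by split => // x Nx; left; exact: NN1.
pose P := jordan_pos (hahnP nu); pose Q := jordan_neg (hahnP nu).
have foo (m1 m2 : {finite_measure set T -> \bar R}) : (measure_add m1 m2 setT < +oo)%E.
  by rewrite measure_addE lte_add_pinfty// ltey_eq fin_num_measure.
have PQ x y : I x -> I y -> ~ N x -> ~ N y -> x < y ->
    (P `]x, y]%classic - Q `]x, y]%classic = (u y - u x)%:E)%E.
  move=> Ix Iy Nx Ny xy; rewrite nuE//.
  have mxy : measurable (`]x, y]%classic : set T) by exact: measurable_itv.
  by rewrite (jordan_decomp (hahnP nu) mxy) /cadd/= /cscale/= mulN1e.
have fin (w : {finite_measure set T -> \bar R}) x y : w `]x, y]%classic \is a fin_num.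
  by apply: fin_num_measure; exact: measurable_itv.
have e1 (E : set T) : measurable E -> E `<=` I -> measure_add mn P E = measure_add m Q E.
  apply: (good_unique mN' N'0 (foo mn P) (foo m Q)) => x y Ix Iy N'x N'y xy.
  suff E0 : (mn `]x, y]%classic + P `]x, y]%classic = m `]x, y]%classic + Q `]x, y]%classic)%E.
    transitivity (mn `]x, y]%classic + P `]x, y]%classic)%E; [exact: measure_addE|].
    by rewrite E0; apply/esym; exact: measure_addE.
  rewrite mV// mnE ?ltW//.
  have [Nx n1 n2 n3] := N'N _ N'x; have [Ny k1 k2 k3] := N'N _ N'y.
  apply: (fin_swap2 (fin P x y) (fin Q x y) (PQ x y Ix Iy Nx Ny xy)).
  by rewrite !AnE//; ring.
have e2 (E : set T) : measurable E -> E `<=` I -> measure_add mp Q E = measure_add m P E.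
  apply: (good_unique mN' N'0 (foo mp Q) (foo m P)) => x y Ix Iy N'x N'y xy.
  suff E0 : (mp `]x, y]%classic + Q `]x, y]%classic = m `]x, y]%classic + P `]x, y]%classic)%E.
    transitivity (mp `]x, y]%classic + Q `]x, y]%classic)%E; [exact: measure_addE|].
    by rewrite E0; apply/esym; exact: measure_addE.
  rewrite mV// mpE ?ltW//.
  have [Nx n1 n2 n3] := N'N _ N'x; have [Ny k1 k2 k3] := N'N _ N'y.
  apply: (fin_swap3 (fin P x y) (fin Q x y) (PQ x y Ix Iy Nx Ny xy)).
  by rewrite !ApE//; ring.
have [psP nsN PNT PN0] := hahnP nu.
have mP : measurable (hahn_pos nu : set T) by case: psP.
have mNg : measurable (hahn_neg nu : set T) by case: nsN.
move=> E mE' EI.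
have PE (F : set T) : measurable F -> P F = nu (F `&` hahn_pos nu).
  by move=> mF; rewrite /P jordan_posE cjordan_posE /crestr0 mem_set.
have QE (F : set T) : measurable F -> Q F = (- nu (F `&` hahn_neg nu))%E.
  by move=> mF; rewrite /Q jordan_negE cjordan_negE /crestr0 mem_set.
have mEp : measurable (E `&` hahn_pos nu : set T) by exact: measurableI.
have mEn : measurable (E `&` hahn_neg nu : set T) by exact: measurableI.
have h1 : (P E <= m (E `&` hahn_pos nu))%E.
  have -> : P E = P (E `&` hahn_pos nu) by rewrite !PE// -setIA setIid.
  have Q0 : Q (E `&` hahn_pos nu) = 0%E by rewrite QE// -setIA PN0 setI0 charge0 oppe0.
  have h := etrans (esym (measure_addE mn P _)) (etrans (e1 _ mEp (subIset (or_introl EI))) (measure_addE m Q _)).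
  apply: (@le_trans _ _ (mn (E `&` hahn_pos nu) + P (E `&` hahn_pos nu))%E); first by rewrite leeDr.
  apply: (@le_trans _ _ (m (E `&` hahn_pos nu) + Q (E `&` hahn_pos nu))%E); last by rewrite Q0 adde0.
  by rewrite le_eqVlt; apply/orP; left; apply/eqP; exact: h.
have h2 : (Q E <= m (E `&` hahn_neg nu))%E.
  have -> : Q E = Q (E `&` hahn_neg nu) by rewrite !QE// -setIA setIid.
  have P0 : P (E `&` hahn_neg nu) = 0%E by rewrite PE// -setIA [hahn_neg _ `&` _]setIC PN0 setI0 charge0.
  have h := etrans (esym (measure_addE mp Q _)) (etrans (e2 _ mEn (subIset (or_introl EI))) (measure_addE m P _)).
  apply: (@le_trans _ _ (mp (E `&` hahn_neg nu) + Q (E `&` hahn_neg nu))%E); first by rewrite leeDr.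
  apply: (@le_trans _ _ (m (E `&` hahn_neg nu) + P (E `&` hahn_neg nu))%E); last by rewrite P0 adde0.
  by rewrite le_eqVlt; apply/orP; left; apply/eqP; exact: h.
have -> : m E = (m (E `&` hahn_pos nu) + m (E `&` hahn_neg nu))%E.
  rewrite -measureU//; first by rewrite -setIUr PNT setIT.
  by rewrite setIACA PN0 setI0.
exact: leeD.
Qed.

End Variation.
End GoodPoints.

Lemma fin_swap_inv {R : realType} (p q a b : \bar R) : p \is a fin_num -> q \is a fin_num ->
  a \is a fin_num -> b \is a fin_num -> (p + b = q + a)%E -> (p - q = a - b)%E.
Proof. by move: p q a b => [p| |] [q| |] [a| |] [b| |] //= _ _ _ _ [h]; congr EFin; lra. Qed.

(** * Uniqueness of charges and of densities *)

Section ChargeUnique.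
Context {R : realType}.
Local Notation T := (measurableTypeR R).
Implicit Types (x y t : R).
Variables (I : set R) (N : set T).
Hypotheses (oI : open I) (II : is_interval I) (mN : measurable N) (N0 : mu N = 0%E).

Lemma charge_unique (nu1 nu2 : {charge set T -> \bar R}) :
  (forall x y, I x -> I y -> ~ N x -> ~ N y -> x < y -> nu1 `]x, y]%classic = nu2 `]x, y]%classic) ->
  forall E : set T, measurable E -> E `<=` I -> nu1 E = nu2 E.
Proof.
move=> H E mE EI.
pose P1 := jordan_pos (hahnP nu1); pose Q1 := jordan_neg (hahnP nu1).
pose P2 := jordan_pos (hahnP nu2); pose Q2 := jordan_neg (hahnP nu2).
have nuE (nu : {charge set T -> \bar R}) (F : set T) : measurable F ->
    nu F = (jordan_pos (hahnP nu) F - jordan_neg (hahnP nu) F)%E.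
  by move=> mF; rewrite (jordan_decomp (hahnP nu) mF) /cadd/= /cscale/= mulN1e.
have fin (m : {finite_measure set T -> \bar R}) (F : set T) : measurable F -> m F \is a fin_num.
  by move=> mF; exact: fin_num_measure.
have foo (m1 m2 : {finite_measure set T -> \bar R}) : (measure_add m1 m2 setT < +oo)%E.
  by rewrite measure_addE lte_add_pinfty// ltey_eq fin_num_measure.
have e1 : measure_add P1 Q2 E = measure_add Q1 P2 E.
  apply: (good_unique oI II mN N0 (foo P1 Q2) (foo Q1 P2)) => // x y Ix Iy Nx Ny xy.
  have mxy : measurable (`]x, y]%classic : set T) by exact: measurable_itv.
  have h := H x y Ix Iy Nx Ny xy; rewrite (nuE nu1 _ mxy) (nuE nu2 _ mxy) in h.
  have h' := fin_swap (fin P1 _ mxy) (fin Q1 _ mxy) (fin P2 _ mxy) (fin Q2 _ mxy) h.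
  exact: (etrans (measure_addE P1 Q2 _) (etrans h' (esym (measure_addE Q1 P2 _)))).
rewrite (nuE nu1 _ mE) (nuE nu2 _ mE).
apply: (fin_swap_inv (fin P1 _ mE) (fin Q1 _ mE) (fin P2 _ mE) (fin Q2 _ mE)).
exact: (etrans (esym (measure_addE P1 Q2 _)) (etrans e1 (measure_addE Q1 P2 _))).
Qed.

Lemma density_unique (f g : T -> R) : mu.-integrable setT (EFin \o f) -> mu.-integrable setT (EFin \o g) ->
  (forall x y, I x -> I y -> ~ N x -> ~ N y -> x < y ->
    (\int[mu]_(t in `]x, y]) (f t)%:E = \int[mu]_(t in `]x, y]) (g t)%:E)%E) ->
  ae_eq mu (I : set T) (EFin \o f) (EFin \o g).
Proof.
move=> fi gi H; have mI : measurable (I : set T) by exact: open_interval_measurable.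
apply: integral_ae_eq => //.
- exact: integrableS fi.
- by have /integrableP[mg _] := gi; exact: measurable_funTS.
- move=> E EI mE; exact: (charge_unique (nu1 := induced_charge fi) (nu2 := induced_charge gi) H mE EI).
Qed.

End ChargeUnique.

(** If [a > K h], then [h ^ (p - 1) <= e * a ^ (p - 1)], and dividing the hypothesis by
    [a ^ (p - 1)] gives [a <= e w]. The constant [K] is the one with [K ^ (p - 1) = e^-1]. *)
Lemma young_slope {R : realType} (p e : R) : 1 < p -> 0 < e ->
  exists2 K : R, 0 <= K & forall a h w : R, 0 <= a -> 0 <= h -> 0 <= w ->
    a `^ p <= h `^ (p - 1) * w -> a <= K * h + e * w.
Proof.
move=> p1 e0; have q0 : 0 < p - 1 by rewrite subr_gt0.
pose K : R := e `^ (- (p - 1)^-1); have K0 : 0 < K by exact: powR_gt0.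
exists K => [|a h w a0 h0 w0 H]; first exact: ltW.
have [ak|ka] := leP a (K * h); first by apply: (le_trans ak); rewrite lerDl mulr_ge0// ltW.
have a_gt0 : 0 < a by apply: le_lt_trans ka; rewrite mulr_ge0// ltW.
have hq : h `^ (p - 1) <= e * a `^ (p - 1).
  have h1 : (K * h) `^ (p - 1) <= a `^ (p - 1).
    apply: ge0_ler_powR; [exact: ltW| |by rewrite nnegrE|exact: ltW].
    by rewrite nnegrE mulr_ge0// ltW.
  have KE : K `^ (p - 1) = e^-1.
    by rewrite /K -powRrM mulNr mulVf ?gt_eqF// powRN powRr1// ltW.
  by move: h1; rewrite powRM ?(ltW K0)// KE ler_pdivrMl.
have aE : a `^ p = a `^ (p - 1) * a.
  have c1 : (p - 1 + 1 == 0) ==> (a != 0) by rewrite (gt_eqF a_gt0) implybT.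
  by have := powRD c1; rewrite subrK powRr1.
have h2 : a `^ (p - 1) * a <= a `^ (p - 1) * (e * w).
  by rewrite -aE; apply: (le_trans H); rewrite mulrA [X in _ <= X * w]mulrC; exact: ler_wpM2r.
have h3 : a <= e * w by rewrite -(ler_pM2l (powR_gt0 (p - 1) a_gt0)).
by apply: (le_trans h3); rewrite lerDr mulr_ge0// ltW.
Qed.

(** * Absolute continuity of the derivative on bounded intervals when p > 1 *)

Section AbsolutelyContinuous.
Local Open Scope charge_scope.
Context {R : realType}.
Local Notation T := (measurableTypeR R).
Implicit Types (x y t : R).
Variables (p c d : R) (N : set T) (u W : R -> R) (M : R).
Local Notation J := (`]c, d[%classic : set R).
Hypotheses (p1 : 1 < p) (cd : c < d) (mN : measurable N) (N0 : mu N = 0%E).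
Hypotheses (ndW : {homo W : x y / x <= y}) (W_itv : forall x, 0 <= W x <= M).
Hypothesis uW : forall x y, J x -> J y -> ~ N x -> ~ N y -> x < y ->
  `|u y - u x| `^ p <= (y - x) `^ (p - 1) * (W y - W x).
Hypothesis muJ : measurable_fun setT ((u \_ J) : T -> R).
Hypothesis up : (\int[mu]_(x in J) (`|u x| `^ p)%:E < +oo)%E.

(** A primitive of Lebesgue measure on [J], continued by constants so that [e * W + K * clamp] is
    bounded on the whole line. *)
Let clamp x := Num.min (Num.max x c) d - c.

Let clampE x : J x -> clamp x = x - c.
Proof. by rewrite /= in_itv/= => /andP[cx xd]; rewrite /clamp (max_l (ltW cx)) (min_l (ltW xd)). Qed.

Let clamp_nd : {homo clamp : x y / x <= y}.
Proof. by move=> x y xy; rewrite /clamp lerD2r le_min !ge_min lexx orbT andbT ge_max !le_max xy lexx orbT. Qed.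

Let clamp_itv x : 0 <= clamp x <= d - c.
Proof.
rewrite /clamp subr_ge0 lerD2r ge_min lexx orbT andbT le_min (ltW cd) andbT le_max lexx orbT//.
Qed.

Let slopeV (e : R) : 0 < e -> exists2 K : R, 0 <= K & let V := fun x => e * W x + K * clamp x in
  (forall x, 0 <= V x <= e * M + K * (d - c)) /\ {homo V : x y / x <= y} /\
  (forall x y, J x -> J y -> ~ N x -> ~ N y -> x < y -> `|u y - u x| <= V y - V x).
Proof.
move=> e0; have [K K0 HK] := young_slope p1 e0; exists K => //= ; split.
  move=> x; have /andP[w1 w2] := W_itv x; have /andP[c1 c2] := clamp_itv x.
  rewrite addr_ge0 ?mulr_ge0 ?(ltW e0)//=; apply: lerD; apply: ler_wpM2l => //; exact: ltW.
split; first by move=> x y xy; apply: lerD; apply: ler_wpM2l; rewrite ?(ltW e0)//; [exact: ndW|exact: clamp_nd].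
move=> x y Jx Jy Nx Ny xy.
have := HK `|u y - u x| (y - x) (W y - W x) (normr_ge0 _).
rewrite !subr_ge0 (ltW xy) => /(_ isT (ndW (ltW xy)) (uW Jx Jy Nx Ny xy)).
by rewrite (clampE Jx) (clampE Jy) => /le_trans; apply; rewrite le_eqVlt; apply/orP; left; apply/eqP; ring.
Qed.

(* The derivative charge is dominated by [e * dW + K_e * dx] for every e > 0,
   hence is absolutely continuous. *)
Lemma ac_density : exists v : T -> R, [/\ mu.-integrable setT (EFin \o v),
  (exists N' : set T, [/\ measurable N', mu N' = 0%E, N `<=` N' & forall x y, J x -> J y -> ~ N' x -> ~ N' y -> x < y ->
     (u y - u x)%:E = (\int[mu]_(t in `]x, y]) (v t)%:E)%E]) &
  forall psi, test_function J psi ->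
    (\int[mu]_(x in J) (u x * derive1 psi x)%:E = - \int[mu]_(x in J) (v x * psi x)%:E)%E].
Proof.
have oJ : open J by exact: itv_open.
have IJ : is_interval J by exact: interval_is_interval.
have mJ : measurable (J : set T) by exact: measurable_itv.
have M0 : 0 <= M by have /andP[] := W_itv 0; exact: le_trans.
have mJu : measurable_fun (J : set T) (u : T -> R) by apply/(measurable_restrictT _ mJ).
have [K1 K10 [V1b [_ uV1]]] := slopeV ltr01.
have [nu nuP] := bv_exists oJ mN N0 V1b uV1 mJu.
have loc : locally_integrable setT (u \_ J).
  by apply: (Lp_locally_integrable (ltW p1) muJ); exact: restrict_Lp (lt_trans ltr01 p1) up.
have [N1 [mN1 N10 nuE]] := weak_measure_jump oJ IJ loc nuP.
pose P := jordan_pos (hahnP nu); pose Q := jordan_neg (hahnP nu).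
pose N2 := N `|` N1; have mN2 : measurable N2 by exact: measurableU.
have N20 : mu N2 = 0%E by exact: nullU.
have nN2 x : ~ N2 x -> ~ N x /\ ~ N1 x by move=> h; split => h'; apply: h; [left|right].
have [A [mW [N3 [[mN3 N30 NN3 ndA _] [AE mWE mWM]]]]] :=
  stieltjes_rep mN N0 M0 (fun x y (_ : J x) (_ : J y) (_ : ~ N x) (_ : ~ N y) xy => ndW (ltW xy)) (fun x _ _ => W_itv x).
rewrite subr0 in mWM.
have null (E : set T) : measurable E -> E `<=` J -> mu E = 0%E -> (P E + Q E)%E = 0%E.
  move=> mE EJ E0.
  have small (e : R) : 0 < e -> (P E + Q E <= (e * M)%:E)%E.
    move=> e0; have [K K0 [Vb [ndV uV]]] := slopeV e0.
    pose V x := e * W x + K * clamp x.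
    have uV2 x y : J x -> J y -> ~ N2 x -> ~ N2 y -> x < y -> `|u y - u x| <= V y - V x.
      by move=> Jx Jy /nN2[Nx _] /nN2[Ny _]; exact: uV.
    have nuE2 x y : J x -> J y -> ~ N2 x -> ~ N2 y -> x < y -> (u y - u x)%:E = nu `]x, y]%classic.
      by move=> Jx Jy /nN2[_ Nx] /nN2[_ Ny]; exact: nuE.
    have [m [N4 [[mN4 N40 NN4 mM mE4] PQ]]] := variation_le oJ IJ mN2 N20 Vb uV2 nuE2
      (fun x y (_ : J x) (_ : J y) (_ : ~ N2 x) (_ : ~ N2 y) xy => ndV _ _ (ltW xy)).
    apply: (le_trans (PQ E mE EJ)).
    (* [m2] is [e dW] plus [K dx] on [J]. It has the increments of [V], hence those of [m], between
       good points of [J], and on null sets only its first part survives. *)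
    pose m2 := measure_add (mscale (NngNum (ltW e0)) mW) (mscale (NngNum K0) (mrestr mu mJ)).
    have m2E (F : set T) : m2 F = (e%:E * mW F + K%:E * mu (F `&` J))%E.
      exact: measure_addE.
    have muJE : mu (J : set T) = (d - c)%:E by rewrite lebesgue_measure_itv/= lte_fin cd EFinB.
    have m2oo : (m2 setT < +oo)%E.
      rewrite m2E setTI muJE lte_add_pinfty//; last by rewrite -EFinM ltry.
      by rewrite ltey_eq fin_numM// fin_num_measure.
    have moo : (m setT < +oo)%E by rewrite ltey_eq fin_num_measure.
    pose N5 := N3 `|` N4; have mN5 : measurable N5 by exact: measurableU.
    have N50 : mu N5 = 0%E by exact: nullU.
    have -> : m E = m2 E.
      apply: (good_unique oJ IJ mN5 N50 moo m2oo) => // x y Jx Jy N5x N5y xy.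
      have [N3x N4x] : ~ N3 x /\ ~ N4 x by split => h; apply: N5x; [left|right].
      have [N3y N4y] : ~ N3 y /\ ~ N4 y by split => h; apply: N5y; [left|right].
      transitivity (e%:E * mW `]x, y]%classic + K%:E * mu (`]x, y]%classic `&` J))%E; last exact/esym/m2E.
      have -> : `]x, y]%classic `&` J = (`]x, y]%classic : set T).
        apply/setIidl => t /=; move: Jx Jy; rewrite /= !in_itv/= => /andP[cx _] /andP[_ yd] /andP[xt ty].
        by rewrite (lt_trans cx)//= (le_lt_trans ty).
      have muxy : mu (`]x, y]%classic : set T) = (y - x)%:E by exact: lebesgue_measure_ocitv (ltW xy).
      have mWxy : mW `]x, y]%classic = (W y - W x)%:E by rewrite mWE ?ltW// !AE.
      transitivity (V y - V x)%:E; first exact: mE4.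
      transitivity (e%:E * (W y - W x)%:E + K%:E * (y - x)%:E)%E; last by congr (_ * _ + _ * _)%E; exact/esym.
      by rewrite -!EFinM -EFinD /V/= (clampE Jx) (clampE Jy); congr EFin; ring.
    rewrite m2E (setIidl EJ) [X in (_ + _ * X)%E]E0 mule0 adde0 EFinM lee_wpmul2l ?lee_fin ?(ltW e0)//.
    by apply: le_trans mWM; apply: le_measure; rewrite ?inE.
  have finPQ : (P E + Q E)%E \is a fin_num by rewrite fin_numD !fin_num_measure.
  apply/eqP; rewrite eq_le adde_ge0 ?measure_ge0// andbT.
  rewrite -(fineK finPQ) lee_fin; apply/ler_addgt0Pr => e e0; rewrite add0r.
  have M1 : 0 < M + 1 by rewrite ltr_wpDl.
  rewrite -lee_fin (fineK finPQ); apply: (le_trans (small _ (divr_gt0 e0 M1))).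
  by rewrite lee_fin mulrAC ler_pdivrMr// ler_wpM2l ?ltW// ltrDl.
have nullP (E : set T) : measurable E -> mu E = 0%E -> P (E `&` J) = 0%E /\ Q (E `&` J) = 0%E.
  move=> mE E0; have mEJ : measurable (E `&` J) by exact: measurableI.
  have EJ0 : mu (E `&` J) = 0%E.
    have h : (mu (E `&` J) <= mu E)%E by apply: le_measure; rewrite ?inE//; exact: subIset (or_introl (fun _ => id)).
    by apply/eqP; rewrite eq_le -{1}E0 h measure_ge0.
  have := null _ mEJ (@subIsetr _ _ _) EJ0 => /eqP.
  by rewrite padde_eq0 ?measure_ge0// => /andP[/eqP -> /eqP ->].
(* Absolute continuity is known for subsets of [J] only, so both Jordan parts are restricted to [J]
   before the Radon-Nikodym theorem is applied. *)
have restr (m : {finite_measure set T -> \bar R}) : (forall E : set T, measurable E -> mu E = 0%E -> m (E `&` J) = 0%E) ->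
    exists2 m' : {finite_measure set T -> \bar R}, forall F, m' F = m (F `&` J) & m' `<< mu.
  move=> m0; have moo : (mrestr m mJ setT < +oo)%E.
    by change ((m (setT `&` J) < +oo)%E); rewrite ltey_eq fin_num_measure// setTI.
  have [m' m'E] := finite_restrict moo; exists m' => [F|]; first by rewrite m'E.
  by apply/null_content_dominatesP => E mE E0; rewrite m'E; exact: m0.
have [mp mpE mp_ac] := restr P (fun E mE E0 => (nullP E mE E0).1).
have [mn mnE mn_ac] := restr Q (fun E mE E0 => (nullP E mE E0).2).
pose dp := 'd (charge_of_finite_measure mp) '/d mu; pose dn := 'd (charge_of_finite_measure mn) '/d mu.
have dpf t : dp t \is a fin_num by exact: Radon_Nikodym_fin_num.
have dnf t : dn t \is a fin_num by exact: Radon_Nikodym_fin_num.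
have dpi : mu.-integrable setT dp by exact: Radon_Nikodym_integrable.
have dni : mu.-integrable setT dn by exact: Radon_Nikodym_integrable.
pose v t := fine (dp t) - fine (dn t).
have vE : EFin \o v = (dp \- dn)%E.
  by apply/funext => t; rewrite /v /= EFinB !fineK.
have nuD (E : set T) : measurable E -> E `<=` J -> nu E = (mp E - mn E)%E.
  move=> mE EJ; rewrite mpE mnE !(setIidl EJ).
  by rewrite (jordan_decomp (hahnP nu) mE) /cadd/= /cscale/= mulN1e.
exists v; split.
- by rewrite vE; exact: integrableB.
- exists N2; split => // [x Nx|x y Jx Jy N2x N2y xy]; first by left.
  have [Nx N1x] := nN2 _ N2x; have [Ny N1y] := nN2 _ N2y.
  have mxy : measurable (`]x, y]%classic : set T) by exact: measurable_itv.
  have sub : `]x, y]%classic `<=` J.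
    move=> t /=; move: Jx Jy; rewrite /= !in_itv/= => /andP[cx _] /andP[_ yd] /andP[xt ty].
    by rewrite (lt_trans cx)//= (le_lt_trans ty).
  rewrite nuE// nuD//.
  have -> : mp `]x, y]%classic = (\int[mu]_(t in `]x, y]) dp t)%E by exact: (Radon_Nikodym_integral (nu := charge_of_finite_measure mp) mp_ac mxy).
  have -> : mn `]x, y]%classic = (\int[mu]_(t in `]x, y]) dn t)%E by exact: (Radon_Nikodym_integral (nu := charge_of_finite_measure mn) mn_ac mxy).
  rewrite -integralB//; [|exact: integrableS dpi|exact: integrableS dni].
  by apply: eq_integral => t _; rewrite -[RHS]/((EFin \o v) t) vE.
- move=> psi tp; rewrite nuP// (charge_integralE oJ tp nuD).
  have [r [B [r0 [mpsi _] _ bd _]]] := test_facts tp.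
  have ipsi (m : {finite_measure set T -> \bar R}) : m.-integrable (J : set T) (fun t : T => (psi t)%:E).
    by apply: (integrableS measurableT) => //; exact: (test_integrable m tp).
  rewrite -(Radon_Nikodym_change_of_variables mp_ac mJ (ipsi mp)).
  rewrite -(Radon_Nikodym_change_of_variables mn_ac mJ (ipsi mn)).
  have bpsi : [bounded psi x | x in (J : set T)].
    by exists B; split; [exact: num_real|move=> b Bb t _; apply: (le_trans (bd t).1); exact: ltW].
  have ip (f : T -> \bar R) : mu.-integrable setT f -> mu.-integrable (J : set T) (fun t : T => (psi t)%:E * f t)%E.
    move=> fi; apply: (@integrableMr _ _ _ mu J mJ psi f) => //; first exact: measurable_funTS mpsi.
    exact: integrableS fi.
  rewrite -integralB//; [|exact: ip|exact: ip].
  congr (- _)%E; apply: eq_integral => t _.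
  rewrite -/dp -/dn -(fineK (dpf t)) -(fineK (dnf t)) -!EFinM -EFinB /v; congr EFin; ring.
Qed.

End AbsolutelyContinuous.

(** * Exhaustion of an open interval by bounded ones *)

Section Exhaustion.
Context {R : realType}.
Local Notation T := (measurableTypeR R).
Implicit Types (x y t : R).
Variables (I : set R).
Hypotheses (oI : open I) (II : is_interval I).

(** The term [K_e dx] has finite mass on bounded intervals only; densities are therefore found on
    the intervals []c n, d n[] and then transferred to [I]. *)
Definition exhausts (c d : nat -> R) := [/\ forall n, [/\ I (c n), I (d n) & c n < d n],
  forall m n, (m <= n)%N -> c n <= c m /\ d m <= d n & forall x, I x -> exists n, c n < x < d n].

Lemma exhaustion x0 : I x0 -> exists c d, exhausts c d.
Proof.
move=> Ix0; have [c0 [d0 [cdI cov]]] := interval_cover oI Ix0.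
pose c n := iteri n (fun i a => Num.min a (c0 i.+1)) (c0 0%N).
pose d n := iteri n (fun i a => Num.max a (d0 i.+1)) (d0 0%N).
have cS n : c n.+1 = Num.min (c n) (c0 n.+1) by [].
have dS n : d n.+1 = Num.max (d n) (d0 n.+1) by [].
have cn n : c n <= c0 n by case: n => [|n] //; rewrite cS ge_min lexx orbT.
have dn n : d0 n <= d n by case: n => [|n] //; rewrite dS le_max lexx orbT.
have cmon : nonincreasing_seq c by apply/nonincreasing_seqP => n; rewrite cS ge_min lexx.
have dmon : nondecreasing_seq d by apply/nondecreasing_seqP => n; rewrite dS le_max lexx.
exists c, d; split.
- move=> n; split.
  + elim: n => [|n IH]; first by have [] := cdI 0%N.
    by rewrite cS; case: ltP => // _; have [] := cdI n.+1.
  + elim: n => [|n IH]; first by have [] := cdI 0%N.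
    by rewrite dS; case: ltP => // _; have [] := cdI n.+1.
  + by apply: le_lt_trans (cn n) _; apply: lt_le_trans (dn n); have [] := cdI n.
- by move=> m n mn; split; [exact: cmon|exact: dmon].
- move=> x /cov[n /andP[h1 h2]]; exists n.
  by rewrite (le_lt_trans (cn n))//= (lt_le_trans h2).
Qed.

Lemma test_exhaust c d psi : exhausts c d -> test_function I psi ->
  exists n, test_function `]c n, d n[%classic psi.
Proof.
move=> [cdI mon cov] [dpsi cC CI]; set C := closure _ in cC CI *.
have [C0|/set0P C0] := eqVneq C set0.
  by exists 0%N; split => //; rewrite -/C C0.
have [b bC bmax] : exists2 b, b \in C & forall t, t \in C -> t <= b.
  apply: (@compact_EVT_max R R id C) => //; apply: continuous_subspaceT.
  by move=> t; exact: cvg_id.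
have [a aC amin] : exists2 a, a \in C & forall t, t \in C -> - t <= - a.
  apply: (@compact_EVT_max R R -%R C) => //; apply: continuous_subspaceT.
  by move=> t; exact: (@continuousN _ R R id t (fun A h => h)).
rewrite !inE in aC bC.
have [m /andP[ma _]] := cov a (CI _ aC); have [n /andP[_ nb]] := cov b (CI _ bC).
exists (maxn m n); split => // t Ct /=; rewrite in_itv/=; apply/andP; split.
  have [h _] := mon _ _ (leq_maxl m n); apply: (le_lt_trans h); apply: (lt_le_trans ma).
  by rewrite -lerN2; apply: amin; rewrite inE.
have [_ h] := mon _ _ (leq_maxr m n); apply: lt_le_trans h; apply: le_lt_trans nb.
by apply: bmax; rewrite inE.
Qed.

Lemma exhaust_nd c d : exhausts c d ->
  forall m n, (m <= n)%N -> (`]c m, d m[%classic : set R) `<=` `]c n, d n[%classic.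
Proof.
move=> [_ mon _] m n mn t /=; rewrite !in_itv/= => /andP[h1 h2]; have [h3 h4] := mon _ _ mn.
by rewrite (le_lt_trans h3)//= (lt_le_trans h2).
Qed.

Lemma exhaust_sub c d : exhausts c d -> forall n, (`]c n, d n[%classic : set R) `<=` I.
Proof.
move=> [cdI _ _] n t /=; rewrite in_itv/= => /andP[h1 h2]; have [Ic Id _] := cdI n.
by apply: (II Ic Id); rewrite !ltW.
Qed.

Lemma exhaust_bigcup c d : exhausts c d -> \bigcup_n (`]c n, d n[%classic : set R) = I.
Proof.
move=> ex; apply/seteqP; split => [t [n _]|t It]; first exact: exhaust_sub ex n t.
by have [_ _ cov] := ex; have [n h] := cov t It; exists n => //=; rewrite in_itv.
Qed.

Lemma exhaust_energy c d (p M : R) (v : T -> R) : exhausts c d -> measurable_fun (I : set T) v ->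
  (forall n, (\int[mu]_(x in `]c n, d n[) (`|v x| `^ p)%:E <= M%:E)%E) ->
  (\int[mu]_(x in I) (`|v x| `^ p)%:E <= M%:E)%E.
Proof.
move=> ex mv H; pose F n : set T := `]c n, d n[%classic.
have mF n : measurable (F n) by exact: measurable_itv.
have mf : measurable_fun (I : set T) (fun x : T => (`|v x| `^ p)%:E).
  by apply/measurable_EFinP; apply: (measurableT_comp (measurable_powR _)); exact: measurableT_comp.
have mI : measurable (I : set T) by exact: open_interval_measurable.
have ndF : nondecreasing_seq F.
  by move=> m n mn; rewrite subsetEset; exact: exhaust_nd ex _ _ mn.
have mfn n : measurable_fun (F n) (fun x : T => (`|v x| `^ p)%:E).
  by apply: (measurable_funS mI _ mf); exact: exhaust_sub.
have f0 n (x : T) : F n x -> (0 <= (`|v x| `^ p)%:E)%E by move=> _; rewrite lee_fin powR_ge0.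
have := @ge0_nondecreasing_set_cvg_integral _ _ _ F _ mu ndF mF mfn f0.
rewrite (exhaust_bigcup ex) => cv.
rewrite -(cvg_lim _ cv)//; apply: lime_le; first by apply/cvg_ex; exists (\int[mu]_(x in I) (`|v x| `^ p)%:E)%E.
by apply: nearW => n; exact: H.
Qed.

End Exhaustion.

Lemma null_shift {R : realType} (N : set (measurableTypeR R)) (h : R) : measurable N -> mu N = 0%E ->
  measurable (affine 1 h @^-1` N : set (measurableTypeR R)) /\ mu (affine 1 h @^-1` N) = 0%E.
Proof.
move=> mN N0; have mS : measurable (affine 1 h @^-1` N : set (measurableTypeR R)).
  by rewrite -[X in measurable X]setTI; exact: measurable_affine.
split => //; have := @ge0_integral_affine R 1 h N (cst 1%E) ltr01 mN (measurable_cst _) (fun _ _ => lee01).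
rewrite integral_cst// integral_cst// !mul1e invr1 mul1e => E.
by rewrite -N0; exact: E.
Qed.

(** Differentiability of the power function settles positive limits; the limit 0 is handled
    directly, since differentiability is available on the positive half-line only. *)
Lemma powR_cvgn {R : realType} (p : R) (a : nat -> R) (l : R) : 0 < p -> (forall n, 0 <= a n) -> 0 <= l ->
  a n @[n --> \oo] --> l -> a n `^ p @[n --> \oo] --> l `^ p.
Proof.
move=> p0 a0; rewrite le_eqVlt => /predU1P[<- cv|l0 cv].
  rewrite powR0 ?gt_eqF//; apply/cvgrPdist_le => e e0.
  have e1 : 0 < e `^ p^-1 by exact: powR_gt0.
  near=> n; have : `|0 - a n| <= e `^ p^-1 by near: n; move/cvgrPdist_le: cv; apply.
  rewrite !sub0r !normrN ger0_norm// ger0_norm ?powR_ge0// => h.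
  have : a n `^ p <= (e `^ p^-1) `^ p by apply: ge0_ler_powR; rewrite ?nnegrE ?(ltW p0) ?a0 ?(ltW e1).
  by rewrite -powRrM mulVf ?gt_eqF// powRr1// ltW.
apply: (@cvg_comp _ _ _ a (fun x => x `^ p) _ (nbhs l)) => //.
have : derivable (fun x : R => x `^ p) l 1 by apply: derivable_powR; rewrite in_itv/= l0.
by move=> /derivable1_diffP/differentiable_continuous; exact.
Unshelve. all: by end_near. Qed.

(** * The bound for the p-th power of the density *)

Section DensityEnergy.
Context {R : realType}.
Local Notation T := (measurableTypeR R).
Implicit Types (x y t : R).
Variables (p c d : R) (N : set T) (u W : R -> R) (M : R) (v : T -> R).
Local Notation J := (`]c, d[%classic : set R).
Hypotheses (p1 : 1 < p) (cd : c < d) (mN : measurable N) (N0 : mu N = 0%E).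
Hypotheses (ndW : {homo W : x y / x <= y}) (W_itv : forall x, 0 <= W x <= M).
Hypothesis uW : forall x y, J x -> J y -> ~ N x -> ~ N y -> x < y ->
  `|u y - u x| `^ p <= (y - x) `^ (p - 1) * (W y - W x).
Hypothesis muJ : measurable_fun setT ((u \_ J) : T -> R).
Hypothesis vi : mu.-integrable setT (EFin \o v).
Hypothesis uv : forall x y, J x -> J y -> ~ N x -> ~ N y -> x < y ->
  (u y - u x)%:E = (\int[mu]_(t in `]x, y]) (v t)%:E)%E.

Let M0 : 0 <= M. Proof. by have /andP[] := W_itv 0; exact: le_trans. Qed.

Let mW (D : set T) : measurable D -> measurable_fun D (W : T -> R).
Proof. by move=> mD; exact: nondecreasing_measurable. Qed.

(** After a shift by [h] the two integrals of [W] cancel except near the ends of the interval; what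
    remains is at most the integral of [W <= M] over the last piece of length [h]. *)
Let W_quotient_integral (h : R) : 0 < h -> c < d - h ->
  (\int[mu]_(x in `]c, (d - h)%R[) (W (x + h) - W x)%:E <= (M * h)%:E)%E.
Proof.
move=> h0 ch; pose D1 : set T := `]c, (d - h)%R[%classic; pose D2 : set T := `](c + h)%R, d[%classic.
pose D3 : set T := `[(d - h)%R, d[%classic.
have m1 : measurable D1 by exact: measurable_itv.
have m2 : measurable D2 by exact: measurable_itv.
have m3 : measurable D3 by exact: measurable_itv.
have W0 x : (0 <= (W x)%:E)%E by rewrite lee_fin; have /andP[] := W_itv x.
have mWE (D : set T) : measurable D -> measurable_fun D (fun x : T => (W x)%:E).
  by move=> mD; apply/measurable_EFinP; exact: mW.
have aff : (\int[mu]_(x in D1) (W (x + h))%:E = \int[mu]_(x in D2) (W x)%:E)%E.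
  have := @ge0_integral_affine R 1 h D2 (fun x => (W x)%:E) ltr01 m2 (mWE _ m2) (fun x _ => W0 x).
  rewrite invr1 mul1e => <-.
  have -> : affine 1 h @^-1` D2 = D1.
    by apply/seteqP; split => x /=; rewrite /affine /D1 /D2 /= !in_itv/= mul1r ltrD2r ltrBrDr.
  by apply: eq_integral => x _; rewrite mul1r.
have X_fin : (\int[mu]_(x in D1) (W x)%:E)%E \is a fin_num.
  rewrite ge0_fin_numE; last by apply: integral_ge0 => x _; exact: W0.
  apply: (@le_lt_trans _ _ (\int[mu]_(x in D1) cst M%:E x)%E).
    apply: ge0_le_integral => //; first exact: mWE.
    by move=> x _; rewrite lee_fin; have /andP[] := W_itv x.
  have muD : mu D1 = (d - h - c)%:E by rewrite lebesgue_measure_itv/= lte_fin ch EFinB.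
  by rewrite integral_cst// [X in (_ * X)%E]muD -EFinM ltry.
have b2 : (\int[mu]_(x in D2) (W x)%:E <= \int[mu]_(x in D1) (W x)%:E + (M * h)%:E)%E.
  apply: (@le_trans _ _ (\int[mu]_(x in D1 `|` D3) (W x)%:E)%E).
    apply: ge0_subset_integral => //; [exact: measurableU|apply: mWE; exact: measurableU|].
    move=> x /=; rewrite /D1 /D2 /D3 /= !in_itv/= => /andP[hx xd].
    have [h1|h1] := ltP x (d - h); [left|right] => //; apply/andP; split => //.
    by apply: lt_trans hx; rewrite ltrDl.
  rewrite ge0_integral_setU//; last 2 first.
  - by apply: mWE; exact: measurableU.
  - apply/disj_setPS => x []/=; rewrite /D1 /D3 /= !in_itv/= => /andP[_ h1] /andP[h2 _].
    by have := lt_le_trans h1 h2; rewrite ltxx.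
  rewrite leeD2l//; apply: (@le_trans _ _ (\int[mu]_(x in D3) cst M%:E x)%E).
    apply: ge0_le_integral => //; first exact: mWE.
    by move=> x _; rewrite lee_fin; have /andP[] := W_itv x.
  have muD : mu D3 = h%:E.
    by rewrite lebesgue_measure_itv/= lte_fin ltrBlDr ltrDl h0 -EFinB; congr EFin; ring.
  by rewrite integral_cst// [X in (_ * X)%E]muD -EFinM.
have sumE : (\int[mu]_(x in D1) (W (x + h) - W x)%:E + \int[mu]_(x in D1) (W x)%:E =
    \int[mu]_(x in D1) (W (x + h))%:E)%E.
  rewrite -ge0_integralD//.
  - by apply: eq_integral => x _; rewrite -EFinD subrK.
  - by move=> x _; rewrite lee_fin subr_ge0 ndW// lerDl ltW.
  - apply/measurable_EFinP; apply: measurable_funB; last exact: mW.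
    by apply: (measurableT_comp (mW measurableT)); exact: measurable_funD.
  - exact: mWE.
move: b2; rewrite -aff -sumE addeC leeD2lE//.
Qed.

Lemma density_energy : (\int[mu]_(x in J) (`|v x| `^ p)%:E <= M%:E)%E.
Proof.
have p0 : 0 < p by exact: lt_trans p1.
have mJ : measurable (J : set T) by exact: measurable_itv.
pose h (n : nat) : R := n.+1%:R^-1.
have h0 n : 0 < h n by rewrite invr_gt0.
have hcv : h n @[n --> \oo] --> (0 : R) by exact: cvg_harmonic.
have loc : locally_integrable setT (v : R -> R) by have := integrable_locally_restrict measurableT vi; rewrite patch_setT.
have [B [mB B0 HB]] := lebesgue_differentiation loc.
have lx x : ~ B x -> lebesgue_pt v x by move=> Bx; apply: contrapT => k; apply: Bx; exact: HB.
(* The difference quotients at [x] involve all the points [x + h n]; the [x] for which one of these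
   is bad lie in countably many translates of [N]. *)
have S_null : mu.-negligible (\bigcup_n (affine 1 (h n) @^-1` N : set T)).
  apply: negligible_bigcup => n; have [h1 h2] := null_shift (h n) mN N0.
  by exists (affine 1 (h n) @^-1` N); split.
have [S [mS S0 HS]] := S_null.
pose w : T -> R := u \_ J.
have wE x : J x -> w x = u x by move=> Jx; rewrite /w patchE mem_set.
(* The condition [x + h n < d] keeps the quotients inside [J], and every point of [J] satisfies it
   for large [n]. *)
pose g n (x : T) : \bar R := (if x + h n < d then `|(h n)^-1 * (w (x + h n) - w x)| `^ p else 0)%:E.
pose phi n (x : T) : \bar R := (if x + h n < d then (h n)^-1 * (W (x + h n) - W x) else 0)%:E.
have msh n (f : T -> R) : measurable_fun setT f -> measurable_fun setT (fun x : T => f (x + h n)).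
  by move=> mf; apply: (measurableT_comp mf); exact: measurable_funD.
have mc n : measurable_fun setT (fun x : T => x + h n < d).
  by apply: measurable_fun_ltr => //; exact: measurable_funD.
have mg n : measurable_fun setT (g n).
  apply/measurable_EFinP; apply: measurable_fun_ifT => //.
  apply: (measurableT_comp (measurable_powR _)); apply: measurableT_comp => //.
  by apply: measurable_funM => //; apply: measurable_funB => //; exact: msh.
have mphi n : measurable_fun setT (phi n).
  apply/measurable_EFinP; apply: measurable_fun_ifT => //.
  by apply: measurable_funM => //; apply: measurable_funB; [apply: msh|]; exact: mW.
have g0 n x : (0 <= g n x)%E by rewrite lee_fin; case: ifP => // _; exact: powR_ge0.
have phi0 n x : (0 <= phi n x)%E.
  rewrite lee_fin; case: ifP => // _; apply: mulr_ge0; first by rewrite invr_ge0 ltW.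
  by rewrite subr_ge0 ndW// lerDl ltW.
have nN n x : ~ S x -> ~ N (x + h n).
  by move=> Sx Nx; apply: Sx; apply: HS; exists n => //=; rewrite /affine mul1r.
have Jh n x : J x -> x + h n < d -> J (x + h n).
  rewrite /= !in_itv/= => /andP[cx _] ->; rewrite andbT; apply: (lt_trans cx).
  by rewrite ltrDl.
have gphi n x : J x -> ~ (N `|` S) x -> (g n x <= phi n x)%E.
  move=> Jx NS; rewrite lee_fin; case: ifP => // xd.
  have Nx : ~ N x by move=> k; apply: NS; left.
  have Nxh : ~ N (x + h n) by apply: nN => k; apply: NS; right.
  have xh : x < x + h n by rewrite ltrDl.
  rewrite !wE//; last exact: Jh.
  have := uW Jx (Jh _ _ Jx xd) Nx Nxh xh; rewrite addrAC subrr add0r => H.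
  have hi : 0 <= (h n)^-1 by rewrite invr_ge0 ltW.
  rewrite normrM (ger0_norm hi) powRM//.
  apply: (@le_trans _ _ ((h n)^-1 `^ p * (h n `^ (p - 1) * (W (x + h n) - W x)))).
    by apply: ler_wpM2l => //; exact: powR_ge0.
  (* The slope bound over a step [h n] contributes the power [p - 1] of [h n] and the quotient
     divides by the power [p], which leaves exactly the difference quotient of [W]. *)
  rewrite mulrA; suff -> : (h n)^-1 `^ p * h n `^ (p - 1) = (h n)^-1 by [].
  have c1 : (p - 1 + 1 == 0) ==> (h n != 0) by rewrite (gt_eqF (h0 n)) implybT.
  have := powRD c1; rewrite subrK (powRr1 (ltW (h0 n))) => hE.
  have e1 : (h n)^-1 `^ p * h n `^ p = 1.
    by rewrite -powRM// ?(ltW (h0 n))// mulVf ?gt_eqF// powR1.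
  have hn0 : h n != 0 by rewrite gt_eqF.
  by apply: (mulIf hn0); rewrite -mulrA -hE e1 mulVf.
have mNS : measurable (N `|` S) by exact: measurableU.
have NS0 : mu (N `|` S) = 0%E by exact: nullU.
have phi_le n : (\int[mu]_(x in J) phi n x <= M%:E)%E.
  have [dc|cdh] := leP (d - h n) c.
    rewrite (_ : (\int[mu]_(x in J) phi n x)%E = 0%E) ?lee_fin//; apply: integral0_eq => x.
    rewrite /= in_itv/= => /andP[cx _]; rewrite /phi ltNge.
    by rewrite -lerBlDr (le_trans dc (ltW cx)).
  have E : (\int[mu]_(x in J) phi n x = \int[mu]_(x in `]c, (d - h n)%R[) ((h n)^-1%:E * (W (x + h n) - W x)%:E))%E.
    rewrite integral_mkcond [RHS]integral_mkcond; apply: eq_integral => x _.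
    have E1 : (x \in (`]c, (d - h n)%R[%classic : set T)) = (x \in (J : set T)) && (x + h n < d).
      apply/idP/andP => [|[]]; rewrite !inE/= !in_itv/= ltrBrDr.
        by move=> /andP[-> k]; split => //=; apply: lt_trans k; rewrite ltrDl.
      by move=> /andP[-> _] ->.
    rewrite !patchE /phi E1; case: (x \in (J : set T)) => //=.
    by case: ifP => // _; rewrite EFinM.
  have mq : measurable_fun (`]c, (d - h n)%R[%classic : set T) (fun x : T => (W (x + h n) - W x)%:E).
    apply/measurable_EFinP; apply: measurable_funB; last by apply: mW; exact: measurable_itv.
    by apply: measurable_funTS; apply: msh; exact: mW.
  rewrite E ge0_integralZl_EFin//; [|by move=> x _; rewrite lee_fin subr_ge0 ndW// lerDl ltW|by rewrite invr_ge0 ltW].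
  apply: (@le_trans _ _ ((h n)^-1%:E * (M * h n)%:E)%E).
    by rewrite lee_wpmul2l ?lee_fin ?invr_ge0 ?(ltW (h0 n))//; exact: W_quotient_integral.
  by rewrite -EFinM mulrC mulfK ?gt_eqF.
have g_le n : (\int[mu]_(x in J) g n x <= M%:E)%E.
  apply: le_trans (phi_le n); apply: ae_ge0_le_integral => //; [exact: measurable_funTS|exact: measurable_funTS|].
  exists (N `|` S); split => // x /= /not_implyP[Jx ne]; apply: contrapT => NSx; apply: ne.
  exact: gphi.
pose Z := (N `|` S) `|` B; have mZ : measurable Z by exact: measurableU.
have Z0 : mu Z = 0%E by exact: nullU.
have g_cvg x : J x -> ~ Z x -> g n x @[n --> \oo] --> (`|v x| `^ p)%:E.
  move=> Jx Zx; have Bx : ~ B x by move=> k; apply: Zx; right.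
  have Nx : ~ N x by move=> k; apply: Zx; left; left.
  have Sx : ~ S x by move=> k; apply: Zx; left; right.
  have cv := average_right_cvg vi h0 hcv (lx x Bx).
  have cv2 : `|(h n)^-1 * (primitive v (x + h n) - primitive v x)| `^ p @[n --> \oo] --> `|v x| `^ p.
    have c1 := cvg_norm cv.
    by apply: powR_cvgn => //; exact: c1.
  have xd0 : 0 < d - x by move: Jx; rewrite /= in_itv/= subr_gt0 => /andP[].
  apply: cvg_EFin; first exact: nearW.
  apply: cvg_trans cv2; apply: near_eq_cvg; near=> n.
  have xd : x + h n < d.
    by rewrite -ltrBrDl; near: n; exact: (cvgr_lt _ hcv _ xd0).
  have xh : x < x + h n by rewrite ltrDl.
  rewrite /= xd !wE//; last exact: Jh.
  rewrite (primitiveB vi (ltW xh)) /Rintegral.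
  by have := uv Jx (Jh _ _ Jx xd) Nx (nN n x Sx) xh => /(congr1 fine) /= ->.
have mv : measurable_fun (J : set T) (fun x : T => (`|v x| `^ p)%:E).
  have /integrableP[/measurable_EFinP mv _] := vi; apply/measurable_EFinP; apply: measurable_funTS.
  by apply: (measurableT_comp (measurable_powR _)); exact: measurableT_comp.
have mJZ : measurable ((J : set T) `\` Z) by exact: measurableD.
rewrite (ge0_negligible_integral mZ)//.
rewrite (_ : (\int[mu]_(x in _) _)%E = \int[mu]_(x in (J : set T) `\` Z) limn_einf (g^~ x))%E; last first.
  apply: eq_integral => x; rewrite inE => -[Jx Zx].
  have cv := g_cvg x Jx Zx; have c' : cvgn (g^~ x) by apply/cvg_ex; exists (`|v x| `^ p)%:E.
  by rewrite (is_cvg_limn_einfE c'); apply/esym; exact: (cvg_lim _ cv).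
apply: le_trans (@fatou _ _ _ mu _ mJZ g _ _) _.
- by move=> n; exact: measurable_funTS.
- by move=> n x _; exact: g0.
apply: le_trans (limn_einf_sup _) _; rewrite limn_esup_lim.
apply: lime_le; first exact: is_cvg_esups.
apply: nearW => n; apply: ub_ereal_sup => _ [k _ <-]; apply: le_trans (g_le k).
by apply: ge0_subset_integral => //; exact: measurable_funTS.
Unshelve. all: by end_near. Qed.

End DensityEnergy.

(** * Weak derivatives obtained from slope bounds *)

Section SobolevFromSlopes.
Context {R : realType}.
Local Notation T := (measurableTypeR R).
Implicit Types (x y t : R).
Variables (p : R) (I : set R) (N : set T) (u W : R -> R) (M : R).
Hypotheses (p1 : 1 < p) (oI : open I) (II : is_interval I) (mN : measurable N) (N0 : mu N = 0%E).
Hypotheses (ndW : {homo W : x y / x <= y}) (W_itv : forall x, 0 <= W x <= M).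
Hypothesis uW : forall x y, I x -> I y -> ~ N x -> ~ N y -> x < y ->
  `|u y - u x| `^ p <= (y - x) `^ (p - 1) * (W y - W x).
Hypothesis muI : measurable_fun setT ((u \_ I) : T -> R).
Hypothesis up : (\int[mu]_(x in I) (`|u x| `^ p)%:E < +oo)%E.

Let p0 : 0 < p. Proof. exact: lt_trans p1. Qed.
Let mI : measurable (I : set T). Proof. exact: open_interval_measurable. Qed.
Let M0 : 0 <= M. Proof. by have /andP[] := W_itv 0; exact: le_trans. Qed.
Let mIu : measurable_fun (I : set T) (u : T -> R). Proof. exact/(measurable_restrictT _ mI). Qed.

Let mu_sub (J : set R) : measurable (J : set T) -> J `<=` I -> measurable_fun setT ((u \_ J) : T -> R).
Proof. by move=> mJ JI; apply/(measurable_restrictT _ mJ); exact: (measurable_funS mI JI mIu). Qed.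

Let up_sub (J : set R) : measurable (J : set T) -> J `<=` I -> (\int[mu]_(x in J) (`|u x| `^ p)%:E < +oo)%E.
Proof.
move=> mJ JI; apply: le_lt_trans up; apply: ge0_subset_integral => //.
- by apply/measurable_EFinP; apply: (measurableT_comp (measurable_powR _)); exact: measurableT_comp.
Qed.

(** Stated for an arbitrary weak derivative, because the energy is computed with the one selected by
    [cid]. *)
Lemma weak_energy v : measurable_fun setT ((v \_ I) : T -> R) -> (\int[mu]_(x in I) (`|v x| `^ p)%:E < +oo)%E ->
  weak_derivative I u v -> (\int[mu]_(x in I) (`|v x| `^ p)%:E <= M%:E)%E.
Proof.
move=> mv vp wv.
have [[x0 Ix0]|I0] := pselect (exists x, I x); last first.
  have -> : I = set0 by apply/seteqP; split => // x Ix; apply: I0; exists x.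
  by rewrite integral_set0 lee_fin.
have [c [d ex]] := exhaustion oI Ix0.
have locu : locally_integrable setT (u \_ I) by apply: (Lp_locally_integrable (ltW p1) muI); exact: restrict_Lp up.
have locv : locally_integrable setT (v \_ I) by apply: (Lp_locally_integrable (ltW p1) mv); exact: restrict_Lp vp.
have [N1 [mN1 N10 uv]] := weak_fun_jump oI II locu locv wv.
have mN2 : measurable (N `|` N1) by exact: measurableU.
have N20 : mu (N `|` N1) = 0%E by exact: nullU.
have nN2 x : ~ (N `|` N1) x -> ~ N x /\ ~ N1 x by move=> k; split => h; apply: k; [left|right].
apply: (exhaust_energy oI II ex); first exact/(measurable_restrictT _ mI).
move=> n; have [cdI _ _] := ex; have [Ic Id cd] := cdI n.
have JI := @exhaust_sub R I II c d ex n.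
have mJ : measurable (`]c n, d n[%classic : set T) by exact: measurable_itv.
have mK : measurable (`[c n, d n]%classic : set T) by exact: measurable_itv.
(* The cut-off to [[c n, d n]] gives a function integrable on the whole line, as [density_energy]
   requires, and leaves [v] unchanged on the [n]-th interval. *)
pose vn : T -> R := fun t => (v \_ I) t * \1_(`[c n, d n]%classic : set T) t.
have vni : mu.-integrable setT (EFin \o vn).
  apply: (@integrable_mul_supp _ _ _ (c n) (d n) 1 locv) => //.
  - by move=> t; rewrite indicE; case: (_ \in _); rewrite ?normr1 ?normr0.
  - by move=> t /negP h; rewrite indicE memNset//= in_itv.
have vnE t : c n <= t <= d n -> vn t = v t.
  move=> h; rewrite /vn indicE mem_set/= ?in_itv//= mulr1 patchE mem_set//.
  exact: (II Ic Id h).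
rewrite (_ : (\int[mu]_(x in _) _)%E = \int[mu]_(x in `]c n, d n[) (`|vn x| `^ p)%:E)%E; last first.
  by apply: eq_integral => t; rewrite inE/= in_itv/= => /andP[h1 h2]; rewrite vnE// !ltW.
apply: (@density_energy R p (c n) (d n) (N `|` N1) u W M vn p1 mN2 N20 ndW W_itv) => //.
- by move=> x y Jx Jy /nN2[Nx _] /nN2[Ny _]; apply: uW => //; exact: JI.
- exact: mu_sub.
- move=> x y Jx Jy /nN2[_ Nx] /nN2[_ Ny] xy; rewrite (uv _ _ (JI _ Jx) (JI _ Jy) Nx Ny xy) /Rintegral.
  have mxy : measurable (`]x, y]%classic : set T) by exact: measurable_itv.
  have E : (\int[mu]_(t in `]x, y]) ((v \_ I) t)%:E = \int[mu]_(t in `]x, y]) (vn t)%:E)%E.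
    apply: eq_integral => t; rewrite inE/= in_itv/= => /andP[xt ty].
    rewrite /vn indicE mem_set ?mulr1//= in_itv/=; move: Jx Jy; rewrite /= !in_itv/=.
    by move=> /andP[cx _] /andP[_ yd]; rewrite (ltW (lt_trans cx xt)) (le_trans ty (ltW yd)).
  rewrite E fineK//; apply: (integrable_fin_num mxy); exact: integrableS vni.
Qed.

(** The densities found on the intervals of an exhaustion have equal increments, hence agree almost
    everywhere on overlaps; one null set [Z] collects all the pairwise exceptions. The glued
    function uses at [x] the density of the first interval that contains [x]. Every test function on
    [I] is supported in one of the intervals, so the weak identity passes to [I]. *)
Lemma weak_exists : exists v : R -> R, [/\ measurable_fun (I : set T) (v : T -> R), weak_derivative I u v &
  (\int[mu]_(x in I) (`|v x| `^ p)%:E <= M%:E)%E].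
Proof.
have [[x0 Ix0]|I0] := pselect (exists x, I x); last first.
  have I00 : I = set0 by apply/seteqP; split => // x Ix; apply: I0; exists x.
  exists (cst 0); split; [exact: measurable_cst| |by rewrite I00 integral_set0 lee_fin].
  by move=> psi _; rewrite I00 !integral_set0 oppe0.
have [c [d ex]] := exhaustion oI Ix0.
pose J n : set T := `]c n, d n[%classic.
have mJ n : measurable (J n) by exact: measurable_itv.
have oJ n : open (J n : set R) by exact: itv_open.
have IJ n : is_interval (J n : set R) by exact: interval_is_interval.
have JI n : J n `<=` I by exact: (@exhaust_sub R I II c d ex n).
have Jmon m n : (m <= n)%N -> J m `<=` J n by exact: (@exhaust_nd R I c d ex m n).
have JU : \bigcup_n J n = I by exact: (exhaust_bigcup II ex).
have dens n : exists v : T -> R, [/\ mu.-integrable setT (EFin \o v),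
    (exists N' : set T, [/\ measurable N', mu N' = 0%E, N `<=` N' & forall x y, J n x -> J n y -> ~ N' x -> ~ N' y -> x < y ->
      (u y - u x)%:E = (\int[mu]_(t in `]x, y]) (v t)%:E)%E]) &
    forall psi, test_function (J n) psi ->
      (\int[mu]_(x in J n) (u x * derive1 psi x)%:E = - \int[mu]_(x in J n) (v x * psi x)%:E)%E].
  have [cdI _ _] := ex; have [Ic Id cd] := cdI n.
  apply: (@ac_density R p (c n) (d n) N u W M p1 cd mN N0 ndW W_itv).
  - by move=> x y Jx Jy Nx Ny xy; apply: uW => //; exact: (JI n).
  - exact: (mu_sub (mJ n) (JI n)).
  - exact: (up_sub (mJ n) (JI n)).
have /choice[v_ Hv] := dens.
have vi n : mu.-integrable setT (EFin \o v_ n) by have [] := Hv n.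
have mv_ n : measurable_fun setT (v_ n) by have /integrableP[/measurable_EFinP] := vi n.
have /choice[N_ HN] : forall n, exists N' : set T, [/\ measurable N', mu N' = 0%E, N `<=` N' & forall x y, J n x -> J n y -> ~ N' x -> ~ N' y -> x < y ->
      (u y - u x)%:E = (\int[mu]_(t in `]x, y]) (v_ n t)%:E)%E] by move=> n; have [] := Hv n.
have agree m n : exists Z : set T, [/\ measurable Z, mu Z = 0%E &
    (m <= n)%N -> forall x, J m x -> ~ Z x -> v_ m x = v_ n x].
  have [mn|nm] := leqP m n; last by exists set0; split => //; exact: measure0.
  have [m1 m2 m3 m4] := HN m; have [n1 n2 n3 n4] := HN n.
  have mZ : measurable (N_ m `|` N_ n) by exact: measurableU.
  have Z0 : mu (N_ m `|` N_ n) = 0%E by exact: nullU.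
  have [|Z [mZ' Z0' HZ]] := @density_unique R (J m) (N_ m `|` N_ n) (oJ m) (IJ m) mZ Z0 (v_ m) (v_ n) (vi m) (vi n).
    move=> x y Jx Jy Nx Ny xy; rewrite -m4//; [|by move=> k; apply: Nx; left|by move=> k; apply: Ny; left].
    by rewrite n4//; [exact: (Jmon _ _ mn)|exact: (Jmon _ _ mn)|move=> k; apply: Nx; right|move=> k; apply: Ny; right].
  exists Z; split => // _ x Jx Zx; apply: contrapT => ne; apply: Zx; apply: HZ => /= H.
  by apply: ne; have := H Jx => -[].
have /choice[Z_ HZ_] : forall mn : nat * nat, exists Z : set T, [/\ measurable Z, mu Z = 0%E &
    (mn.1 <= mn.2)%N -> forall x, J mn.1 x -> ~ Z x -> v_ mn.1 x = v_ mn.2 x] by move=> [m n]; exact: agree.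
have Znull : mu.-negligible (\bigcup_k Z_ (odflt (0, 0)%N (unpickle k))).
  apply: negligible_bigcup => k; have [h1 h2 _] := HZ_ (odflt (0, 0)%N (unpickle k)).
  by exists (Z_ (odflt (0, 0)%N (unpickle k))); split.
have [Z [mZ Z0 HZ]] := Znull.
have vv m n x : (m <= n)%N -> J m x -> ~ Z x -> v_ m x = v_ n x.
  move=> mn Jx Zx; have [_ _ H] := HZ_ (m, n); apply: H => // k; apply: Zx; apply: HZ.
  by exists (pickle (m, n)) => //; rewrite pickleK.
pose S n := seqDU J n.
have mS n : measurable (S n) by apply: measurableD => //; exact: bigsetU_measurable.
have SU : \bigcup_n S n = I by rewrite -seqDU_bigcup_eq.
pose k x := xget 0%N [set n | S n x].
have kE n x : S n x -> k x = n.
  move=> Sx; have H : S (k x) x by rewrite /k; case: xgetP => [m _ //|/(_ n)].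
  by apply: (trivIset_seqDU J _ _ Logic.I Logic.I); exists x.
pose v x := v_ (k x) x.
have vE n x : J n x -> ~ Z x -> v x = v_ n x.
  move=> Jx Zx; have : I x by exact: (JI n).
  rewrite -SU => -[m _ Sx]; rewrite /v (kE _ _ Sx); have Jmx : J m x by exact: (@subset_seqDU _ J m x Sx).
  by have [mn|/ltnW nm] := leqP m n; [exact: vv|apply/esym; exact: vv].
have mv : measurable_fun (I : set T) (v : T -> R).
  rewrite -SU; apply/(measurable_fun_bigcup _ mS) => n.
  apply: (eq_measurable_fun (v_ n)); last exact: measurable_funTS.
  by move=> x; rewrite inE => Sx; rewrite /v (kE _ _ Sx).
have mpow (D : set T) (w : T -> R) : measurable_fun D w -> measurable_fun D (fun x : T => (`|w x| `^ p)%:E).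
  by move=> mw; apply/measurable_EFinP; apply: (measurableT_comp (measurable_powR _)); exact: measurableT_comp.
exists v; split => //.
- move=> psi tp; have [n tpn] := test_exhaust ex tp.
  have [_ _ wn] := Hv n; have := wn psi tpn.
  rewrite (test_integral_dom mu u tpn).2 (test_integral_dom mu u tp).2 => ->; congr (- _)%E.
  have [r [B [r0 [mpsi _] outn _ _]]] := test_facts tpn.
  have mvJ : measurable_fun (J n) v by exact: (measurable_funS mI (JI n) mv).
  transitivity (\int[mu]_(x in J n) (v x * psi x)%:E)%E.
    apply: ae_eq_integral => //.
    - by apply/measurable_EFinP; apply: measurable_funM; exact: measurable_funTS.
    - by apply/measurable_EFinP; apply: measurable_funM => //; exact: measurable_funTS.
    - exists Z; split => // x /= /not_implyP[Jx ne]; apply: contrapT => Zx; apply: ne.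
      by rewrite (vE n).
  rewrite integral_mkcond [RHS]integral_mkcond; apply: eq_integral => x _; rewrite !patchE.
  case: ifPn => h1; case: ifPn => h2 //.
    by move/negP: h2; case; move: h1; rewrite !inE; exact: (JI n).
  have nJ : ~ J n x by move=> Jx; move/negP: h1; apply; rewrite inE.
  by have [-> _] := outn x (or_introl nJ); rewrite mulr0.
- apply: (exhaust_energy oI II ex mv) => n.
  have [n1 n2 n3 n4] := HN n; have [cdI _ _] := ex; have [Ic Id cd] := cdI n.
  rewrite (_ : (\int[mu]_(x in _) _)%E = \int[mu]_(x in J n) (`|v_ n x| `^ p)%:E)%E.
    apply: (@density_energy R p (c n) (d n) (N_ n) u W M (v_ n) p1 n1 n2 ndW W_itv) => //.
    + move=> x y Jx Jy Nx Ny xy; apply: uW; rewrite ?(JI n)//; [exact: (JI n)|exact: (JI n)|by move=> /n3|by move=> /n3].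
    + exact: (mu_sub (mJ n) (JI n)).
  apply: ae_eq_integral => //.
  + by apply: mpow; exact: (measurable_funS mI (JI n) mv).
  + by apply: mpow; exact: measurable_funTS.
  + exists Z; split => // x /= /not_implyP[Jx ne]; apply: contrapT => Zx; apply: ne.
    by rewrite (vE n).
Qed.

End SobolevFromSlopes.

(** * Finite energy and slope bounds *)

Section EnergyAndSlopes.
Context {R : realType}.
Local Notation T := (measurableTypeR R).
Implicit Types (p x y t : R) (I : set R).

Lemma in_LpP p I (u : T -> R) : 0 < p -> in_Lp p I u <->
  measurable_fun setT ((u \_ I) : T -> R) /\ (\int[mu]_(x in I) (`|u x| `^ p)%:E < +oo)%E.
Proof.
move=> p0; have E : (\int[mu]_x (`|((u \_ I) x)%:E| `^ p) = \int[mu]_(x in I) (`|u x| `^ p)%:E)%E.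
  rewrite [RHS]integral_mkcond; apply: eq_integral => x _; rewrite !patchE; case: ifP => // _.
  by rewrite /= normr0 powR0// gt_eqF.
have normE : ('N[mu]_(p%:E)[EFin \o (u \_ I)] = (\int[mu]_(x in I) (`|u x| `^ p)%:E) `^ p^-1)%E.
  by rewrite unlock E.
rewrite /in_Lp; split.
  move=> /andP[]; rewrite !inE => mw; rewrite /finite_norm/= normE => h; split => //.
  by apply: lty_poweRy h; rewrite invr_neq0// gt_eqF.
move=> [mw h]; apply/andP; rewrite !inE; split => //.
by rewrite /finite_norm/= normE; exact: poweR_lty.
Qed.

Lemma cvg_LpP p I (g_ : R -> R -> R) (g : R -> R) : 0 < p -> cvg_Lp p I g_ g <->
  forall e : R, 0 < e -> \forall d \near 0^'+, (\int[mu]_(x in I) (`|g_ d x - g x| `^ p)%:E <= e%:E)%E.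
Proof.
move=> p0; have pi0 : 0 < p^-1 by rewrite invr_gt0.
pose A d := (\int[mu]_(x in I) (`|g_ d x - g x| `^ p)%:E)%E.
have A0 d : (0 <= A d)%E by apply: integral_ge0 => x _; rewrite lee_fin powR_ge0.
have normE d : ('N[mu]_(p%:E)[EFin \o ((g_ d \- g)%R \_ I)] = A d `^ p^-1)%E.
  have E : (\int[mu]_x (`|(((g_ d \- g)%R \_ I) x)%:E| `^ p) = A d)%E.
    rewrite /A [RHS]integral_mkcond; apply: eq_integral => x _; rewrite !patchE; case: ifP => // _.
    by rewrite /= normr0 powR0// gt_eqF.
  by rewrite unlock E.
have le_pow d (e : R) : 0 <= e -> (A d <= (e `^ p)%:E)%E = (A d `^ p^-1 <= e%:E)%E.
  move=> e0; have h : (0 <= (e `^ p)%:E)%E by rewrite lee_fin powR_ge0.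
  case: (A d) (A0 d) => [a| |] //= a0; last by rewrite gt_eqF.
  rewrite !lee_fin; rewrite lee_fin in a0; apply/idP/idP => k.
    have : a `^ p^-1 <= (e `^ p) `^ p^-1 by apply: ge0_ler_powR; rewrite ?nnegrE ?powR_ge0// ltW.
    by rewrite -powRrM mulfV ?gt_eqF// powRr1.
  have : (a `^ p^-1) `^ p <= e `^ p by apply: ge0_ler_powR; rewrite ?nnegrE ?powR_ge0// ltW.
  by rewrite -powRrM mulVf ?gt_eqF// powRr1.
rewrite /cvg_Lp; split.
  move=> cv e e0; have e1 : 0 < e `^ p^-1 by exact: powR_gt0.
  have := cv _ (open_ereal_lt' (x := 0%E) (y := (e `^ p^-1)%:E) _); rewrite lte_fin => /(_ e1).
  move=> H1; near=> d.
  have : ('N[mu]_(p%:E)[EFin \o ((g_ d \- g)%R \_ I)] < (e `^ p^-1)%:E)%E by near: d; exact: H1.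
  by rewrite normE => /ltW; rewrite -le_pow ?powR_ge0// -powRrM mulVf ?gt_eqF// powRr1// ltW.
move=> H; have near_le (e : R) : 0 < e -> \forall d \near 0^'+, (A d `^ p^-1 <= e%:E)%E.
  by move=> e0; have := H _ (powR_gt0 p e0); apply: filterS => d; rewrite -/(A d) le_pow// ltW.
apply: cvg_EFin.
  apply: filterS (near_le _ ltr01) => d h; rewrite normE ge0_fin_numE ?poweR_ge0//.
  exact: le_lt_trans h (ltry _).
apply/cvgrPdist_le => e e0; apply: filterS (near_le _ e0) => d h.
rewrite sub0r normrN /= normE ger0_norm ?fine_ge0 ?poweR_ge0//.
rewrite -lee_fin fineK// ge0_fin_numE ?poweR_ge0//.
exact: le_lt_trans h (ltry _).
Unshelve. all: by end_near. Qed.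

Lemma sobolev_slopes p I u v : 1 < p -> open I -> is_interval I -> measurable_fun setT ((u \_ I) : T -> R) ->
  (\int[mu]_(x in I) (`|u x| `^ p)%:E < +oo)%E -> measurable_fun setT ((v \_ I) : T -> R) ->
  (\int[mu]_(x in I) (`|v x| `^ p)%:E < +oo)%E -> weak_derivative I u v ->
  exists (N : set T) (W : R -> R), [/\ measurable N, mu N = 0%E, {homo W : x y / x <= y},
    forall x, 0 <= W x <= fine (\int[mu]_(x in I) (`|v x| `^ p)%:E)%E &
    forall x y, I x -> I y -> ~ N x -> ~ N y -> x < y -> `|u y - u x| `^ p <= (y - x) `^ (p - 1) * (W y - W x)].
Proof.
move=> p1 oI II mw up mv vp wv; have p0 : 0 < p by exact: lt_trans p1.
have mI : measurable (I : set T) by exact: open_interval_measurable.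
have locu : locally_integrable setT (u \_ I) by apply: (Lp_locally_integrable (ltW p1) mw); exact: restrict_Lp up.
have locv : locally_integrable setT (v \_ I) by apply: (Lp_locally_integrable (ltW p1) mv); exact: restrict_Lp vp.
have [N [mN N0 uv]] := weak_fun_jump oI II locu locv wv.
pose f (x : T) : \bar R := (`|v x| `^ p)%:E.
have f0 x : (0 <= f x)%E by rewrite lee_fin powR_ge0.
have mf : measurable_fun (I : set T) f.
  apply/measurable_EFinP; apply: (measurableT_comp (measurable_powR _)); apply: measurableT_comp => //.
  exact/(measurable_restrictT _ mI).
pose D x : set T := I `&` `]-oo, x]%classic.
have mD x : measurable (D x) by apply: measurableI => //; exact: measurable_itv.
have mfs (E : set T) : E `<=` I -> measurable_fun E f by move=> EI; exact: (measurable_funS mI EI mf).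
have int0 (E : set T) : (0 <= \int[mu]_(x in E) f x)%E by apply: integral_ge0 => x _; exact: f0.
have sub_le (E F : set T) : measurable E -> measurable F -> E `<=` F -> F `<=` I ->
    (\int[mu]_(x in E) f x <= \int[mu]_(x in F) f x)%E.
  by move=> mE mF EF FI; apply: ge0_subset_integral => //; exact: mfs.
have fin (E : set T) : measurable E -> E `<=` I -> (\int[mu]_(x in E) f x)%E \is a fin_num.
  move=> mE EI; rewrite (ge0_fin_numE (int0 E)); apply: (le_lt_trans _ vp); exact: (sub_le E I mE mI EI (fun _ => id)).
have DI x : D x `<=` I by move=> z [].
pose W x : R := fine (\int[mu]_(t in D x) f t)%E.
exists N, W; split => //.
- move=> x y xy; apply: fine_le; [exact: fin|exact: fin|apply: sub_le => //].
  by move=> z [Iz]; rewrite /= !in_itv/= => zx; split => //=; rewrite in_itv/= (le_trans zx).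
- by move=> x; rewrite fine_ge0//=; apply: fine_le; [exact: fin|exact: fin|exact: sub_le].
move=> x y Ix Iy Nx Ny xy; pose E : set T := `]x, y]%classic.
have mE : measurable E by exact: measurable_itv.
have EI : E `<=` I.
  by move=> z; rewrite /E/= in_itv/= => /andP[xz zy]; apply: (II _ _ Ix Iy); rewrite (ltW xz).
have DE : D y = D x `|` E.
  apply/seteqP; split => z.
    move=> [Iz]; rewrite /= in_itv/= => zy; have [zx|xz] := leP z x; [left|right].
      by split => //=; rewrite in_itv.
    by rewrite /E/= in_itv/= xz.
  move=> [[Iz]|Ez]; [rewrite /= in_itv/= => zx|]; split => //=; rewrite ?in_itv/=.
  - exact: le_trans zx (ltW xy).
  - exact: EI.
  - by move: Ez; rewrite /E/= in_itv/= => /andP[].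
have WE : W y - W x = fine (\int[mu]_(t in E) f t)%E.
  rewrite /W DE ge0_integral_setU//.
  - by rewrite fineD ?fin// addrAC subrr add0r.
  - by apply: mfs => z []; [exact: DI|exact: EI].
  - apply/disj_setPS => z [[_]]; rewrite /E/= !in_itv/= => zx /andP[xz _].
    by have := lt_le_trans xz zx; rewrite ltxx.
have yx : 0 < y - x by rewrite subr_gt0.
have muE : mu E = (y - x)%:E by exact: lebesgue_measure_ocitv (ltW xy).
have mvE : measurable_fun E ((v \_ I) : T -> R) by exact: measurable_funTS.
have fE : (\int[mu]_(t in E) (`|(v \_ I) t| `^ p)%:E = \int[mu]_(t in E) f t)%E.
  by apply: eq_integral => t; rewrite inE => Et; rewrite /f patchE mem_set//; exact: EI.
have v1 : (\int[mu]_(t in E) `|(v \_ I) t|%:E < +oo)%E.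
  have [_ _ /(_ `[x, y]%classic (@subsetT _ _) (@segment_compact _ x y))] := locv.
  have mK : measurable (`[x, y]%classic : set T) by exact: measurable_itv.
  apply: le_lt_trans; apply: (ge0_subset_integral _ mE mK).
  - by apply/measurable_EFinP; apply: measurableT_comp => //; exact: measurable_funTS.
  - by move=> z _; rewrite lee_fin.
  - by move=> z; rewrite /E/= !in_itv/= => /andP[/ltW -> ->].
have vE : mu.-integrable E (EFin \o (v \_ I)).
  by apply/integrableP; split => //; exact/measurable_EFinP.
have fEoo : (\int[mu]_(t in E) (`|(v \_ I) t| `^ p)%:E < +oo)%E by rewrite fE -ge0_fin_numE// fin.
have := jensen_powR (ltW p1) mE muE yx mvE fEoo v1; rewrite fE WE; apply: le_trans.
apply: ge0_ler_powR; [exact: ltW|by rewrite nnegrE|rewrite nnegrE|].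
  by apply: fine_ge0; apply: integral_ge0 => t _; rewrite lee_fin.
by rewrite (uv _ _ Ix Iy Nx Ny xy); exact: le_normr_Rintegral.
Qed.

(** The exponents [1] and [1 - 1] are left unreduced so that the conclusion is literally the general
    slope bound at [p = 1]. *)
Lemma bv_slopes I u (nu : {charge set T -> \bar R}) : open I -> is_interval I ->
  measurable_fun setT ((u \_ I) : T -> R) -> (\int[mu]_(x in I) (`|u x| `^ 1)%:E < +oo)%E ->
  measure_derivative I u nu -> charge_total_variation nu I \is a fin_num /\
  exists (N : set T) (W : R -> R), [/\ measurable N, mu N = 0%E, {homo W : x y / x <= y},
    forall x, 0 <= W x <= fine (charge_total_variation nu I) &
    forall x y, I x -> I y -> ~ N x -> ~ N y -> x < y -> `|u y - u x| `^ 1 <= (y - x) `^ (1 - 1) * (W y - W x)].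
Proof.
move=> oI II mw up nuP.
have mI : measurable (I : set T) by exact: open_interval_measurable.
have locu : locally_integrable setT (u \_ I).
  by apply: (Lp_locally_integrable (lexx 1) mw); exact: restrict_Lp ltr01 up.
have [N [mN N0 uv]] := weak_measure_jump oI II locu nuP.
pose P := jordan_pos (hahnP nu); pose Q := jordan_neg (hahnP nu).
pose a (E : set T) : R := fine (P E); pose b (E : set T) : R := fine (Q E).
have PE (E : set T) : measurable E -> P E = (a E)%:E by move=> mE; rewrite fineK// fin_num_measure.
have QE (E : set T) : measurable E -> Q E = (b E)%:E by move=> mE; rewrite fineK// fin_num_measure.
have a0 E : 0 <= a E by apply: fine_ge0; exact: measure_ge0.
have b0 E : 0 <= b E by apply: fine_ge0; exact: measure_ge0.
have a_le (E F : set T) : measurable E -> measurable F -> E `<=` F -> a E <= a F.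
  by move=> mE mF EF; rewrite -lee_fin -!PE//; apply: le_measure; rewrite ?inE.
have b_le (E F : set T) : measurable E -> measurable F -> E `<=` F -> b E <= b F.
  by move=> mE mF EF; rewrite -lee_fin -!QE//; apply: le_measure; rewrite ?inE.
have tvE : charge_total_variation nu I = (a I + b I)%:E.
  by rewrite /charge_total_variation /charge_variation EFinD -PE// -QE.
split; first by rewrite tvE.
pose D x : set T := I `&` `]-oo, x]%classic.
have mD x : measurable (D x) by apply: measurableI => //; exact: measurable_itv.
have DI x : D x `<=` I by move=> z [].
exists N, (fun x => a (D x) + b (D x)); split => //.
- have DD x y : x <= y -> D x `<=` D y.
    by move=> xy z [Iz]; rewrite /= !in_itv/= => zx; split => //=; rewrite in_itv/= (le_trans zx).
  by move=> x y xy; apply: lerD; [apply: a_le|apply: b_le] => //; exact: DD.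
- move=> x; rewrite tvE/= addr_ge0//=; apply: lerD; [exact: a_le|exact: b_le].
move=> x y Ix Iy Nx Ny xy; pose E : set T := `]x, y]%classic.
have mE : measurable E by exact: measurable_itv.
have EI : E `<=` I.
  by move=> z; rewrite /E/= in_itv/= => /andP[xz zy]; apply: (II _ _ Ix Iy); rewrite (ltW xz).
have DE : D y = D x `|` E.
  apply/seteqP; split => z.
    move=> [Iz]; rewrite /= in_itv/= => zy; have [zx|xz] := leP z x; [left|right].
      by split => //=; rewrite in_itv.
    by rewrite /E/= in_itv/= xz.
  move=> [[Iz]|Ez]; [rewrite /= in_itv/= => zx|]; split => //=; rewrite ?in_itv/=.
  - exact: le_trans zx (ltW xy).
  - exact: EI.
  - by move: Ez; rewrite /E/= in_itv/= => /andP[].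
have DE0 : D x `&` E = set0.
  apply/seteqP; split => // z [[_]]; rewrite /E/= !in_itv/= => zx /andP[xz _].
  by have := lt_le_trans xz zx; rewrite ltxx.
have aD : a (D y) = a (D x) + a E.
  apply: EFin_inj; rewrite EFinD -!PE// DE; exact: measureU.
have bD : b (D y) = b (D x) + b E.
  apply: EFin_inj; rewrite EFinD -!QE// DE; exact: measureU.
have uE : u y - u x = a E - b E.
  apply: EFin_inj; rewrite (uv _ _ Ix Iy Nx Ny xy) (jordan_decomp (hahnP nu) mE) /cadd/= /cscale/= mulN1e.
  by rewrite EFinB -PE// -QE.
rewrite subrr powRr0 mul1r powRr1// aD bD uE; have := a0 E; have := b0 E.
by move=> h1 h2; rewrite ler_norml; apply/andP; split; lra.
Qed.

(** The existence of a derivative comes first, to exclude the default value [+oo]; the bound is then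
    applied to the derivative that [cid] selects. *)
Lemma derivative_energy_le p I u (N : set T) (W : R -> R) (M : R) : 1 <= p -> open I -> is_interval I -> in_Lp p I u ->
  measurable N -> mu N = 0%E -> {homo W : x y / x <= y} -> (forall x, 0 <= W x <= M) ->
  (forall x y, I x -> I y -> ~ N x -> ~ N y -> x < y -> `|u y - u x| `^ p <= (y - x) `^ (p - 1) * (W y - W x)) ->
  (derivative_energy p I u <= M%:E)%E.
Proof.
move=> p_ge1 oI II uLp mN N0 ndW W_itv uW.
have mI : measurable (I : set T) by exact: open_interval_measurable.
have p0 : 0 < p by exact: lt_le_trans p_ge1.
have [mw up] := (in_LpP I u p0).1 uLp.
have mIu : measurable_fun (I : set T) (u : T -> R) by exact/(measurable_restrictT _ mI).
rewrite /derivative_energy; case: ifPn => [/eqP pE|pN1].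
  have uW1 x y : I x -> I y -> ~ N x -> ~ N y -> x < y -> `|u y - u x| <= W y - W x.
    move=> Ix Iy Nx Ny xy; have := uW x y Ix Iy Nx Ny xy.
    by rewrite pE subrr powRr0 mul1r powRr1.
  rewrite /BV_energy; case: pselect => [uBV|nBV]; last first.
    exfalso; apply: nBV; split; first by rewrite -pE.
    exact: (bv_exists oI mN N0 W_itv uW1 mIu).
  have nuP := svalP (cid uBV.2); move: nuP; set nu := sval _ => nuP.
  have locu : locally_integrable setT (u \_ I).
    by apply: (Lp_locally_integrable p_ge1 mw); exact: restrict_Lp up.
  have [N1 [mN1 N10 uv]] := weak_measure_jump oI II locu nuP.
  have mN2 : measurable (N `|` N1) by exact: measurableU.
  have N20 : mu (N `|` N1) = 0%E by exact: nullU.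
  have nN2 x : ~ (N `|` N1) x -> ~ N x /\ ~ N1 x by move=> k; split => h; apply: k; [left|right].
  have [m [N' [[_ _ _ mM _] PQ]]] := @variation_le R I oI II (N `|` N1) u W M mN2 N20 W_itv
    (fun x y Ix Iy Nx Ny => uW1 x y Ix Iy (nN2 x Nx).1 (nN2 y Ny).1) nu
    (fun x y Ix Iy Nx Ny => uv x y Ix Iy (nN2 x Nx).2 (nN2 y Ny).2)
    (fun x y (_ : I x) (_ : I y) (_ : ~ (N `|` N1) x) (_ : ~ (N `|` N1) y) xy => ndW _ _ (ltW xy)).
  apply: le_trans (PQ I mI (fun _ => id)) _; apply: le_trans mM.
  by apply: le_measure; rewrite ?inE.
have p1 : 1 < p by rewrite lt_neqAle eq_sym pN1.
have [v [mv wv vM]] := weak_exists p1 oI II mN N0 ndW W_itv uW mw up.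
rewrite /W1p_energy; case: pselect => [uW1|nW1]; last first.
  exfalso; apply: nW1; split => //; exists v; split => //; apply/(in_LpP I v p0); split.
    exact/(measurable_restrictT _ mI).
  by apply: le_lt_trans vM _; exact: ltry.
have [] := svalP (cid uW1.2); set v' := sval _ => /(in_LpP I v' p0)[mv' vp'] wv'.
exact: (weak_energy p1 oI II mN N0 ndW W_itv uW mw up mv' vp' wv').
Qed.

Lemma energy_slopes p I u (M : R) : 1 <= p -> open I -> is_interval I -> in_Lp p I u ->
  derivative_energy p I u = M%:E ->
  exists (N : set T) (W : R -> R), [/\ measurable N, mu N = 0%E, {homo W : x y / x <= y}, forall x, 0 <= W x <= M &
    forall x y, I x -> I y -> ~ N x -> ~ N y -> x < y -> `|u y - u x| `^ p <= (y - x) `^ (p - 1) * (W y - W x)].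
Proof.
move=> p_ge1 oI II uLp; have p0 : 0 < p by exact: lt_le_trans p_ge1.
have [mw up] := (in_LpP I u p0).1 uLp.
rewrite /derivative_energy; case: ifPn => [/eqP pE|pN1].
  rewrite /BV_energy; case: pselect => // uBV; have := svalP (cid uBV.2); set nu := sval _ => nuP EM.
  rewrite pE in up *; have [_ [N [W H]]] := bv_slopes oI II mw up nuP.
  by exists N, W; rewrite EM in H.
have p1 : 1 < p by rewrite lt_neqAle eq_sym pN1.
rewrite /W1p_energy; case: pselect => // uW1; have [] := svalP (cid uW1.2).
set v := sval _ => /(in_LpP I v p0)[mv vp] wv EM.
have [N [W H]] := sobolev_slopes p1 oI II mw up mv vp wv.
by exists N, W; rewrite EM in H.
Qed.

End EnergyAndSlopes.

Lemma limf_einf_ge {R : realType} (F : R -> \bar R) (c : \bar R) :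
  (\forall d \near 0^'+, (c <= F d)%E) -> (c <= limf_einf F 0^'+)%E.
Proof.
move=> H; rewrite limf_einfE; apply: le_trans (ereal_sup_ubound _); last by exists [set d | (c <= F d)%E].
by apply: le_ereal_inf_tmp => _ [d h <-].
Qed.

Lemma limf_esup_le {R : realType} (F : R -> \bar R) (c : \bar R) :
  (\forall d \near 0^'+, (F d <= c)%E) -> (limf_esup F 0^'+ <= c)%E.
Proof.
move=> H; apply: le_trans (ereal_inf_lbound _) _; first by exists [set d | (F d <= c)%E].
by apply: ub_ereal_sup => _ [d h <-].
Qed.

(** * Measurability of the interaction function *)

Section PiecewiseContinuous.
Context {R : realType}.
Local Notation T := (measurableTypeR R).

(** Composition with the absolute value turns continuity relative to [[0, +oo[] into continuity on
    the open set [D], including at 0; the complement of [D] is finite. *)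
Lemma piecewise_continuous_measurable (phi : R -> R) : piecewise_continuous phi ->
  measurable_fun setT ((fun t => phi `|t|) : T -> R).
Proof.
move=> [S [finS _ cS _]]; pose D : set R := [set t | ~ S `|t|].
have cl : closed S by apply: compact_closed; [exact: Rhausdorff|exact: finite_compact].
have oD : open D.
  apply: (@open_comp _ _ (fun t : R => `|t|) (~` S)); first by move=> x _; exact: norm_continuous.
  exact: closed_openC.
have mD : measurable (D : set T) by exact: open_measurable.
have cD : {in D, continuous (fun t : R => phi `|t|)}.
  move=> t; rewrite inE => Dt; have := cS `|t| (normr_ge0 t) Dt; apply: (@cvg_comp _ _ _ (fun t : R => `|t|) phi) => A.
  rewrite /within/= => nA; have H : \forall z \near t, (`|z| \in `[0, +oo[ -> A `|z|) by exact: (@norm_continuous _ R t _ nA).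
  by apply: filterS H => z; apply; rewrite in_itv/= normr_ge0.
have finDC : finite_set (~` D).
  apply: (@sub_finite_set _ _ (S `|` (-%R @` S))); last by rewrite finite_setU; split => //; exact: finite_image.
  move=> t /= /contrapT St; have [t0|t0] := leP 0 t; first by left; rewrite -(ger0_norm t0).
  by right; exists `|t| => //; rewrite ltr0_norm ?opprK.
have cDC (E : set R) : E `<=` ~` D -> measurable (E : set T).
  by move=> ED; apply: countable_measurable => //; apply: finite_set_countable; exact: sub_finite_set ED finDC.
rewrite (_ : setT = (D : set T) `|` ~` D); last by rewrite setUv.
apply/measurable_funU => //; first exact: measurableC.
split; first exact: open_continuous_measurable_fun.
by move=> _ Y mY; apply: cDC => t [].
Qed.

End PiecewiseContinuous.

(** * The interaction energy and its elementary estimates *)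

Section Interaction.
Context {R : realType}.
Variables (p : R) (phi : R -> R) (beta : R).
Hypothesis p_ge1 : 1 <= p.
Hypothesis mphi : measurable_fun setT phi.
Hypothesis phi_ge0 : forall t, 0 <= phi t.
Hypothesis phi0 : phi 0 = 0.
Hypothesis beta_gt0 : 0 < beta.
Hypothesis phi_beta : forall t, phi t <= beta.
Local Notation T := (measurableTypeR R).
Implicit Types (u v : T -> R) (A B : set T).

Let p_gt0 : 0 < p. Proof. exact: lt_le_trans ltr01 p_ge1. Qed.

Definition kern u (z : T * T) : \bar R :=
  (phi `|u z.1 - u z.2| / `|z.1 - z.2| `^ (p + 1))%:E.

(** Two separate sets are allowed because splitting a domain produces cross interactions, which have
    to be estimated on their own. *)
Definition J u A B : \bar R := (\int[mu]_(x in A) \int[mu]_(y in B) kern u (x, y))%E.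

Lemma kern_ge0 u z : (0 <= kern u z)%E.
Proof. by rewrite lee_fin divr_ge0// powR_ge0. Qed.

Lemma kern_sym u x y : kern u (x, y) = kern u (y, x).
Proof. by rewrite /kern/= distrC (distrC x). Qed.

Lemma measurable_kern u : measurable_fun setT u -> measurable_fun setT (kern u).
Proof.
move=> mu_; apply/measurable_EFinP; apply: measurable_funM.
  apply: (measurableT_comp mphi); apply: measurableT_comp => //.
  by apply: measurable_funB; apply: measurableT_comp mu_ _.
under eq_fun do rewrite -powRN.
apply: (measurableT_comp (measurable_powR _)); apply: measurableT_comp => //.
by apply: measurable_funB.
Qed.

Lemma J_ge0 u A B : (0 <= J u A B)%E.
Proof. by apply: integral_ge0 => x _; apply: integral_ge0 => y _; exact: kern_ge0. Qed.

Lemma measurable_kern2 u x B : measurable_fun setT u -> measurable_fun B (fun y => kern u (x, y)).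
Proof.
move=> m; apply: measurable_funTS.
by apply: (measurableT_comp (measurable_kern m)); apply: measurable_pair1.
Qed.

Lemma measurable_kern_int u B : measurable_fun setT u -> measurable B ->
  forall A, measurable_fun A (fun x => \int[mu]_(y in B) kern u (x, y))%E.
Proof.
move=> m mB A; apply: measurable_funTS; exact: (@measurable_int_set _ (kern u) (measurable_kern m) (kern_ge0 u)).
Qed.

Lemma J_sym u A B : measurable_fun setT u -> measurable A -> measurable B ->
  J u A B = J u B A.
Proof.
move=> m mA mB.
have := @tonelli_set _ (kern u) (measurable_kern m) (kern_ge0 u) A B mA mB.
rewrite /J => ->.
by apply: eq_integral => x _; apply: eq_integral => y _; rewrite kern_sym.
Qed.

Lemma J_le u A B A' B' : measurable_fun setT u ->
  measurable A -> measurable B -> measurable A' -> measurable B' ->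
  A `<=` A' -> B `<=` B' -> (J u A B <= J u A' B')%E.
Proof.
move=> m mA mB mA' mB' AA BB.
apply: (@le_trans _ _ (J u A B')).
  apply: ge0_le_integral => //.
  - by move=> x _; apply: integral_ge0 => y _; exact: kern_ge0.
  - exact: measurable_kern_int.
  - exact: measurable_kern_int.
  - move=> x _; apply: ge0_subset_integral => //; first exact: measurable_kern2.
    by move=> y _; exact: kern_ge0.
apply: ge0_subset_integral => //; first exact: measurable_kern_int.
by move=> x _; apply: integral_ge0 => y _; exact: kern_ge0.
Qed.

Lemma J_setUl u A A' B : measurable_fun setT u ->
  measurable A -> measurable A' -> measurable B -> [disjoint A & A'] ->
  J u (A `|` A') B = (J u A B + J u A' B)%E.
Proof.
move=> m mA mA' mB d; rewrite /J ge0_integral_setU//.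
- exact: measurable_kern_int.
- by move=> x _; apply: integral_ge0 => y _; exact: kern_ge0.
Qed.

Lemma J_setUr u A A' B : measurable_fun setT u ->
  measurable A -> measurable A' -> measurable B -> [disjoint A & A'] ->
  J u B (A `|` A') = (J u B A + J u B A')%E.
Proof.
move=> m mA mA' mB d.
rewrite (J_sym m mB (measurableU _ _ mA mA')) (J_setUl m mA mA' mB d) (J_sym m mA mB) (J_sym m mA' mB).
reflexivity.
Qed.

Lemma J_ext u v A B : (forall x y, A x -> B y -> `|u x - u y| = `|v x - v y|) ->
  J u A B = J v A B.
Proof.
move=> e; apply: eq_integral => x /set_mem Ax; apply: eq_integral => y /set_mem By.
by rewrite /kern/= e.
Qed.

Lemma J_eq0 u A B : (forall x y, A x -> B y -> u x = u y) -> J u A B = 0%E.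
Proof.
move=> e; apply: integral0_eq => x Ax; apply: integral0_eq => y By.
by rewrite /kern/= (e x y)// subrr normr0 phi0 mul0r.
Qed.

Lemma powRN_cvgy : (fun t : R => t `^ (- p)) t @[t --> +oo] --> 0.
Proof.
apply: (@squeeze_cvgr _ _ _ _ (cst 0) (fun t : R => t^-1)).
- near=> t; rewrite powR_ge0/= -powR_inv1; last by near: t; exact: nbhs_pinfty_ge.
  by rewrite ler_powR ?lerN2//; near: t; exact: nbhs_pinfty_ge.
- exact: cvg_cst.
- apply/(@gtr0_cvgV0 _ _ _ _ (fun t : R => t)).
    by near=> t; near: t; exact: nbhs_pinfty_gt.
  exact: cvg_id.
Unshelve. all: by end_near. Qed.

Lemma tail_integral (eta : R) : 0 < eta ->
  (\int[mu]_(t in `[eta, +oo[) (t `^ (- (p + 1)))%:E = (eta `^ (- p) / p)%:E)%E.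
Proof.
move=> eta0.
have dF (x : R) : 0 < x -> is_derive x 1 (fun t => - (t `^ (- p) / p)) (x `^ (- (p + 1))).
  move=> x0.
  have D : is_derive x 1 (fun t : R => t `^ (- p)) (- p * x `^ (- p - 1)).
    apply: DeriveDef; first by apply: derivable_powR; rewrite in_itv/= x0.
    by rewrite -derive1E powR_derive1// in_itv/= x0.
  have -> : x `^ (- (p + 1)) = - (p^-1 *: (- p * x `^ (- p - 1))).
    by rewrite opprD /GRing.scale/= mulNr mulrN opprK mulrA mulVf ?mul1r//; exact: lt0r_neq0.
  have -> : (fun t : R => - (t `^ (- p) / p)) = - (p^-1 \*: (fun t : R => t `^ (- p))).
    by apply/funext => t; congr (- _); rewrite mulrC.
  exact: is_deriveN.
rewrite (@ge0_continuous_FTC2y R _ (fun t => - (t `^ (- p) / p)) eta 0).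
- by rewrite sub0e -EFinN opprK.
- by move=> x _; exact: powR_ge0.
- apply: derivable_within_continuous => x; rewrite in_itv/= andbT => x1.
  by apply: derivable_powR; rewrite in_itv/= andbT (lt_le_trans eta0).
- rewrite -oppr0; apply: cvgN; rewrite -(mul0r p^-1); apply: cvgMl.
  exact: powRN_cvgy.
- by move=> x x1; have [] := dF x (lt_trans eta0 x1).
- apply: cvg_at_right_filter.
  have [/derivable1_diffP/differentiable_continuous + _] := dF eta eta0.
  exact.
- by move=> x; rewrite in_itv/= andbT => x1; rewrite derive1E; have [] := dF x (lt_trans eta0 x1).
Qed.

Lemma tail_right (x z : R) : x < z ->
  (\int[mu]_(y in `[z, +oo[) (`|x - y| `^ (- (p + 1)))%:E = ((z - x) `^ (- p) / p)%:E)%E.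
Proof.
move=> xz; rewrite -(@tail_integral (z - x)); last by rewrite subr_gt0.
transitivity (1^-1%:E * \int[mu]_(t in `[(z - x)%R, +oo[) (t `^ (- (p + 1)))%:E)%E; last first.
  by rewrite invr1 mul1e.
rewrite -(@ge0_integral_affine _ 1 (- x)); first last.
- by move=> t _; rewrite lee_fin powR_ge0.
- by apply: measurable_funTS; apply/measurable_EFinP; exact: measurable_powR.
- exact: measurable_itv.
- exact: ltr01.
- have -> : affine 1 (- x) @^-1` `[(z - x), +oo[%classic = `[z, +oo[%classic.
    by apply/seteqP; split=> y /=; rewrite /affine !in_itv/= !andbT mul1r lerD2r.
  apply: eq_integral => y /set_mem/=; rewrite in_itv/= andbT => zy.
  by rewrite mul1r distrC ger0_norm// subr_ge0 (le_trans (ltW xz)).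
Qed.

Lemma tail_left (x z : R) : z < x ->
  (\int[mu]_(y in `]-oo, z]) (`|x - y| `^ (- (p + 1)))%:E = ((x - z) `^ (- p) / p)%:E)%E.
Proof.
move=> zx.
have -> : x - z = - z - - x by rewrite opprK addrC.
rewrite -(@tail_right (- x) (- z)); last by rewrite ltrN2.
rewrite -[RHS]ge0_integral_opp; first last.
- by move=> t _; rewrite lee_fin powR_ge0.
- apply: measurable_funTS; apply/measurable_EFinP; apply: (measurableT_comp (measurable_powR _)).
  by apply: measurableT_comp => //; apply: measurable_funB.
- exact: measurable_itv.
have -> : -%R @^-1` `[(- z), +oo[%classic = `]-oo, z]%classic.
  by apply/seteqP; split=> y /=; rewrite !in_itv/= ?andbT lerN2.
by apply: eq_integral => y _; rewrite -opprD normrN.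
Qed.

(** Points closer than [eta] contribute nothing as [phi 0 = 0]. Beyond, [phi <= beta], and the
    kernel integrates to [eta ^ (- p) / p] on each of the two sides. *)
Lemma kern_far u (x : T) B (eta : R) : measurable_fun setT u -> measurable B ->
  0 < eta -> (forall y, B y -> `|x - y| < eta -> u x = u y) ->
  (\int[mu]_(y in B) kern u (x, y) <= (2 * beta / p * eta `^ (- p))%:E)%E.
Proof.
move=> m mB eta0 near0.
pose F : set T := `]-oo, (x - eta)%R]%classic `|` `[(x + eta)%R, +oo[%classic.
pose g (y : T) := (beta%:E * (`|x - y| `^ (- (p + 1)))%:E)%E.
have mF : measurable F by apply: measurableU; exact: measurable_itv.
have mh (D : set T) : measurable_fun D (fun y : T => (`|x - y| `^ (- (p + 1)))%:E).
  apply: measurable_funTS; apply/measurable_EFinP; apply: (measurableT_comp (measurable_powR _)).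
  by apply: measurableT_comp => //; apply: measurable_funB.
have h0 y : (0 <= (`|x - y| `^ (- (p + 1)))%:E)%E by rewrite lee_fin powR_ge0.
have g0 y : (0 <= g y)%E by rewrite mule_ge0 ?h0 ?lee_fin ?(ltW beta_gt0).
have mg : measurable_fun setT (g \_ F).
  by apply/(measurable_restrictT _ _).1 => //; apply: measurable_funeM.
have gF0 y : (0 <= (g \_ F) y)%E by rewrite patchE; case: ifP.
apply: (@le_trans _ _ (\int[mu]_(y in B) (g \_ F) y)%E).
  apply: ge0_le_integral => //.
  - by move=> y _; exact: kern_ge0.
  - exact: measurable_kern2.
  - exact: measurable_funTS.
  - move=> y By; rewrite patchE; case: ifPn => [_|].
      by rewrite /g /kern/= powRN -EFinM lee_fin ler_wpM2r ?invr_ge0 ?powR_ge0.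
    rewrite notin_setE => nF; rewrite /kern/= (near0 y By) ?subrr ?normr0 ?phi0 ?mul0r//.
    rewrite ltNge; apply/negP => h; apply: nF; move: h; rewrite /F/= !in_itv/= andbT.
    by rewrite ler_normr => /orP[|] ?; [left|right]; lra.
apply: (@le_trans _ _ (\int[mu]_(y in F) g y)%E).
  rewrite [leRHS]integral_mkcond; apply: ge0_subset_integral => //.
have -> : (2 * beta / p * eta `^ (- p))%:E =
    (beta%:E * (eta `^ (- p) / p)%:E + beta%:E * (eta `^ (- p) / p)%:E)%E.
  by rewrite -EFinM -EFinD; congr EFin; field; exact: lt0r_neq0.
rewrite ge0_integral_setU//; first last.
- rewrite disj_set2E; apply/eqP; rewrite -subset0 => y [/=]; rewrite !in_itv/= andbT; lra.
- exact: measurable_funeM.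
rewrite !ge0_integralZl//; try by rewrite lee_fin ltW.
rewrite tail_left ?tail_right; [|lra|lra].
by rewrite [x + eta - x]addrAC subrr add0r opprB [x + _]addrC subrK.
Qed.

Lemma J_far u A B (eta : R) : measurable_fun setT u -> measurable A -> measurable B ->
  0 < eta -> (forall x y, A x -> B y -> `|x - y| < eta -> u x = u y) ->
  (J u A B <= (2 * beta / p * eta `^ (- p))%:E * mu A)%E.
Proof.
move=> m mA mB eta0 near0.
rewrite -integral_cst//; apply: ge0_le_integral => //.
- by move=> x _; apply: integral_ge0 => y _; exact: kern_ge0.
- exact: measurable_kern_int.
- by move=> x Ax; apply: kern_far => // y By; exact: near0.
Qed.

Lemma powR_addr_le (a b : R) : 0 <= a -> 0 <= b ->
  (a + b) `^ p <= 2 `^ p * (a `^ p + b `^ p).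
Proof.
move=> a0 b0; have p0 := ltW p_gt0.
have m0 : 0 <= Num.max a b by rewrite le_max a0.
apply: (@le_trans _ _ ((2 * Num.max a b) `^ p)).
  rewrite ge0_ler_powR// ?nnegrE ?addr_ge0// ?mulr_ge0//.
  by rewrite mulr_natl mulr2n lerD// le_max lexx ?orbT.
rewrite powRM//; apply: ler_wpM2l; first exact: powR_ge0.
by rewrite /Num.max; case: ifPn => _; rewrite ?lerDl ?lerDr powR_ge0.
Qed.

Lemma measurable_affine_preimage (a b : R) A : measurable A -> measurable (affine a b @^-1` A).
Proof.
move=> mA; have := measurable_affine a b; move=> /(_ measurableT A mA).
by rewrite setTI.
Qed.

(** The kernel contributes [a ^ (p + 1)] and each of the two changes of variable [a^-1]. *)
Lemma J_affine u (a b : R) A B : 0 < a -> measurable_fun setT u -> measurable A -> measurable B ->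
  J (fun x => u (a * x + b)) (affine a b @^-1` A) (affine a b @^-1` B) =
  ((a `^ (p - 1))%:E * J u A B)%E.
Proof.
move=> a0 m mA mB.
pose ua : T -> R := fun x => u (a * x + b).
rewrite -/ua.
have a1 : 0 <= a^-1 by rewrite invr_ge0 ltW.
have E (x y : T) : kern ua (x, y) =
    ((a `^ (p + 1))%:E * kern u (affine a b x, affine a b y))%E.
  rewrite /kern/= -EFinM; congr EFin; rewrite /ua /affine.
  rewrite (_ : a * x + b - (a * y + b) = a * (x - y)); last by ring.
  rewrite normrM (gtr0_norm a0) powRM ?(ltW a0)// invfM.
  rewrite [RHS]mulrCA; congr (_ * _); rewrite mulrA divff ?mul1r//.
  by rewrite gt_eqF ?powR_gt0.
have I x : (\int[mu]_(y in affine a b @^-1` B) kern ua (x, y) =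
    (a `^ p)%:E * \int[mu]_(y in B) kern u (affine a b x, y))%E.
  under eq_integral do rewrite E.
  have mk : measurable_fun (affine a b @^-1` B) (fun y => kern u (affine a b x, affine a b y)).
    apply: measurable_funTS.
    apply: (measurableT_comp (measurable_kern2 (affine a b x) (B := setT) m)).
    exact: measurable_affine.
  rewrite (ge0_integralZl mu (measurable_affine_preimage a b mB) mk); last 2 first.
  - by move=> y _; exact: kern_ge0.
  - by rewrite lee_fin powR_ge0.
  rewrite (@ge0_integral_affine _ a b B (fun y => kern u (affine a b x, y)) a0 mB); last 2 first.
  - exact: measurable_kern2.
  - by move=> y _; exact: kern_ge0.
  rewrite muleA -EFinM; congr (_%:E * _)%E.
  rewrite powRD ?powRr1 ?(ltW a0)//; last by rewrite (gt_eqF a0) implybT.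
  by rewrite mulfK// gt_eqF.
rewrite /J; under eq_integral do rewrite I.
have mI := measurable_kern_int m mB.
have I0 x : (0 <= \int[mu]_(y in B) kern u (x, y))%E.
  by apply: integral_ge0 => y _; exact: kern_ge0.
have mk : measurable_fun (affine a b @^-1` A)
    (fun x => \int[mu]_(y in B) kern u (affine a b x, y))%E.
  apply: measurable_funTS.
  apply: (measurableT_comp (mI setT)); exact: measurable_affine.
rewrite (ge0_integralZl mu (measurable_affine_preimage a b mA) mk); last 2 first.
- by move=> x _; exact: I0.
- by rewrite lee_fin powR_ge0.
rewrite (@ge0_integral_affine _ a b A (fun x => (\int[mu]_(y in B) kern u (x, y))%E) a0 mA (mI A)); last by move=> x _; exact: I0.
rewrite muleA -EFinM; congr (_%:E * _)%E.
rewrite powRB; last by rewrite (gt_eqF a0) implybT.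
by rewrite powRr1 ?ltW.
Qed.

(** * Cells and the constant kappa *)

Definition cell (W : T -> R) (H theta : R) : Prop :=
  [/\ [/\ measurable_fun setT W, 0 < H & 0 < theta],
      forall x, W (x + 1) = W x + H,
      forall x, `|x| <= theta -> W x = 0
    & (\int[mu]_(x in `[0%R, 1%R[) (`|W x| `^ p)%:E < +oo)%E].

(** The second set is the whole line: a cell is charged with its interaction with all of its
    translates, which makes the cost of consecutive cells additive. The value is extended real, as
    finiteness is only known after [kappaE_le1]. *)
Definition kappaE : \bar R := ereal_inf
  [set r | exists W H theta, cell W H theta /\
    r = ((H `^ p)^-1%:E * J W `[0%R, 1%R[%classic setT)%E].

Definition periodize (w : T -> R) (H : R) : T -> R :=
  fun x => w (x - (Num.floor (x : R))%:~R) + H * (Num.floor (x : R))%:~R.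

Lemma periodize_eq w H x (k : int) : k%:~R <= x < (k + 1)%:~R ->
  periodize w H x = w (x - k%:~R) + H * k%:~R.
Proof. by move=> /floor_def E; rewrite /periodize E. Qed.

Lemma measurable_periodize w H : measurable_fun setT w -> measurable_fun setT (periodize w H).
Proof.
move=> mw.
have mf : measurable_fun setT (fun x : R => (Num.floor x)%:~R : R).
  apply: nondecreasing_measurable => // x y xy.
  by rewrite ler_int le_floor.
apply: measurable_funD; last exact: measurable_funM.
by apply: (measurableT_comp mw); apply: measurable_funB.
Qed.

Lemma kappaE_ge0 : (0 <= kappaE)%E.
Proof.
apply: le_ereal_inf_tmp => _ [W [H [theta [_ ->]]]].
by rewrite mule_ge0 ?J_ge0// lee_fin invr_ge0 powR_ge0.
Qed.

(** The function [w] has plateaus of width [theta] at both ends of [[0, 1[], so its periodization is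
    a cell that is constant across the integers. Its interaction with the outside of [[0, 1[] then
    takes place at distance at least [theta], which accounts for the error term. *)
Lemma kappaE_le (w : T -> R) (H theta : R) : measurable_fun setT w -> 0 < H -> 0 < theta -> theta < 2^-1 ->
  (forall x : R, 0 <= x <= theta -> w x = 0) ->
  (forall x : R, 1 - theta <= x < 1 -> w x = H) ->
  (\int[mu]_(x in `[0%R, 1%R[) (`|w x| `^ p)%:E < +oo)%E ->
  (kappaE * (H `^ p)%:E <= J w `[0%R, 1%R[%classic `[0%R, 1%R[%classic +
     (2 * beta / p * theta `^ (- p))%:E)%E.
Proof.
move=> mw H0 t0 t1 w0 w1 wp.
pose W := periodize w H.
have mW : measurable_fun setT W by exact: measurable_periodize.
pose A : set T := `[0%R, 1%R[%classic.
have mA : measurable A by exact: measurable_itv.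
have WA (x : R) : 0 <= x < 1 -> W x = w x.
  by move=> x01; rewrite /W (@periodize_eq w H x 0) ?add0r// subr0 mulr0 addr0.
have WN (x : R) : -1 <= x < 0 -> W x = w (x + 1) - H.
  by move=> x01; rewrite /W (@periodize_eq w H x (-1)) ?addNr// opprK mulrN mulr1.
have W2 (x : R) : 1 <= x < 2 -> W x = w (x - 1) + H.
  by move=> x01; rewrite /W (@periodize_eq w H x 1) ?mulr1.
have cW : cell W H theta.
  split; [split; [exact: measurable_periodize|by []|by []]| | |].
  - move=> x; rewrite /W /periodize.
    have -> : Num.floor (x + 1 : R) = Num.floor (x : R) + 1 by rewrite floorDrz ?int_num1// floor1.
    rewrite intrD opprD addrACA subrr addr0 mulrDr mulr1 addrA//.
  - move=> x; rewrite ler_norml => /andP[x1 x2].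
    have [x3|x3] := leP 0 x.
      by rewrite WA; [rewrite w0// x3|lra].
    by rewrite WN; [rewrite w1 ?subrr//; lra|lra].
  - rewrite (eq_integral (fun x => (`|w x| `^ p)%:E))// => x /set_mem/=; rewrite in_itv/= => x01.
    by rewrite WA.
have H1 : (kappaE <= (H `^ p)^-1%:E * J W A setT)%E.
  by apply: ereal_inf_lbound; exists W, H, theta.
have Hp : 0 < H `^ p by exact: powR_gt0.
apply: (@le_trans _ _ (J W A setT)).
  rewrite -[leRHS]mule1 -(divff (lt0r_neq0 Hp)) EFinM muleCA muleC.
  by rewrite [(J W A setT * _)%E]muleC; apply: lee_wpmul2l => //; rewrite lee_fin ltW.
rewrite -(setUv A) J_setUr//; [|exact: measurableC|by rewrite disj_set2E setICr].
apply: leeD.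
  rewrite (@J_ext W w A A)// => x y; rewrite /A/= !in_itv/= => Ax Ay.
  by rewrite !WA.
apply: le_trans (J_far mW mA (measurableC mA) t0 _) _.
  move=> x y; rewrite /A/= !in_itv/= => /andP[x0 x1] /negP.
  rewrite negb_and -ltNge -leNgt => /orP[y0|y1]; rewrite ltr_norml => /andP[xy1 xy2].
    by rewrite WA ?WN; [rewrite w0 ?w1 ?subrr//; lra|lra|lra].
  by rewrite (WA x) ?(W2 y) ?(w1 x) ?(w0 (y - 1)) ?add0r//; lra.
by rewrite lebesgue_measure_itv/= lte_fin ltr01 oppr0 adde0 mule1.
Qed.

(** * The cost of cutting a function at two points *)

Definition edge u (z : R) A : \bar R :=
  (\int[mu]_(y in A) (phi `|u z - u y| * `|y - z| `^ (- p))%:E)%E.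

Definition clamp_ends u (z1 z2 : R) : T -> R :=
  fun t => if t <= z1 then u z1 else if z2 <= t then u z2 else u t.

Lemma measurable_clamp_ends u (z1 z2 : R) :
  measurable_fun setT u -> measurable_fun setT (clamp_ends u z1 z2).
Proof.
move=> m; apply: measurable_fun_ifT => //.
  by apply: (@measurable_fun_ler _ _ _ setT (fun t : R => t) (cst z1)).
by apply: measurable_fun_ifT => //; apply: (@measurable_fun_ler _ _ _ setT (cst z2) (fun t : R => t)).
Qed.

Lemma measurable_edge u (z : R) A : measurable_fun setT u ->
  measurable_fun A (fun y : R => (phi `|u z - u y| * `|y - z| `^ (- p))%:E).
Proof.
move=> m; apply: measurable_funTS; apply/measurable_EFinP; apply: measurable_funM.
  by apply: (measurableT_comp mphi); apply: measurableT_comp => //; exact: measurable_funB.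
by apply: (measurableT_comp (measurable_powR _)); apply: measurableT_comp => //; apply: measurable_funB.
Qed.

(** The origin of [edge]: the kernel [|x - y| ^ (- (p + 1))], integrated in [x] over a half-line
    ending at [z] on which [u] keeps the value [u z], leaves [|y - z| ^ (- p) / p]. *)
Lemma J_edge u (z : R) A B : measurable_fun setT u -> measurable A -> measurable B ->
  (forall x, A x -> u x = u z) ->
  A `<=` `]-oo, z] /\ B `<=` `]z, +oo[ \/ A `<=` `[z, +oo[ /\ B `<=` `]-oo, z[ ->
  (J u A B <= (p^-1)%:E * edge u z B)%E.
Proof.
move=> m mA mB uA AB.
rewrite J_sym// /J -ge0_integralZl//; last 3 first.
- exact: measurable_edge.
- by move=> y _; rewrite lee_fin mulr_ge0// powR_ge0.
- by rewrite lee_fin invr_ge0 ltW.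
apply: ge0_le_integral => //.
- by move=> y _; apply: integral_ge0 => x _; exact: kern_ge0.
- exact: measurable_kern_int.
- by apply: measurable_funeM; exact: measurable_edge.
move=> y By.
have mh (D : set T) : measurable_fun D (fun x : T => (`|y - x| `^ (- (p + 1)))%:E).
  apply: measurable_funTS; apply/measurable_EFinP; apply: (measurableT_comp (measurable_powR _)).
  by apply: measurableT_comp => //; apply: measurable_funB.
have E x : A x -> kern u (y, x) = ((phi `|u z - u y|)%:E * (`|y - x| `^ (- (p + 1)))%:E)%E.
  by move=> Ax; rewrite (powRN _ (p + 1)) -EFinM /kern/= (uA _ Ax) distrC.
rewrite (eq_integral _ _ (fun x Ax => E x (set_mem Ax))).
rewrite ge0_integralZl//; last by rewrite lee_fin.
rewrite EFinM muleCA; apply: lee_wpmul2l; first by rewrite lee_fin.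
rewrite -EFinM mulrC.
have sub D : measurable D -> A `<=` D -> (\int[mu]_(x in A) (`|y - x| `^ (- (p + 1)))%:E <=
    \int[mu]_(x in D) (`|y - x| `^ (- (p + 1)))%:E)%E.
  by move=> mD AD; apply: ge0_subset_integral => // x _; rewrite lee_fin powR_ge0.
case: AB => -[Az Bz]; have /= := Bz _ By; rewrite in_itv/= ?andbT => zy.
  apply: le_trans (sub _ _ Az) _; first exact: measurable_itv.
  by rewrite tail_left// gtr0_norm// subr_gt0.
apply: le_trans (sub _ _ Az) _; first exact: measurable_itv.
by rewrite tail_right// distrC gtr0_norm// subr_gt0.
Qed.

Local Opaque J.

(** The square splits into nine interactions of the margins [L], [N] and the middle [M]. A margin
    does not interact with itself; [L] and [N] interact with [M] through edge terms, and with each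
    other at distance at least [z2 - z1]. By symmetry each cross term occurs twice. *)
Lemma J_clamp_ends u (z1 z2 eta : R) : measurable_fun setT u -> z1 < z2 -> 0 < eta ->
  (J (clamp_ends u z1 z2) `[(z1 - eta)%R, (z2 + eta)%R[%classic `[(z1 - eta)%R, (z2 + eta)%R[%classic <=
   J u `]z1, z2[%classic `]z1, z2[%classic +
   (2 / p)%:E * (edge u z1 `]z1, z2[%classic + edge u z2 `]z1, z2[%classic) +
   (4 * beta / p * eta * (z2 - z1) `^ (- p))%:E)%E.
Proof.
move=> m z12 eta0; set v := clamp_ends u z1 z2; set C := (X in J v X X).
have mv : measurable_fun setT v by exact: measurable_clamp_ends.
set M := `]z1, z2[%classic : set T.
pose L : set T := `[(z1 - eta)%R, z1]%classic.
pose N : set T := `[z2, (z2 + eta)%R[%classic.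
have mM : measurable M by exact: measurable_itv.
have mL : measurable L by exact: measurable_itv.
have mN : measurable N by exact: measurable_itv.
have vL x : L x -> v x = u z1.
  by rewrite /L/= in_itv/= => /andP[_ x1]; rewrite /v /clamp_ends x1.
have vN x : N x -> v x = u z2.
  rewrite /N/= in_itv/= => /andP[x1 _]; rewrite /v /clamp_ends x1.
  by rewrite leNgt (lt_le_trans z12 x1).
have vM x : M x -> v x = u x.
  by rewrite /M/= in_itv/= => /andP[x1 x2]; rewrite /v /clamp_ends !leNgt x1 x2.
have v1 : v z1 = u z1 by rewrite /v /clamp_ends lexx.
have v2 : v z2 = u z2 by rewrite /v /clamp_ends lexx leNgt z12.
have CE : C = L `|` (M `|` N).
  apply/seteqP; split => x; rewrite /C /L /M /N/= !in_itv/=.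
    move=> /andP[x1 x2]; have [?|?] := leP x z1; first by left; rewrite x1.
    by right; have [?|?] := leP z2 x; [right; rewrite x2|left].
  by move=> [|[]] /andP[? ?]; apply/andP; lra.
have dMN : [disjoint M & N].
  rewrite disj_set2E; apply/eqP; rewrite -subset0 => x; rewrite /M /N/= !in_itv/=; lra.
have dL : [disjoint L & M `|` N].
  rewrite disj_set2E; apply/eqP; rewrite -subset0 => x; rewrite /L /M /N/= !in_itv/=; lra.
have mMN : measurable (M `|` N) by exact: measurableU.
have mC : measurable C by exact: measurable_itv.
have eM z : v z = u z -> edge v z M = edge u z M.
  by move=> vz; apply: eq_integral => y /set_mem My; rewrite vz vM.
have LL : J v L L = 0%E by apply: J_eq0 => x y Lx Ly; rewrite !vL.
have NN : J v N N = 0%E by apply: J_eq0 => x y Lx Ly; rewrite !vN.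
have MM : J v M M = J u M M by apply: J_ext => x y Mx My; rewrite !vM.
have LM : (J v L M <= (p^-1)%:E * edge u z1 M)%E.
  rewrite -(eM _ v1); apply: (J_edge mv mL mM); first by move=> x /vL ->; rewrite v1.
  by left; split => x; rewrite /L /M/= !in_itv/= ?andbT; lra.
have NM : (J v N M <= (p^-1)%:E * edge u z2 M)%E.
  rewrite -(eM _ v2); apply: (J_edge mv mN mM); first by move=> x /vN ->; rewrite v2.
  by right; split => x; rewrite /N /M/= !in_itv/= ?andbT; lra.
have LN : (J v L N <= (2 * beta / p * eta * (z2 - z1) `^ (- p))%:E)%E.
  have z0 : 0 < z2 - z1 by rewrite subr_gt0.
  apply: le_trans (J_far mv mL mN z0 _) _.
    move=> x y; rewrite /L /N/= !in_itv/= => /andP[_ x1] /andP[y1 _].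
    by rewrite ltr_norml => /andP[? ?]; lra.
  rewrite lebesgue_measure_itv/= lte_fin ifT; last by lra.
  by rewrite -EFinD -EFinM lee_fin opprB addrCA subrr addr0 mulrAC.
have e0 z : (0 <= edge u z M)%E by apply: integral_ge0 => y _; rewrite lee_fin mulr_ge0// powR_ge0.
clearbody C L M N.
have -> : J v C C = ((J u M M + ((J v L M + J v L M) + (J v N M + J v N M))) + (J v L N + J v L N))%E.
  have mC' : measurable (L `|` (M `|` N)) by rewrite -CE.
  rewrite CE (J_setUl mv mL mMN mC' dL) (J_setUl mv mM mN mC' dMN).
  rewrite (J_setUr mv mL mMN mL dL) (J_setUr mv mM mN mL dMN).
  rewrite (J_setUr mv mL mMN mM dL) (J_setUr mv mM mN mM dMN).
  rewrite (J_setUr mv mL mMN mN dL) (J_setUr mv mM mN mN dMN) LL NN MM.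
  rewrite (J_sym mv mM mL) (J_sym mv mM mN) (J_sym mv mN mL) add0e adde0.
  have := J_ge0 v L M; have := J_ge0 v L N; have := J_ge0 v N M; have := J_ge0 u M M.
  move: (J v L M) (J v L N) (J v N M) (J u M M) => a b c d d0 c0 b0 a0.
  by case: a a0 => [a| |] a0; case: b b0 => [b| |] b0; case: c c0 => [c| |] c0;
    case: d d0 => [d| |] d0 //; rewrite -!EFinD; congr EFin; ring.
have ea := e0 z1; have eb := e0 z2.
move: (J v L M) (J v N M) (J v L N) (J u M M) (edge u z1 M) (edge u z2 M) LM NM LN ea eb.
move=> a b c d e1 e2 LM NM LN ea eb.
apply: leeD; last first.
  apply: le_trans (leeD LN LN) _; rewrite -EFinD lee_fin.
  by rewrite le_eqVlt; apply/orP; left; apply/eqP; ring.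
apply: leeD => //.
rewrite ge0_muleDr// (_ : (2 / p)%:E = (p^-1)%:E + (p^-1)%:E)%E; last first.
  by rewrite -EFinD; congr EFin; ring.
have p1 : (0 <= (p^-1)%:E)%E by rewrite lee_fin invr_ge0 ltW.
rewrite !(ge0_muleDl _ p1 p1).
apply: leeD; apply: leeD; [exact: LM|exact: LM|exact: NM|exact: NM].
Qed.

Local Transparent J.

Lemma JE u A B : J u A B = (\int[mu]_(x in A) \int[mu]_(y in B) kern u (x, y))%E.
Proof. by []. Qed.

Lemma edgeE u (z : R) A :
  edge u z A = (\int[mu]_(y in A) (phi `|u z - u y| * `|y - z| `^ (- p))%:E)%E.
Proof. by []. Qed.

Lemma edge_ge0 u (z : R) A : (0 <= edge u z A)%E.
Proof. by apply: integral_ge0 => y _; rewrite lee_fin mulr_ge0// powR_ge0. Qed.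

Local Opaque J edge.

Let bp_ge0 : 0 <= 2 * beta / p.
Proof. by rewrite divr_ge0 ?(ltW p_gt0)// mulr_ge0// (ltW beta_gt0). Qed.

Lemma ler_powRp (a b : R) : 0 <= a -> a <= b -> a `^ p <= b `^ p.
Proof.
move=> a0 ab; apply: ge0_ler_powR => //; first exact: ltW.
by rewrite nnegrE (le_trans a0).
Qed.

(** Clamping adds plateaus of width [eta] on both sides, so that after rescaling from the length
    [l = z2 - z1 + 2 * eta] to the unit interval [kappaE_le] applies with [theta = eta / l]. The
    last error term does not involve [u]: for [u = v / d] it is removed by the factor [d ^ p]. *)
Lemma cell_bound u (z1 z2 eta : R) : measurable_fun setT u -> z1 < z2 -> 0 < eta ->
  u z1 != u z2 -> (\int[mu]_(x in `]z1, z2[) (`|u x| `^ p)%:E < +oo)%E ->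
  (kappaE * (`|u z2 - u z1| `^ p / (z2 - z1 + 2 * eta) `^ (p - 1))%:E <=
   J u `]z1, z2[%classic `]z1, z2[%classic +
   (2 / p)%:E * (edge u z1 `]z1, z2[%classic + edge u z2 `]z1, z2[%classic) +
   (4 * beta / p * eta * (z2 - z1) `^ (- p) +
    2 * beta / p * (eta / (z2 - z1 + 2 * eta)) `^ (- p) / (z2 - z1 + 2 * eta) `^ (p - 1))%:E)%E.
Proof.
move=> m z12 eta0 u12 fin.
set l := z2 - z1 + 2 * eta; set H := `|u z2 - u z1|.
have l0 : 0 < l by rewrite /l; lra.
have lp0 : 0 < l `^ (p - 1) by rewrite powR_gt0.
have H0 : 0 < H by rewrite normr_gt0 subr_eq0 eq_sym.
pose v := clamp_ends u z1 z2.
have mv : measurable_fun setT v by exact: measurable_clamp_ends.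
(* The sign makes the total rise positive, as a cell requires. *)
pose s := Num.sg (u z2 - u z1).
have s1 : `|s| = 1 by rewrite normr_sg subr_eq0 eq_sym u12.
pose w : T -> R := fun x => s * (v (l * x + (z1 - eta)) - u z1).
have mw : measurable_fun setT w.
  apply: measurable_funM => //; apply: measurable_funB => //.
  by apply: (measurableT_comp mv); exact: (measurable_affine l (z1 - eta)).
pose C : set T := `[(z1 - eta)%R, (z2 + eta)%R[%classic.
have mC : measurable C by exact: measurable_itv.
have AC : affine l (z1 - eta) @^-1` C = `[0, 1[%classic.
  apply/seteqP; split => x /=; rewrite /C/= /affine !in_itv/=.
    move=> /andP[x1 x2]; apply/andP; split.
      by rewrite -(pmulr_rge0 _ l0); lra.
    by rewrite -(ltr_pM2l l0) mulr1 /l; rewrite /l in x1 x2 *; lra.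
  move=> /andP[x1 x2]; apply/andP; split.
    by have : 0 <= l * x by [exact: mulr_ge0 (ltW l0) x1]; lra.
  by move: x2; rewrite -(ltr_pM2l l0) mulr1 => x2; rewrite {2}/l in x2; lra.
have Jw : J w `[0, 1[%classic `[0, 1[%classic = ((l `^ (p - 1))%:E * J v C C)%E.
  rewrite -(J_affine (z1 - eta) l0 mv mC mC) AC; apply: J_ext => x y _ _.
  by rewrite /w -mulrBr normrM s1 mul1r; congr `|_|; ring.
have t0 : 0 < eta / l by rewrite divr_gt0.
have E : l * (eta / l) = eta by rewrite mulrC divfK// gt_eqF.
have := @kappaE_le w H (eta / l) mw H0 t0.
have -> : eta / l < 2^-1 by rewrite ltr_pdivrMr// /l; lra.
move=> /(_ isT) K.
have {}K : (kappaE * (H `^ p)%:E <= J w `[0%R, 1%R[%classic `[0%R, 1%R[%classic +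
    (2 * beta / p * (eta / l) `^ (- p))%:E)%E.
  apply: K.
  - move=> x /andP[x0 x1]; rewrite /w /v /clamp_ends ifT ?subrr ?mulr0//.
    by move: x1; rewrite -(ler_pM2l l0) E; lra.
  - move=> x /andP[x0 x1]; rewrite /w /v /clamp_ends.
    have h : z2 <= l * x + (z1 - eta).
      by move: x0; rewrite -(ler_pM2l l0) mulrBr mulr1 E {1}/l; lra.
    rewrite ifF ?h; last by apply/negbTE; rewrite -ltNge (lt_le_trans z12 h).
    by rewrite /H normrEsg.
  - pose h (t : R) : \bar R := (`|v t - u z1| `^ p)%:E.
    have mh (D : set R) : measurable_fun D h.
      apply: measurable_funTS; apply/measurable_EFinP; apply: (measurableT_comp (measurable_powR _)).
      by apply: measurableT_comp => //; exact: measurable_funB.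
    have h0 t : (0 <= h t)%E by rewrite lee_fin powR_ge0.
    have -> : (\int[mu]_(x in `[0%R, 1%R[) (`|w x| `^ p)%:E =
        \int[mu]_(x in `[0%R, 1%R[) h (l * x + (z1 - eta))%R)%E.
      by apply: eq_integral => x _; rewrite /w normrM s1 mul1r.
    rewrite -AC (@ge0_integral_affine _ l (z1 - eta) C h l0 mC (mh C)); last by move=> x _; exact: h0.
    apply: lte_mul_pinfty; [by rewrite lee_fin invr_ge0 ltW|by []|].
    pose f (t : R) : \bar R := (`|u t| `^ p)%:E.
    have mf (D : set R) : measurable_fun D f.
      apply: measurable_funTS; apply/measurable_EFinP; apply: (measurableT_comp (measurable_powR _)).
      exact: measurableT_comp.
    have f0 t : (0 <= f t)%E by rewrite lee_fin powR_ge0.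
    pose M := `]z1, z2[%classic : set R.
    have mM : measurable M by exact: measurable_itv.
    have mfM : measurable_fun setT (f \_ M).
      by apply/(measurable_restrictT _ _).1 => //; exact: mf.
    have fM0 t : (0 <= (f \_ M) t)%E by rewrite patchE; case: ifP.
    pose K' := H `^ p + 2 `^ p * `|u z1| `^ p.
    have K'0 : 0 <= K' by rewrite addr_ge0 ?mulr_ge0 ?powR_ge0.
    have p2 : (0 <= (2 `^ p)%:E :> \bar R)%E by rewrite lee_fin powR_ge0.
    apply: (@le_lt_trans _ _ (\int[mu]_(t in C) (K'%:E + (2 `^ p)%:E * (f \_ M) t))%E).
      apply: ge0_le_integral => //.
      - exact: mh.
      - apply: emeasurable_funD => //; apply: measurable_funeM; exact: measurable_funTS mfM.
      - move=> t _; rewrite /h /v /clamp_ends patchE.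
        have [_|t1] := leP t z1.
          rewrite subrr normr0 powR0 ?gt_eqF// lee_paddr// ?lee_fin//.
          by rewrite mule_ge0//; case: ifP.
        have [_|t2] := leP z2 t.
          apply: (@le_trans _ _ K'%:E).
            by rewrite lee_fin /K' lerDl mulr_ge0 ?powR_ge0.
          by rewrite leeDl// mule_ge0//; case: ifP.
        rewrite ifT; last by rewrite inE /M/= in_itv/= t1 t2.
        rewrite /f -EFinM -EFinD lee_fin.
        apply: (@le_trans _ _ ((`|u t| + `|u z1|) `^ p)).
          by apply: ler_powRp => //; exact: ler_normB.
        apply: le_trans (powR_addr_le _ _) _ => //.
        by rewrite mulrDr /K'; have := powR_ge0 H p; lra.
    rewrite ge0_integralD//.
    all: try by move=> t _; rewrite ?mule_ge0 ?lee_fin.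
    all: try by apply: measurable_funeM; exact: measurable_funTS mfM.
    rewrite integral_cst//.
    apply: lte_add_pinfty.
      apply: lte_mul_pinfty => //.
      have : (mu C < +oo)%E by rewrite /C lebesgue_measure_itv/=; case: ifP => _; rewrite ?ltry.
      exact.
    rewrite ge0_integralZl//; last exact: measurable_funTS mfM.
    apply: lte_mul_pinfty => //.
    apply: le_lt_trans fin; rewrite [leRHS]integral_mkcond.
    by apply: ge0_subset_integral.
have K2 : (kappaE * (H `^ p / l `^ (p - 1))%:E <= J v C C +
    (2 * beta / p * (eta / l) `^ (- p) / l `^ (p - 1))%:E)%E.
  have L0 : (0 <= ((l `^ (p - 1))^-1)%:E)%E by rewrite lee_fin invr_ge0 ltW.
  rewrite EFinM muleA; apply: le_trans (lee_wpmul2r L0 K) _.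
  rewrite Jw muleC ge0_muleDr; [|by rewrite mule_ge0 ?J_ge0// lee_fin ltW|].
    by rewrite muleA -EFinM mulVf ?gt_eqF// mul1e -EFinM mulrC.
  by rewrite lee_fin (mulr_ge0 bp_ge0)// powR_ge0.
apply: le_trans K2 _.
rewrite [X in (_ <= _ + X)%E]EFinD addeA; apply: leeD; last by [].
exact: J_clamp_ends.
Qed.

Definition Ld u (delta : R) A : \bar R :=
  ((delta `^ p)%:E * J (fun x => (u x / delta)%R) A A)%E.

Lemma measurable_divr u (delta : R) :
  measurable_fun setT u -> measurable_fun setT (fun x : T => u x / delta).
Proof. by move=> m; apply: measurable_funM. Qed.

Lemma Ld_ge0 u delta A : (0 <= Ld u delta A)%E.
Proof. by rewrite mule_ge0 ?J_ge0// lee_fin powR_ge0. Qed.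

Lemma Ld_le u delta A A' : measurable_fun setT u -> measurable A -> measurable A' ->
  A `<=` A' -> (Ld u delta A <= Ld u delta A')%E.
Proof.
move=> m mA mA' AA; apply: lee_wpmul2l; first by rewrite lee_fin powR_ge0.
by apply: J_le => //; exact: measurable_divr.
Qed.

Lemma Ld_superadditive u delta A A' C : measurable_fun setT u -> measurable A -> measurable A' ->
  measurable C -> [disjoint A & A'] -> A `|` A' `<=` C -> (Ld u delta A + Ld u delta A' <= Ld u delta C)%E.
Proof.
move=> m mA mA' mC d AC; rewrite /Ld -ge0_muleDr ?J_ge0//.
apply: lee_wpmul2l; first by rewrite lee_fin powR_ge0.
have mu' := @measurable_divr u delta m.
have mAA : measurable (A `|` A') by exact: measurableU.
apply: le_trans (J_le mu' mAA mAA mC mC AC AC).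
rewrite (J_setUl mu' mA mA' mAA d) (J_setUr mu' mA mA' mA d) (J_setUr mu' mA mA' mA' d).
by apply: leeD; [rewrite leeDl|rewrite leeDr]; rewrite ?J_ge0.
Qed.

(** At distance at most [r], the edge kernel is at most [r] times the interaction kernel; at larger
    distance it is at most [r ^ (- p)], and [phi <= beta]. *)
Lemma edge_average u (r : R) A : measurable_fun setT u -> measurable A -> 0 < r ->
  (\int[mu]_(z in A) edge u z A <= r%:E * J u A A + (beta * r `^ (- p))%:E * (mu A * mu A))%E.
Proof.
move=> m mA r0.
have br0 : (0 <= (beta * r `^ (- p))%:E)%E.
  by rewrite lee_fin mulr_ge0 ?powR_ge0// (ltW beta_gt0).
have k0 x : (0 <= \int[mu]_(y in A) kern u (x, y))%E.
  by apply: integral_ge0 => y _; exact: kern_ge0.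
have mk := @measurable_kern_int u A m mA A.
have S z : A z -> (edge u z A <= r%:E * (\int[mu]_(y in A) kern u (z, y)) + (beta * r `^ (- p))%:E * mu A)%E.
  move=> Az; rewrite edgeE.
  rewrite -ge0_integralZl//; [|exact: measurable_kern2|by move=> y _; exact: kern_ge0|by rewrite lee_fin ltW].
  rewrite -integral_cst// -ge0_integralD//.
  all: try by move=> y _; rewrite mule_ge0 ?kern_ge0// lee_fin (ltW r0).
  all: try by apply: measurable_funeM; exact: measurable_kern2.
  apply: ge0_le_integral => //.
  all: try by move=> y _; rewrite lee_fin mulr_ge0// powR_ge0.
  all: try exact: measurable_edge.
  all: try by apply: emeasurable_funD => //; apply: measurable_funeM; exact: measurable_kern2.
  move=> y Ay; rewrite /kern/= distrC -EFinM -EFinD lee_fin (distrC z y).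
  have [yz|yz] := leP `|y - z| r.
    apply: ler_wpDr; first by rewrite mulr_ge0 ?powR_ge0// (ltW beta_gt0).
    rewrite mulrCA; apply: ler_wpM2l; first exact: phi_ge0.
    have [->|nz] := eqVneq `|y - z| 0.
      by rewrite powR0 ?oppr_eq0 ?gt_eqF// powR0 ?gt_eqF// ?invr0 ?mulr0//; exact: addr_gt0.
    have yz0 : 0 < `|y - z| by rewrite lt_neqAle eq_sym nz normr_ge0.
    rewrite -powRN opprD powRD ?nz ?implybT// powR_inv1// mulrCA ler_peMr ?powR_ge0//.
    by rewrite ler_pdivlMr// mul1r.
  apply: ler_wpDl; first by rewrite mulr_ge0 ?(ltW r0)// divr_ge0// powR_ge0.
  apply: ler_pM; rewrite ?powR_ge0//.
  by rewrite !powRN lef_pV2 ?posrE ?powR_gt0 ?(lt_trans r0 yz)//; apply: ler_powRp; apply: ltW.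
rewrite JE -ge0_integralZl//; last by rewrite lee_fin ltW.
rewrite muleA -integral_cst// -ge0_integralD//.
all: try by move=> y _; rewrite mule_ge0// lee_fin (ltW r0).
all: try exact: measurable_funeM.
all: try by move=> y _; exact: mule_ge0.
have me : measurable_fun A (edge u ^~ A).
  pose k (z : T * T) : \bar R := (phi `|u z.1 - u z.2| * `|z.2 - z.1| `^ (- p))%:E.
  have mk' : measurable_fun setT k.
    apply/measurable_EFinP; apply: measurable_funM.
      apply: (measurableT_comp mphi); apply: measurableT_comp => //.
      by apply: measurable_funB; apply: measurableT_comp m _.
    apply: (measurableT_comp (measurable_powR _)); apply: measurableT_comp => //.
    by apply: measurable_funB.
  have k0' z : (0 <= k z)%E by rewrite lee_fin mulr_ge0// powR_ge0.
  apply: measurable_funTS.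
  exact: (@measurable_int_set _ k mk' k0' A mA).
apply: ge0_le_integral => //.
all: try by move=> z _; exact: edge_ge0.
by apply: emeasurable_funD => //; exact: measurable_funeM.
Qed.

(** * Lower bound: slopes of the limits of sequences with bounded energy *)

Lemma powR_shift_cvg (a q : R) : 0 < a -> (a + 2 * t) `^ q @[t --> 0^'+] --> a `^ q.
Proof.
move=> a0; apply: (@cvg_comp _ _ _ (fun t => a + 2 * t) (fun x => x `^ q) _ (nbhs a)); last first.
  have : derivable (fun x : R => x `^ q) a 1 by apply: derivable_powR; rewrite in_itv/= a0.
  by move=> /derivable1_diffP/differentiable_continuous; exact.
apply: cvg_at_right_filter; rewrite -[X in _ --> X]addr0 -[X in _ + X](mulr0 2).
by apply: cvgD; [exact: cvg_cst|apply: cvgMr; exact: cvg_id].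
Qed.

Fact le_chain (a b c x y z e : R) :
  x <= a + b + c -> y - e / 4 < x -> z - e / 4 < y -> c <= e / 4 -> b <= e / 4 -> z - e <= a.
Proof. lra. Qed.

(** [cell_bound] is applied to [v n / d n] and multiplied by the power [p] of [d n]. A real [K]
    below [kappaE] is used because [kappaE] is not yet known to be finite. *)
Lemma eventually_slope (v : nat -> T -> R) (d : nat -> R) (g : R -> R) (z1 z2 K : R) :
  (forall n, measurable_fun setT (v n)) -> (forall n, 0 < d n) -> d @ \oo --> 0 ->
  z1 < z2 -> 0 <= K -> (K%:E <= kappaE)%E ->
  v n z1 @[n --> \oo] --> g z1 -> v n z2 @[n --> \oo] --> g z2 ->
  (forall n, \int[mu]_(x in `]z1, z2[) (`|v n x| `^ p)%:E < +oo)%E ->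
  (forall e : R, 0 < e -> \forall n \near \oo,
    ((d n `^ p)%:E * edge (fun x => (v n x / d n)%R) z1 `]z1, z2[%classic <= e%:E)%E) ->
  (forall e : R, 0 < e -> \forall n \near \oo,
    ((d n `^ p)%:E * edge (fun x => (v n x / d n)%R) z2 `]z1, z2[%classic <= e%:E)%E) ->
  forall e : R, 0 < e -> \forall n \near \oo,
    ((K * (`|g z2 - g z1| `^ p / (z2 - z1) `^ (p - 1)) - e)%:E <= Ld (v n) (d n) `]z1, z2[%classic)%E.
Proof.
move=> mv d0 dcvg z12 K0 Kk v1 v2 fin E1 E2 e e0.
have [->|gz] := eqVneq (g z1) (g z2).
  near=> n; apply: le_trans (Ld_ge0 _ _ _).
  by rewrite subrr normr0 powR0 ?gt_eqF// mul0r mulr0 sub0r lee_fin oppr_le0 ltW.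
set D : R := `|g z2 - g z1|.
have D0 : 0 < D by rewrite normr_gt0 subr_eq0 eq_sym.
have e4 : 0 < e / 4 by rewrite divr_gt0.
set l := z2 - z1; have l0 : 0 < l by rewrite subr_gt0.
(* The margin is fixed before [n], small enough that lengthening the interval costs at most [e / 4];
   the error [C] is then a constant, which the power of [d n] makes small. *)
have [eta [eta0 Heta]] : exists eta, 0 < eta /\
    K * (D `^ p / l `^ (p - 1)) - e / 4 < K * (D `^ p / (l + 2 * eta) `^ (p - 1)).
  have H : K * (D `^ p * (l + 2 * t) `^ (- (p - 1))) @[t --> 0^'+] -->
      K * (D `^ p * l `^ (- (p - 1))).
    by apply: cvgMr; apply: cvgMr; exact: powR_shift_cvg.
  have {}H := @cvgr_gt _ _ _ _ _ _ H (K * (D `^ p / l `^ (p - 1)) - e / 4).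
  rewrite powRN in H.
  have {}H : \forall t \near 0^'+, K * (D `^ p / l `^ (p - 1)) - e / 4 < K * (D `^ p * (l + 2 * t) `^ (- (p - 1))).
    by apply: H; rewrite ltrBlDr ltrDl.
  have [t [/= t0 Ht]] := filter_ex (filterI (nbhs_right_gt 0) H).
  by exists t; split; [exact: t0|move: Ht; rewrite (powRN (l + 2 * t))].
set L := (l + 2 * eta) `^ (p - 1).
have L0 : 0 < L by rewrite powR_gt0// /l; lra.
set C := 4 * beta / p * eta * l `^ (- p) +
    2 * beta / p * (eta / (l + 2 * eta)) `^ (- p) / L.
have Xcvg : K * (`|v n z2 - v n z1| `^ p / L) @[n --> \oo] --> K * (D `^ p / L).
  apply: cvgMr; apply: cvgMl.
  apply: (@cvg_comp _ _ _ (fun n => `|v n z2 - v n z1|) (fun x => x `^ p) _ (nbhs D)).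
    by apply: cvg_norm; exact: cvgB.
  have : derivable (fun x : R => x `^ p) D 1 by apply: derivable_powR; rewrite in_itv/= D0.
  by move=> /derivable1_diffP/differentiable_continuous; exact.
have vne : \forall n \near \oo, v n z1 != v n z2.
  have : v n z2 - v n z1 @[n --> \oo] --> g z2 - g z1 by exact: cvgB.
  move=> /cvgr_neq0; rewrite subr_eq0 eq_sym => /(_ gz); apply: filterS => n.
  by rewrite subr_eq0 eq_sym.
have Cp : 0 < e / 4 / (`|C| + 1) by rewrite divr_gt0// ltr_wpDl.
(* The two edge terms enter with the factor [2 / p]; with this tolerance for each, they cost [e / 4]
   together. *)
have ep : 0 < e / 4 * p / 4 by rewrite divr_gt0// mulr_gt0.
have [P1 F1 PE1] : exists2 P : set nat, (\forall n \near \oo, P n) & forall n, P n ->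
    ((d n `^ p)%:E * edge (fun x => (v n x / d n)%R) z1 `]z1, z2[%classic
    <= (e / 4 * p / 4)%:E)%E by eexists; [exact: (E1 _ ep)|move=> n; exact].
have [P2 F2 PE2] : exists2 P : set nat, (\forall n \near \oo, P n) & forall n, P n ->
    ((d n `^ p)%:E * edge (fun x => (v n x / d n)%R) z2 `]z1, z2[%classic
    <= (e / 4 * p / 4)%:E)%E by eexists; [exact: (E2 _ ep)|move=> n; exact].
near=> n.
have n1 : v n z1 != v n z2 by near: n.
have dn0 := d0 n; have dp0 : 0 < d n `^ p by rewrite powR_gt0.
have dC : d n `^ p * C <= e / 4.
  apply: (@le_trans _ _ (d n * (`|C| + 1))).
    apply: (@le_trans _ _ (d n `^ p * (`|C| + 1))).
      apply: ler_wpM2l; first exact: ltW.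
      by have := ler_norm C; lra.
    apply: ler_wpM2r; first by rewrite addr_ge0.
    apply: ge1r_powR => //; rewrite dn0/=.
    by near: n; apply: (cvgr_le _ dcvg); exact: ltr01.
  rewrite -ler_pdivlMr ?ltr_wpDl//.
  by near: n; apply: (cvgr_le _ dcvg).
have X : K * (D `^ p / L) - e / 4 < K * (`|v n z2 - v n z1| `^ p / L).
  by near: n; apply: (cvgr_gt _ Xcvg); rewrite ltrBlDr ltrDl.
have p1 : P1 n by near: n.
have e1 := PE1 n p1.
have p2 : P2 n by near: n.
have e2 := PE2 n p2.
move: e1 e2; set M : set T := `]z1, z2[%classic; set u : T -> R := fun x => (v n x / d n)%R.
move=> e1 e2.
have mM : measurable M by exact: measurable_itv.
have mu_ : measurable_fun setT u by exact: measurable_divr.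
have u12 : u z1 != u z2 by rewrite /u; apply: contra n1 => /eqP/(divIf (lt0r_neq0 dn0))/eqP.
have fu : (\int[mu]_(x in M) (`|u x| `^ p)%:E < +oo)%E.
  have -> : (\int[mu]_(x in M) (`|u x| `^ p)%:E =
      \int[mu]_(x in M) ((d n `^ p)^-1%:E * (`|v n x| `^ p)%:E))%E.
    apply: eq_integral => x _; rewrite /u normrM normfV powRM ?invr_ge0// (gtr0_norm dn0).
    by rewrite -EFinM -powRN -powR_inv1 ?(ltW dn0)// -powRrM mulN1r mulrC.
  rewrite ge0_integralZl//; last 2 first.
  - apply: measurable_funTS; apply/measurable_EFinP; apply: (measurableT_comp (measurable_powR _)).
    by apply: measurableT_comp => //; exact: mv.
  - by rewrite lee_fin invr_ge0 ltW.
  by apply: lte_mul_pinfty => //; rewrite lee_fin invr_ge0 ltW.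
have cb := cell_bound mu_ z12 eta0 u12 fu.
rewrite -/M -/l -/L -/C in cb.
have dpe : (0 <= (d n `^ p)%:E :> \bar R)%E by rewrite lee_fin ltW.
have {}cb := lee_wpmul2l dpe cb.
have Mu : d n `^ p * (`|u z2 - u z1| `^ p / L) = `|v n z2 - v n z1| `^ p / L.
  rewrite /u -mulrBl normrM normfV powRM ?invr_ge0// (gtr0_norm dn0).
  rewrite -[(d n)^-1]powR_inv1 ?(ltW dn0)// -powRrM mulN1r powRN.
  by rewrite !mulrA mulrAC mulrC !mulrA mulVf ?mul1r ?gt_eqF.
have cb1 : ((K * (`|v n z2 - v n z1| `^ p / L))%:E <= (d n `^ p)%:E *
    (J u M M + (2 / p)%:E * (edge u z1 M + edge u z2 M) + C%:E))%E.
  apply: le_trans cb; rewrite -Mu mulrCA EFinM; apply: lee_wpmul2l => //.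
  by rewrite EFinM; apply: lee_wpmul2r => //; rewrite lee_fin divr_ge0 ?powR_ge0// ltW.
clear cb; rewrite /Ld -/u -/M.
have J0 := J_ge0 u M M; have e10 := edge_ge0 u z1 M; have e20 := edge_ge0 u z2 M.
move: (J u M M) (edge u z1 M) (edge u z2 M) J0 e10 e20 e1 e2 cb1 => j a b j0 a0 b0 a1 b1.
case: j j0 => [j| |//] j0; last by move=> _; rewrite gt0_muley ?lte_fin// leey.
case: a a0 a1 => [a| |//] a0; last by rewrite gt0_muley ?lte_fin// leye_eq.
move=> a1; case: b b0 b1 => [b| |//] b0; last by rewrite gt0_muley ?lte_fin// leye_eq.
move=> b1; move: a1 b1; rewrite -?EFinM -?EFinD -?EFinM -?EFinD !lee_fin => a1 b1 cb1.
have T1 : 2 / p * (d n `^ p * a + d n `^ p * b) <= e / 4.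
  apply: (@le_trans _ _ (2 / p * (e / 4 * p / 4 + e / 4 * p / 4))).
    by apply: ler_wpM2l; [rewrite divr_ge0// ltW|exact: lerD].
  rewrite (_ : 2 / p * _ = e / 4)//; field; exact: lt0r_neq0.
have T2 : d n `^ p * (j + 2 / p * (a + b) + C) = d n `^ p * j + 2 / p * (d n `^ p * a + d n `^ p * b) + d n `^ p * C.
  by rewrite !mulrDr !(mulrCA (d n `^ p)).
rewrite T2 in cb1; clear T2; move: cb1 X Heta dC T1; rewrite -/L.
exact: le_chain.
Unshelve. all: by end_near. Qed.

(** The sum of the [f n] has finite integral, hence is finite almost everywhere, and there its terms
    tend to 0. *)
Lemma ae_small_of_summable (f : nat -> T -> \bar R) (C : R) : 0 <= C ->
  (forall n, measurable_fun setT (f n)) -> (forall n x, 0 <= f n x)%E ->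
  (forall n, \int[mu]_x f n x <= (C / (2 ^ n.+1)%:R)%:E)%E ->
  mu.-negligible (~` [set z | forall e : R, 0 < e -> \forall n \near \oo, (f n z <= e%:E)%E]).
Proof.
move=> C0 mf f0 fC.
have mS : measurable_fun setT (fun x => \sum_(n <oo) f n x)%E.
  by apply: ge0_emeasurable_sum.
have iS : mu.-integrable setT (fun x => \sum_(n <oo) f n x)%E.
  apply/integrableP; split; first exact: mS.
  rewrite (eq_integral (fun x => \sum_(n <oo) f n x)%E); last first.
    by move=> x _; rewrite gee0_abs// nneseries_ge0.
  rewrite integral_nneseries//.
  apply: (@le_lt_trans _ _ (\sum_(n <oo) (C / (2 ^ n.+1)%:R)%:E)%E).
    by apply: lee_nneseries => [n _ _|n _]; [apply: integral_ge0 => x _; exact: f0|exact: fC].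
  by apply: le_lt_trans (epsilon_trick0 _ C0) _; rewrite ltry.
have := integrable_ae measurableT iS.
apply: negligibleS => z /= nz fz; apply: nz => e e0.
have {}fz : (\sum_(n <oo) f n z < +oo)%E by have := fz I; rewrite fin_numElt => /andP[].
have tail := nneseries_tail_cvg fz (fun k _ => f0 k z).
have : \forall N \near \oo, (\sum_(N <= k <oo) f k z < e%:E)%E.
  have : nbhs (0 : \bar R)%E [set y | (y < e%:E)%E].
    by exists e => //= y; rewrite /ball/= sub0r normrN => /(le_lt_trans (ler_norm _)); rewrite lte_fin.
  by move=> /tail.
apply: filterS => n /ltW; apply: le_trans.
have -> : (f n z = \sum_(n <= k < n.+1) f k z)%E by rewrite big_nat1.
by apply: nneseries_lim_ge => k _ _; exact: f0.
Qed.

Definition mLp (I : set T) (u : T -> R) : Prop :=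
  measurable_fun setT (u \_ I) /\ (\int[mu]_(x in I) (`|u x| `^ p)%:E < +oo)%E.

Lemma measurable_powabs (u : T -> R) (D : set T) : measurable_fun D u ->
  measurable_fun D (fun x => (`|u x| `^ p)%:E).
Proof.
move=> m; apply/measurable_EFinP; apply: (measurableT_comp (measurable_powR _)).
exact: measurableT_comp.
Qed.

(** The last clause makes the bound of [edge_integral_small] on the window [[- n, n]] summable in
    [n]; the third does the same for the distance to [g]. *)
Definition good_delta (I : set T) (g : T -> R) (gd : R -> T -> R) (c : R) (n : nat) (d : R) :=
  [/\ 0 < d < n.+1%:R^-1,
      (Ld (gd d \_ I) d I <= c%:E)%E,
      (\int[mu]_(x in I) (`|gd d x - g x| `^ p)%:E <= (1 / (2 ^ n.+1)%:R)%:E)%E &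
      Num.sqrt d * (c + beta * (2 * n%:R) ^+ 2) <= 1 / (2 ^ n.+1)%:R].

Lemma choose_deltas (I : set T) (g : T -> R) (gd : R -> T -> R) (c : R) : 0 <= c ->
  (forall e : R, 0 < e -> exists2 d0 : R, 0 < d0 &
     forall d : R, 0 < d < d0 -> (\int[mu]_(x in I) (`|gd d x - g x| `^ p)%:E <= e%:E)%E) ->
  (forall d0 : R, 0 < d0 -> exists2 d : R, 0 < d < d0 & (Ld (gd d \_ I) d I <= c%:E)%E) ->
  exists d : nat -> R, forall n, good_delta I g gd c n (d n).
Proof.
move=> c0 H1 H2.
suff /choice[d Hd] : forall n, exists d, good_delta I g gd c n d by exists d.
move=> n.
have e0 : 0 < 1 / (2 ^ n.+1)%:R :> R by rewrite divr_gt0// ltr0n expn_gt0.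
have [d1 d10 D1] := H1 _ e0.
pose C := c + beta * (2 * n%:R) ^+ 2.
have C0 : 0 <= C by rewrite addr_ge0// mulr_ge0 ?sqr_ge0// ltW.
pose d2 : R := (1 / (2 ^ n.+1)%:R / (C + 1)) ^+ 2.
have d20 : 0 < d2 by rewrite exprn_gt0// divr_gt0// ltr_wpDl.
have [|d /andP[d0]] := H2 (Num.min d1 (Num.min d2 n.+1%:R^-1)).
  by rewrite !lt_min d10 d20 invr_gt0 ltr0n.
rewrite !lt_min => /and3P[dd1 dd2 dn] Ldc; exists d; split => //.
- by rewrite d0.
- by apply: D1; rewrite d0.
- have : Num.sqrt d <= 1 / (2 ^ n.+1)%:R / (C + 1).
    have E0 : 0 <= 1 / (2 ^ n.+1)%:R / (C + 1) by rewrite ltW// divr_gt0// ltr_wpDl.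
    rewrite -[leRHS](ger0_norm E0) -sqrtr_sqr.
    by apply: ler_wsqrtr; exact: ltW.
  rewrite ler_pdivlMr ?ltr_wpDl//; apply: le_trans.
  by apply: ler_wpM2l; [exact: sqrtr_ge0|rewrite lerDl].
Qed.

(** [edge_average] with [r = sqrt d]. Its first term is [r] times an energy at most [c]; in the
    second, [d ^ p * r ^ (- p) = r ^ p], which is at most [r] because [r <= 1 <= p]. *)
Lemma edge_integral_small (u : T -> R) (d c : R) (n : nat) (A : set T) : 0 <= c ->
  measurable_fun setT u -> measurable A -> 0 < d <= 1 -> A `<=` `[(- n%:R), n%:R] ->
  (Ld u d A <= c%:E)%E ->
  ((d `^ p)%:E * \int[mu]_(z in A) edge (fun x => (u x / d)%R) z A <=
    (Num.sqrt d * (c + beta * (2 * n%:R) ^+ 2))%:E)%E.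
Proof.
move=> c0 m mA /andP[d0 d1] An Lc.
pose r := Num.sqrt d.
have r0 : 0 < r by rewrite sqrtr_gt0.
have r1 : r <= 1 by rewrite -sqrtr1; exact: ler_wsqrtr.
have rr : r * r = d by rewrite -expr2 sqr_sqrtr// ltW.
have dp0 : (0 <= (d `^ p)%:E :> \bar R)%E by rewrite lee_fin powR_ge0.
have := edge_average (measurable_divr d m) mA r0.
move=> /(lee_wpmul2l dp0) /le_trans; apply.
have J0 := J_ge0 (fun x => u x / d) A A.
have muA : (mu A * mu A <= ((2 * n%:R) ^+ 2)%:E)%E.
  have mA2 : (mu A <= (2 * n%:R)%:E)%E.
    apply: (@le_trans _ _ (mu (`[(- n%:R)%R, n%:R]%classic : set T))).
      by apply: le_measure => //; rewrite inE; [exact: mA|exact: measurable_itv].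
    rewrite lebesgue_measure_itv/=; case: ifP => _.
      by rewrite -EFinD lee_fin opprK mulr2n mulrDl mul1r.
    by rewrite lee_fin mulr_ge0.
  by rewrite expr2 EFinM; apply: lee_pmul.
have b0 : 0 <= beta * r `^ (- p) by rewrite mulr_ge0 ?powR_ge0// ltW.
rewrite ge0_muleDr; [|by rewrite mule_ge0// lee_fin ltW|by rewrite mule_ge0// mule_ge0].
rewrite mulrDr EFinD; apply: leeD.
  by rewrite muleCA EFinM; apply: lee_wpmul2l => //; rewrite lee_fin ltW.
rewrite muleA -EFinM.
have -> : d `^ p * (beta * r `^ (- p)) = r `^ p * beta.
  rewrite -rr powRM ?(ltW r0)// mulrCA -!mulrA -powRD; last by rewrite subrr eqxx/= gt_eqF.
  by rewrite subrr powRr0 mulr1 mulrC.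
rewrite (mulrA (Num.sqrt d)) [leRHS]EFinM; apply: lee_pmul => //.
- by rewrite lee_fin mulr_ge0 ?powR_ge0// ltW.
- by rewrite mule_ge0.
- by rewrite lee_fin ler_wpM2r ?(ltW beta_gt0)// ge1r_powR// r0.
Qed.

Lemma cvg_of_powR_small (a : nat -> R) (l : R) :
  (forall e : R, 0 < e -> \forall n \near \oo, `|a n - l| `^ p <= e) -> a @ \oo --> l.
Proof.
move=> H; apply/cvgrPdist_le => e e0; have := H (e `^ p) (powR_gt0 _ e0).
apply: filterS => n h; rewrite distrC leNgt; apply/negP => he.
have : e `^ p < `|a n - l| `^ p.
  by apply: gt0_ltr_powR => //; rewrite ?nnegrE ?(ltW e0).
by rewrite ltNge h.
Qed.

Lemma measurable_edge_point u A : measurable_fun setT u -> measurable A ->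
  measurable_fun setT (fun z : T => edge u z A).
Proof.
move=> m mA; pose k (z : T * T) : \bar R := (phi `|u z.1 - u z.2| * `|z.2 - z.1| `^ (- p))%:E.
have mk' : measurable_fun setT k.
  apply/measurable_EFinP; apply: measurable_funM.
    apply: (measurableT_comp mphi); apply: measurableT_comp => //.
    by apply: measurable_funB; apply: measurableT_comp m _.
  apply: (measurableT_comp (measurable_powR _)); apply: measurableT_comp => //.
  by apply: measurable_funB.
have k0' z : (0 <= k z)%E by rewrite lee_fin mulr_ge0// powR_ge0.
have -> : (fun z : T => edge u z A) = (fun z : T => \int[mu]_(y in A) k (z, y))%E.
  by apply/funext => z; rewrite edgeE.
exact: (@measurable_int_set _ k mk' k0' A mA).
Qed.

Lemma edge_le u (z : R) A A' : measurable_fun setT u -> measurable A -> measurable A' ->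
  A `<=` A' -> (edge u z A <= edge u z A')%E.
Proof.
move=> m mA mA' AA; rewrite !edgeE; apply: ge0_subset_integral => //.
  exact: measurable_edge.
by move=> y _; rewrite lee_fin mulr_ge0// powR_ge0.
Qed.

(** On [G] the sequence converges to [g] and the edge terms vanish, so each pair of points of [G] is
    a legitimate place to cut. Superadditivity of the energy over []-oo, x[] and []x, y[] then turns
    the bound for []x, y[] into a bound for an increment of [W]. *)
Lemma liminf_slopes (I : set T) (g : T -> R) (gd : R -> T -> R) (K c : R) :
  measurable I -> is_interval (I : set R) ->
  mLp I g -> (forall d : R, 0 < d -> mLp I (gd d)) ->
  (forall e : R, 0 < e -> exists2 d0 : R, 0 < d0 &
     forall d : R, 0 < d < d0 -> (\int[mu]_(x in I) (`|gd d x - g x| `^ p)%:E <= e%:E)%E) ->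
  (forall d0 : R, 0 < d0 -> exists2 d : R, 0 < d < d0 & (Ld (gd d \_ I) d I <= c%:E)%E) ->
  0 <= c -> 0 <= K -> (K%:E <= kappaE)%E ->
  exists G W, [/\ mu.-negligible (I `\` G), {homo W : x y / x <= y :> R},
    forall x, 0 <= W x <= c &
    forall x y : R, I x -> I y -> G x -> G y -> x < y ->
      K * `|g y - g x| `^ p <= (y - x) `^ (p - 1) * (W y - W x)].
Proof.
move=> mI II mg mgd Hcvg Hc c0 K0 Kk.
have [d Hd] := choose_deltas c0 Hcvg Hc.
have d0 n : 0 < d n by case: (Hd n) => /andP[].
have d1 n : d n <= 1.
  case: (Hd n) => /andP[_ /ltW +] _ _ _; move=> /le_trans; apply.
  by rewrite invf_le1 ?ltr0n// ler1n.
have dcvg : d @ \oo --> 0.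
  apply: (@squeeze_cvgr _ _ _ _ (cst 0) (fun n => n.+1%:R^-1)); [|exact: cvg_cst|exact: cvg_harmonic].
  by apply: nearW => n; rewrite (ltW (d0 n))/=; case: (Hd n) => /andP[_ /ltW].
pose v n : T -> R := gd (d n) \_ I.
have mv n : measurable_fun setT (v n) by case: (mgd _ (d0 n)).
pose Jn n : set T := I `&` `[(- n%:R), n%:R]%classic.
have mJ n : measurable (Jn n) by apply: measurableI => //; exact: measurable_itv.
have LI n : (Ld (v n) (d n) I <= c%:E)%E by case: (Hd n).
pose en n (z : T) := ((d n `^ p)%:E * edge (fun x => (v n x / d n)%R) z (Jn n))%E.
pose dn n (z : T) : \bar R := (`|v n z - (g \_ I) z| `^ p)%:E.
(* One nonnegative function controls both quantities that must vanish almost everywhere: the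
   distance to [g] and the edge term on a window that grows to [I]. *)
pose f n z := ((dn n \_ I) z + (en n \_ (Jn n)) z)%E.
have mdn n : measurable_fun setT (dn n).
  by apply: measurable_powabs; apply: measurable_funB => //; case: mg.
have men n : measurable_fun setT (en n).
  by apply: measurable_funeM; exact: measurable_edge_point (measurable_divr _ (mv n)) (mJ n).
have dn0 n z : (0 <= (dn n \_ I) z)%E by rewrite patchE; case: ifP => // _; rewrite lee_fin powR_ge0.
have ene0 n z : (0 <= en n z)%E by rewrite mule_ge0 ?edge_ge0// lee_fin powR_ge0.
have en0 n z : (0 <= (en n \_ (Jn n)) z)%E by rewrite patchE; case: ifP.
have mdI n : measurable_fun setT (dn n \_ I).
  by apply/(measurable_restrictT _ _).1 => //; exact: measurable_funTS.
have meJ n : measurable_fun setT (en n \_ (Jn n)).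
  by apply/(measurable_restrictT _ _).1 => //; exact: measurable_funTS.
have mf n : measurable_fun setT (f n) by exact: emeasurable_funD.
have f0 n z : (0 <= f n z)%E by exact: adde_ge0.
have If n : (\int[mu]_x f n x <= (2 / (2 ^ n.+1)%:R)%:E)%E.
  rewrite ge0_integralD// -!integral_mkcond.
  have [/andP[_ _] _ h1 h2] := Hd n.
  rewrite (_ : 2 / _ = 1 / (2 ^ n.+1)%:R + 1 / (2 ^ n.+1)%:R); last by rewrite -mulrDl.
  rewrite EFinD; apply: leeD.
    apply: le_trans h1; rewrite le_eqVlt; apply/orP; left; apply/eqP.
    by apply: eq_integral => z zI; rewrite /dn /v !patchE zI.
  rewrite ge0_integralZl//; first last.
  - by rewrite lee_fin powR_ge0.
  - by move=> z _; exact: edge_ge0.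
  - by apply: measurable_funTS; exact: measurable_edge_point (measurable_divr _ (mv n)) (mJ n).
  apply: le_trans (@edge_integral_small (v n) (d n) c n (Jn n) c0 (mv n) (mJ n) _ _ _) _.
  - by rewrite d0 d1.
  - by move=> z [].
  - by apply: le_trans (LI n); apply: Ld_le => // z [].
  - by rewrite lee_fin.
have neg := ae_small_of_summable (ler0n _ 2) mf f0 If.
set G := [set z | _] in neg.
have vg z : I z -> G z -> v n z @[n --> \oo] --> g z.
  move=> Iz Gz; apply: cvg_of_powR_small => e e0; have := Gz e e0; apply: filterS => n h.
  rewrite -lee_fin; apply: le_trans h; rewrite /f.
  have -> : (`|v n z - g z| `^ p)%:E = (dn n \_ I) z.
    by rewrite /dn !patchE !mem_set//.
  by rewrite leeDl.
have xyI (x y : R) : I x -> I y -> `]x, y[%classic `<=` I.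
  by move=> Ix Iy z /=; rewrite in_itv/= => /andP[xz zy]; apply: (II x y) => //; rewrite !ltW.
have E (x y z : R) : I x -> I y -> I z -> G z -> forall e : R, 0 < e -> \forall n \near \oo,
    ((d n `^ p)%:E * edge (fun t => (v n t / d n)%R) z `]x, y[%classic <= e%:E)%E.
  move=> Ix Iy Iz Gz e e0.
  have Hz := Gz e e0.
  have B (t : R) : \forall n \near \oo, `|t| <= n%:R by exact: nbhs_infty_ger.
  apply: filterS (filterI Hz (filterI (B z) (filterI (B x) (B y)))) => n [h [zn [xn yn]]].
  apply: le_trans h.
  have Jz : Jn n z by split => //; rewrite /= in_itv/= -ler_norml.
  apply: (@le_trans _ _ ((en n \_ (Jn n)) z)); last by rewrite /f leeDr.
  rewrite patchE mem_set//; apply: lee_wpmul2l; first by rewrite lee_fin powR_ge0.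
  apply: edge_le; [exact: measurable_divr|exact: measurable_itv|exact: mJ|].
  move=> t txy; split; first exact: (xyI x y).
  move: txy; rewrite /= !in_itv/= => /andP[xt ty].
  by move: xn yn; rewrite !ler_norml; lra.
have fin (x y : R) n : I x -> I y -> (\int[mu]_(t in `]x, y[) (`|v n t| `^ p)%:E < +oo)%E.
  move=> Ix Iy; have [_] := mgd _ (d0 n); apply: le_lt_trans.
  have -> : (\int[mu]_(x in I) (`|gd (d n) x| `^ p)%:E = \int[mu]_(x in I) (`|v n x| `^ p)%:E)%E.
    by apply: eq_integral => t tI; rewrite /v patchE tI.
  apply: ge0_subset_integral => //; last exact: xyI.
  by apply: measurable_powabs; exact: measurable_funTS.
have slope (x y : R) : I x -> I y -> G x -> G y -> x < y -> forall e : R, 0 < e ->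
    \forall n \near \oo, ((K * (`|g y - g x| `^ p / (y - x) `^ (p - 1)) - e)%:E <=
      Ld (v n) (d n) `]x, y[%classic)%E.
  move=> Ix Iy Gx Gy xy.
  by apply: (eventually_slope mv d0 dcvg xy K0 Kk (vg x Ix Gx) (vg y Iy Gy)) => [n|e e0|e e0];
    [exact: fin|exact: E|exact: E].
pose I' (x : R) : set T := I `&` `]-oo, x[%classic.
have mI' x : measurable (I' x) by apply: measurableI => //; exact: measurable_itv.
(* The supremum of [S x] is the lower limit of the energies to the left of [x], as a real number. *)
pose S (x : R) := [set t : R | \forall n \near \oo, (t%:E <= Ld (v n) (d n) (I' x))%E].
have S0 x : S x 0 by apply: nearW => n; exact: Ld_ge0.
have Sc x t : S x t -> t <= c.
  move=> /filter_ex[n]; rewrite -lee_fin => /le_trans; apply; apply: le_trans (LI n).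
  by apply: Ld_le => // z [].
have hS x : has_sup (S x) by split; [exists 0; exact: S0|exists c => t /Sc].
exists G, (fun x => sup (S x)); split.
- apply: negligibleS neg => z [_ nG]; exact: nG.
- move=> x y xy; apply: ge_sup; first by exists 0; exact: S0.
  move=> t St; apply: ub_le_sup; first by case: (hS y).
  apply: filterS St => n /le_trans; apply; apply: Ld_le => // z [Iz zx]; split => //.
  by move: zx; rewrite /= !in_itv/= => /lt_le_trans; apply.
- move=> x; apply/andP; split; first by apply: ub_le_sup; [case: (hS x)|exact: S0].
  by apply: ge_sup; [exists 0; exact: S0|move=> t /Sc].
- move=> x y Ix Iy Gx Gy xy.
  have q0 : 0 < (y - x) `^ (p - 1) by rewrite powR_gt0// subr_gt0.
  set b := K * (`|g y - g x| `^ p / (y - x) `^ (p - 1)).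
  suff : b <= sup (S y) - sup (S x).
    by rewrite /b mulrA ler_pdivrMr// [leRHS]mulrC.
  rewrite lerBrDl -lerBrDr; apply: ge_sup; first by exists 0; exact: S0.
  move=> t St; apply/ler_addgt0Pr => e e0.
  suff : t + (b - e) <= sup (S y) by lra.
  apply: ub_le_sup; first by case: (hS y).
  have sl := slope x y Ix Iy Gx Gy xy e e0.
  apply: filterS2 St sl => n h1 h2; rewrite EFinD; apply: le_trans (leeD h1 h2) _.
  apply: Ld_superadditive => //.
  - rewrite disj_set2E; apply/eqP; rewrite -subset0 => z [[_ /=]]; rewrite !in_itv/= => zx.
    by move=> /andP[/lt_trans/(_ zx)]; rewrite ltxx.
  - move=> z [[Iz zx]|zxy]; split => //; rewrite ?/=.
    + by move: zx; rewrite /= !in_itv/= => /lt_trans; apply.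
    + exact: (xyI x y).
    + by move: zxy; rewrite /= !in_itv/= => /andP[].
Qed.

(** * Normalization of the interaction, junctions, and the upper bound for kappa *)

Hypothesis phi_int : (\int[mu]_(t in `]0%R, +oo[%classic) (phi t * t `^ (- (p + 1)))%:E = (2^-1)%:E)%E.

(** For the identity the inner integral over the whole line is [d ^ (- p)]: each half-line
    contributes one half of it, by the normalization 1/2. *)
Lemma Ld_id_le1 (d : R) : 0 < d -> (Ld (fun x => x) d `]0%R, 1%R[%classic <= 1)%E.
Proof.
move=> d0; rewrite /Ld JE.
pose f (t : R) : \bar R := (phi t * t `^ (- (p + 1)))%:E.
have mf (D : set R) : measurable_fun D f.
  apply: measurable_funTS; apply/measurable_EFinP; apply: measurable_funM; first exact: mphi.
  exact: measurable_powR.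
have f0 t : (0 <= f t)%E by rewrite lee_fin mulr_ge0// powR_ge0.
pose P : set R := `]0%R, +oo[%classic.
have mP : measurable P by exact: measurable_itv.
have di : 0 < d^-1 by rewrite invr_gt0.
have half : (d^-1%:E * (d `^ (- p))%:E * (2^-1)%:E = (d `^ (- (p + 1)) / 2)%:E)%E.
  rewrite -!EFinM -[d^-1]powR_inv1 ?ltW// -powRD; last by rewrite (gt_eqF d0) implybT.
  by rewrite opprD addrC.
pose ud : T -> R := fun x => x / d.
have md : measurable_fun setT ud by apply: measurable_divr.
rewrite -/ud.
have scale (x y : R) : x < y -> kern ud (x, y) =
    ((d `^ (- (p + 1)))%:E * f (d^-1 * y + - (d^-1 * x))%R)%E.
  move=> xy; rewrite /f /kern/= /ud -EFinM; congr EFin.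
  rewrite -mulrBl -mulrBr normrM (gtr0_norm di) distrC gtr0_norm ?subr_gt0//.
  rewrite [(y - x) / d]mulrC [RHS]mulrCA; congr (_ * _).
  rewrite powRM ?invr_ge0 ?ltW ?subr_gt0// -powRN mulrA -[X in _ * X * _]/(d^-1 `^ (- (p + 1))).
  rewrite -powRM ?ltW// divff ?powR1 ?mul1r//; exact: lt0r_neq0.
have right (x : R) : (\int[mu]_(y in `]x, +oo[) kern ud (x, y) = (d `^ (- p) / 2)%:E)%E.
  have -> : (\int[mu]_(y in `]x, +oo[) kern ud (x, y) =
      \int[mu]_(y in `]x, +oo[) ((d `^ (- (p + 1)))%:E * f (d^-1 * y + - (d^-1 * x))%R))%E.
    apply: eq_integral => y /set_mem/=; rewrite in_itv/= andbT; exact: scale.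
  have PE : affine d^-1 (- (d^-1 * x)) @^-1` P = `]x, +oo[%classic.
    apply/seteqP; split => y /=; rewrite /affine/P/= !in_itv/= !andbT.
      by rewrite subr_gt0 ltr_pM2l.
    by rewrite subr_gt0 ltr_pM2l.
  rewrite ge0_integralZl//; last 2 first.
  - apply: measurable_funTS; apply: (measurableT_comp (mf setT)).
    exact: (measurable_affine d^-1 (- (d^-1 * x))).
  - by rewrite lee_fin powR_ge0.
  rewrite -PE (@ge0_integral_affine _ d^-1 (- (d^-1 * x)) P f di mP (mf P)); last by move=> y _; exact: f0.
  rewrite invrK phi_int -!EFinM; congr EFin; rewrite mulrA; congr (_ / _).
  rewrite -{2}[d]powRr1 ?ltW// -powRD; last by rewrite (gt_eqF d0) implybT.
  by congr (_ `^ _); ring.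
have left (x : R) : (\int[mu]_(y in `]-oo, x]) kern ud (x, y) = (d `^ (- p) / 2)%:E)%E.
  rewrite -(right (- x)) integral_itv_obnd_cbnd; last exact: measurable_kern2.
  rewrite -[RHS]ge0_integral_opp; last 3 first.
  - exact: measurable_itv.
  - exact: measurable_kern2.
  - by move=> y _; exact: kern_ge0.
  have -> : -%R @^-1` `[(- x), +oo[%classic = `]-oo, x]%classic.
    by apply/seteqP; split=> y /=; rewrite !in_itv/= ?andbT lerN2.
  apply: eq_integral => y _; rewrite /kern/= /ud !mulNr -!opprD !normrN//.
have inner (x : T) : (\int[mu]_(y in `]0%R, 1%R[) kern ud (x, y) <= (d `^ (- p))%:E)%E.
  have k0 (y : T) : (0 <= kern ud (x, y))%E by exact: kern_ge0.
  have -> : (d `^ (- p))%:E = (\int[mu]_y kern ud (x, y))%E.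
    have -> : [set: T] = `]-oo, x]%classic `|` `]x, +oo[%classic.
      apply/seteqP; split => y //= _; rewrite !in_itv/= andbT.
      by have [?|?] := leP y x; [left|right].
    rewrite ge0_integral_setU//.
    - by rewrite right left -EFinD; congr EFin; field.
    - exact: measurable_kern2.
    - rewrite disj_set2E; apply/eqP; rewrite -subset0 => y [/=]; rewrite !in_itv/= andbT.
      by move=> /le_lt_trans h /h; rewrite ltxx.
  by apply: ge0_subset_integral => //; exact: measurable_kern2.
apply: (@le_trans _ _ ((d `^ p)%:E * (d `^ (- p))%:E)%E); last first.
  by rewrite -EFinM -powRD ?subrr ?powRr0// (gt_eqF d0) implybT.
apply: lee_wpmul2l; first by rewrite lee_fin powR_ge0.
apply: (@le_trans _ _ (\int[mu]_(x in (`]0%R, 1%R[%classic : set T)) (cst (d `^ (- p))%:E x))%E).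
  apply: ge0_le_integral => //.
  - by move=> x _; apply: integral_ge0 => y _; exact: kern_ge0.
  - exact: measurable_kern_int.
rewrite integral_cst//= lebesgue_measure_itv/= lte_fin ltr01 oppr0 adde0 mule1//.
Qed.

Lemma J_junction u A B (c eta r m : R) : measurable_fun setT u -> measurable A -> measurable B ->
  A `<=` `]-oo, c] /\ B `<=` `[c, +oo[ \/ A `<=` `[c, +oo[ /\ B `<=` `]-oo, c] ->
  0 < eta -> 0 < r -> (mu A <= m%:E)%E ->
  (forall x y, A x -> B y -> `|x - y| < eta -> u x = u y) ->
  (J u A B <= (2 * beta / p * (eta `^ (- p) * (2 * r) + r `^ (- p) * m))%:E)%E.
Proof.
move=> mu_ mA mB AB eta0 r0 mAm near0.
pose N : set T := `](c - r)%R, (c + r)%R[%classic.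
have mN : measurable N by exact: measurable_itv.
have mAN : measurable (A `&` N) by exact: measurableI.
have mAN' : measurable (A `&` ~` N) by apply: measurableI => //; exact: measurableC.
have d : [disjoint A `&` N & A `&` ~` N].
  by rewrite disj_set2E; apply/eqP; rewrite -subset0 => x [[_ ?] [_]].
have AE : A = (A `&` N) `|` (A `&` ~` N) by rewrite -setIUr setUv setIT.
rewrite {1}AE (J_setUl mu_ mAN mAN' mB d) mulrDr EFinD; apply: leeD.
  apply: le_trans (J_far mu_ mAN mB eta0 _) _; first by move=> x y [Ax _]; exact: near0.
  rewrite [X in (_ <= X%:E)%E]mulrA [leRHS]EFinM; apply: lee_wpmul2l; first by rewrite lee_fin (mulr_ge0 bp_ge0)// powR_ge0.
  apply: (@le_trans _ _ (mu N)).
    by apply: le_measure; rewrite ?inE//; exact: subIsetr.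
  rewrite lebesgue_measure_itv/= lte_fin ifT; last by lra.
  by rewrite -EFinD lee_fin; lra.
apply: le_trans (J_far mu_ mAN' mB r0 _) _.
  move=> x y [Ax nN] By h; exfalso; apply: nN; rewrite /N/= in_itv/=.
  by case: AB => -[Az Bz]; have := Az _ Ax; have := Bz _ By; rewrite /= !in_itv/= ?andbT => yc xc;
    move: h; rewrite ltr_norml => /andP[? ?]; apply/andP; lra.
rewrite [X in (_ <= X%:E)%E]mulrA [leRHS]EFinM; apply: lee_wpmul2l; first by rewrite lee_fin (mulr_ge0 bp_ge0)// powR_ge0.
apply: le_trans mAm; apply: le_measure; rewrite ?inE//; exact: subIsetl.
Qed.

Section OneSlope.
Variables (W : T -> R) (H theta : R).
Hypothesis cW : cell W H theta.

Let mW : measurable_fun setT W. Proof. by case: cW => -[]. Qed.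
Let H_gt0 : 0 < H. Proof. by case: cW => -[]. Qed.
Let theta_gt0 : 0 < theta. Proof. by case: cW => -[]. Qed.

Lemma cell_addn (x : R) (n : nat) : W (x + n%:R) = W x + n%:R * H.
Proof.
have [_ W1 _ _] := cW.
elim: n => [|n IH]; first by rewrite addr0 mul0r addr0.
by rewrite -addn1 natrD addrA W1 IH mulrDl mul1r addrA.
Qed.

Lemma cell0 : W 0 = 0.
Proof. by have [_ _ W0 _] := cW; apply: W0; rewrite normr0 ltW. Qed.

(** Translating by an integer changes the cell by a constant, and the second set, the whole line, is
    invariant; so the cost is exactly additive. *)
Lemma J_cell_addn (n : nat) : J W `[0%R, n%:R[%classic setT = (n%:R%:E * J W `[0%R, 1%R[%classic setT)%E.
Proof.
elim: n => [|n IH].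
  rewrite mul0e JE (_ : `[0, 0%:R[%classic = set0) ?integral_set0//.
  by apply/seteqP; split => x //=; rewrite in_itv/= => /andP[/le_lt_trans h /h]; rewrite ltxx.
have -> : `[0%R, n.+1%:R[%classic = `[0%R, n%:R[%classic `|` `[n%:R, n.+1%:R[%classic :> set R.
  apply/seteqP; split => x /=; rewrite !in_itv/=.
    by move=> /andP[x0 x1]; have [?|?] := ltP x n%:R; [left; rewrite x0|right].
  have n1 : n%:R <= n.+1%:R :> R by rewrite ler_nat.
  move=> [/andP[x0 x1]|/andP[x0 x1]]; apply/andP; split => //.
    exact: lt_le_trans n1.
  by apply: le_trans x0.
rewrite J_setUl//; try exact: measurable_itv; last first.
  rewrite disj_set2E; apply/eqP; rewrite -subset0 => x [/=]; rewrite !in_itv/= => /andP[_ h] /andP[/le_lt_trans/(_ h)].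
  by rewrite ltxx.
rewrite IH; have -> : n.+1%:R%:E = (n%:R%:E + 1%:E :> \bar R)%E by rewrite -EFinD natr1.
rewrite ge0_muleDl ?lee_fin// mul1e; congr (_ + _)%E.
have A1 : affine 1 n%:R @^-1` `[n%:R, n.+1%:R[%classic = `[0%R, 1%R[%classic :> set R.
  apply/seteqP; split => x /=; rewrite /affine/= !in_itv/= mul1r -natr1 => /andP[? ?]; apply/andP; lra.
have := J_affine n%:R ltr01 mW (measurable_itv `[n%:R, n.+1%:R[) (@measurableT _ T).
rewrite powR1 mul1e A1 preimage_setT => <-.
apply: J_ext => x y _ _; rewrite !mul1r !cell_addn; congr `|_|; ring.
Qed.

Lemma int_cell_addn (n : nat) : (\int[mu]_(x in `[0%R, n%:R[) (`|W x - H * x| `^ p)%:E =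
  n%:R%:E * \int[mu]_(x in `[0%R, 1%R[) (`|W x - H * x| `^ p)%:E)%E.
Proof.
pose f (x : R) : \bar R := (`|W x - H * x| `^ p)%:E.
have mf (D : set R) : measurable_fun D f.
  apply: measurable_powabs; apply: measurable_funB => //; exact: measurable_funTS.
have f0 x : (0 <= f x)%E by rewrite lee_fin powR_ge0.
rewrite -/f.
elim: n => [|n IH].
  rewrite mul0e (_ : `[0, 0%:R[%classic = set0) ?integral_set0//.
  by apply/seteqP; split => x //=; rewrite in_itv/= => /andP[/le_lt_trans h /h]; rewrite ltxx.
have -> : `[0%R, n.+1%:R[%classic = `[0%R, n%:R[%classic `|` `[n%:R, n.+1%:R[%classic :> set R.
  apply/seteqP; split => x /=; rewrite !in_itv/=.
    by move=> /andP[x0 x1]; have [?|?] := ltP x n%:R; [left; rewrite x0|right].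
  have n1 : n%:R <= n.+1%:R :> R by rewrite ler_nat.
  move=> [/andP[x0 x1]|/andP[x0 x1]]; apply/andP; split => //.
    exact: lt_le_trans n1.
  by apply: le_trans x0.
have dj : [disjoint (`[0%R, n%:R[%classic : set R) & `[n%:R, n.+1%:R[].
  rewrite disj_set2E; apply/eqP; rewrite -subset0 => x [/=]; rewrite !in_itv/= => /andP[_ h] /andP[/le_lt_trans/(_ h)].
  by rewrite ltxx.
have -> := ge0_integral_setU mu (measurable_itv _) (measurable_itv _) (mf _) (fun x _ => f0 x) dj.
rewrite IH; have -> : n.+1%:R%:E = (n%:R%:E + 1%:E :> \bar R)%E by rewrite -EFinD natr1.
rewrite ge0_muleDl ?lee_fin// mul1e; congr (_ + _)%E.
have A1 : affine 1 n%:R @^-1` `[n%:R, n.+1%:R[%classic = `[0%R, 1%R[%classic :> set R.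
  apply/seteqP; split => x /=; rewrite /affine/= !in_itv/= mul1r -natr1 => /andP[? ?]; apply/andP; lra.
rewrite -A1.
have := @ge0_integral_affine _ 1 n%:R `[n%:R, n.+1%:R[%classic f ltr01 (measurable_itv _) (mf _) (fun x _ => f0 x).
rewrite invr1 mul1e => <-.
apply: eq_integral => x _; rewrite /f mul1r cell_addn; congr ((`|_| `^ _)%:E); ring.
Qed.

End OneSlope.

Lemma not_negligible_itv (N : set T) (a b : R) : mu.-negligible N -> a < b ->
  exists x : R, a < x < b /\ ~ N x.
Proof.
move=> [B [mB B0 NB]] ab; apply: contrapT => H.
have sub : `]a, b[%classic `<=` B.
  move=> x /=; rewrite in_itv/= => xab; apply: NB; apply: contrapT => nx; apply: H.
  by exists x.
have : (mu (`]a, b[%classic : set T) <= mu B)%E.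
  by apply: le_measure => //; rewrite inE; [exact: measurable_itv|exact: mB].
rewrite B0 lebesgue_measure_itv/= lte_fin ab -EFinD lee_fin => h.
by move: ab; rewrite -subr_gt0 ltNge h.
Qed.

(** If [kappaE] exceeded some [K > 1], the lower bound for the constant family equal to the identity
    on []0, 1[], with energy at most 1, would give [K * (y - x) <= W y - W x <= 1] for almost all
    [x < y]; this fails for [x] near 0 and [y] near 1. *)
Lemma kappaE_le1 : (kappaE <= 1)%E.
Proof.
rewrite leNgt; apply/negP => k1.
have [K K1 Kk] : exists2 K : R, 1 < K & (K%:E <= kappaE)%E.
  case: kappaE k1 => [k|_|//]; last by exists 2; rewrite ?leey// ltr1n.
  by rewrite lte_fin => k1; exists k.
pose I : set T := `]0%R, 1%R[%classic.
have mI : measurable I by exact: measurable_itv.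
have mid : measurable_fun setT ((fun x : T => x) \_ I).
  by apply/(measurable_restrictT _ _).1.
have mLid : mLp I (fun x : T => x).
  split; first exact: mid.
  apply: (@le_lt_trans _ _ (\int[mu]_(x in I) (cst 1%E x))%E).
    apply: ge0_le_integral => //.
    all: try by move=> x _; rewrite lee_fin powR_ge0.
    - exact: measurable_powabs.
    - move=> x; rewrite /I/= in_itv/= => /andP[x0 x1]; rewrite lee_fin.
      have h : `|x| <= 1 by rewrite ger0_norm; exact: ltW.
      by have := ler_powRp (normr_ge0 x) h; rewrite powR1.
  suff : (mu I < +oo)%E by rewrite integral_cst// mul1e.
  by rewrite /I lebesgue_measure_itv/= lte_fin ltr01 oppr0 adde0 ltry.
have [|||||G [W [negG Wnd W01 GW]]] :=
    @liminf_slopes I (fun x => x) (fun _ x => x) K 1 mI (@interval_is_interval _ `]0, 1[) mLid (fun _ _ => mLid).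
- move=> e e0; exists 1 => // d _; rewrite integral0_eq ?lee_fin ?ltW// => x _.
  by rewrite subrr normr0 powR0 ?gt_eqF.
- move=> d0 d00; exists (d0 / 2); first by rewrite divr_gt0//= ltr_pdivrMr// ltr_pMr// ltr1n.
  have d2 : 0 < d0 / 2 by rewrite divr_gt0.
  apply: le_trans (Ld_id_le1 d2); rewrite le_eqVlt; apply/orP; left; apply/eqP.
  rewrite /Ld; congr (_ * _)%E; apply: J_ext => x y Ix Iy.
  by rewrite !patchE !mem_set.
- exact: ler01.
- by rewrite ltW// (lt_trans ltr01).
- exact: Kk.
(* With [x < e] and [y > 1 - e], the difference [y - x] exceeds [1 - 2 * e = K^-1]. *)
pose e := (1 - K^-1) / 2.
have Ki : 0 < K^-1 by rewrite invr_gt0 (lt_trans ltr01).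
have Ki1 : K^-1 < 1 by rewrite invf_lt1// (lt_trans ltr01).
have e0 : 0 < e by rewrite divr_gt0// subr_gt0.
have e1 : e < 1 / 2 by rewrite /e; lra.
have [x [/andP[x0 xe] nx]] := not_negligible_itv negG e0.
have [|y [/andP[ye y1] ny]] := @not_negligible_itv _ (1 - e) 1 negG; first by lra.
have Ix : I x by rewrite /I/= in_itv/= x0; lra.
have Iy : I y by rewrite /I/= in_itv/= y1 andbT; lra.
have Gx : G x by apply: contrapT => n; apply: nx.
have Gy : G y by apply: contrapT => n; apply: ny.
have xy : x < y by lra.
have yx0 : 0 < y - x by rewrite subr_gt0.
have := GW x y Ix Iy Gx Gy xy; rewrite gtr0_norm//.
rewrite -(mulr_powRB1 (ltW yx0) p_gt0) mulrA [leRHS]mulrC ler_pM2r ?powR_gt0//.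
have := W01 x; have := W01 y => /andP[_ Wy] /andP[Wx _].
have Kyx : 1 < K * (y - x).
  rewrite -(@ltr_pM2l _ K^-1)// mulrA mulVf ?mul1r ?mulr1; last by rewrite gt_eqF// (lt_trans ltr01).
  by move: xe ye; rewrite /e; lra.
lra.
Qed.

Definition kappa : R := fine kappaE.

Lemma kappa_fin : kappaE = kappa%:E.
Proof.
rewrite /kappa fineK// fin_numE; apply/andP; split; apply/eqP => k.
  by have := kappaE_ge0; rewrite k.
by have := kappaE_le1; rewrite k.
Qed.

Lemma kappa_itv : 0 <= kappa <= 1.
Proof. by have := kappaE_ge0; have := kappaE_le1; rewrite kappa_fin !lee_fin => -> ->. Qed.

(** * Upper bound: staircases made of rescaled cells *)

Definition slope_fun (W : T -> R) (A s : R) (n : nat) (z L : R) : T -> R :=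
  fun x => A + s * W (n%:R * (x - z) / L).

Lemma slope_fun_affine (W : T -> R) (A s : R) (n : nat) (z L : R) :
  slope_fun W A s n z L = fun x : T => A + s * W (n%:R / L * x + - (n%:R / L * z)).
Proof. by apply/funext => x; rewrite /slope_fun mulrAC mulrBr. Qed.

Lemma measurable_slope_fun (W : T -> R) (A s : R) (n : nat) (z L : R) : measurable_fun setT W ->
  measurable_fun setT (slope_fun W A s n z L).
Proof.
move=> mW; rewrite slope_fun_affine; apply: measurable_funD => //; apply: measurable_funM => //.
by apply: (measurableT_comp mW); exact: (measurable_affine (n%:R / L) (- (n%:R / L * z))).
Qed.

Lemma affine_preimage_cell (n : nat) (z L : R) : (0 < n)%N -> 0 < L ->
  affine (n%:R / L) (- (n%:R / L * z)) @^-1` `[0%R, n%:R[%classic = `[z, (z + L)%R[%classic.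
Proof.
move=> n0 L0; have a0 : 0 < n%:R / L by rewrite divr_gt0// ltr0n.
have E : n%:R = n%:R / L * L by rewrite divfK// gt_eqF.
move: a0 E; set a := n%:R / L => a0 E.
have H1 x : (a * x + - (a * z) < n%:R) = (x < z + L).
  by rewrite ltrBlDr E -mulrDr ltr_pM2l// [L + z]addrC.
have H2 x : (0 <= a * x + - (a * z)) = (z <= x) by rewrite subr_ge0 ler_pM2l.
by apply/seteqP; split => x /=; rewrite /affine !in_itv/= H1 H2.
Qed.

(** Rescaling contributes the factor [(n / L) ^ (p - 1)] and the number of cells a factor [n];
    together with [H ^ p] they form the energy of a segment of rise [n H] and length [L]. *)
Lemma slope_fun_J (W : T -> R) (H theta D A s : R) (n : nat) (z L : R) : cell W H theta ->
  (J W `[0%R, 1%R[%classic setT <= (D * H `^ p)%:E)%E -> `|s| = 1 -> 0 < L ->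
  (J (slope_fun W A s n z L) `[z, (z + L)%R[%classic `[z, (z + L)%R[%classic <=
   (D * ((n%:R * H) `^ p / L `^ (p - 1)))%:E)%E.
Proof.
move=> cW JD s1 L0; have [[mW H0 t0] _ _ _] := cW.
have [->|n0] := posnP n.
  rewrite J_eq0; last by move=> x y _ _; rewrite /slope_fun !mul0r (cell0 cW).
  by rewrite mul0r powR0 ?gt_eqF// mul0r mulr0.
have a0 : 0 < n%:R / L by rewrite divr_gt0// ltr0n.
pose b := - (n%:R / L * z).
have -> : J (slope_fun W A s n z L) `[z, (z + L)%R[%classic `[z, (z + L)%R[%classic =
    J (fun x : T => W (n%:R / L * x + b)) `[z, (z + L)%R[%classic `[z, (z + L)%R[%classic.
  apply: J_ext => x y _ _; rewrite slope_fun_affine.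
  rewrite (_ : A + _ - _ = s * (W (n%:R / L * x + b) - W (n%:R / L * y + b))); last by rewrite /b; ring.
  by rewrite normrM s1 mul1r.
rewrite -(affine_preimage_cell z n0 L0) -/b.
have mC : measurable (`[0%R, n%:R[%classic : set T) by exact: measurable_itv.
rewrite (J_affine b a0 mW mC mC).
have q0 : (0 <= ((n%:R / L) `^ (p - 1))%:E)%E by rewrite lee_fin powR_ge0.
apply: (@le_trans _ _ (((n%:R / L) `^ (p - 1))%:E * (n%:R%:E * (D * H `^ p)%:E))%E).
  apply: lee_wpmul2l => //.
  apply: (@le_trans _ _ (J W `[0%R, n%:R[%classic setT)); first exact: J_le.
  by rewrite (J_cell_addn cW); apply: lee_wpmul2l => //; rewrite lee_fin.
rewrite -!EFinM lee_fin le_eqVlt; apply/orP; left; apply/eqP.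
have n0' : 0 < n%:R :> R by rewrite ltr0n.
rewrite !powRM ?invr_ge0 ?(ltW n0') ?(ltW L0) ?(ltW H0)//.
rewrite -(mulr_powRB1 (ltW n0') p_gt0).
have -> : L^-1 `^ (p - 1) = (L `^ (p - 1))^-1.
  by rewrite -powR_inv1 ?(ltW L0)// -powRrM mulN1r powRN.
by ring.
Qed.

(** [W x - H x] is periodic, so the distance to the chord does not grow with [n]; a later
    multiplication by [d] makes it small. *)
Lemma slope_fun_Lp (W : T -> R) (H theta E0 A s : R) (n : nat) (z L : R) : cell W H theta ->
  (\int[mu]_(x in `[0%R, 1%R[) (`|W x - H * x| `^ p)%:E <= E0%:E)%E -> `|s| = 1 -> 0 < L ->
  (\int[mu]_(x in `[z, (z + L)%R[) (`|slope_fun W A s n z L x - (A + s * (n%:R * H) * ((x - z) / L))| `^ p)%:E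
    <= (L * E0)%:E)%E.
Proof.
move=> cW WE s1 L0; have [[mW H0 t0] _ _ _] := cW.
pose f (x : R) : \bar R := (`|W x - H * x| `^ p)%:E.
have mf (D : set R) : measurable_fun D f.
  apply: measurable_powabs; apply: measurable_funB => //; exact: measurable_funTS.
have f0 x : (0 <= f x)%E by rewrite lee_fin powR_ge0.
have E00 : 0 <= E0 by rewrite -lee_fin; apply: le_trans WE; apply: integral_ge0 => x _; exact: f0.
have [->|n0] := posnP n.
  rewrite integral0_eq ?lee_fin ?mulr_ge0 ?(ltW L0)// => x _.
  by rewrite /slope_fun !mul0r (cell0 cW) !mulr0 mul0r subrr normr0 powR0// gt_eqF.
have a0 : 0 < n%:R / L by rewrite divr_gt0// ltr0n.
pose b := - (n%:R / L * z).
have -> : (\int[mu]_(x in `[z, (z + L)%R[) (`|slope_fun W A s n z L x - (A + s * (n%:R * H) * ((x - z) / L))| `^ p)%:E =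
    \int[mu]_(x in `[z, (z + L)%R[) f (n%:R / L * x + b)%R)%E.
  apply: eq_integral => x _; rewrite slope_fun_affine /f -/b; congr ((_ `^ _)%:E).
  rewrite (_ : _ - _ = s * (W (n%:R / L * x + b) - H * (n%:R / L * x + b))); last by rewrite /b; ring.
  by rewrite normrM s1 mul1r.
rewrite -(affine_preimage_cell z n0 L0) -/b.
rewrite (@ge0_integral_affine _ (n%:R / L) b _ f a0 (measurable_itv _) (mf _)); last by move=> x _; exact: f0.
rewrite (int_cell_addn cW) muleA -EFinM invf_div.
rewrite (_ : L / n%:R * n%:R = L); last by rewrite divfK// pnatr_eq0 -lt0n.
by rewrite EFinM; apply: lee_wpmul2l => //; rewrite lee_fin ltW.
Qed.

(** A polygon is encoded by its first node [(z, a)] together with the list of the following nodes,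
    so that recursion runs from left to right. *)
Fixpoint incr (z : R) (s : seq (R * R)) : Prop :=
  if s is (z', _) :: s' then z < z' /\ incr z' s' else True.

Fixpoint lastz (z : R) (s : seq (R * R)) : R := if s is (z', _) :: s' then lastz z' s' else z.

Fixpoint lastv (a : R) (s : seq (R * R)) : R := if s is (_, a') :: s' then lastv a' s' else a.

Fixpoint interp (z a : R) (s : seq (R * R)) (x : R) : R :=
  if s is (z', a') :: s' then
    (if x < z' then a + (a' - a) * ((x - z) / (z' - z)) else interp z' a' s' x)
  else a.

Fixpoint slope_energy (z a : R) (s : seq (R * R)) : R :=
  if s is (z', a') :: s' then
    `|a' - a| `^ p / (z' - z) `^ (p - 1) + slope_energy z' a' s'
  else 0.

(** Node values are rounded down to multiples of [delta * H], so that every affine piece rises by an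
    integral number of cells. *)
Definition quant (H delta a : R) : int := Num.floor (a / (delta * H)).

(** The staircase is in units of [delta]: it is [delta * stair] that approximates the polygon. A
    piece that descends uses cells with reversed sign, and the end value of a piece is the start
    value of the next. *)
Fixpoint stair (W : T -> R) (H delta z a : R) (s : seq (R * R)) : T -> R :=
  if s is (z', a') :: s' then
    let m := quant H delta a' - quant H delta a in
    fun x => if (x : R) < z' then
        slope_fun W ((quant H delta a)%:~R * H) ((-1) ^+ (m < 0)%R) `|m|%N z (z' - z) x
      else stair W H delta z' a' s' x
  else fun=> (quant H delta a)%:~R * H.

Lemma lastz_ge z s : incr z s -> z <= lastz z s.
Proof. by elim: s z => //= -[z' a'] s IH z [zz' /IH]; apply: le_trans; exact: ltW. Qed.

Lemma measurable_stair (W : T -> R) (H delta z a : R) (s : seq (R * R)) : measurable_fun setT W ->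
  measurable_fun setT (stair W H delta z a s).
Proof.
move=> mW; elim: s z a => [|[z' a'] s IH] z a; first exact: measurable_cst.
apply: measurable_fun_ifT => //; last exact: measurable_slope_fun.
by apply: (@measurable_fun_ltr _ _ _ setT (fun t : R => t) (cst z')).
Qed.

Lemma quantP (H delta a : R) : 0 < H -> 0 < delta ->
  a - delta * H < delta * ((quant H delta a)%:~R * H) <= a.
Proof.
move=> H0 d0; have dH : 0 < delta * H by rewrite mulr_gt0.
have := floor_itv (a / (delta * H)); rewrite -/(quant H delta a) => /andP[q1 q2].
rewrite mulrCA; apply/andP; split; last by rewrite -ler_pdivlMr.
by move: q2; rewrite ltr_pdivrMr// intrD mulrDl mul1r ltrBlDr.
Qed.

Lemma powR_add_cvg (a h : R) : 0 <= a -> 0 < h -> (a + t * h) `^ p @[t --> 0^'+] --> a `^ p.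
Proof.
rewrite le_eqVlt => /predU1P[<- h0|a0 h0].
  rewrite powR0 ?gt_eqF//.
  have : (t `^ p * h `^ p) @[t --> 0^'+] --> 0 * h `^ p.
    by apply: cvgMl; exact: powR_cvg0.
  rewrite mul0r; apply: cvg_trans; apply: near_eq_cvg; near=> t.
  by rewrite add0r powRM// ltW.
apply: (@cvg_comp _ _ _ (fun t => a + t * h) (fun x => x `^ p) _ (nbhs a)); last first.
  have : derivable (fun x : R => x `^ p) a 1 by apply: derivable_powR; rewrite in_itv/= a0.
  by move=> /derivable1_diffP/differentiable_continuous; exact.
apply: cvg_at_right_filter; rewrite -[X in _ --> X]addr0 -[X in _ + X](mul0r h).
by apply: cvgD; [exact: cvg_cst|apply: cvgMl; exact: cvg_id].
Unshelve. all: by end_near. Qed.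

Lemma sqrt_cvg0 (C : R) : 0 <= C -> forall e : R, 0 < e -> \forall d \near 0^'+, Num.sqrt d * C <= e.
Proof.
move=> C0 e e0.
have C1 : 0 < C + 1 by rewrite ltr_wpDl.
have q0 : 0 < (e / (C + 1)) ^+ 2 by rewrite exprn_gt0// divr_gt0.
near=> d.
have d0 : 0 < d by near: d; exact: nbhs_right_gt.
have : Num.sqrt d <= e / (C + 1).
  have q1 : 0 <= e / (C + 1) by rewrite ltW// divr_gt0.
  rewrite -[leRHS](ger0_norm q1) -sqrtr_sqr; apply: ler_wsqrtr.
  by near: d; exact: nbhs_right_le.
rewrite ler_pdivlMr//; apply: le_trans.
by apply: ler_wpM2l; [exact: sqrtr_ge0|rewrite lerDl].
Unshelve. all: by end_near. Qed.

(** For plateaus of width [eta0 * d], [J_junction] is used with [r = sqrt d]: the near part is of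
    order [r], since [d ^ p * d ^ (- p)] cancels, and the far part is of order [r ^ p <= r]. *)
Lemma J_junction_small u A B (c eta0 m d : R) : measurable_fun setT u -> measurable A -> measurable B ->
  A `<=` `]-oo, c] /\ B `<=` `[c, +oo[ \/ A `<=` `[c, +oo[ /\ B `<=` `]-oo, c] ->
  0 < eta0 -> 0 < d <= 1 -> 0 <= m -> (mu A <= m%:E)%E ->
  (forall x y, A x -> B y -> `|x - y| < eta0 * d -> u x = u y) ->
  ((d `^ p)%:E * J u A B <= (Num.sqrt d * (2 * beta / p * (2 * eta0 `^ (- p) + m)))%:E)%E.
Proof.
move=> mu_ mA mB AB e0 /andP[d0 d1] m0 mAm near0.
pose r := Num.sqrt d.
have r0 : 0 < r by rewrite sqrtr_gt0.
have r1 : r <= 1 by rewrite -sqrtr1; exact: ler_wsqrtr.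
have rr : r * r = d by rewrite -expr2 sqr_sqrtr// ltW.
have dp0 : (0 <= (d `^ p)%:E :> \bar R)%E by rewrite lee_fin powR_ge0.
have ed0 : 0 < eta0 * d by rewrite mulr_gt0.
have := J_junction mu_ mA mB AB ed0 r0 mAm near0.
move=> /(lee_wpmul2l dp0) /le_trans; apply; rewrite -EFinM lee_fin mulrCA [leRHS]mulrCA.
apply: ler_wpM2l; first exact: bp_ge0.
have inv (x : R) : 0 < x -> x `^ p * x `^ (- p) = 1.
  by move=> x0; rewrite -powRD ?subrr ?powRr0 ?(gt_eqF x0) ?implybT.
have E1 : d `^ p * ((eta0 * d) `^ (- p) * (2 * r)) = r * (2 * eta0 `^ (- p)).
  rewrite powRM ?(ltW e0) ?(ltW d0)//.
  rewrite (_ : _ * _ = (d `^ p * d `^ (- p)) * (r * (2 * eta0 `^ (- p)))); last by ring.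
  by rewrite inv// mul1r.
have E2 : d `^ p * (r `^ (- p) * m) = r `^ p * m.
  rewrite -rr powRM ?(ltW r0)//.
  rewrite (_ : _ * _ = (r `^ p * r `^ (- p)) * (r `^ p * m)); last by ring.
  by rewrite inv// mul1r.
rewrite mulrDr E1 E2 mulrDr lerD2l; apply: ler_wpM2r => //.
by apply: ge1r_powR => //; rewrite r0.
Qed.

Section StairSpec.
Variables (W : T -> R) (H theta D E0 : R).
Hypothesis cW : cell W H theta.
Hypothesis JD : (J W `[0%R, 1%R[%classic setT <= (D * H `^ p)%:E)%E.
Hypothesis WE : (\int[mu]_(x in `[0%R, 1%R[) (`|W x - H * x| `^ p)%:E <= E0%:E)%E.
Hypothesis D_ge0 : 0 <= D.
Hypothesis E0_ge0 : 0 <= E0.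

Let mW : measurable_fun setT W. Proof. by case: cW => -[]. Qed.
Let H_gt0 : 0 < H. Proof. by case: cW => -[]. Qed.
Let theta_gt0 : 0 < theta. Proof. by case: cW => -[]. Qed.

(** The plateaus of width [eta * d] at the two ends are what the induction over the nodes needs:
    they keep the interaction across a junction small. *)
Definition stair_ok (z a : R) (s : seq (R * R)) (e eta d : R) : Prop :=
  let U := stair W H d z a s in let l := lastz z s in
  [/\ forall x : R, z <= x < z + eta * d -> U x = (quant H d a)%:~R * H,
      forall x : R, z <= x -> l - eta * d < x -> U x = (quant H d (lastv a s))%:~R * H,
      ((d `^ p)%:E * J U `[z, l[%classic `[z, l[%classic <= (D * slope_energy z a s + e)%:E)%E &
      (\int[mu]_(x in `[z, l[) (`|d * U x - interp z a s x| `^ p)%:E <= e%:E)%E].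

Lemma quant_diff (d a a' : R) : 0 < d ->
  `|d * ((quant H d a' - quant H d a)%:~R * H)| <= `|a' - a| + d * H.
Proof.
move=> d0; have /andP[h1 h2] := quantP a H_gt0 d0; have /andP[h3 h4] := quantP a' H_gt0 d0.
rewrite intrD rmorphN/= mulrDl mulrDr mulNr mulrN ler_norml.
have := ler_norm (a' - a); have := ler_norm (- (a' - a)); rewrite normrN.
by move=> ? ?; apply/andP; lra.
Qed.

(* The quantised slope is at most [(|a' - a| + d H) / L], so each of its [n] cells has length of
   order [d] and the flat parts of the cells have length at least [eta d]. *)
Lemma slope_flat (d z z' a a' eta x : R) : 0 < d <= 1 -> z < z' ->
  eta * (`|a' - a| + H) <= theta * (z' - z) * H -> 0 <= eta ->
  let m := quant H d a' - quant H d a in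
  `|x| < eta * d -> `| `|m|%N%:R * x / (z' - z)| <= theta.
Proof.
move=> /andP[d0 d1] zz eta1 eta0 m xe.
have L0 : 0 < z' - z by rewrite subr_gt0.
rewrite normrM normfV (gtr0_norm L0) ler_pdivrMr// normrM normr_nat.
have md : d * (`|m|%N%:R * H) <= `|a' - a| + H.
  have := quant_diff a a' d0; rewrite -/m !normrM (gtr0_norm d0) (gtr0_norm H_gt0).
  rewrite -intr_norm -abszE -pmulrn => /le_trans; apply.
  by rewrite lerD2l ler_piMl// ltW.
rewrite -(ler_pM2r H_gt0); apply: le_trans eta1.
apply: (@le_trans _ _ (`|m|%N%:R * (eta * d) * H)).
  by apply: ler_wpM2r; [exact: ltW|apply: ler_wpM2l => //; exact: ltW].
rewrite (_ : _ * _ * H = eta * (d * (`|m|%N%:R * H))); last by ring.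
exact: ler_wpM2l.
Qed.

Let slope (z a z' a' d : R) : T -> R := let m := quant H d a' - quant H d a in
  slope_fun W ((quant H d a)%:~R * H) ((-1) ^+ (m < 0)%R) `|m|%N z (z' - z).

Let sgn_abs (m : int) : (-1) ^+ (m < 0)%R * `|m|%N%:R = m%:~R :> R.
Proof. by rewrite [in RHS](intEsign m) rmorphM/= rmorphXn/= rmorphN1 -pmulrn. Qed.

Lemma slope_start (z a z' a' eta d x : R) : 0 < d <= 1 -> z < z' ->
  eta * (`|a' - a| + H) <= theta * (z' - z) * H -> 0 <= eta ->
  `|x - z| < eta * d -> slope z a z' a' d x = (quant H d a)%:~R * H.
Proof.
move=> d01 zz e1 e0 xe; rewrite /slope /slope_fun.
have [_ _ W0 _] := cW; rewrite W0 ?mulr0 ?addr0//.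
exact: slope_flat xe.
Qed.

Lemma slope_end (z a z' a' eta d x : R) : 0 < d <= 1 -> z < z' ->
  eta * (`|a' - a| + H) <= theta * (z' - z) * H -> 0 <= eta ->
  `|x - z'| < eta * d -> slope z a z' a' d x = (quant H d a')%:~R * H.
Proof.
move=> d01 zz e1 e0 xe; rewrite /slope /slope_fun.
set m := quant H d a' - quant H d a.
have L0 : z' - z != 0 by rewrite subr_eq0 gt_eqF.
have -> : `|m|%N%:R * (x - z) / (z' - z) = `|m|%N%:R * (x - z') / (z' - z) + `|m|%N%:R.
  by field.
rewrite (cell_addn cW); have [_ _ W0 _] := cW; rewrite W0; last exact: slope_flat xe.
by rewrite add0r mulrA sgn_abs -mulrDl /m rmorphB/= addrC subrK.
Qed.

Lemma slope_J (z a z' a' d : R) : 0 < d -> z < z' ->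
  ((d `^ p)%:E * J (slope z a z' a' d) `[z, z'[%classic `[z, z'[%classic <=
   (D * ((`|a' - a| + d * H) `^ p / (z' - z) `^ (p - 1)))%:E)%E.
Proof.
move=> d0 zz; have L0 : 0 < z' - z by rewrite subr_gt0.
set m := quant H d a' - quant H d a.
have s1 : `|(-1) ^+ (m < 0)%R| = 1 :> R by exact: normr_sign.
have := @slope_fun_J W H theta D ((quant H d a)%:~R * H) _ `|m|%N z _ cW JD s1 L0.
rewrite (_ : z + (z' - z) = z'); last by rewrite addrC subrK.
have dp0 : (0 <= (d `^ p)%:E :> \bar R)%E by rewrite lee_fin powR_ge0.
move=> /(lee_wpmul2l dp0) /le_trans; apply; rewrite -EFinM lee_fin mulrCA.
apply: ler_wpM2l => //; rewrite mulrA; apply: ler_wpM2r; first by rewrite invr_ge0 powR_ge0.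
rewrite -powRM; [|exact: ltW|by rewrite mulr_ge0// ltW].
apply: ler_powRp; first by rewrite !mulr_ge0// ltW.
have := quant_diff a a' d0; rewrite -/m !normrM (gtr0_norm d0) (gtr0_norm H_gt0).
by rewrite -intr_norm -abszE -pmulrn.
Qed.

Lemma slope_Lp (z a z' a' d : R) : 0 < d -> z < z' ->
  (\int[mu]_(x in `[z, z'[) (`|d * slope z a z' a' d x - (a + (a' - a) * ((x - z) / (z' - z)))| `^ p)%:E <=
   (2 `^ p * (d `^ p * ((z' - z) * E0) + (d * H) `^ p * (z' - z)))%:E)%E.
Proof.
move=> d0 zz; have L0 : 0 < z' - z by rewrite subr_gt0.
set m := quant H d a' - quant H d a.
have s1 : `|(-1) ^+ (m < 0)%R| = 1 :> R by exact: normr_sign.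
pose A := (quant H d a)%:~R * H.
pose aff (x : R) := A + (-1) ^+ (m < 0)%R * (`|m|%N%:R * H) * ((x - z) / (z' - z)).
have := @slope_fun_Lp W H theta E0 A _ `|m|%N z _ cW WE s1 L0.
rewrite (_ : z + (z' - z) = z'); last by rewrite addrC subrK.
rewrite -/(slope z a z' a' d) => sLp.
have mv : measurable_fun setT (slope z a z' a' d) by exact: measurable_slope_fun.
have maff : measurable_fun setT (aff : T -> R).
  apply: measurable_funD => //; apply: measurable_funM => //; apply: measurable_funM => //.
  exact: measurable_funB.
have mI : measurable (`[z, z'[%classic : set T) by exact: measurable_itv.
pose f1 (x : T) : \bar R := (`|slope z a z' a' d x - aff x| `^ p)%:E.
have mf1 : measurable_fun `[z, z'[%classic f1.
  by apply: measurable_powabs; apply: measurable_funTS; exact: measurable_funB.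
have f10 (x : T) : (0 <= f1 x)%E by rewrite lee_fin powR_ge0.
have c0 : 0 <= (2 : R) `^ p by exact: powR_ge0.
have cd0 : 0 <= d `^ p by exact: powR_ge0.
pose f2 (x : T) : \bar R := ((2 `^ p * d `^ p)%:E * f1 x + (2 `^ p * (d * H) `^ p)%:E)%E.
have mf2 : measurable_fun `[z, z'[%classic f2.
  by apply: emeasurable_funD => //; exact: emeasurable_funM.
apply: (@le_trans _ _ (\int[mu]_(x in `[z, z'[) f2 x)%E).
  apply: ge0_le_integral => //.
  - apply: measurable_powabs; apply: measurable_funTS; apply: measurable_funB.
      exact: measurable_funM.
    apply: measurable_funD => //; apply: measurable_funM => //; apply: measurable_funM => //.
    exact: measurable_funB.
  - move=> x /=; rewrite in_itv/= => /andP[zx xz].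
    rewrite /f2 /f1 -EFinM -EFinD lee_fin -!mulrA -mulrDr.
    rewrite -powRM ?normr_ge0 ?(ltW d0)//.
    apply: le_trans (powR_addr_le _ _); [|by rewrite mulr_ge0// ltW|by rewrite mulr_ge0// ltW].
    apply: ler_powRp => //.
    set G := a + _; set v := slope _ _ _ _ _ _.
    have -> : d * v - G = d * (v - aff x) + (d * aff x - G) by ring.
    apply: le_trans (ler_normD _ _) _; rewrite [`|d * _|]normrM (gtr0_norm d0) lerD2l /aff [_ * (_%:R * H)]mulrA sgn_abs /G.
    have := quantP a H_gt0 d0; have := quantP a' H_gt0 d0; rewrite /A /m rmorphB/=.
    set qa := (quant H d a)%:~R; set qa' := (quant H d a')%:~R; set t := (x - z) / _.
    move=> /andP[h1 h2] /andP[h3 h4].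
    have t0 : 0 <= t by rewrite divr_ge0 ?subr_ge0// ltW.
    have t1 : 0 <= 1 - t by rewrite subr_ge0 ler_pdivrMr// mul1r lerD2r ltW.
    (* The rounding error along the piece is a convex combination of the rounding errors at its two
       ends, each at most [d * H]. *)
    rewrite (_ : _ - _ = (d * (qa * H) - a) * (1 - t) + (d * (qa' * H) - a') * t); last by ring.
    have H3 : `|d * (qa * H) - a| <= d * H by rewrite ler_norml; apply/andP; split; lra.
    have H4 : `|d * (qa' * H) - a'| <= d * H by rewrite ler_norml; apply/andP; split; lra.
    clearbody t; apply: le_trans (ler_normD _ _) _.
    rewrite [`|_ * t|]normrM [`|_ * (1 - t)|]normrM (ger0_norm t0) (ger0_norm t1).
    apply: le_trans (lerD (ler_wpM2r t1 H3) (ler_wpM2r t0 H4)) _.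
    by rewrite -mulrDr subrK mulr1.
rewrite /f2 ge0_integralD//; last first.
- by move=> x _; rewrite lee_fin mulr_ge0// powR_ge0.
- exact: emeasurable_funM.
- by move=> x _; rewrite mule_ge0// lee_fin mulr_ge0.
rewrite ge0_integralZl ?lee_fin ?mulr_ge0//.
have muI : mu (`[z, z'[%classic : set T) = (z' - z)%:E by rewrite lebesgue_measure_itv/= lte_fin zz EFinB.
rewrite integral_cst// [X in (_ + _ * X)%E]muI -EFinM.
rewrite [leRHS](_ : _ = ((2 `^ p * d `^ p)%:E * ((z' - z) * E0)%:E + (2 `^ p * (d * H) `^ p * (z' - z))%:E)%E);
  last by rewrite -EFinM -EFinD; congr EFin; ring.
apply: leeD => //; apply: lee_wpmul2l; first by rewrite lee_fin mulr_ge0.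
exact: sLp.
Qed.

Lemma J_split u A B : measurable_fun setT u -> measurable A -> measurable B -> [disjoint A & B] ->
  J u (A `|` B) (A `|` B) = (J u A A + J u A B + (J u A B + J u B B))%E.
Proof.
move=> m mA mB d; have mAB : measurable (A `|` B) by exact: measurableU.
rewrite (J_setUl m mA mB mAB d) (J_setUr m mA mB mA d) (J_setUr m mA mB mB d) (J_sym m mB mA).
reflexivity.
Qed.

(** Error budget for the energy: [e / 4] for the rounded slope of the first piece, [e / 2] for the
    remaining ones, and [e / 8] for each of the two symmetric cross interactions. The L^p error is
    split in halves. *)
Lemma stair_step (z a z' a' : R) (s : seq (R * R)) (e eta eta1 d : R) :
  0 < d <= 1 -> z < z' -> incr z' s -> 0 < eta -> eta <= eta1 ->
  eta * (`|a' - a| + H) <= theta * (z' - z) * H -> eta * d <= z' - z ->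
  stair_ok z' a' s (e / 2) eta1 d ->
  Num.sqrt d * (2 * beta / p * (2 * eta `^ (- p) + (z' - z))) <= e / 8 ->
  D * ((`|a' - a| + d * H) `^ p / (z' - z) `^ (p - 1)) <=
    D * (`|a' - a| `^ p / (z' - z) `^ (p - 1)) + e / 4 ->
  2 `^ p * (d `^ p * ((z' - z) * E0) + (d * H) `^ p * (z' - z)) <= e / 2 ->
  stair_ok z a ((z', a') :: s) e eta d.
Proof.
move=> d01 zz incs eta0 eta01 etat etaL [Sa Sb SJ SL] hJ hS hL.
have /andP[d0 d1] := d01.
have edle : eta * d <= eta1 * d by rewrite ler_wpM2r// ltW.
have ed0 : 0 < eta * d by rewrite mulr_gt0.
have ed10 : 0 < eta1 * d by rewrite mulr_gt0// (lt_le_trans eta0).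
pose U : T -> R := stair W H d z a ((z', a') :: s).
pose U' : T -> R := stair W H d z' a' s.
pose l := lastz z' s.
have zl : z' <= l by exact: lastz_ge.
have Ult (x : R) : x < z' -> U x = slope z a z' a' d x by move=> xz; rewrite /U /= xz.
have Uge (x : R) : z' <= x -> U x = U' x by move=> xz; rewrite /U /= ltNge xz.
have Uend (x : R) : x < z' -> z' - eta * d < x -> U x = (quant H d a')%:~R * H.
  move=> xz' zx; rewrite Ult//; apply: slope_end d01 zz etat (ltW eta0) _.
  by rewrite distrC gtr0_norm ?subr_gt0//; lra.
have mU : measurable_fun setT U by exact: measurable_stair.
pose A : set T := `[z, z'[%classic; pose B : set T := `[z', l[%classic.
have mA : measurable A by exact: measurable_itv.
have mB : measurable B by exact: measurable_itv.
have dAB : [disjoint A & B].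
  rewrite disj_set2E; apply/eqP; rewrite -subset0 => x [] /=.
  by rewrite /A /B/= !in_itv/= => /andP[_ h] /andP[/le_lt_trans/(_ h)]; rewrite ltxx.
have AB : `[z, l[%classic = A `|` B.
  apply/seteqP; split => x; rewrite /A /B/= !in_itv/=.
    by move=> /andP[zx xl]; case: (ltP x z') => xz; [left; rewrite zx|right; rewrite xl].
  move=> [/andP[zx xz]|/andP[zx ->]]; first by rewrite zx (lt_le_trans xz).
  by rewrite andbT (le_trans (ltW zz)).
have dp0 : (0 <= (d `^ p)%:E :> \bar R)%E by rewrite lee_fin powR_ge0.
split.
- move=> x /andP[zx xz]; change (U x = (quant H d a)%:~R * H).
  rewrite Ult; last by apply: lt_le_trans xz _; rewrite -lerBrDl.
  apply: slope_start d01 zz etat (ltW eta0) _.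
  by rewrite ger0_norm ?subr_ge0// ltrBlDl.
- move=> x zx lx; change (U x = (quant H d (lastv a' s))%:~R * H).
  have {}lx : l - eta * d < x by exact: lx.
  have lx1 : l - eta1 * d < x by apply: le_lt_trans lx; rewrite lerD2l lerN2.
  case: (ltP x z') => xz; last by rewrite Uge//; exact: Sb.
  rewrite Uend//; last by apply: le_lt_trans lx; rewrite lerD2r.
  (* Here the final plateau reaches back beyond [z']; then [z'] lies both in the first and in the
     last plateau of the remaining staircase, so the two values agree. *)
  rewrite -(Sa z') ?lexx ?ltrDl//; apply: Sb => //.
  exact: lt_trans lx1 xz.
- change ((d `^ p)%:E * J U `[z, l[%classic `[z, l[%classic <=
    (D * (`|a' - a| `^ p / (z' - z) `^ (p - 1) + slope_energy z' a' s) + e)%:E)%E.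
  rewrite AB J_split//.
  have jA : ((d `^ p)%:E * J U A A <= (D * (`|a' - a| `^ p / (z' - z) `^ (p - 1)) + e / 4)%:E)%E.
    rewrite (@J_ext U (slope z a z' a' d) A A); last first.
      move=> x y; rewrite /A/= !in_itv/= => /andP[_ xz] /andP[_ yz].
      by rewrite !Ult.
    by apply: le_trans (slope_J a a' d0 zz) _; rewrite lee_fin.
  have jB : ((d `^ p)%:E * J U B B <= (D * slope_energy z' a' s + e / 2)%:E)%E.
    rewrite (@J_ext U U' B B); first exact: SJ.
    move=> x y; rewrite /B/= !in_itv/= => /andP[xz _] /andP[yz _].
    by rewrite !Uge.
  have jAB : ((d `^ p)%:E * J U A B <= (e / 8)%:E)%E.
    have L0 : 0 <= z' - z by rewrite subr_ge0 ltW.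
    have muA : (mu A <= (z' - z)%:E)%E by rewrite /A lebesgue_measure_itv/= lte_fin zz EFinB.
    apply: le_trans (@J_junction_small U A B z' eta (z' - z) d mU mA mB _ eta0 d01 L0 muA _) _;
      last by rewrite lee_fin.
      left; split => x; rewrite /A /B/= !in_itv/=; first by move=> /andP[_ /ltW].
      by move=> /andP[->].
    move=> x y; rewrite /A /B/= !in_itv/= => /andP[zx xz] /andP[yz yl] xy.
    have xy' : y - x < eta * d.
      by apply: le_lt_trans xy; rewrite distrC; exact: ler_norm.
    rewrite Uend//; last by lra.
    rewrite Uge//; symmetry; apply: Sa; rewrite yz/=; apply: lt_le_trans _ (lerD (lexx z') edle).
    by lra.
  move: jA jB jAB (J_ge0 U A A) (J_ge0 U A B) (J_ge0 U B B).
  move: (J U A A) (J U A B) (J U B B) => a1 a2 a3 jA jB jAB a10 a20 a30.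
  rewrite !ge0_muleDr ?adde_ge0//.
  apply: le_trans (leeD (leeD jA jAB) (leeD jAB jB)) _.
  rewrite -!EFinD lee_fin mulrDr; move: (D * _) (D * _) => ? ?; lra.
- change (\int[mu]_(x in `[z, l[) (`|d * U x - interp z a ((z', a') :: s) x| `^ p)%:E <= e%:E)%E.
  pose V (x : R) := `|d * U x - interp z a ((z', a') :: s) x| `^ p.
  have mint w b r : measurable_fun setT (interp w b r : T -> R).
    elim: r w b => [|[w' b'] r IH] w b; first exact: measurable_cst.
    apply: measurable_fun_ifT => //=.
      exact: measurable_fun_ltr.
    apply: measurable_funD => //; apply: measurable_funM => //; apply: measurable_funM => //.
    exact: measurable_funB.
  have mV : measurable_fun setT (fun x : T => (V x)%:E).
    apply: measurable_powabs; apply: measurable_funB; last exact: mint.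
    exact: measurable_funM.
  rewrite AB ge0_integral_setU//.
  + have -> : (e%:E = (e / 2)%:E + (e / 2)%:E :> \bar R)%E by rewrite -EFinD; congr EFin; field.
    apply: leeD.
      have -> : (\int[mu]_(x in A) (V x)%:E = \int[mu]_(x in A)
        (`|d * slope z a z' a' d x - (a + (a' - a) * ((x - z) / (z' - z)))| `^ p)%:E)%E.
        apply: eq_integral => x /set_mem; rewrite /A/= in_itv/= => /andP[_ xz].
        by rewrite /V Ult//= xz.
      by apply: le_trans (slope_Lp a a' d0 zz) _; rewrite lee_fin.
    have -> : (\int[mu]_(x in B) (V x)%:E = \int[mu]_(x in B) (`|d * U' x - interp z' a' s x| `^ p)%:E)%E.
      apply: eq_integral => x /set_mem; rewrite /B/= in_itv/= => /andP[xz _].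
      by rewrite /V Uge//= ltNge xz.
    exact: SL.
  + by apply: measurable_funTS.
Qed.

Lemma stair_spec z a s : incr z s -> forall e : R, 0 < e ->
  exists2 eta : R, 0 < eta & \forall d \near 0^'+, stair_ok z a s e eta d.
Proof.
elim: s z a => [|[z' a'] s IH] z a.
  move=> _ e e0; exists 1 => //; near=> d; split => //=.
  - rewrite (_ : `[z, z[%classic = set0); last first.
      by apply/seteqP; split => x //=; rewrite in_itv/= => /andP[/le_lt_trans h /h]; rewrite ltxx.
    by rewrite JE integral_set0 mule0 lee_fin mulr0 add0r ltW.
  - rewrite (_ : `[z, z[%classic = set0); last first.
      by apply/seteqP; split => x //=; rewrite in_itv/= => /andP[/le_lt_trans h /h]; rewrite ltxx.
    by rewrite integral_set0 lee_fin ltW.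
move=> [zz incs] e e0.
have e2 : 0 < e / 2 by rewrite divr_gt0.
have e4 : 0 < e / 4 by rewrite divr_gt0.
have e8 : 0 < e / 8 by rewrite divr_gt0.
have [eta1 eta10 IHs] := IH z' a' incs (e / 2) e2.
pose L := z' - z; have L0 : 0 < L by rewrite subr_gt0.
(* The largest [eta] for which [slope_flat] gives plateaus at both ends of the first piece. *)
pose t0 := theta * L * H / (`|a' - a| + H).
have aH : 0 < `|a' - a| + H by rewrite ltr_wpDl.
have t00 : 0 < t0 by rewrite divr_gt0// mulr_gt0// mulr_gt0.
pose eta := Num.min eta1 t0.
have eta0 : 0 < eta by rewrite lt_min eta10.
have eta01 : eta <= eta1 by rewrite ge_min lexx.
have etat : eta * (`|a' - a| + H) <= theta * L * H.
  by rewrite -ler_pdivlMr// ge_min lexx orbT.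
have C0 : 0 <= 2 * beta / p * (2 * eta `^ (- p) + L).
  by rewrite mulr_ge0// addr_ge0// ?(ltW L0)// mulr_ge0// powR_ge0.
have hJ := sqrt_cvg0 C0 e8.
have Leta : 0 < L / eta by rewrite divr_gt0.
have Lp0 : 0 < L `^ (p - 1) by rewrite powR_gt0.
have c0 : 0 < e / 4 * L `^ (p - 1) / (D + 1) by rewrite divr_gt0 ?ltr_wpDl// mulr_gt0.
have hS : \forall d \near 0^'+, (`|a' - a| + d * H) `^ p <= `|a' - a| `^ p + e / 4 * L `^ (p - 1) / (D + 1).
  have := powR_add_cvg (normr_ge0 (a' - a)) H_gt0.
  move=> /cvgrPdist_le/(_ _ c0); apply: filterS => d.
  by rewrite distrC => /(le_trans (ler_norm _)); rewrite lerBlDl.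
pose K := 2 `^ p * (L * E0 + H `^ p * L) + 1.
have K0 : 0 < K.
  by rewrite ltr_wpDl// mulr_ge0 ?powR_ge0// addr_ge0// mulr_ge0 ?powR_ge0// ltW.
have eK : 0 < e / 2 / K by rewrite divr_gt0.
exists eta => //; near=> d.
have d0 : 0 < d by near: d; exact: nbhs_right_gt.
have d1 : d <= 1 by near: d; exact: nbhs_right_le.
have dK : d <= e / 2 / K by near: d; exact: nbhs_right_le.
have dL : d <= L / eta by near: d; exact: nbhs_right_le.
apply: (@stair_step z a z' a' s e eta eta1 d) => //.
- by rewrite d0.
- by rewrite mulrC -ler_pdivlMr.
- by near: d.
- by near: d.
- have : (`|a' - a| + d * H) `^ p <= `|a' - a| `^ p + e / 4 * L `^ (p - 1) / (D + 1) by near: d.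
  move=> hd; rewrite -/L -[X in _ <= _ + X]mulr1.
  apply: (@le_trans _ _ (D * ((`|a' - a| `^ p + e / 4 * L `^ (p - 1) / (D + 1)) / L `^ (p - 1)))).
    by apply: ler_wpM2l => //; rewrite ler_wpM2r// invr_ge0 ltW.
  rewrite mulrDl mulrDr lerD2l mulr1.
  have -> : D * (e / 4 * L `^ (p - 1) / (D + 1) / L `^ (p - 1)) = e / 4 * (D / (D + 1)).
    have D1 : 0 < D + 1 by rewrite ltr_wpDl.
    by field; apply/andP; split; rewrite gt_eqF.
  by rewrite ler_piMr ?(ltW e4)// ler_pdivrMr ?ltr_wpDl// mul1r lerDl.
- have dp : d `^ p <= d by apply: ge1r_powR; rewrite ?d0.
  rewrite powRM ?(ltW d0) ?(ltW H_gt0)// -/L -[_ * _ * L]mulrA -mulrDr mulrCA.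
  apply: (@le_trans _ _ (d * K)); last by rewrite -ler_pdivlMr.
  have : 0 <= K - 1 by rewrite subr_ge0 lerDr mulr_ge0 ?powR_ge0// addr_ge0// mulr_ge0 ?powR_ge0// ltW.
  rewrite {1}/K addrK => k0.
  apply: (le_trans (ler_wpM2r k0 dp)); rewrite ler_wpM2l// ?(ltW d0)//.
  by rewrite /K lerDl.
Unshelve. all: by end_near. Qed.

End StairSpec.

Lemma measurable_restr (f : T -> R) (B : set T) : measurable B -> measurable_fun setT f ->
  measurable_fun setT (f \_ B).
Proof. by move=> mD mf; apply: (proj1 (measurable_restrictT f mD)); exact: measurable_funTS. Qed.

(** * Restriction of staircases to the given interval *)

Section StairRecovery.
Variables (W : T -> R) (H theta D E0 : R) (I : set T) (z a : R) (s : seq (R * R)).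
Hypothesis cW : cell W H theta.
Hypothesis JD : (J W `[0%R, 1%R[%classic setT <= (D * H `^ p)%:E)%E.
Hypothesis WE : (\int[mu]_(x in `[0%R, 1%R[) (`|W x - H * x| `^ p)%:E <= E0%:E)%E.
Hypothesis D_ge0 : 0 <= D.
Hypothesis E0_ge0 : 0 <= E0.
Hypothesis mI : measurable I.
Hypothesis incs : incr z s.
Hypothesis tailL : a = 0 \/ forall x, I x -> z <= x.
Hypothesis tailR : lastv a s = 0 \/ forall x, I x -> x < lastz z s.

Let l := lastz z s.
Let A : set T := `[z, l[%classic.
Let tstair (d : R) : T -> R := (fun x => d * stair W H d z a s x) \_ A.

(** Extending by 0 outside [A] creates no jump inside [I]: at an end of [A] beyond which [I]
    continues, the node value is 0, it is rounded to 0, and the staircase has a plateau there. The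
    four cross interactions cost [e / 8] each. *)
Lemma stair_truncated (e eta d : R) : 0 < d <= 1 -> 0 < eta -> stair_ok W H D z a s (e / 2) eta d ->
  Num.sqrt d * (2 * beta / p * (2 * eta `^ (- p) + (l - z))) <= e / 8 ->
  ((d `^ p)%:E * J (fun x => ((tstair d \_ I) x / d)%R) I I <= (D * slope_energy z a s + e)%:E)%E.
Proof.
move=> d01 eta0 [Sa Sb SJ _] hJ; set u := tstair d; have /andP[d0 d1] := d01.
have H0 : 0 < H by case: cW => -[].
have mW : measurable_fun setT W by case: cW => -[].
pose v : T -> R := fun x => (u \_ I) x / d.
have mA : measurable A by exact: measurable_itv.
have mU : measurable_fun setT (stair W H d z a s) by exact: measurable_stair.
have mv : measurable_fun setT v.
  apply: measurable_divr; apply: measurable_restr => //.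
  by apply: measurable_restr => //; exact: measurable_funM.
have vA x : I x -> A x -> v x = stair W H d z a s x.
  move=> Ix Ax; rewrite /v patchE mem_set// /u /tstair patchE mem_set// mulrAC divff ?mul1r//.
  by rewrite gt_eqF.
have vC x : I x -> ~ A x -> v x = 0.
  by move=> Ix Ax; rewrite /v patchE mem_set// /u /tstair patchE memNset// mul0r.
have zl : z <= l by exact: lastz_ge.
pose A' := I `&` A; pose B := I `&` `]-oo, z[%classic; pose C := I `&` `[l, +oo[%classic.
have mA' : measurable A' by exact: measurableI.
have mB : measurable B by apply: measurableI => //; exact: measurable_itv.
have mC : measurable C by apply: measurableI => //; exact: measurable_itv.
have mBC : measurable (B `|` C) by exact: measurableU.
have dBC : [disjoint B & C].
  rewrite disj_set2E; apply/eqP; rewrite -subset0 => x [[_ xz] [_ xl]].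
  move: xz xl => /=; rewrite !in_itv/= andbT => xz lx.
  by have := le_lt_trans (le_trans zl lx) xz; rewrite ltxx.
have BA x : B x -> ~ A x.
  move=> [_]; rewrite /A/= !in_itv/= => xz /andP[zx _].
  by have := le_lt_trans zx xz; rewrite ltxx.
have CA x : C x -> ~ A x.
  move=> [_]; rewrite /A/= !in_itv/= andbT => lx /andP[_ xl].
  by have := le_lt_trans lx xl; rewrite ltxx.
have dA : [disjoint A' & B `|` C].
  by rewrite disj_set2E; apply/eqP; rewrite -subset0 => x [[_ Ax] [/BA|/CA]].
have IE : I = A' `|` (B `|` C).
  apply/seteqP; split => x; last by move=> [[]|[[]|[]]].
  move=> Ix; case: (ltP x z) => xz; first by right; left; split => //=; rewrite in_itv.
  case: (ltP x l) => xl; first by left; split => //; rewrite /A/= in_itv/= xz.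
  by right; right; split => //=; rewrite in_itv/= xl.
have dp0 : (0 <= (d `^ p)%:E :> \bar R)%E by rewrite lee_fin powR_ge0.
have l0 : 0 <= l - z by rewrite subr_ge0.
have muA : (mu A' <= (l - z)%:E)%E.
  apply: (@le_trans _ _ (mu A)); first by apply: le_measure => //; rewrite ?inE//; exact: subIsetr.
  rewrite /A lebesgue_measure_itv/= lte_fin; case: ltP => // _; by rewrite ?lee_fin// EFinB.
have q0 : (quant H d 0)%:~R * H = 0 by rewrite /quant mul0r floor0 mul0r.
have jB : ((d `^ p)%:E * J v A' B <= (e / 8)%:E)%E.
  have e80 : 0 <= e / 8.
    by apply: le_trans hJ; rewrite mulr_ge0 ?sqrtr_ge0// mulr_ge0// addr_ge0// mulr_ge0// powR_ge0.
  case: tailL => [a0|IB]; last first.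
    rewrite J_eq0 ?mule0 ?lee_fin// => x y _ [/IB zy] /=.
    by rewrite in_itv/= => /(le_lt_trans zy); rewrite ltxx.
  apply: le_trans (@J_junction_small v A' B z eta (l - z) d mv mA' mB _ eta0 d01 l0 muA _) _;
    last by rewrite lee_fin.
    right; split=> x [_]; rewrite /A/= !in_itv/= ?andbT; first by case/andP.
    exact: ltW.
  move=> x y [Ix Ax] By xy; rewrite vA// vC//; [|by case: By|exact: BA].
  rewrite Sa ?a0//; move: Ax By; rewrite /A/= in_itv/= => /andP[zx xl] [_] /=; rewrite in_itv/= => yz.
  by rewrite zx/=; have := le_lt_trans (ler_norm _) xy; lra.
have jC : ((d `^ p)%:E * J v A' C <= (e / 8)%:E)%E.
  have e80 : 0 <= e / 8.
    by apply: le_trans hJ; rewrite mulr_ge0 ?sqrtr_ge0// mulr_ge0// addr_ge0// mulr_ge0// powR_ge0.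
  case: tailR => [a0|IC]; last first.
    rewrite J_eq0 ?mule0 ?lee_fin// => x y _ [/IC zy] /=.
    by rewrite in_itv/= andbT => /(lt_le_trans zy); rewrite ltxx.
  apply: le_trans (@J_junction_small v A' C l eta (l - z) d mv mA' mC _ eta0 d01 l0 muA _) _;
    last by rewrite lee_fin.
    left; split=> x [_]; rewrite /A/= !in_itv/= ?andbT//.
    by move=> /andP[_ /ltW].
  move=> x y [Ix Ax] Cy xy; rewrite vA// vC//; [|by case: Cy|exact: CA].
  move: Ax Cy; rewrite /A/= in_itv/= => /andP[zx xl] [_] /=; rewrite in_itv/= andbT => ly.
  rewrite Sb ?a0// -/l; rewrite distrC in xy; have := le_lt_trans (ler_norm _) xy; lra.
have jA : ((d `^ p)%:E * J v A' A' <= (D * slope_energy z a s + e / 2)%:E)%E.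
  rewrite (@J_ext v (stair W H d z a s) A' A'); last first.
    by move=> x y [Ix Ax] [Iy Ay]; rewrite !vA.
  apply: le_trans SJ; apply: lee_wpmul2l => //.
  by apply: J_le => //; exact: subIsetr.
rewrite -/v; have -> : J v I I = (J v A' A' + (J v A' B + J v A' C) +
    ((J v A' B + J v A' C) + J v (B `|` C) (B `|` C)))%E.
  by rewrite [in LHS]IE J_split// J_setUr.
have j0 : J v (B `|` C) (B `|` C) = 0%E.
  have v0 x : (B `|` C) x -> v x = 0.
    by move=> [Bx|Cx]; apply: vC; [by case: Bx|exact: BA|by case: Cx|exact: CA].
  by apply: J_eq0 => x y Bx By; rewrite !v0.
rewrite j0; move: jA jB jC (J_ge0 v A' A') (J_ge0 v A' B) (J_ge0 v A' C).
move: (J v A' A') (J v A' B) (J v A' C) => a1 a2 a3 jA jB jC a10 a20 a30.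
rewrite adde0 !ge0_muleDr ?adde_ge0//.
apply: le_trans (leeD (leeD jA (leeD jB jC)) (leeD jB jC)) _.
by rewrite -!EFinD lee_fin; lra.
Qed.

Lemma stair_recovery (e : R) : 0 < e -> \forall d \near 0^'+, exists u : T -> R,
  [/\ measurable_fun setT u, (Ld (u \_ I) d I <= (D * slope_energy z a s + e)%:E)%E &
      (\int[mu]_(x in I) (`|u x - ((interp z a s) \_ A) x| `^ p)%:E <= e%:E)%E].
Proof.
move=> e0; have e2 : 0 < e / 2 by rewrite divr_gt0.
have e8 : 0 < e / 8 by rewrite divr_gt0.
have [eta eta0 Hok] := stair_spec cW JD WE D_ge0 E0_ge0 a incs e2.
have mW : measurable_fun setT W by case: cW => -[].
have C0 : 0 <= 2 * beta / p * (2 * eta `^ (- p) + (l - z)).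
  by rewrite mulr_ge0// addr_ge0// ?subr_ge0 ?lastz_ge// mulr_ge0// powR_ge0.
have hJ := sqrt_cvg0 C0 e8.
near=> d.
have d0 : 0 < d by near: d; exact: nbhs_right_gt.
have d1 : d <= 1 by near: d; exact: nbhs_right_le.
have ok : stair_ok W H D z a s (e / 2) eta d by near: d.
have hd : Num.sqrt d * (2 * beta / p * (2 * eta `^ (- p) + (l - z))) <= e / 8 by near: d.
have mA : measurable A by exact: measurable_itv.
have mU : measurable_fun setT (stair W H d z a s) by exact: measurable_stair.
have mdU : measurable_fun setT ((fun x => d * stair W H d z a s x) : T -> R).
  exact: measurable_funM.
exists (tstair d); split.
- exact: measurable_restr.
- by apply: stair_truncated ok hd => //; rewrite d0.
- have [_ _ _ SL] := ok.
  have mi : measurable_fun setT (interp z a s : T -> R).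
    elim: (s) (z) (a) => [|[w' b'] r IH] w b; first exact: measurable_cst.
    apply: measurable_fun_ifT => //=.
      exact: measurable_fun_ltr.
    apply: measurable_funD => //; apply: measurable_funM => //; apply: measurable_funM => //.
    exact: measurable_funB.
  pose f (x : T) : \bar R := (`|d * stair W H d z a s x - interp z a s x| `^ p)%:E.
  have mf : measurable_fun setT f by apply: measurable_powabs; exact: measurable_funB.
  have f0 x : (0 <= f x)%E by rewrite lee_fin powR_ge0.
  have -> : (\int[mu]_(x in I) (`|tstair d x - ((interp z a s) \_ A) x| `^ p)%:E
     = \int[mu]_(x in I) (f \_ A) x)%E.
    apply: eq_integral => x _; rewrite /tstair !patchE; case: ifP => // _.
    by rewrite subrr normr0 powR0// gt_eqF.
  have e2e : ((e / 2)%:E <= e%:E)%E by rewrite lee_fin; lra.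
  apply: le_trans (le_trans SL e2e).
  rewrite [leRHS]integral_mkcond.
  apply: ge0_subset_integral => //.
  + by apply: (proj1 (measurable_restrictT f mA)); exact: measurable_funTS.
  + by move=> x _; rewrite patchE; case: ifP.
Unshelve. all: by end_near. Qed.

End StairRecovery.

(** * From polygons to recovery families *)

Lemma ler_powRD_p (a b c : R) : 0 <= a -> 0 <= b -> 0 <= c -> a <= b + c ->
  a `^ p <= 2 `^ p * (b `^ p + c `^ p).
Proof.
by move=> a0 b0 c0 h; apply: le_trans (powR_addr_le b0 c0); exact: ler_powRp.
Qed.

Lemma Lp_triangle (A : set T) (f g h : T -> R) (a b : R) : measurable A ->
  measurable_fun A f -> measurable_fun A g -> measurable_fun A h ->
  (\int[mu]_(x in A) (`|f x - g x| `^ p)%:E <= a%:E)%E ->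
  (\int[mu]_(x in A) (`|g x - h x| `^ p)%:E <= b%:E)%E ->
  (\int[mu]_(x in A) (`|f x - h x| `^ p)%:E <= (2 `^ p * (a + b))%:E)%E.
Proof.
move=> mA mf mg mh fg gh.
pose u (x : T) : \bar R := (`|f x - g x| `^ p)%:E.
pose v (x : T) : \bar R := (`|g x - h x| `^ p)%:E.
have mu_ : measurable_fun A u by apply: measurable_powabs; exact: measurable_funB.
have mv : measurable_fun A v by apply: measurable_powabs; exact: measurable_funB.
have u0 (x : T) : A x -> (0 <= u x)%E by move=> _; rewrite lee_fin powR_ge0.
have v0 (x : T) : A x -> (0 <= v x)%E by move=> _; rewrite lee_fin powR_ge0.
have c0 : 0 <= (2 : R) `^ p by exact: powR_ge0.
apply: (@le_trans _ _ (\int[mu]_(x in A) ((2 `^ p)%:E * (u x + v x)))%E).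
  apply: ge0_le_integral => //.
  - by apply: measurable_powabs; exact: measurable_funB.
  - by apply: measurable_funeM; exact: emeasurable_funD.
  - move=> x _; rewrite /u /v -EFinD -EFinM lee_fin; apply: ler_powRD_p => //.
    by apply: le_trans (ler_normD _ _); rewrite addrA subrK.
rewrite ge0_integralZl//; last 2 first.
- exact: emeasurable_funD.
- by move=> x Ax; rewrite adde_ge0 ?u0 ?v0.
rewrite ge0_integralD// EFinM EFinD; apply: lee_wpmul2l; first by rewrite lee_fin.
exact: leeD.
Qed.

(** The approximating functions may depend on the tolerance [e]; a single family valid for all
    tolerances is extracted in [recovery_family]. *)
Definition recoverable (I : set T) (g : T -> R) (c : R) : Prop := forall e : R, 0 < e ->
  \forall d \near 0^'+, exists u : T -> R, [/\ mLp I u, (Ld (u \_ I) d I <= (c + e)%:E)%E &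
     (\int[mu]_(x in I) (`|u x - g x| `^ p)%:E <= e%:E)%E].

Definition nodes_for (I : set T) (g : T -> R) (e z a : R) (s : seq (R * R)) : Prop :=
  [/\ incr z s, a = 0 \/ forall x, I x -> z <= x,
      lastv a s = 0 \/ forall x, I x -> x < lastz z s &
      (\int[mu]_(x in I) (`|((interp z a s) \_ `[z, lastz z s[%classic) x - g x| `^ p)%:E <= e%:E)%E].

Lemma slope_energy_ge0 z a s : 0 <= slope_energy z a s.
Proof.
elim: s z a => //= -[z' a'] s IH z a; rewrite addr_ge0//.
by rewrite divr_ge0// powR_ge0.
Qed.

Lemma measurable_interp z a s : measurable_fun setT (interp z a s : T -> R).
Proof.
elim: s z a => [|[w' b'] r IH] w b; first exact: measurable_cst.
apply: measurable_fun_ifT => //=.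
  exact: measurable_fun_ltr.
apply: measurable_funD => //; apply: measurable_funM => //; apply: measurable_funM => //.
exact: measurable_funB.
Qed.

Lemma cell_cheap (e : R) : 0 < e -> exists W H theta E0, [/\ cell W H theta,
  (J W `[0%R, 1%R[%classic setT <= ((kappa + e) * H `^ p)%:E)%E,
  (\int[mu]_(x in `[0%R, 1%R[) (`|W x - H * x| `^ p)%:E <= E0%:E)%E & 0 <= E0].
Proof.
move=> e0.
have : (kappaE < (kappa + e)%:E)%E by rewrite kappa_fin lte_fin ltrDl.
rewrite /kappaE => /ereal_inf_lt[_ [W [H [theta [cW ->]]]] lt].
have [[mW H0 t0] _ _ WLp] := cW.
exists W, H, theta.
pose f (x : T) : \bar R := (`|W x - H * x| `^ p)%:E.
have f0 (x : T) : (0 <= f x)%E by rewrite lee_fin powR_ge0.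
exists (fine (\int[mu]_(x in `[0%R, 1%R[) f x)).
have Hp : 0 < H `^ p by rewrite powR_gt0.
split => //; last by rewrite fine_ge0// integral_ge0.
- move: lt (J_ge0 W `[0%R, 1%R[%classic setT); case: (J W _ _) => [r| |]//.
  + by rewrite -EFinM lte_fin lee_fin mulrC ltr_pdivrMr// => /ltW.
  + by rewrite gt0_muley// lte_fin invr_gt0.
- rewrite fineK// ge0_fin_numE ?integral_ge0//.
  pose Q : set T := `[0%R, 1%R[%classic.
  have mI : measurable Q by exact: measurable_itv.
  rewrite -/Q; pose u (x : T) : \bar R := (`|W x| `^ p)%:E.
  have mu_ : measurable_fun Q u by apply: measurable_powabs; exact: measurable_funTS.
  have u0 (x : T) : (0 <= u x)%E by rewrite lee_fin powR_ge0.
  have c0 : 0 <= (2 : R) `^ p by exact: powR_ge0.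
  have cc0 : (0 <= (2 `^ p * H `^ p)%:E :> \bar R)%E by rewrite lee_fin mulr_ge0// powR_ge0.
  apply: (@le_lt_trans _ _ (\int[mu]_(x in Q) ((2 `^ p)%:E * u x + (2 `^ p * H `^ p)%:E))%E).
    apply: ge0_le_integral => //.
    + apply: measurable_powabs; apply: measurable_funB; [exact: measurable_funTS|exact: measurable_funM].
    + by apply: emeasurable_funD => //; exact: measurable_funeM.
    + move=> x; rewrite /Q/= in_itv/= => /andP[x0 x1].
      rewrite /u /f -EFinM -EFinD lee_fin -mulrDr; apply: ler_powRD_p => //; first exact: ltW.
      apply: le_trans (ler_normB _ _) _; rewrite lerD2l ger0_norm ?mulr_ge0 ?(ltW H0)//.
      by rewrite ler_piMr// ltW.
  rewrite ge0_integralD//; last 2 first.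
  - by move=> x _; rewrite mule_ge0// lee_fin.
  - exact: measurable_funeM.
  rewrite ge0_integralZl ?lee_fin// integral_cst//.
  have muQ : mu Q = 1%E by rewrite /Q lebesgue_measure_itv/= lte_fin ltr01 oppr0 adde0.
  rewrite [X in (_ + _ * X)%E]muQ mule1 lte_add_pinfty ?ltry// lte_mul_pinfty ?lee_fin//.
Qed.

Lemma mLp_close (I : set T) (u g : T -> R) (e : R) : measurable I -> mLp I g -> measurable_fun setT u ->
  (\int[mu]_(x in I) (`|u x - g x| `^ p)%:E <= e%:E)%E -> mLp I u.
Proof.
move=> mI [mg gLp] mu_ ug; split; first exact: measurable_restr.
pose v (x : T) : \bar R := (`|(g \_ I) x| `^ p)%:E.
pose w (x : T) : \bar R := (`|u x - (g \_ I) x| `^ p)%:E.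
have gI (x : T) : I x -> (g \_ I) x = g x by move=> Ix; rewrite patchE mem_set.
have mv : measurable_fun I v by apply: measurable_powabs; exact: measurable_funTS.
have mw : measurable_fun I w by apply: measurable_powabs; apply: measurable_funTS; exact: measurable_funB.
have v0 (x : T) : (0 <= v x)%E by rewrite lee_fin powR_ge0.
have w0 (x : T) : (0 <= w x)%E by rewrite lee_fin powR_ge0.
have c0 : 0 <= (2 : R) `^ p by exact: powR_ge0.
apply: (@le_lt_trans _ _ (\int[mu]_(x in I) ((2 `^ p)%:E * (w x + v x)))%E).
  apply: ge0_le_integral => //.
  - by apply: measurable_powabs; exact: measurable_funTS.
  - by apply: measurable_funeM; exact: emeasurable_funD.
  - move=> x _; rewrite /v /w -EFinD -EFinM lee_fin; apply: ler_powRD_p => //.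
    by apply: le_trans (ler_normD _ _); rewrite subrK.
rewrite ge0_integralZl//; last 2 first.
- exact: emeasurable_funD.
- by move=> x Ax; rewrite adde_ge0.
rewrite ge0_integralD//; apply: lte_mul_pinfty; rewrite ?lee_fin//.
have -> : (\int[mu]_(x in I) w x = \int[mu]_(x in I) (`|u x - g x| `^ p)%:E)%E.
  by apply: eq_integral => x /set_mem Ix; rewrite /w gI.
have -> : (\int[mu]_(x in I) v x = \int[mu]_(x in I) (`|g x| `^ p)%:E)%E.
  by apply: eq_integral => x /set_mem Ix; rewrite /v gI.
by apply: lte_add_pinfty; [exact: (le_lt_trans ug (ltry _))|assumption].
Qed.

Lemma nodes_recoverable (I : set T) (g : T -> R) (c : R) : measurable I -> mLp I g -> 0 <= c ->
  (forall e : R, 0 < e -> exists z a s, nodes_for I g e z a s /\ kappa * slope_energy z a s <= c + e) ->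
  recoverable I g c.
Proof.
move=> mI gLp c0 NA e e0.
have c2 : 0 < (2 : R) `^ p by rewrite powR_gt0.
pose e1 := Num.min (e / 3) (e / 2 `^ p / 2).
have e10 : 0 < e1 by rewrite lt_min !divr_gt0.
have e13 : e1 <= e / 3 by rewrite ge_min lexx.
have e1p : 2 `^ p * (e1 + e1) <= e.
  have : e1 <= e / 2 `^ p / 2 by rewrite ge_min lexx orbT.
  rewrite ler_pdivlMr// -ler_pdivrMr ?invr_gt0// invrK => h.
  by rewrite mulrC (_ : e1 + e1 = e1 * 2)//; ring.
have [z [a [s [[incs tL tR sLp] sE]]]] := NA e1 e10.
set S := slope_energy z a s in sE.
have S0 : 0 <= S by exact: slope_energy_ge0.
(* The cell is chosen after the polygon: the excess of its cost over [kappa] is multiplied by the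
   slope energy [S], and must stay below [e / 3]. *)
have eS : 0 < e / 3 / (S + 1) by rewrite !divr_gt0// ltr_wpDl.
have [W [H [theta [E0 [cW JD WE E00]]]]] := cell_cheap eS.
have D0 : 0 <= kappa + e / 3 / (S + 1).
  by have /andP[k0 _] := kappa_itv; rewrite addr_ge0// ltW.
have := stair_recovery cW JD WE D0 E00 mI incs tL tR e10.
apply: filterS => d [u [mu_ uL uI]]; exists u.
have mA : measurable (`[z, lastz z s[%classic : set T) by exact: measurable_itv.
have close : (\int[mu]_(x in I) (`|u x - g x| `^ p)%:E <= e%:E)%E.
  have [mg _] := gLp.
  have gI (x : T) : I x -> (g \_ I) x = g x by move=> Ix; rewrite patchE mem_set.
  have -> : (\int[mu]_(x in I) (`|u x - g x| `^ p)%:E = \int[mu]_(x in I) (`|u x - (g \_ I) x| `^ p)%:E)%E.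
    by apply: eq_integral => x /set_mem Ix; rewrite gI.
  apply: (@le_trans _ _ (2 `^ p * (e1 + e1))%:E); last by rewrite lee_fin.
  apply: (@Lp_triangle I u ((interp z a s) \_ `[z, lastz z s[%classic) (g \_ I) e1 e1 mI _ _ _ uI).
  - exact: measurable_funTS.
  - by apply: measurable_funTS; apply: measurable_restr => //; exact: measurable_interp.
  - exact: measurable_funTS.
  - have -> : (\int[mu]_(x in I) (`|((interp z a s) \_ `[z, lastz z s[%classic) x - (g \_ I) x| `^ p)%:E =
       \int[mu]_(x in I) (`|((interp z a s) \_ `[z, lastz z s[%classic) x - g x| `^ p)%:E)%E.
      by apply: eq_integral => x /set_mem Ix; rewrite gI.
    exact: sLp.
split; [exact: mLp_close close| |exact: close].
apply: le_trans uL _; rewrite lee_fin mulrDl.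
have : e / 3 / (S + 1) * S <= e / 3.
  rewrite -mulrA; apply: ler_piMr; first by rewrite divr_ge0// ltW.
  by rewrite mulrC ler_pdivrMr ?ltr_wpDl// mul1r lerDl.
by rewrite -/S; lra.
Qed.

(** A diagonal choice: for each [d] take a function whose tolerance exceeds the infimum of the
    attainable ones by less than [d]. For small [d] the tolerance [e / 2] is attainable, so the
    chosen one is at most [e]. *)
Lemma recovery_family (I : set T) (g : T -> R) (c : R) : mLp I g -> recoverable I g c ->
  exists g_ : R -> T -> R, (forall d, mLp I (g_ d)) /\ forall e : R, 0 < e -> \forall d \near 0^'+,
    (Ld (g_ d \_ I) d I <= (c + e)%:E)%E /\ (\int[mu]_(x in I) (`|g_ d x - g x| `^ p)%:E <= e%:E)%E.
Proof.
move=> gLp rec.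
pose ok (e d : R) (u : T -> R) := [/\ mLp I u, (Ld (u \_ I) d I <= (c + e)%:E)%E &
     (\int[mu]_(x in I) (`|u x - g x| `^ p)%:E <= e%:E)%E].
pose E (d : R) : set R := [set e | 0 < e /\ exists u, ok e d u].
have best d : exists u : T -> R, mLp I u /\ (E d !=set0 -> 0 < d -> exists2 e, e < inf (E d) + d & ok e d u).
  case: (pselect (E d !=set0 /\ 0 < d)) => [[Ed d0]|nE]; last first.
    by exists g; split=> // Ed d0; case: nE.
  have hi : has_inf (E d) by split => //; exists 0 => e [/ltW].
  have [e [e0 [u oku]] lt] := inf_adherent d0 hi.
  by exists u; split; [case: oku|move=> _ _; exists e].
have [g_ Hg] := choice best.
exists g_; split=> [d|e e0]; first by case: (Hg d).
have e2 : 0 < e / 2 by rewrite divr_gt0.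
have rec2 := rec _ e2.
near=> d.
have d0 : 0 < d by near: d; exact: nbhs_right_gt.
have d2 : d <= e / 2 by near: d; exact: nbhs_right_le.
have Ee : E d (e / 2) by split => //; near: d.
have [_ /(_ (ex_intro _ _ Ee) d0)[e' e'lt [_ h1 h2]]] := Hg d.
have e'e : e' <= e.
  have : inf (E d) <= e / 2 by apply: ge_inf => //; exists 0 => r [/ltW].
  by move=> ie; apply: (le_trans (ltW e'lt)); rewrite [leRHS]splitr lerD.
split; first by apply: le_trans h1 _; rewrite lee_fin lerD2l.
by apply: le_trans h2 _; rewrite lee_fin.
Unshelve. all: by end_near. Qed.

Lemma convex_dist (a b c t : R) : 0 <= t <= 1 -> `|a + (b - a) * t - c| <= `|c - a| + `|c - b|.
Proof.
move=> /andP[t0 t1]; rewrite (_ : _ - c = (1 - t) * (a - c) + t * (b - c)); last by ring.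
apply: le_trans (ler_normD _ _) _; rewrite !normrM (ger0_norm t0) ger0_norm ?subr_ge0//.
rewrite (distrC c a) (distrC c b); apply: lerD; apply: ler_piMl => //.
by rewrite gerBl.
Qed.

Lemma interp_cons_Lp (I : set T) (g : T -> R) (z a z' a' : R) (s : seq (R * R)) (e1 e2 e3 : R) :
  measurable I -> measurable_fun setT g -> z < z' -> z' <= lastz z' s ->
  (\int[mu]_(x in I `&` `[z, z'[) (`|g x - a| `^ p)%:E <= e1%:E)%E ->
  (\int[mu]_(x in I `&` `[z, z'[) (`|g x - a'| `^ p)%:E <= e2%:E)%E ->
  (\int[mu]_(x in I `&` `[z', lastz z' s[) (`|interp z' a' s x - g x| `^ p)%:E <= e3%:E)%E ->
  (\int[mu]_(x in I `&` `[z, lastz z' s[) (`|interp z a ((z', a') :: s) x - g x| `^ p)%:E <=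
    (2 `^ p * (e1 + e2) + e3)%:E)%E.
Proof.
move=> mI mg zz zl h1 h2 h3; set l := lastz z' s in zl h3 *.
pose A : set T := I `&` `[z, z'[%classic; pose B : set T := I `&` `[z', l[%classic.
have mA : measurable A by apply: measurableI => //; exact: measurable_itv.
have mB : measurable B by apply: measurableI => //; exact: measurable_itv.
have dAB : [disjoint A & B].
  rewrite disj_set2E; apply/eqP; rewrite -subset0 => x [[_] + [_]] /=.
  by rewrite /A /B/= !in_itv/= => /andP[_ h] /andP[/le_lt_trans/(_ h)]; rewrite ltxx.
have AB : I `&` `[z, l[%classic = A `|` B.
  rewrite /A /B -setIUr; congr (I `&` _); apply/seteqP; split => x /=; rewrite !in_itv/=.
    by move=> /andP[zx xl]; case: (ltP x z') => xz; [left; rewrite zx|right; rewrite xl].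
  move=> [/andP[zx xz]|/andP[zx ->]]; first by rewrite zx (lt_le_trans xz).
  by rewrite andbT (le_trans (ltW zz)).
have mi := measurable_interp z a ((z', a') :: s).
pose V (x : T) : \bar R := (`|interp z a ((z', a') :: s) x - g x| `^ p)%:E.
have mV : measurable_fun setT V by apply: measurable_powabs; exact: measurable_funB.
have V0 (x : T) : (0 <= V x)%E by rewrite lee_fin powR_ge0.
pose u (x : T) : \bar R := (`|g x - a| `^ p)%:E.
pose v (x : T) : \bar R := (`|g x - a'| `^ p)%:E.
have mu_ : measurable_fun A u by apply: measurable_funTS; apply: measurable_powabs; exact: measurable_funB.
have mv : measurable_fun A v by apply: measurable_funTS; apply: measurable_powabs; exact: measurable_funB.
have u0 (x : T) : (0 <= u x)%E by rewrite lee_fin powR_ge0.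
have v0 (x : T) : (0 <= v x)%E by rewrite lee_fin powR_ge0.
have c0 : 0 <= (2 : R) `^ p by exact: powR_ge0.
rewrite AB -/V ge0_integral_setU//; last by exact: measurable_funTS.
rewrite EFinD; apply: leeD; last first.
  have -> : (\int[mu]_(x in B) V x = \int[mu]_(x in B) (`|interp z' a' s x - g x| `^ p)%:E)%E.
    apply: eq_integral => x /set_mem[_]; rewrite /= in_itv/= => /andP[xz _].
    by rewrite /V /= ltNge xz.
  exact: h3.
apply: (@le_trans _ _ (\int[mu]_(x in A) ((2 `^ p)%:E * (u x + v x)))%E).
  apply: ge0_le_integral => //.
  - exact: measurable_funTS.
  - by apply: measurable_funeM; exact: emeasurable_funD.
  - move=> x [_]; rewrite /= in_itv/= => /andP[zx xz].
    rewrite /V /u /v/= xz -EFinD -EFinM lee_fin; apply: ler_powRD_p => //.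
    apply: convex_dist; rewrite divr_ge0 ?subr_ge0 ?(ltW zz)//=.
    by rewrite ler_pdivrMr ?subr_gt0// mul1r lerD2r ltW.
rewrite ge0_integralZl//; last 2 first.
- exact: emeasurable_funD.
- by move=> x Ax; rewrite adde_ge0.
rewrite ge0_integralD// EFinM EFinD; apply: lee_wpmul2l; first by rewrite lee_fin.
exact: leeD.
Qed.

(** * Polygonal interpolation under a slope bound *)

Definition slope_bound (I : set T) (g : T -> R) (N : set T) (W : R -> R) (M : R) : Prop :=
  [/\ measurable N, mu N = 0%E, {homo W : x y / x <= y}, forall x, 0 <= W x <= M &
      forall x y : R, I x -> I y -> ~ N x -> ~ N y -> x < y ->
        `|g y - g x| `^ p <= (y - x) `^ (p - 1) * (W y - W x)].

Lemma integral_ae_cst (B N : set T) (f : T -> \bar R) (c m : R) : measurable B -> measurable N ->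
  mu N = 0%E -> measurable_fun B f -> (forall x, 0 <= f x)%E -> 0 <= c -> (mu B <= m%:E)%E ->
  (forall x, B x -> ~ N x -> f x <= c%:E)%E -> (\int[mu]_(x in B) f x <= (c * m)%:E)%E.
Proof.
move=> mB mN N0 mf f0 c0 Bm fc.
have mBN : measurable (B `\` N) by exact: measurableD.
rewrite (ge0_negligible_integral mN mB)//.
apply: (@le_trans _ _ (\int[mu]_(x in B `\` N) cst c%:E x)%E).
  apply: ge0_le_integral => //.
  - by apply: measurable_funS mf => //; exact: subDsetl.
  - by move=> x [Bx Nx]; exact: fc.
rewrite integral_cst// EFinM; apply: lee_wpmul2l; first by rewrite lee_fin.
apply: le_trans Bm; apply: le_measure; rewrite ?inE//; exact: subDsetl.
Qed.

Section SlopeNodes.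
Variables (I : set T) (g : T -> R).
Hypothesis mI : measurable I.
Hypothesis oI : open (I : set R).
Hypothesis II : is_interval (I : set R).
Hypothesis mg : measurable_fun setT g.

Section WithBound.
Variables (N : set T) (W : R -> R) (M : R).
Hypothesis sb : slope_bound I g N W M.

Lemma sb_near (x y z z' : R) : I x -> I y -> ~ N x -> ~ N y -> z <= x <= z' -> z <= y <= z' ->
  `|g x - g y| `^ p <= (z' - z) `^ (p - 1) * (W z' - W z).
Proof.
have [_ _ Wnd _ H] := sb; have p10 : 0 <= p - 1 by rewrite subr_ge0.
have key (u v : R) : I u -> I v -> ~ N u -> ~ N v -> u < v -> z <= u -> v <= z' ->
    `|g v - g u| `^ p <= (z' - z) `^ (p - 1) * (W z' - W z).
  move=> Iu Iv Nu Nv uv zu vz; apply: (le_trans (H _ _ Iu Iv Nu Nv uv)).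
  have vu : v - u <= z' - z by rewrite lerB.
  apply: ler_pM; rewrite ?powR_ge0 ?subr_ge0 ?(Wnd _ _ (ltW uv))//.
    by apply: ge0_ler_powR => //; rewrite nnegrE subr_ge0 ?(ltW uv)// (le_trans zu)// (le_trans (ltW uv)).
  by apply: lerB; exact: Wnd.
move=> Ix Iy Nx Ny /andP[zx xz] /andP[zy yz].
have [xy|xy|->] := ltgtP x y.
- by rewrite distrC; exact: key.
- exact: key.
- rewrite subrr normr0 powR0 ?gt_eqF// mulr_ge0 ?powR_ge0// subr_ge0.
  exact: Wnd (le_trans zx xz).
Qed.

(** The pointwise bound carries the power [p - 1] of [z' - z]; integration over the interval
    supplies the missing factor. *)
Lemma sb_int (B : set T) (y z z' : R) : measurable B -> B `<=` I `&` `[z, z']%classic ->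
  I y -> ~ N y -> z <= y <= z' ->
  (\int[mu]_(x in B) (`|g x - g y| `^ p)%:E <= ((z' - z) `^ p * (W z' - W z))%:E)%E.
Proof.
move=> mB BI Iy Ny zyz; have [mN N0 Wnd W0M H] := sb.
have zz : z <= z' by have /andP[/le_trans h /h] := zyz.
have W0 : 0 <= W z' - W z by rewrite subr_ge0 Wnd.
have -> : (z' - z) `^ p * (W z' - W z) = (z' - z) `^ (p - 1) * (W z' - W z) * (z' - z).
  rewrite mulrAC; congr (_ * _); have [->|zz0] := eqVneq z z'.
    by rewrite subrr mulr0 powR0// gt_eqF.
  rewrite -[X in _ * X]powRr1 ?subr_ge0// -powRD ?subrK//.
  by rewrite (gt_eqF p_gt0).
apply: (@integral_ae_cst B N) => //.
- by apply: measurable_powabs; apply: measurable_funTS; exact: measurable_funB.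
- by rewrite mulr_ge0// powR_ge0.
- apply: (@le_trans _ _ (mu (`[z, z']%classic : set T))).
    by apply: le_measure; rewrite ?inE// => x /BI[].
  by rewrite lebesgue_measure_itv/= lte_fin; case: ltP => //; rewrite ?EFinB// lee_fin subr_ge0.
- by move=> x /BI[Ix] /=; rewrite in_itv/= => zxz Nx; rewrite lee_fin; exact: sb_near.
Qed.

Lemma sb_point (x y : R) : x < y -> (forall z, x < z < y -> I z) -> exists z : R, [/\ x < z < y, I z & ~ N z].
Proof.
move=> xy h; have [mN N0 _ _ _] := sb.
have nN : mu.-negligible N by exists N; split.
by have [z [zxy nz]] := not_negligible_itv nN xy; exists z; split => //; exact: h.
Qed.

(** Goes from [z] to [w] through good points, advancing by more than [h / 2] and less than [h] until
    [w] is within reach [h]; this bounds the number of steps by [n]. Energy and L^p error of the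
    pieces are controlled by increments of [W], which telescope. The final segment, from [w] to
    [zR], is the one charged to [e]. *)
Lemma sb_chain (w zR aR h e : R) (n : nat) : I w -> ~ N w -> w < zR -> 0 < h ->
  `|aR - g w| `^ p <= e * (zR - w) `^ (p - 1) ->
  (\int[mu]_(x in I `&` `[w, zR[) (`|g x - aR| `^ p)%:E <= e%:E)%E ->
  (\int[mu]_(x in I `&` `[w, zR[) (`|g x - g w| `^ p)%:E <= e%:E)%E ->
  forall z : R, I z -> ~ N z -> z <= w -> w - z <= n%:R * (h / 2) ->
  exists s, [/\ incr z s, lastz z s = zR, lastv (g z) s = aR,
    slope_energy z (g z) s <= W w - W z + e &
    (\int[mu]_(x in I `&` `[z, zR[) (`|interp z (g z) s x - g x| `^ p)%:E <=
      (2 `^ p * 2 * h `^ p * (W w - W z) + 2 `^ p * 2 * e)%:E)%E].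
Proof.
move=> Iw Nw wR h0 E1 E2 E3; have [mN N0 Wnd W0M H] := sb.
have base : exists s, [/\ incr w s, lastz w s = zR, lastv (g w) s = aR,
    slope_energy w (g w) s <= W w - W w + e &
    (\int[mu]_(x in I `&` `[w, zR[) (`|interp w (g w) s x - g x| `^ p)%:E <=
      (2 `^ p * 2 * h `^ p * (W w - W w) + 2 `^ p * 2 * e)%:E)%E].
  exists [:: (zR, aR)]; split => //=.
    rewrite subrr add0r addr0 ler_pdivrMr ?powR_gt0 ?subr_gt0//.
  have I0 : (\int[mu]_(x in I `&` `[zR, lastz zR [::]%R[) (`|interp zR aR [::] x - g x| `^ p)%:E <= (0%R)%:E)%E.
    rewrite (_ : I `&` _ = set0) ?integral_set0//; apply/seteqP; split => x //= [_].
    by rewrite in_itv/= => /andP[/le_lt_trans zx /zx]; rewrite ltxx.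
  have := @interp_cons_Lp I g w (g w) zR aR [::] e e 0 mI mg wR (lexx zR) E3 E2 I0.
  move=> /le_trans; apply; rewrite lee_fin subrr mulr0 add0r addr0.
  by rewrite -mulrA ler_wpM2l ?powR_ge0// (_ : 2 * e = e + e)//; ring.
have step (z z' : R) s : I z -> ~ N z -> I z' -> ~ N z' -> z < z' -> z' - z <= h -> z' <= w ->
  [/\ incr z' s, lastz z' s = zR, lastv (g z') s = aR,
    slope_energy z' (g z') s <= W w - W z' + e &
    (\int[mu]_(x in I `&` `[z', zR[) (`|interp z' (g z') s x - g x| `^ p)%:E <=
      (2 `^ p * 2 * h `^ p * (W w - W z') + 2 `^ p * 2 * e)%:E)%E] ->
  exists s, [/\ incr z s, lastz z s = zR, lastv (g z) s = aR,
    slope_energy z (g z) s <= W w - W z + e &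
    (\int[mu]_(x in I `&` `[z, zR[) (`|interp z (g z) s x - g x| `^ p)%:E <=
      (2 `^ p * 2 * h `^ p * (W w - W z) + 2 `^ p * 2 * e)%:E)%E].
  move=> Iz Nz Iz' Nz' zz zh zw [s1 s2 s3 s4 s5].
  exists ((z', g z') :: s); split => //.
    rewrite /=; have L0 : 0 < (z' - z) `^ (p - 1) by rewrite powR_gt0// subr_gt0.
    have : `|g z' - g z| `^ p / (z' - z) `^ (p - 1) <= W z' - W z.
      by rewrite ler_pdivrMr// mulrC; exact: H.
    by lra.
  set hp := h `^ p * (W z' - W z).
  have hpE (B : set T) (y : R) : measurable B -> B `<=` I `&` `[z, z']%classic -> I y -> ~ N y -> z <= y <= z' ->
      (\int[mu]_(x in B) (`|g x - g y| `^ p)%:E <= hp%:E)%E.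
    move=> mB BI Iy Ny zyz; apply: (le_trans (sb_int mB BI Iy Ny zyz)).
    rewrite lee_fin; apply: ler_wpM2r; first by rewrite subr_ge0 Wnd// ltW.
    by apply: ler_powRp => //; rewrite subr_ge0 ltW.
  pose B : set T := I `&` `[z, z'[%classic.
  have mB : measurable B by apply: measurableI => //; exact: measurable_itv.
  have BI : B `<=` I `&` `[z, z']%classic.
    by move=> x [Ix] /=; rewrite !in_itv/= => /andP[-> /ltW ->].
  have h1 := hpE B z mB BI Iz Nz (introT andP (conj (lexx z) (ltW zz))).
  have h2 := hpE B z' mB BI Iz' Nz' (introT andP (conj (ltW zz) (lexx z'))).
  have zl : z' <= lastz z' s by rewrite s2 ltW// (le_lt_trans zw).
  rewrite -s2 in s5; have := interp_cons_Lp mI mg zz zl h1 h2 s5; rewrite s2.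
  move=> /le_trans; apply; rewrite lee_fin /hp.
  have : 2 `^ p * 2 * h `^ p * (W w - W z) = 2 `^ p * 2 * h `^ p * (W w - W z') + 2 `^ p * (h `^ p * (W z' - W z) + h `^ p * (W z' - W z)) by ring.
  by move=> ->; rewrite addrCA addrA addrC addrA.
elim: n => [|n IH] z Iz Nz zw zn.
  have -> : z = w by apply/eqP; rewrite eq_le zw -subr_le0 (le_trans zn)// mul0r.
  exact: base.
have [->//|zNw] := eqVneq z w.
have zw' : z < w by rewrite lt_neqAle zNw.
have [wh|hw] := leP (w - z) h.
  by have [s Hs] := base; apply: step Hs.
have h2 : 0 < h / 2 by rewrite divr_gt0.
have hh : h / 2 < h by rewrite ltr_pdivrMr// ltr_pMr// ltr1n.
have [] := @sb_point (z + h / 2) (z + h); first by rewrite ltrD2l.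
  move=> x /andP[x1 x2]; apply: (II Iz Iw).
  by rewrite (le_trans _ (ltW x1)) ?lerDl ?(ltW h2)//= ltW// (lt_trans x2)// -ltrBrDl.
move=> z' [/andP[z1 z2] Iz' Nz'].
have z'w : z' <= w by rewrite ltW// (lt_trans z2)// -ltrBrDl.
have [|s Hs] := IH z' Iz' Nz' z'w.
  move: zn; rewrite -natr1 mulrDl mul1r => zn.
  by move: (n%:R * _) zn => t zn; lra.
apply: step Hs => //; first by rewrite (le_lt_trans _ z1)// lerDl ltW.
by rewrite lerBlDl ltW.
Qed.

End WithBound.
End SlopeNodes.

(** * Behaviour of the polygon at the ends of the interval *)

Lemma tail_small (D : set T) (f : T -> \bar R) (e : R) : measurable D -> measurable_fun D f ->
  (forall x, 0 <= f x < +oo)%E -> (\int[mu]_(x in D) f x < +oo)%E -> 0 < e ->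
  exists n : nat, (\int[mu]_(x in D `&` `]-oo, (- n%:R)%R]) f x <= e%:E)%E.
Proof.
move=> mD mf f0 fI e0.
have ff (x : T) : (0 <= f x)%E by case/andP: (f0 x).
have mfn n : measurable_fun D (f \_ `]-oo, (- n%:R)%R]).
  have mt : measurable (`]-oo, (- n%:R)%R]%classic : set T) by exact: measurable_itv.
  by apply: (proj1 (measurable_restrict _ mt mD)); apply: measurable_funS mf => //; exact: subIsetl.
have cv (x : T) : D x -> (f \_ `]-oo, (- n%:R)%R]) x @[n --> \oo] --> (cst 0%E : T -> \bar R) x.
  move=> _; apply: cvg_near_cst; near=> n; rewrite patchE memNset//= in_itv/= => xn.
  have : `|x| < n%:R by near: n; exact: nbhs_infty_gtr.
  by rewrite ltr_norml => /andP[/(le_lt_trans xn)]; rewrite ltxx.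
have iF : mu.-integrable D f.
  apply/integrableP; split; first exact: mf.
  suff -> : (\int[mu]_(x in D) `|f x| = \int[mu]_(x in D) f x)%E by [].
  by apply: eq_integral => x _; rewrite gee0_abs.
have ffin (x : T) : D x -> f x \is a fin_num by move=> _; rewrite ge0_fin_numE//; case/andP: (f0 x).
have dom n (x : T) : D x -> (`|(f \_ `]-oo, (- n%:R)%R]) x| <= f x)%E.
  by move=> _; rewrite patchE; case: ifP => _; rewrite ?gee0_abs// abse0.
have := @dominated_cvg _ _ _ mu D mD (fun n => f \_ `]-oo, (- n%:R)%R]) (cst 0%E) f mfn cv ffin iF dom.
rewrite integral0 => /fine_cvgP[fin /cvgrPdist_le/(_ e e0) near_e].
have [n [h1 h2]] : exists n : nat, (\int[mu]_(x in D) (f \_ `]-oo, (- n%:R)%R]) x)%E \is a fin_num /\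
    fine (\int[mu]_(x in D) (f \_ `]-oo, (- n%:R)%R]) x)%E <= e.
  near \oo => n; exists n; split; first by near: n.
  have /= : `|0 - fine (\int[mu]_(x in D) (f \_ `]-oo, (- n%:R)%R]) x)%E| <= e by near: n.
  by rewrite sub0r normrN; apply: le_trans; exact: ler_norm.
by exists n; rewrite integral_mkcondr -(fineK h1) lee_fin.
Unshelve. all: by end_near. Qed.

(** The first segment, from [(z, a)] to [(y, g y)], covers two situations. If [I] is bounded below,
    [z] is its infimum and the segment is constant; if not, the polygon descends to [a = 0] over a
    unit length. *)
Definition left_cap (I : set T) (g : T -> R) (N : set T) (b e z y a : R) : Prop :=
  [/\ I y, ~ N y, z < y < b & a = 0 \/ forall x, I x -> z < x] /\
  [/\ `|g y - a| `^ p <= e * (y - z) `^ (p - 1),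
      (\int[mu]_(x in I `&` `]-oo, z]) (`|g x| `^ p)%:E <= e%:E)%E,
      (\int[mu]_(x in I `&` `[z, y]) (`|g x - a| `^ p)%:E <= e%:E)%E &
      (\int[mu]_(x in I `&` `[z, y]) (`|g x - g y| `^ p)%:E <= e%:E)%E].

Lemma left_cap_bounded (I : set T) (g : T -> R) (N : set T) (W : R -> R) (M b e : R) :
  measurable I -> open (I : set R) -> is_interval (I : set R) -> measurable_fun setT g ->
  slope_bound I g N W M -> I b -> has_lbound (I : set R) -> 0 < e ->
  exists z y a, left_cap I g N b e z y a.
Proof.
move=> mI oI II mg sb Ib lbI e0; have [mN N0 Wnd W0M H] := sb.
have hI : has_inf (I : set R) by split => //; exists b.
pose z := inf (I : set R).
have zI x : I x -> z < x.
  move=> Ix; have [r r0 rI] := (@nbhs_ballP R R x I).1 (open_nbhs_nbhs (conj oI Ix)).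
  have Ixr : I (x - r / 2).
    apply: rI; rewrite /ball/= opprB addrC subrK gtr0_norm ?divr_gt0//.
    by rewrite ltr_pdivrMr// ltr_pMr// ltr1n.
  have : z <= x - r / 2 by apply: ge_inf => //; case: hI.
  by move=> /le_lt_trans; apply; rewrite ltrBlDr ltrDl divr_gt0.
have M0 : 0 <= M by have /andP[h1 h2] := W0M 0; exact: le_trans h2.
(* The three bounds give in turn [h ^ p <= h], [y < b], and [h * M <= e]. *)
pose h := Num.min 1 (Num.min (b - z) (e / (M + 1))).
have h0 : 0 < h by rewrite !lt_min ltr01 subr_gt0 zI//= divr_gt0// ltr_wpDl.
have h1 : h <= 1 by rewrite ge_min lexx.
have hb : h <= b - z by rewrite !ge_min lexx orbT.
have he : h <= e / (M + 1) by rewrite !ge_min lexx !orbT.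
have hp : h `^ p * M <= e.
  apply: (@le_trans _ _ (h * M)).
    by apply: ler_wpM2r => //; apply: ge1r_powR => //; rewrite h0.
  move: he; rewrite ler_pdivlMr ?ltr_wpDl// => /(le_trans _); apply.
  by rewrite ler_wpM2l ?lerDl// ltW.
have [] := @sb_point I g N W M sb z (z + h); first by rewrite ltrDl.
  move=> x /andP[zx xh]; have xz : 0 < x - z by rewrite subr_gt0.
  have [i Ii] := inf_adherent xz hI; rewrite -/z addrC subrK => ix.
  by apply: (II _ _ Ii Ib); rewrite (ltW ix)/= ltW// (lt_le_trans xh)// -lerBrDl.
move=> y [/andP[zy yh] Iy Ny].
have yh' : y - z <= h by rewrite lerBlDl ltW.
exists z, y, (g y); split; split => //.
- by rewrite zy (lt_le_trans yh)// -lerBrDl.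
- by right.
- by rewrite subrr normr0 powR0 ?gt_eqF// mulr_ge0 ?powR_ge0// ltW.
- rewrite (_ : I `&` _ = set0) ?integral_set0 ?lee_fin ?ltW//.
  apply/seteqP; split => x //= [/zI zx]; rewrite in_itv/= => /(lt_le_trans zx).
  by rewrite ltxx.
all: have mB : measurable (I `&` `[z, y]%classic) by apply: measurableI => //; exact: measurable_itv.
all: apply: (le_trans (sb_int mg sb mB (@subset_refl _ _) Iy Ny _)); rewrite ?lexx ?(ltW zy)//.
all: rewrite lee_fin; apply: le_trans hp; apply: ler_pM; rewrite ?powR_ge0 ?subr_ge0 ?Wnd ?(ltW zy)//.
all: try by apply: ler_powRp => //; rewrite subr_ge0 ltW.
all: have /andP[_ w2] := W0M y; have /andP[w1 _] := W0M z; by rewrite (le_trans _ w2)// gerBl.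
Qed.

(** Far to the left [|g| ^ p] has integral at most [q / 2] on an interval of length 1, so some good
    point [y] there has [|g y| ^ p <= q]. With [z = y - 1] the segment has unit length, and its
    energy is [|g y| ^ p]. *)
Lemma left_cap_unbounded (I : set T) (g : T -> R) (N : set T) (b e : R) :
  measurable I -> is_interval (I : set R) -> measurable_fun setT g ->
  measurable N -> mu N = 0%E -> (\int[mu]_(x in I) (`|g x| `^ p)%:E < +oo)%E ->
  I b -> ~ has_lbound (I : set R) -> 0 < e ->
  exists z y a, left_cap I g N b e z y a.
Proof.
move=> mI II mg mN N0 gLp Ib lbI e0.
have Idown (x : R) : x <= b -> I x.
  move=> xb; apply: contrapT => nI; apply: lbI; exists x => y Iy.
  rewrite leNgt; apply/negP => yx; apply: nI.
  by apply: (II _ _ Iy Ib); rewrite (ltW yx).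
have c2 : 0 < (2 : R) `^ p by rewrite powR_gt0.
pose q := Num.min e (e / (2 `^ p * 2)).
have q0 : 0 < q by rewrite lt_min e0 divr_gt0// mulr_gt0.
have qe : q <= e by rewrite ge_min lexx.
have q2 : 2 `^ p * (q + q) <= e.
  have : q <= e / (2 `^ p * 2) by rewrite ge_min lexx orbT.
  rewrite ler_pdivlMr ?mulr_gt0// => h.
  by rewrite (_ : _ * (q + q) = q * (2 `^ p * 2))//; ring.
pose f (x : T) : \bar R := (`|g x| `^ p)%:E.
have mf D : measurable_fun D f by apply: measurable_powabs; exact: measurable_funTS.
have f0 (x : T) : (0 <= f x < +oo)%E by rewrite lee_fin powR_ge0 ltry.
have f0' (x : T) : (0 <= f x)%E by rewrite lee_fin powR_ge0.
have qq : 0 < q / 2 by rewrite divr_gt0.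
have [n tn] := tail_small mI (mf _) f0 gLp qq.
pose r := Num.min (- n%:R) b.
have rb : r <= b by rewrite ge_min lexx orbT.
have rn : r <= - n%:R by rewrite ge_min lexx.
have sub (B : set T) : measurable B -> B `<=` I `&` `]-oo, r]%classic -> (\int[mu]_(x in B) f x <= (q / 2)%:E)%E.
  move=> mB BI; apply: le_trans tn; apply: ge0_subset_integral => //.
  - by apply: measurableI => //; exact: measurable_itv.
  - by move=> x /BI[Ix] /=; rewrite !in_itv/= => xr; split => //; exact: le_trans rn.
have [y [/andP[y1 y2] Ny yq]] : exists y : R, [/\ r - 1 < y < r, ~ N y & `|g y| `^ p <= q].
  apply: contrapT => nex.
  pose B : set T := `](r - 1), r[%classic.
  have mB : measurable B by exact: measurable_itv.
  have : (\int[mu]_(x in B) cst q%:E x <= (q / 2)%:E)%E.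
    rewrite (ge0_negligible_integral mN mB)//; last by move=> x _; rewrite lee_fin ltW.
    have mBN : measurable (B `\` N) by exact: measurableD.
    apply: (le_trans _ (@sub (B `\` N) mBN _)).
      apply: ge0_le_integral => //.
        by move=> x _; rewrite lee_fin ltW.
      move=> x [Bx Nx]; rewrite lee_fin leNgt; apply/negP => lt; apply: nex.
      by exists x; split; [move: Bx; rewrite /B/= in_itv/=|exact: Nx|exact: ltW].
    move=> x [+ _]; rewrite /B/= !in_itv/= => /andP[_ /ltW xr]; split => //.
    exact: Idown (le_trans xr rb).
  have muB : mu B = 1%E.
    rewrite /B lebesgue_measure_itv/= lte_fin ltrBlDr ltrDl ltr01 -EFinB.
    by congr EFin; ring.
  rewrite integral_cst// [X in (_ * X)%E]muB mule1 lee_fin.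
  by rewrite ler_pdivlMr// mulr_natr mulr2n gerDl leNgt q0.
have yr : y <= r by exact: ltW.
have Iy : I y by exact: Idown (le_trans yr rb).
have mlow : measurable (I `&` `]-oo, (y - 1)%R]%classic).
  by apply: measurableI => //; exact: measurable_itv.
have mmid : measurable (I `&` `[(y - 1)%R, y]%classic).
  by apply: measurableI => //; exact: measurable_itv.
have q2e : ((q / 2)%:E <= e%:E)%E by rewrite lee_fin (le_trans _ qe)// ler_pdivrMr// ler_pMr// ler1n.
have mids : (\int[mu]_(x in I `&` `[(y - 1)%R, y]) f x <= (q / 2)%:E)%E.
  by apply: sub => // x [Ix] /=; rewrite !in_itv/= => /andP[_ xy]; split => //; exact: le_trans yr.
exists (y - 1), y, 0; split; split => //.
- by rewrite ltrBlDr ltrDl ltr01 (lt_le_trans y2).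
- by left.
- by rewrite subr0 opprB addrC subrK powR1 mulr1 (le_trans yq).
- apply: le_trans q2e; apply: sub => // x [Ix] /=; rewrite !in_itv/= => xy; split => //.
  by rewrite (le_trans xy)// (le_trans _ yr)// gerBl.
- apply: le_trans q2e; have -> : (\int[mu]_(x in I `&` `[(y - 1)%R, y]) (`|g x - 0| `^ p)%:E =
    \int[mu]_(x in I `&` `[(y - 1)%R, y]) f x)%E by apply: eq_integral => x _; rewrite subr0.
  exact: mids.
- apply: (@le_trans _ _ (2 `^ p * (q / 2 + q))%:E); last first.
    rewrite lee_fin; apply: le_trans q2; rewrite ler_pM2l// lerD2r.
    by rewrite ler_pdivrMr// ler_pMr// ler1n.
  apply: (@Lp_triangle _ g (cst 0) (cst (g y))); [by apply: measurableI| |exact: measurable_cst|exact: measurable_cst| |].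
  + exact: measurable_funTS.
  + have -> : (\int[mu]_(x in I `&` `[(y - 1)%R, y]) (`|g x - cst 0 x| `^ p)%:E =
      \int[mu]_(x in I `&` `[(y - 1)%R, y]) f x)%E by apply: eq_integral => x _; rewrite subr0.
    exact: mids.
  + have -> : (\int[mu]_(x in I `&` `[(y - 1)%R, y]) (`|cst 0 x - cst (g y) x| `^ p)%:E =
      \int[mu]_(x in I `&` `[(y - 1)%R, y]) cst (`|g y| `^ p)%:E x)%E.
      by apply: eq_integral => x _; rewrite sub0r normrN.
    rewrite integral_cst//.
    apply: (@le_trans _ _ ((`|g y| `^ p)%:E * 1)%E); last by rewrite mule1 lee_fin.
    apply: lee_wpmul2l; first by rewrite lee_fin powR_ge0.
    apply: (@le_trans _ _ (mu (`[(y - 1)%R, y]%classic : set T))).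
      by apply: le_measure; rewrite ?inE//; exact: measurable_itv.
    rewrite lebesgue_measure_itv/= lte_fin ltrBlDr ltrDl ltr01 -EFinB lee_fin.
    by rewrite opprB addrC subrK.
Qed.

Lemma left_cap_ex (I : set T) (g : T -> R) (N : set T) (W : R -> R) (M b e : R) :
  measurable I -> open (I : set R) -> is_interval (I : set R) -> measurable_fun setT g ->
  (\int[mu]_(x in I) (`|g x| `^ p)%:E < +oo)%E ->
  slope_bound I g N W M -> I b -> 0 < e ->
  exists z y a, left_cap I g N b e z y a.
Proof.
move=> mI oI II mg gLp sb Ib e0; have [mN N0 _ _ _] := sb.
have [lb|nlb] := pselect (has_lbound (I : set R)).
  exact: left_cap_bounded sb Ib lb e0.
exact: left_cap_unbounded.
Qed.

Definition right_cap (I : set T) (g : T -> R) (N : set T) (b e w z a : R) : Prop :=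
  [/\ I w, ~ N w, b < w < z & a = 0 \/ forall x, I x -> x < z] /\
  [/\ `|a - g w| `^ p <= e * (z - w) `^ (p - 1),
      (\int[mu]_(x in I `&` `[z, +oo[) (`|g x| `^ p)%:E <= e%:E)%E,
      (\int[mu]_(x in I `&` `[w, z]) (`|g x - a| `^ p)%:E <= e%:E)%E &
      (\int[mu]_(x in I `&` `[w, z]) (`|g x - g w| `^ p)%:E <= e%:E)%E].

(** The left case for the reflected data; [W] is replaced by [M - W (- x)], which is again
    nondecreasing with values in [[0, M]]. *)
Lemma right_cap_ex (I : set T) (g : T -> R) (N : set T) (W : R -> R) (M b e : R) :
  measurable I -> open (I : set R) -> is_interval (I : set R) -> measurable_fun setT g ->
  (\int[mu]_(x in I) (`|g x| `^ p)%:E < +oo)%E ->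
  slope_bound I g N W M -> I b -> 0 < e ->
  exists w z a, right_cap I g N b e w z a.
Proof.
move=> mI oI II mg gLp [mN N0 Wnd W0M H] Ib e0.
pose opp : T -> T := -%R.
have mopp : measurable_fun setT opp by exact: oppr_measurable.
have mpre (B : set T) : measurable B -> measurable (opp @^-1` B).
  by move=> mB; rewrite -[X in measurable X]setTI; exact: mopp.
have intN (B : set T) (F : T -> \bar R) : measurable B -> measurable_fun setT F ->
    (forall x, 0 <= F x)%E -> (\int[mu]_(x in opp @^-1` B) F (opp x) = \int[mu]_(x in B) F x)%E.
  by move=> mB mF F0; apply: ge0_integral_opp => //; exact: measurable_funTS.
have mG (c : R) : measurable_fun setT (fun x : T => (`|g x - c| `^ p)%:E).
  by apply: measurable_powabs; exact: measurable_funB.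
have mG0 : measurable_fun setT (fun x : T => (`|g x| `^ p)%:E) by exact: measurable_powabs.
have G0 (h : T -> R) (x : T) : (0 <= (`|h x| `^ p)%:E :> \bar R)%E by rewrite lee_fin powR_ge0.
pose I' := opp @^-1` I; pose g' := g \o opp; pose N' := opp @^-1` N.
have [||||||||z [y [a [[Iy Ny /andP[zy yb] ta] [e1 e2 e3 e4]]]]] :=
    @left_cap_ex I' g' N' (fun x => M - W (- x)) M (- b) e.
- exact: mpre.
- by apply: open_comp => // x _; exact: opp_continuous.
- move=> x y Ix Iy z /andP[xz zy]; apply: (II (- y) (- x) Iy Ix).
  by rewrite !lerN2 xz zy.
- exact: measurableT_comp.
- apply: le_lt_trans gLp.
  by rewrite -(intN I (fun x => (`|g x| `^ p)%:E) mI mG0 (G0 g)).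
- split.
  + exact: mpre.
  + have := intN N (cst 1%E) mN (measurable_cst _) (fun _ => lee01).
    by rewrite !integral_cst ?mul1e//; [move=> ->|exact: mpre].
  + by move=> x y xy; rewrite lerD2l lerN2 Wnd// lerN2.
  + by move=> x; have /andP[h1 h2] := W0M (- x); rewrite subr_ge0 h2 gerBl.
  + move=> x y Ix Iy Nx Ny xy.
    have := H _ _ Iy Ix Ny Nx; rewrite /opp ltrN2 => /(_ xy); rewrite /g'/= distrC /opp.
    have -> : - x - - y = y - x by rewrite opprK addrC.
    by have -> : M - W (- y) - (M - W (- x)) = W (- x) - W (- y) by ring.
- by rewrite /I' /opp/= opprK.
- exact: e0.
have sw (B : set T) (B' : set T) (F : T -> \bar R) : measurable B -> measurable_fun setT F ->
    (forall x, 0 <= F x)%E -> opp @^-1` B = B' ->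
    (\int[mu]_(x in I' `&` B') F (opp x) <= e%:E)%E -> (\int[mu]_(x in I `&` B) F x <= e%:E)%E.
  move=> mB mF F0 <- h; have mIB : measurable (I `&` B) by exact: measurableI.
  by rewrite -(intN _ F mIB mF F0).
exists (- y), (- z), a; split; [split; [exact: Iy|exact: Ny| |]|split].
- by rewrite ltrN2 zy ltrNr yb.
- case: ta => [a0|ta]; [by left|right => x Ix].
  by rewrite ltrNr; apply: ta; rewrite /I' /opp/= opprK.
- by rewrite distrC opprK [- z + y]addrC.
- apply: (sw `[(- z)%R, +oo[%classic `]-oo, z]%classic _ (measurable_itv _) mG0 (G0 g) _ e2).
  by apply/seteqP; split => x /=; rewrite /opp !in_itv/= andbT lerN2.
- apply: (sw `[(- y)%R, (- z)%R]%classic `[z, y]%classic _ (measurable_itv _) (mG a) (G0 (fun x => g x - a)) _ e3).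
  by apply/seteqP; split => x /=; rewrite /opp !in_itv/= !lerN2 andbC.
- apply: (sw `[(- y)%R, (- z)%R]%classic `[z, y]%classic _ (measurable_itv _) (mG (g (- y)))
    (G0 (fun x => g x - g (- y))) _ e4).
  by apply/seteqP; split => x /=; rewrite /opp !in_itv/= !lerN2 andbC.
Qed.

Lemma nodes_of_slopes (I : set T) (g : T -> R) (N : set T) (W : R -> R) (M e : R) :
  measurable I -> open (I : set R) -> is_interval (I : set R) -> measurable_fun setT g ->
  (\int[mu]_(x in I) (`|g x| `^ p)%:E < +oo)%E ->
  slope_bound I g N W M -> 0 < e ->
  exists z a s, nodes_for I g e z a s /\ slope_energy z a s <= M + e.
Proof.
move=> mI oI II mg gLp sb e0; have [mN N0 Wnd W0M H] := sb.
have M0 : 0 <= M by have /andP[h1 h2] := W0M 0; exact: le_trans h2.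
have [I0|/set0P[b Ib]] := eqVneq I set0.
  exists 0, 0, [::]; split; last by rewrite addr_ge0// ltW.
  by split => //; [left|left|rewrite I0 integral_set0 lee_fin ltW].
have c2 : 0 < (2 : R) `^ p by rewrite powR_gt0.
(* The two end segments and the two parts of [g] outside the polygon produce an L^p error
   [e1 * (2 + 2 ^ p * 4)]; this is made equal to [e / 2]. *)
pose K := 2 * (2 + 2 `^ p * 4); have K0 : 0 < K by rewrite mulr_gt0// addr_gt0// mulr_gt0.
pose e1 := e / K; have e10 : 0 < e1 by rewrite divr_gt0.
have eK : e1 * (2 + 2 `^ p * 4) = e / 2.
  by rewrite /e1 /K; field; rewrite gt_eqF// addr_gt0// mulr_gt0.
have e1e : e1 + e1 <= e.
  have : e1 * 2 <= e / 2 by rewrite -eK ler_pM2l// lerDl ltW// mulr_gt0.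
  by lra.
have [zL [yL [aL [[Iy Ny /andP[zy yb] tL] [L1 L2 L3 L4]]]]] := left_cap_ex mI oI II mg gLp sb Ib e10.
have [w [zR [aR [[Iw Nw /andP[bw wz] tR] [R1 R2 R3 R4]]]]] := right_cap_ex mI oI II mg gLp sb Ib e10.
(* The mesh is chosen so that the interpolation error of the middle part takes the other [e / 2]. *)
pose h := Num.min 1 (e / 2 / (2 `^ p * 2 * (M + 1))).
have M1 : 0 < M + 1 by rewrite ltr_wpDl.
have h0 : 0 < h by rewrite lt_min ltr01/= divr_gt0 ?divr_gt0// mulr_gt0// mulr_gt0.
have h1 : h <= 1 by rewrite ge_min lexx.
have hM : 2 `^ p * 2 * h `^ p * M <= e / 2.
  have : h <= e / 2 / (2 `^ p * 2 * (M + 1)) by rewrite ge_min lexx orbT.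
  rewrite ler_pdivlMr ?mulr_gt0//; apply: le_trans.
  have -> : h * (2 `^ p * 2 * (M + 1)) = 2 `^ p * 2 * h * (M + 1) by ring.
  have hh : h `^ p <= h by apply: ge1r_powR => //; rewrite h0.
  apply: ler_pM; rewrite ?mulr_ge0 ?powR_ge0 ?(ltW c2)// ?lerDl//.
  by apply: ler_wpM2l => //; rewrite mulr_ge0// ltW.
have yw : yL <= w by rewrite ltW// (lt_trans yb).
have [n nw] : exists n : nat, w - yL <= n%:R * (h / 2).
  have h2 : 0 < h / 2 by rewrite divr_gt0.
  exists (Num.truncn ((w - yL) / (h / 2))).+1.
  by rewrite -ler_pdivrMr// ltW// truncnS_gt.
have sub (B : set T) (c : R) (B' : set T) : measurable B -> measurable B' -> B `<=` B' ->
    (\int[mu]_(x in B') (`|g x - c| `^ p)%:E <= e1%:E)%E -> (\int[mu]_(x in B) (`|g x - c| `^ p)%:E <= e1%:E)%E.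
  move=> mB mB' BB; apply: le_trans; apply: ge0_subset_integral => //.
    by apply: measurable_powabs; apply: measurable_funTS; exact: measurable_funB.
have mII (i : interval R) : measurable (I `&` [set` i]) by apply: measurableI => //; exact: measurable_itv.
have IIr (x y : R) : I `&` `[x, y[%classic `<=` I `&` `[x, y]%classic.
  by move=> t [It] /=; rewrite !in_itv/= => /andP[-> /ltW ->].
have R3' := sub _ aR _ (mII `[w, zR[) (mII `[w, zR]) (@IIr _ _) R3.
have R4' := sub _ (g w) _ (mII `[w, zR[) (mII `[w, zR]) (@IIr _ _) R4.
have L3' := sub _ aL _ (mII `[zL, yL[) (mII `[zL, yL]) (@IIr _ _) L3.
have L4' := sub _ (g yL) _ (mII `[zL, yL[) (mII `[zL, yL]) (@IIr _ _) L4.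
have [s [s1 s2 s3 s4 s5]] := sb_chain mI II mg sb Iw Nw wz h0 R1 R3' R4' Iy Ny yw nw.
have yz : yL <= lastz yL s by rewrite s2 (le_trans yw)// ltW.
rewrite -s2 in s5.
have mid := interp_cons_Lp mI mg zy yz L3' L4' s5; rewrite s2 in mid.
have WM : W w - W yL <= M.
  by have /andP[_ w2] := W0M w; have /andP[w1 _] := W0M yL; rewrite (le_trans _ w2)// gerBl.
exists zL, aL, ((yL, g yL) :: s); split; last first.
  rewrite /=; have : `|g yL - aL| `^ p / (yL - zL) `^ (p - 1) <= e1.
    by rewrite ler_pdivrMr// powR_gt0// subr_gt0.
  by move: s4 WM e1e; clear; lra.
split.
- by split.
- by case: tL => [a0|tL]; [left|right => x /tL /ltW].
- by rewrite /= s2 s3; case: tR => [a0|tR]; [left|right].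
rewrite /= s2.
pose A := I `&` `[zL, zR[%classic; pose B := I `&` `]-oo, zL[%classic; pose C := I `&` `[zR, +oo[%classic.
have mA : measurable A by exact: mII.
have mB : measurable B by exact: mII.
have mC : measurable C by exact: mII.
have zLR : zL <= zR by rewrite ltW// (lt_trans zy)// (lt_trans yb)// (lt_trans bw).
have IE : I = A `|` (B `|` C).
  apply/seteqP; split => x; last by move=> [[]|[[]|[]]].
  move=> Ix; case: (ltP x zL) => xz; first by right; left; split => //=; rewrite in_itv.
  case: (ltP x zR) => xl; first by left; split => //; rewrite /A/= in_itv/= xz.
  by right; right; split => //=; rewrite in_itv/= xl.
have dBC : [disjoint B & C].
  rewrite disj_set2E; apply/eqP; rewrite -subset0 => x [[_ xz] [_ xl]].
  move: xz xl => /=; rewrite !in_itv/= andbT => xz lx.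
  by have := le_lt_trans (le_trans zLR lx) xz; rewrite ltxx.
have BA x : B x -> ~ `[zL, zR[%classic x.
  move=> [_] /=; rewrite !in_itv/= => xz /andP[zx _].
  by have := le_lt_trans zx xz; rewrite ltxx.
have CA x : C x -> ~ `[zL, zR[%classic x.
  move=> [_] /=; rewrite !in_itv/= andbT => lx /andP[_ xl].
  by have := le_lt_trans lx xl; rewrite ltxx.
have dA : [disjoint A & B `|` C].
  by rewrite disj_set2E; apply/eqP; rewrite -subset0 => x [[_ Ax] [/BA|/CA]].
pose G := interp zL aL ((yL, g yL) :: s).
pose V (x : T) : \bar R := (`|(G \_ `[zL, zR[%classic) x - g x| `^ p)%:E.
have mV : measurable_fun setT V.
  apply: measurable_powabs; apply: measurable_funB => //.
  apply: measurable_restr; [exact: measurable_itv|exact: measurable_interp].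
have V0 (x : T) : (0 <= V x)%E by rewrite lee_fin powR_ge0.
change (\int[mu]_(x in I) V x <= e%:E)%E.
have mBC : measurable (B `|` C) by exact: measurableU.
have mVD (D : set T) : measurable_fun D V by exact: measurable_funTS.
rewrite {1}IE (ge0_integral_setU _ mA mBC (mVD _) (fun x _ => V0 x) dA).
rewrite (ge0_integral_setU _ mB mC (mVD _) (fun x _ => V0 x) dBC).
have out (D : set T) : (forall x, D x -> ~ `[zL, zR[%classic x) ->
    (\int[mu]_(x in D) V x = \int[mu]_(x in D) (`|g x| `^ p)%:E)%E.
  move=> DA; apply: eq_integral => x /set_mem Dx.
  by rewrite /V patchE memNset ?sub0r ?normrN//; exact: DA.
have VA : (\int[mu]_(x in A) V x = \int[mu]_(x in A) (`|G x - g x| `^ p)%:E)%E.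
  by apply: eq_integral => x /set_mem[_ Ax]; rewrite /V patchE mem_set.
have VB : (\int[mu]_(x in B) V x <= e1%:E)%E.
  rewrite (out _ BA); apply: le_trans L2.
  apply: (ge0_subset_integral _ mB (mII `]-oo, zL])).
  - by apply: measurable_powabs; exact: measurable_funTS.
  - by move=> x _; rewrite lee_fin powR_ge0.
  - by move=> x [Ix] /=; rewrite !in_itv/= => /ltW.
have VC : (\int[mu]_(x in C) V x <= e1%:E)%E by rewrite (out _ CA); exact: R2.
rewrite VA; apply: (le_trans (leeD mid (leeD VB VC))).
rewrite -!EFinD lee_fin.
have : 2 `^ p * 2 * h `^ p * (W w - W yL) <= e / 2.
  by apply: le_trans hM; apply: ler_wpM2l => //; rewrite mulr_ge0 ?powR_ge0// mulr_ge0// ltW.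
have : 2 `^ p * (e1 + e1) + 2 `^ p * 2 * e1 + (e1 + e1) = e / 2 by rewrite -eK; ring.
by move: (2 `^ p * 2 * h `^ p * _) (2 `^ p * (e1 + e1)) (2 `^ p * 2 * e1) => u v t; lra.
Qed.

(** * Approximation in L^p by Lipschitz functions with compact support, and by polygons *)

Lemma truncation_Lp (g : T -> R) (e : R) : measurable_fun setT g ->
  (\int[mu]_x (`|g x| `^ p)%:E < +oo)%E -> 0 < e ->
  exists (h : T -> R) (n : R), [/\ measurable_fun setT h, 0 < n, forall x, `|h x| <= n,
    forall x : R, n <= `|x| -> h x = 0 & (\int[mu]_x (`|h x - g x| `^ p)%:E <= e%:E)%E].
Proof.
move=> mg gLp e0.
pose h (n : nat) (x : T) : R := if (`|x : R| < n%:R) && (`|g x| <= n%:R) then g x else 0.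
have mh n : measurable_fun setT (h n).
  apply: measurable_fun_ifT => //; apply: measurable_and.
    by apply: measurable_fun_ltr => //; exact: measurable_normr.
  by apply: measurable_fun_ler => //; exact: measurableT_comp.
pose F n (x : T) : \bar R := (`|h n x - g x| `^ p)%:E.
pose G (x : T) : \bar R := (`|g x| `^ p)%:E.
have mF n : measurable_fun setT (F n) by apply: measurable_powabs; exact: measurable_funB.
have mG : measurable_fun setT G by exact: measurable_powabs.
have G0 (x : T) : (0 <= G x)%E by rewrite lee_fin powR_ge0.
have cv (x : T) : setT x -> F n x @[n --> \oo] --> (cst 0%E : T -> \bar R) x.
  move=> _; apply: cvg_near_cst; near=> n; rewrite /F /h.
  have -> : `|x : R| < n%:R by near: n; exact: nbhs_infty_gtr.
  have -> /= : `|g x| <= n%:R by near: n; exact: nbhs_infty_ger.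
  by rewrite subrr normr0 powR0// gt_eqF.
have iG : mu.-integrable setT G.
  apply/integrableP; split; first exact: mG.
  suff -> : (\int[mu]_x `|G x| = \int[mu]_x G x)%E by [].
  by apply: eq_integral => x _; rewrite gee0_abs.
have Gf (x : T) : setT x -> G x \is a fin_num by [].
have dom n (x : T) : setT x -> (`|F n x| <= G x)%E.
  move=> _; rewrite gee0_abs; last by rewrite lee_fin powR_ge0.
  rewrite lee_fin; apply: ler_powRp => //; rewrite /h; case: ifP => _.
    by rewrite subrr normr0.
  by rewrite sub0r normrN.
have := @dominated_cvg _ _ _ mu setT measurableT F (cst 0%E) G mF cv Gf iG dom.
rewrite integral0 => /fine_cvgP[fin /cvgrPdist_le/(_ e e0) near_e].
have [n [n0 h1 h2]] : exists n : nat, [/\ (0 < n)%N, (\int[mu]_x F n x)%E \is a fin_num &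
    fine (\int[mu]_x F n x)%E <= e].
  near \oo => n; exists n; split; [by near: n; exact: nbhs_infty_gt|by near: n|].
  have /= : `|0 - fine (\int[mu]_x F n x)%E| <= e by near: n.
  by rewrite sub0r normrN; apply: le_trans; exact: ler_norm.
exists (h n), n%:R; split => //.
- by rewrite ltr0n.
- by move=> x; rewrite /h; case: ifP => [/andP[]//|_]; rewrite normr0.
- by move=> x nx; rewrite /h ltNge nx.
- by rewrite -(fineK h1) lee_fin.
Unshelve. all: by end_near. Qed.

Lemma lipschitz_measurable (f : T -> R) (L : R) : 0 < L ->
  (forall x y : R, `|f y - f x| <= L * `|y - x|) -> measurable_fun setT f.
Proof.
move=> L0 fL; apply: continuous_measurable_fun => x; apply/cvgrPdist_le => r r0.
have rL : 0 < r / L by rewrite divr_gt0.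
have : \forall y \near x, ball x (r / L) y by exact: nbhsx_ballx.
apply: filterS => y; rewrite /ball/= => xy.
by apply: (le_trans (fL y x)); rewrite mulrC -ler_pdivlMr// ltW.
Qed.

(** Forward averages over length [d k] of the bounded function [h] are Lipschitz, vanish outside a
    fixed bounded set because [d k <= 1], converge almost everywhere by Lebesgue differentiation,
    and are dominated there by a constant. *)
Lemma average_Lp (h : T -> R) (n e : R) : measurable_fun setT h -> 0 < n -> (forall x, `|h x| <= n) ->
  (forall x : R, n <= `|x| -> h x = 0) -> 0 < e ->
  exists (f : T -> R) (L K : R), [/\ 0 <= L, 0 < K, forall x y : R, `|f y - f x| <= L * `|y - x|,
    forall x : R, K <= `|x| -> f x = 0 & (\int[mu]_x (`|f x - h x| `^ p)%:E <= e%:E)%E].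
Proof.
move=> mh n0 hn h0 e0.
pose D : set T := `[(- (n + 1))%R, (n + 1)%R]%classic.
have mD : measurable D by exact: measurable_itv.
have n1 : 0 < n + 1 by rewrite addr_gt0.
have muD : (mu D = (2 * (n + 1))%:E)%E.
  rewrite /D lebesgue_measure_itv/= lte_fin gtrN// -EFinB.
  by congr EFin; ring.
have outD (x : R) : ~ D x -> n + 1 < `|x|.
  by move=> Dx; rewrite ltNge ler_norml; apply/negP => /andP[h1 h2]; apply: Dx; rewrite /D/= in_itv/= h1.
have hi : mu.-integrable setT (EFin \o h).
  apply/integrableP; split; first exact/measurable_EFinP.
  apply: (@le_lt_trans _ _ (\int[mu]_(x in D) cst n%:E x)%E); last first.
    by rewrite integral_cst// [X in (_ * X)%E]muD -EFinM ltry.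
  rewrite [leRHS]integral_mkcond; apply: ge0_le_integral.
  - exact: measurableT.
  - by [].
  - by apply: measurableT_comp => //; exact/measurable_EFinP.
  - by apply: (proj1 (measurable_restrictT _ mD)); exact: measurable_cst.
  - move=> x _; rewrite patchE; case: ifPn => [_|/negP nD]; first by rewrite lee_fin.
    rewrite /= h0 ?normr0// ltW// (lt_trans _ (outD x _))// ?ltrDl//.
    by move=> Dx; apply: nD; rewrite inE.
pose d (k : nat) : R := k.+1%:R^-1.
have d0 k : 0 < d k by rewrite invr_gt0.
have d1 k : d k <= 1 by rewrite invf_le1// ler1n.
have dcv : d k @[k --> \oo] --> (0 : R) by exact: cvg_harmonic.
pose f k (x : R) := (d k)^-1 * (primitive h (x + d k) - primitive h x).
have fL k (x y : R) : `|f k y - f k x| <= (2 * n / d k) * `|y - x|.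
  rewrite /f -mulrBr normrM ger0_norm ?invr_ge0 ?(ltW (d0 k))//.
  rewrite (_ : 2 * n / d k * `|y - x| = (d k)^-1 * (n * `|y - x| + n * `|y - x|)); last by ring.
  apply: ler_wpM2l; first by rewrite invr_ge0 ltW.
  rewrite (_ : _ - _ = (primitive h (y + d k) - primitive h (x + d k)) - (primitive h y - primitive h x)); last by ring.
  apply: le_trans (ler_normB _ _) _; apply: lerD; last exact: primitive_lipschitz.
  rewrite (_ : `|y - x| = `|(y + d k) - (x + d k)|); first exact: primitive_lipschitz.
  by congr Num.norm; ring.
have f0 k (x : R) : n + 1 <= `|x| -> f k x = 0.
  move=> nx; rewrite /f (primitiveB hi) ?lerDl ?(ltW (d0 k))//.
  rewrite (_ : Rintegral _ _ _ = 0) ?mulr0//.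
  rewrite /Rintegral integral0_eq// => t /=; rewrite in_itv/= => /andP[xt tx].
  rewrite h0//; rewrite ler_normr in nx; rewrite ler_normr; have := d1 k.
  by case/orP: nx => nx d1k; apply/orP; [left|right]; lra.
have fn k (x : R) : `|f k x| <= n.
  rewrite /f normrM ger0_norm ?invr_ge0 ?(ltW (d0 k))// mulrC ler_pdivrMr//.
  rewrite (_ : n * d k = n * `|(x + d k) - x|); first exact: primitive_lipschitz.
  by rewrite addrC addKr gtr0_norm.
have mf k : measurable_fun setT (f k : T -> R).
  apply: (@lipschitz_measurable _ (2 * n / d k)); last exact: fL.
  by rewrite divr_gt0// mulr_gt0.
pose F k (x : T) : \bar R := (`|f k x - h x| `^ p)%:E.
have mF k : measurable_fun D (F k).
  by apply: measurable_powabs; apply: measurable_funTS; exact: measurable_funB.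
pose G : T -> \bar R := cst ((2 * n) `^ p)%:E.
have iG : mu.-integrable D G.
  apply/integrableP; split; first exact: measurable_cst.
  by rewrite /G/= integral_cst// [X in (_ * X)%E]muD ?lte_mul_pinfty// ?ltry.
have locf : locally_integrable setT h by apply: open_integrable_locally => //; exact: openT.
have aecv : {ae mu, forall x, D x -> F k x @[k --> \oo] --> (cst 0%E : T -> \bar R) x}.
  have [N [mN N0 NB]] := lebesgue_differentiation locf.
  exists N; split; [exact: mN|exact: N0|apply: subset_trans NB => x nF lx; apply: nF => _].
  have fcv : f k x @[k --> \oo] --> h x by exact: average_right_cvg.
  have nz : `|f k x - h x| @[k --> \oo] --> (0 : R).
    by apply/norm_cvg0P; rewrite -(subrr (h x)); apply: cvgB => //; exact: cvg_cst.
  apply: cvg_EFin; first by near=> k.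
  apply/cvgrPdist_le => r r0.
  have rp : 0 < r `^ p^-1 by rewrite powR_gt0.
  near=> k; rewrite /= sub0r normrN ger0_norm ?powR_ge0//.
  have : `|f k x - h x| <= r `^ p^-1.
    near: k; move/cvgrPdist_le : nz => /(_ _ rp); apply: filterS => k.
    by rewrite sub0r normrN normr_id.
  move=> /(ler_powRp (normr_ge0 _)) /le_trans; apply.
  by rewrite -powRrM mulVf ?gt_eqF// powRr1// ltW.
have aedom : {ae mu, forall x k, D x -> (`|F k x| <= G x)%E}.
  apply/aeW => x k _; rewrite gee0_abs ?lee_fin ?powR_ge0//; apply: ler_powRp => //.
  by apply: le_trans (ler_normB _ _) _; rewrite mulr_natl mulr2n lerD.
have [_ _] := @dominated_convergence _ _ _ mu D mD F (cst 0%E) G mF (measurable_cst _) aecv iG aedom.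
rewrite integral0 => /fine_cvgP[fin /cvgrPdist_le/(_ e e0) near_e].
have [k [h1 h2]] : exists k : nat, (\int[mu]_(x in D) F k x)%E \is a fin_num /\
    fine (\int[mu]_(x in D) F k x)%E <= e.
  near \oo => k; exists k; split; first by near: k.
  have /= : `|0 - fine (\int[mu]_(x in D) F k x)%E| <= e by near: k.
  by rewrite sub0r normrN; apply: le_trans; exact: ler_norm.
exists (f k), (2 * n / d k), (n + 1); split => //.
- by rewrite divr_ge0// ?mulr_ge0// ltW.
- exact: f0.
- have -> : (\int[mu]_x (`|f k x - h x| `^ p)%:E = \int[mu]_x ((F k) \_ D) x)%E.
    apply: eq_integral => x _; rewrite patchE; case: ifPn => // /negP nD.
    have nDx : n + 1 < `|x| by apply: outD => Dx; apply: nD; rewrite inE.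
    by rewrite (f0 _ _ (ltW nDx)) h0 ?subrr ?normr0 ?powR0 ?gt_eqF// ltW// (lt_trans _ nDx)// ltrDl.
  by rewrite -integral_mkcond -(fineK h1) lee_fin.
Unshelve. all: by end_near. Qed.

Lemma powR_splitl (t : R) : 0 <= t -> t `^ p = t `^ (p - 1) * t.
Proof.
move=> t0; rewrite -[X in _ * X]powRr1// -powRD ?subrK//.
by rewrite (gt_eqF p_gt0).
Qed.

(** [W] is the primitive of the constant [L ^ p] on [[- K, K]]. Since [f] vanishes outside that
    interval, it depends on [x] only through the clamped value. *)
Lemma lipschitz_slopes (f : T -> R) (L K : R) : 0 <= L -> 0 < K ->
  (forall x y : R, `|f y - f x| <= L * `|y - x|) -> (forall x : R, K <= `|x| -> f x = 0) ->
  slope_bound setT f set0 (fun x => L `^ p * (Num.max (- K) (Num.min x K) + K)) (L `^ p * (2 * K)).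
Proof.
move=> L0 K0 fL f0; pose c (x : R) := Num.max (- K) (Num.min x K).
have NK : - K <= K by rewrite ltW// gtrN.
have fK : f K = 0 by apply: f0; rewrite ger0_norm// ltW.
have fNK : f (- K) = 0 by apply: f0; rewrite normrN ger0_norm// ltW.
have cE (x : R) : f x = f (c x).
  rewrite /c; have [xK|Kx] := leP x (- K).
    have xK' : x <= K by exact: le_trans NK.
    rewrite (min_idPl xK') (max_idPl xK) fNK; apply: f0.
    by rewrite ler_normr lerNr xK orbT.
  have [xK|Kx'] := leP x K; first by rewrite (max_idPr (ltW Kx)).
  by rewrite (max_idPr NK) fK; apply: f0; rewrite ler_normr (ltW Kx').
have cnd (x y : R) : x <= y -> 0 <= c y - c x <= y - x.
  rewrite /c => xy; apply/andP; split; first by rewrite subr_ge0 le_max2// le_min2.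
  have [xK|Kx] := leP x K; have [yK|Ky] := leP y K; rewrite /Num.max.
  - by case: ifP => h1; case: ifP => h2; lra.
  - by case: ifP => h1; case: ifP => h2; lra.
  - by lra.
  - by case: ifP => h1; lra.
have cK (x : R) : - K <= c x <= K by rewrite /c le_max lexx/= ge_max NK ge_min lexx orbT.
split => //.
- move=> x y xy; apply: ler_wpM2l; first exact: powR_ge0.
  by rewrite lerD2r -subr_ge0; have /andP[] := cnd _ _ xy.
- move=> x; have /andP[c1 c2] := cK x; rewrite -/(c x); apply/andP; split.
    by rewrite mulr_ge0 ?powR_ge0//; lra.
  by apply: ler_wpM2l; [exact: powR_ge0|lra].
- move=> x y _ _ _ _ xy; rewrite cE (cE x); have /andP[c1 c2] := cnd _ _ (ltW xy).
  rewrite -/(c x) -/(c y) -mulrBr (_ : c y + K - (c x + K) = c y - c x); last by ring.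
  apply: (@le_trans _ _ ((L * (c y - c x)) `^ p)).
    by apply: ler_powRp => //; rewrite -[X in _ * X](ger0_norm c1).
  rewrite powRM// (powR_splitl c1) [leRHS]mulrCA; apply: ler_wpM2l; first exact: powR_ge0.
  have p1 : 0 <= p - 1 by rewrite subr_ge0.
  by apply: ler_wpM2r => //; apply: ge0_ler_powR; rewrite ?nnegrE// (le_trans c1).
Qed.

(** When [kappa = 0] the slope energy of the polygon is irrelevant, so only approximation in L^p
    matters and [g] need not satisfy any slope bound: polygons are found for a nearby Lipschitz
    function on the whole line. *)
Lemma mLp_nodes (I : set T) (g : T -> R) (e : R) : measurable I -> mLp I g -> 0 < e ->
  exists z a s, nodes_for I g e z a s.
Proof.
move=> mI [mg gLp] e0; pose G := g \_ I.
have GLp : (\int[mu]_x (`|G x| `^ p)%:E < +oo)%E.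
  have -> : (\int[mu]_x (`|G x| `^ p)%:E = \int[mu]_x ((fun x => (`|g x| `^ p)%:E) \_ I) x)%E.
    by apply: eq_integral => x _; rewrite /G !patchE; case: ifP; rewrite ?normr0 ?powR0// gt_eqF.
  by rewrite -integral_mkcond.
have c2 : 0 < (2 : R) `^ p by rewrite powR_gt0.
pose e1 := e / (2 `^ p * (1 + 2 `^ p * 2)).
have c3 : 0 < (2 : R) `^ p * (1 + 2 `^ p * 2) by rewrite mulr_gt0// addr_gt0// mulr_gt0.
have e10 : 0 < e1 by rewrite divr_gt0.
have [h [n [mh n0 hn h0 hG]]] := truncation_Lp mg GLp e10.
have [f [L [K [L0 K0 fL fK fh]]]] := average_Lp mh n0 hn h0 e10.
have mf : measurable_fun setT f.
  apply: (@lipschitz_measurable f (L + 1)); first by rewrite ltr_wpDl.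
  by move=> x y; apply: (le_trans (fL x y)); rewrite ler_wpM2r// lerDl.
have fG := Lp_triangle measurableT mf mh mg fh hG.
have gT : mLp setT G by split; [rewrite patch_setT|].
have [_ fLp] := mLp_close measurableT gT mf fG.
have sl := lipschitz_slopes L0 K0 fL fK.
have [z [a [s [[incs tL tR fs] _]]]] := nodes_of_slopes measurableT openT (fun _ _ _ _ _ _ => Logic.I) mf fLp sl e10.
exists z, a, s; split => //.
(* No node has the whole line on one side of it, so both end values are 0 and the polygon remains
   admissible on every [I]. *)
- by case: tL => [|h1]; [left|have := h1 (z - 1) Logic.I; rewrite lerBrDl gerDr ler10].
- by case: tR => [|h1]; [left|have := h1 (lastz z s) Logic.I; rewrite ltxx].
pose S := (interp z a s) \_ `[z, lastz z s[%classic.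
have mS : measurable_fun setT (S : T -> R).
  by apply: measurable_restr; [exact: measurable_itv|exact: measurable_interp].
have SG := Lp_triangle measurableT mS mf mg fs fG.
have -> : (\int[mu]_(x in I) (`|S x - g x| `^ p)%:E = \int[mu]_(x in I) (`|S x - G x| `^ p)%:E)%E.
  by apply: eq_integral => x xI; rewrite /G patchE xI.
apply: (@le_trans _ _ (\int[mu]_x (`|S x - G x| `^ p)%:E)%E).
  apply: (ge0_subset_integral _ mI measurableT).
  - by apply: measurable_powabs; exact: measurable_funB.
  - by move=> x _; rewrite lee_fin powR_ge0.
  - exact: subsetT.
apply: (le_trans SG); rewrite lee_fin.
have -> : 2 `^ p * (e1 + 2 `^ p * (e1 + e1)) = e1 * (2 `^ p * (1 + 2 `^ p * 2)) by ring.
by rewrite divfK// gt_eqF.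
Qed.

(** * Both inequalities expressed through slope bounds *)

Lemma recoverable_zero (I : set T) (g : T -> R) : measurable I -> mLp I g -> kappa = 0 ->
  recoverable I g 0.
Proof.
move=> mI gLp k0; apply: nodes_recoverable => // e e0.
have [z [a [s ns]]] := mLp_nodes mI gLp e0; exists z, a, s; split => //.
by rewrite k0 mul0r add0r ltW.
Qed.

Lemma recoverable_slopes (I : set T) (g : T -> R) (N : set T) (W : R -> R) (M : R) :
  measurable I -> open (I : set R) -> is_interval (I : set R) -> mLp I g ->
  slope_bound I g N W M -> recoverable I g (kappa * M).
Proof.
move=> mI oI II gLp sb; have [mg gI] := gLp.
have /andP[k0 k1] := kappa_itv.
have M0 : 0 <= M by have [_ _ _ /(_ 0)/andP[h1 h2] _] := sb; exact: le_trans h2.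
apply: nodes_recoverable => //; first exact: mulr_ge0.
move=> e e0; pose G := g \_ I.
have GI (x : T) : I x -> G x = g x by move=> Ix; rewrite /G patchE mem_set.
have GLp : (\int[mu]_(x in I) (`|G x| `^ p)%:E < +oo)%E.
  have -> : (\int[mu]_(x in I) (`|G x| `^ p)%:E = \int[mu]_(x in I) (`|g x| `^ p)%:E)%E.
    by apply: eq_integral => x /set_mem Ix; rewrite GI.
  exact: gI.
have sbG : slope_bound I G N W M.
  case: sb => mN N0 Wnd W0M H; split => // x y Ix Iy Nx Ny xy.
  by rewrite !GI//; exact: H.
have [z [a [s [[incs tL tR sLp] sE]]]] := nodes_of_slopes mI oI II mg GLp sbG e0.
exists z, a, s; split; last first.
  apply: (le_trans (ler_wpM2l k0 sE)); rewrite mulrDr lerD2l.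
  by rewrite ler_piMl// ltW.
split; [exact: incs|exact: tL|exact: tR|]; apply: le_trans sLp; rewrite le_eqVlt; apply/orP; left; apply/eqP.
by apply: eq_integral => x /set_mem Ix; rewrite -(GI x Ix).
Qed.

Lemma liminf_slope_bound (I : set T) (g : T -> R) (gd : R -> T -> R) (c : R) :
  measurable I -> is_interval (I : set R) ->
  mLp I g -> (forall d : R, 0 < d -> mLp I (gd d)) ->
  (forall e : R, 0 < e -> exists2 d0 : R, 0 < d0 &
     forall d : R, 0 < d < d0 -> (\int[mu]_(x in I) (`|gd d x - g x| `^ p)%:E <= e%:E)%E) ->
  (forall d0 : R, 0 < d0 -> exists2 d : R, 0 < d < d0 & (Ld (gd d \_ I) d I <= c%:E)%E) ->
  0 <= c -> 0 < kappa -> exists N W, slope_bound I g N W (c / kappa).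
Proof.
move=> mI II mg mgd Hcvg Hc c0 k0.
have kE : (kappa%:E <= kappaE)%E by rewrite kappa_fin.
have [G [W [[N [mN N0 GN]] Wnd W0c H]]] := liminf_slopes mI II mg mgd Hcvg Hc c0 (ltW k0) kE.
have k0' : 0 <= kappa^-1 by rewrite invr_ge0 ltW.
exists N, (fun x => W x / kappa); split.
- exact: mN.
- exact: N0.
- by move=> x y xy; rewrite ler_wpM2r// Wnd.
- by move=> x; have /andP[h1 h2] := W0c x; rewrite divr_ge0 ?(ltW k0)//= ler_wpM2r.
- move=> x y Ix Iy Nx Ny xy.
  have inG z : I z -> ~ N z -> G z by move=> Iz nN; apply: contrapT => nG; apply: nN; apply: GN.
  have := H _ _ Ix Iy (inG _ Ix Nx) (inG _ Iy Ny) xy.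
  by rewrite -mulrBl mulrA ler_pdivlMr// mulrC.
Qed.

End Interaction.

(** * Conclusion of the Gamma-convergence *)

Lemma derivative_energy_ge0 {R : realType} (p : R) (I : set R) u : (0 <= derivative_energy p I u)%E.
Proof.
rewrite /derivative_energy; case: ifP => _.
  by rewrite /BV_energy; case: pselect => // uBV; apply: adde_ge0; exact: measure_ge0.
by rewrite /W1p_energy; case: pselect => // uW; apply: integral_ge0 => x _; rewrite lee_fin powR_ge0.
Qed.

Lemma near_rightP {R : realType} (P : R -> Prop) : (\forall d \near 0^'+, P d) ->
  exists2 d0 : R, 0 < d0 & forall d, 0 < d < d0 -> P d.
Proof.
move=> [r /= r0 H]; exists r => // d /andP[d0 dr]; apply: H => //=.
by rewrite sub0r normrN gtr0_norm.
Qed.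

Lemma right_near {R : realType} (P : R -> Prop) (d0 : R) : 0 < d0 -> (forall d, 0 < d < d0 -> P d) ->
  \forall d \near 0^'+, P d.
Proof.
move=> d00 H; exists d0 => // d /=; rewrite sub0r normrN => dd dpos; apply: H.
by rewrite dpos/=; apply: le_lt_trans dd; exact: ler_norm.
Qed.

Unset Implicit Arguments.
Set Strict Implicit.
Set Printing Implicit Defensive.

Theorem theorem1p1 (R : realType) (p : R) (phi : R -> R)
    (p_ge1 : 1 <= p)
    (phi_ge0 : forall t : R, 0 <= t -> 0 <= phi t)
    (phi0 : phi 0 = 0)
    (phi_pc : piecewise_continuous phi)
    (phi_alpha : exists2 alpha : R, 0 < alpha &
       forall t : R, 0 <= t <= 1 -> phi t <= alpha * t `^ (p + 1))
    (phi_beta : exists2 beta : R, 0 < beta &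
       forall t : R, 0 <= t -> phi t <= beta)
    (phi_int : (\int[@lebesgue_measure R]_(t in `]0%R, +oo[%classic)
                  (phi t * t `^ (- (p + 1)))%:E = (2^-1)%:E)%E) :
  exists kappa : R, 0 <= kappa <= 1 /\
    forall I : set R, open_interval I ->
      Gamma_converges p I
        (fun (delta : R) (u : R -> R) => Lambda_delta phi p delta u I)
        (fun u : R -> R => Lambda0 kappa p u I).
Proof.
have p0 : 0 < p by exact: lt_le_trans p_ge1.
have [beta beta0 hbeta] := phi_beta.
(* [phi] is controlled on [[0, +oo[] only. Replacing it by [psi] changes no energy, since only
   absolute values are inserted, and makes the bounds and measurability hold on the whole line. *)
pose psi (t : R) : R := phi `|t|.
have mpsi : measurable_fun setT (psi : measurableTypeR R -> R) by exact: piecewise_continuous_measurable.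
have psi_ge0 t : 0 <= psi t by exact: phi_ge0.
have psi0 : psi 0 = 0 by rewrite /psi normr0.
have psi_beta t : psi t <= beta by exact: hbeta.
have psi_int : (\int[@lebesgue_measure R]_(t in `]0%R, +oo[%classic) (psi t * t `^ (- (p + 1)))%:E = (2^-1)%:E)%E.
  rewrite -phi_int; apply: eq_integral => t; rewrite inE/= in_itv/= andbT => t0.
  by rewrite /psi gtr0_norm.
exists (kappa p psi); split; first exact: (kappa_itv p_ge1 mpsi psi_ge0 psi0 beta0 psi_beta psi_int).
have /andP[k0 k1] := kappa_itv p_ge1 mpsi psi_ge0 psi0 beta0 psi_beta psi_int.
move=> I [oI II]; have mI : measurable (I : set (measurableTypeR R)) by exact: open_interval_measurable.
have LE delta u : Lambda_delta phi p delta u I = Ld p psi (u \_ I) delta I.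
  rewrite /Lambda_delta /Lambda /Ld JE; apply: (congr1 (fun z => ((delta `^ p)%:E * z)%E)).
  apply: eq_integral => x Ix; apply: eq_integral => y Iy.
  by rewrite /kern/= !patchE Ix Iy /psi normr_id.
have L0 delta u : (0 <= Lambda_delta phi p delta u I)%E.
  by rewrite LE; exact: Ld_ge0.
have mLpP (u : R -> R) : in_Lp p I u <-> mLp p I u by exact: in_LpP.
have recovery (g : R -> R) (c : R) : mLp p I g -> recoverable p psi I g c ->
    exists g_ : R -> R -> R, [/\ forall delta, 0 < delta -> in_Lp p I (g_ delta), cvg_Lp p I g_ g &
      (limf_esup (fun delta => Lambda_delta phi p delta (g_ delta) I) 0^'+ <= c%:E)%E].
  move=> gLp rec; have [g_ [g_Lp H]] := recovery_family gLp rec.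
  exists g_; split.
  - by move=> delta _; apply/mLpP.
  - by apply/(cvg_LpP I g_ g p0) => e e0; apply: filterS (H e e0) => d [].
  - apply/lee_addgt0Pr => e e0; apply: limf_esup_le; apply: filterS (H e e0) => d [h _].
    by rewrite LE -EFinD.
split.
  move=> g g_ gLp g_Lp cv; rewrite /Lambda0; case: ifPn => [_|kN0].
    by apply: limf_einf_ge; apply: nearW => d; exact: L0.
  have kpos : 0 < kappa p psi by rewrite lt_neqAle eq_sym kN0.
  set L := limf_einf _ _.
  have Lge0 : (0 <= L)%E by apply: limf_einf_ge; apply: nearW => d; exact: L0.
  (* If [L] is finite, the bound for every real [c > L] gives the one for [L]; if it is infinite,
     there is nothing to show. *)
  suff H (c : R) : (L < c%:E)%E -> ((kappa p psi)%:E * derivative_energy p I g <= c%:E)%E.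
    case LE' : L Lge0 H => [l| |] //= _ H; last by rewrite leey.
    by apply/lee_addgt0Pr => e e0; rewrite -EFinD; apply: H; rewrite lte_fin ltrDl.
  move=> Lc; have c0 : 0 <= c by rewrite -lee_fin (le_trans Lge0)// ltW.
  (* A lower limit below [c] provides arbitrarily small [d] with energy at most [c], not all small
     [d]; [liminf_slope_bound] asks for no more. *)
  have freq (d0 : R) : 0 < d0 -> exists2 d : R, 0 < d < d0 & (Ld p psi (g_ d \_ I) d I <= c%:E)%E.
    move=> d00; apply: contrapT => nex; move: Lc; rewrite ltNge => /negP; apply.
    apply: limf_einf_ge; apply: (right_near d00) => d dd; rewrite LE leNgt; apply/negP => h.
    by apply: nex; exists d => //; exact: ltW.
  have small (e : R) : 0 < e -> exists2 d0 : R, 0 < d0 &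
      forall d : R, 0 < d < d0 -> (\int[@lebesgue_measure R]_(x in I) (`|g_ d x - g x| `^ p)%:E <= e%:E)%E.
    by move=> e0; apply: near_rightP; exact: ((cvg_LpP I g_ g p0).1 cv e e0).
  have [N [W [mN N0 ndW W_itv sW]]] := liminf_slope_bound p_ge1 mpsi psi_ge0 psi0 beta0 psi_beta psi_int
    mI II ((mLpP g).1 gLp) (fun d d0 => (mLpP _).1 (g_Lp d d0)) small freq c0 kpos.
  have := derivative_energy_le p_ge1 oI II gLp mN N0 ndW W_itv sW => h.
  apply: (@le_trans _ _ ((kappa p psi)%:E * (c / kappa p psi)%:E)%E).
    by rewrite lee_wpmul2l ?lee_fin.
  by rewrite -EFinM mulrC divfK ?gt_eqF.
move=> g gLp; have gmLp := (mLpP g).1 gLp.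
rewrite /Lambda0; case: ifPn => [/eqP kE|kN0].
  apply: recovery => //.
  exact: (recoverable_zero p_ge1 mpsi psi_ge0 psi0 beta0 psi_beta psi_int mI gmLp kE).
have kpos : 0 < kappa p psi by rewrite lt_neqAle eq_sym kN0.
case E : (derivative_energy p I g) => [M| |].
- have [N [W H]] := energy_slopes p_ge1 oI II gLp E; rewrite -EFinM; apply: recovery => //.
  exact: (recoverable_slopes p_ge1 mpsi psi_ge0 psi0 beta0 psi_beta psi_int mI oI II gmLp H).
(* The target is [+oo], so the constant family is a recovery family. *)
- exists (fun=> g); split => //; last by rewrite gt0_muley ?lte_fin// leey.
  apply/(cvg_LpP I _ g p0) => e e0; apply: nearW => d.
  rewrite integral0_eq ?lee_fin ?(ltW e0)// => x _.
  by rewrite subrr normr0 powR0// gt_eqF.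
- by have := derivative_energy_ge0 p I g; rewrite E.
Qed.
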